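(* Let $n\ge 1$, $\alpha>0$, $s>1$ with $\alpha s\le n$. There is a constant $\overline{c}=\overline{c}(n,\alpha,s)\ge1$, depending only on $n,\alpha,s$, such that for every $p>1$, with $p'=p/(p-1)$ and with $N^{\alpha,s}_{p'}$ defined using this constant, one has $(N^{\alpha,s}_{p'})^*\approx M^{\alpha,s}_p$ in the following sense: each bounded linear functional $L\in (N^{\alpha,s}_{p'})^*$ corresponds to a unique $f\in M^{\alpha,s}_p$ such that $L(g)=L_f(g)$ for all $g\in N^{\alpha,s}_{p'}$, where $$L_f(g)=\int_{\mathbb{R}^n}f(x)g(x)\,dx,\qquad g\in N^{\alpha,s}_{p'}.$$ Moreover, $\|f\|_{M^{\alpha,s}_p}\simeq\|L_f\|_{(N^{\alpha,s}_{p'})^*}$, with equivalence constants independent of $f$.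
   Context: $G_\alpha=\mathcal{F}^{-1}[(1+|\xi|^2)^{-\alpha/2}]$ is the Bessel kernel of order $\alpha$ on $\mathbb{R}^n$. For $E\subset\mathbb{R}^n$ the Bessel capacity is ${\rm Cap}_{\alpha,s}(E)=\inf\{\|f\|_{L^s}^s: f\ge 0,\ G_\alpha*f\ge 1 \text{ on } E\}$. A property holds quasieverywhere (q.e.) if it holds outside a set of zero capacity ${\rm Cap}_{\alpha,s}$. A (q.e. defined) function $f$ is quasicontinuous if for every $\epsilon>0$ there is an open set $G$ with ${\rm Cap}_{\alpha,s}(G)<\epsilon$ such that $f$ is continuous on $\mathbb{R}^n\setminus G$. For q.e. defined $w:\mathbb{R}^n\to[0,\infty]$ the Choquet integral is $\int w\,dC=\int_0^\infty {\rm Cap}_{\alpha,s}(\{x: w(x)>t\})\,dt$. $L^1(C)$ is the space of quasicontinuous functions $f$ with $\|f\|_{L^1(C)}:=\int|f|\,dC<\infty$. For $p\ge1$, $M^{\alpha,s}_p$ is the space of $f\in L^p_{\rm loc}(\mathbb{R}^n)$ with finite norm $\|f\|_{M^{\alpha,s}_p}=\sup_K\big(\int_K|f|^p\,dx/{\rm Cap}_{\alpha,s}(K)\big)^{1/p}$, the supremum over all compact $K\subset\mathbb{R}^n$ with ${\rm Cap}_{\alpha,s}(K)\neq 0$. The local maximal function is ${\bf M}^{\rm loc}f(x)=\sup_{0<r\le1}|B_r(x)|^{-1}\int_{B_r(x)}|f(y)|\,dy$. $A_1^{\rm loc}$ is the class of nonnegative locally integrable $w$ such that ${\bf M}^{\rm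 loc}w\le C\,w$ a.e. for some constant $C$; $[w]_{A_1^{\rm loc}}$ is the least such $C$. Given the constant $\overline{c}\ge1$ and $q>1$, $N^{\alpha,s}_q$ is the space of measurable functions $g$ with $$\|g\|_{N^{\alpha,s}_q}=\inf_w\Big(\int_{\mathbb{R}^n}|g(x)|^q w(x)^{1-q}\,dx\Big)^{1/q}<\infty,$$ the infimum over all (nonnegative) $w\in L^1(C)\cap A_1^{\rm loc}$ with $\|w\|_{L^1(C)}\le1$ and $[w]_{A_1^{\rm loc}}\le\overline{c}$ (finiteness of the integral means in particular that $g=0$ a.e. on $\{w=0\}$). $N^{\alpha,s}_q$ is a quasinormed space; its dual consists of bounded linear functionals with the usual operator norm. $A\simeq B$ means $c_1A\le B\le c_2A$ for positive constants $c_1,c_2$. *)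

(* Defs.v *)
From HB Require Import structures.
From mathcomp Require Import all_boot all_order all_algebra.
From mathcomp Require Import all_classical all_reals all_analysis
  measurable_realfun.

Set Implicit Arguments.
Unset Strict Implicit.
Unset Printing Implicit Defensive.

Import Order.TTheory GRing.Theory Num.Theory.
Import numFieldNormedType.Exports.

Local Open Scope classical_set_scope.
Local Open Scope ring_scope.

Definition rV_display : measure_display. Proof. exact. Qed.

Section measurable_rV.
Context (R : realType) (n : nat).

Let coor (i : 'I_n) (x : 'rV[R]_n) : R := x ord0 i.

(* The product sigma-algebra, as for the library's n.-tuple R; it is the Borel
   sigma-algebra of 'rV[R]_n. *)
HB.instance Definition _ := @isMeasurable.Build rV_display 'rV[R]_n
  (g_sigma_preimage coor) (@sigma_algebra0 _ _ _)
  (@sigma_algebraC _ _) (@sigma_algebra_bigcup _ _ _).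

Lemma measurable_coor (i : 'I_n) :
  measurable_fun [set: 'rV[R]_n] (fun x : 'rV[R]_n => x ord0 i).
Proof.
move=> _ Y mY; rewrite setTI; apply: sub_sigma_algebra => /=.
rewrite -bigcup_seq/=; exists i => /=; first by rewrite mem_index_enum.
by exists Y => //; rewrite setTI.
Qed.

Lemma measurable_fun_coorP d (T : measurableType d) (f : T -> 'rV[R]_n) :
  (forall i, measurable_fun [set: T] (fun t => f t ord0 i)) ->
  measurable_fun [set: T] f.
Proof.
move=> mf _ A mA; rewrite setTI.
suff : g_sigma_preimage coor `<=` [set B | measurable (f @^-1` B)] by exact.
apply: smallest_sub; first split => /=.
- by rewrite preimage_set0.
- by move=> B mB; rewrite setTD preimage_setC; exact: measurableC.
- by move=> F mF; rewrite preimage_bigcup; exact: bigcupT_measurable.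
- move=> B; rewrite -bigcup_seq => -[i _] [C mC <-] /=.
  rewrite setTI -[X in measurable X]setTI; exact: (mf i).
Qed.

End measurable_rV.

Section lebesgue_measure_rV.
Context {R : realType}.
Local Open Scope ereal_scope.

Definition rV_cons n (p : R * 'rV[R]_n) : 'rV[R]_n.+1 :=
  \row_j oapp (fun i => p.2 ord0 i) p.1 (unlift ord0 j).

Lemma measurable_rV_cons n :
  measurable_fun [set: measurableTypeR R * 'rV[R]_n] (@rV_cons n).
Proof.
apply: measurable_fun_coorP => j; rewrite /rV_cons.
under eq_fun do rewrite mxE.
case: unliftP => [i|] _ /=; last exact: measurable_fst.
exact: (measurableT_comp (@measurable_coor R n i) measurable_snd).
Qed.

Section step.
Variables (n : nat) (m : {sigma_finite_measure set 'rV[R]_n -> \bar R}).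

Definition lebesgue_rV_step : set 'rV[R]_n.+1 -> \bar R :=
  pushforward ((@lebesgue_measure R) \x m) (@rV_cons n).

HB.instance Definition _ := Measure.copy lebesgue_rV_step
  (measure_function_pushforward__canonical__measure_function_Measure
    ((@lebesgue_measure R) \x m) (@measurable_rV_cons n)).

Let lebesgue_rV_step_sigma_finite : sigma_finite setT lebesgue_rV_step.
Proof.
have /sigma_finiteP[F [FT ndF Foo]] := sigma_finiteT (@lebesgue_measure R).
have /sigma_finiteP[G [GT ndG Goo]] := sigma_finiteT m.
pose hd (x : 'rV[R]_n.+1) : R * 'rV[R]_n :=
  (x ord0 ord0, \row_i x ord0 (lift ord0 i)).
have mhd : measurable_fun setT hd.
  apply: measurable_fun_pair; first exact: measurable_coor.
  apply: measurable_fun_coorP => i; under eq_fun do rewrite mxE.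
  exact: measurable_coor.
have hdK p : hd (rV_cons p) = p.
  case: p => a x; rewrite /hd /rV_cons mxE unlift_none/=; congr pair.
  by apply/rowP => i; rewrite !mxE liftK.
exists (fun k => hd @^-1` (F k `*` G k)).
  apply/esym; rewrite -subTset => x _.
  have [i _ Fi] : (\bigcup_i F i) (hd x).1 by rewrite -FT.
  have [j _ Gj] : (\bigcup_i G i) (hd x).2 by rewrite -GT.
  exists (maxn i j) => //; split.
  - by move: Fi; exact/subsetPset/ndF/leq_maxl.
  - by move: Gj; exact/subsetPset/ndG/leq_maxr.
move=> k; have [mF Fk] := Foo k; have [mG Gk] := Goo k; split.
  by rewrite -[X in measurable X]setTI; apply: mhd => //; exact: measurableX.
rewrite /lebesgue_rV_step /pushforward.
rewrite (_ : _ @^-1` _ = F k `*` G k); last first.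
  by apply/funext => p; rewrite /preimage /mkset hdK.
by rewrite product_measure1E// lte_mul_pinfty// ge0_fin_numE.
Qed.

HB.instance Definition _ := @Measure_isSigmaFinite.Build _ _ _
  lebesgue_rV_step lebesgue_rV_step_sigma_finite.

End step.

(* n-dimensional Lebesgue measure, by iterating the library's product. *)
Fixpoint lebesgue_rV (n : nat) : {sigma_finite_measure set 'rV[R]_n -> \bar R} :=
  if n is n'.+1 then lebesgue_rV_step (lebesgue_rV n')
  else \d_(0%R : 'rV[R]_0).

End lebesgue_measure_rV.

Section choquet.
Context {R : realType} {n : nat}.
Local Notation Rn := 'rV[R]_n.
Local Notation mu := (@lebesgue_rV R n).

Implicit Types (x y xi : Rn) (r t : R).

(* The library's norm on 'rV[R]_n is the sup norm, hence the explicit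
   Euclidean structure. *)
Definition dotr x y : R := \sum_(i < n) x ord0 i * y ord0 i.

Definition eball x r : set Rn := [set y | dotr (x - y) (x - y) < r ^+ 2].

(* G is the (real) integrable function whose Fourier transform
   xi |-> \int G(x) e^{-i x.xi} dx is the real function m. *)
Definition is_inverse_fourier (m : Rn -> R) (G : Rn -> R) : Prop :=
  mu.-integrable setT (EFin \o G) /\
  forall xi, \int[mu]_x (G x * cos (dotr x xi)) = m xi /\
             \int[mu]_x (G x * sin (dotr x xi)) = 0.

(* The Bessel kernel, determined up to a null set by Fourier inversion; only
   convolutions with it are used, and these do not see null sets. *)
Definition bessel_kernel (alpha : R) : Rn -> R :=
  xget (cst 0) [set G | is_inverse_fourier
    (fun xi => (1 + dotr xi xi) `^ (- alpha / 2)) G].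

Local Open Scope ereal_scope.

Definition convolution (G f : Rn -> R) x : \bar R :=
  \int[mu]_y (G (x - y)%R * f y)%:E.

Definition bessel_capacity (alpha s : R) (E : set Rn) : \bar R :=
  ereal_inf [set 'N[mu]_s%:E[EFin \o f] `^ s | f in [set f : Rn -> R |
    [/\ measurable_fun [set: Rn] f, forall x, (0 <= f x)%R &
        forall x, E x -> 1 <= convolution (bessel_kernel alpha) f x]]].

(* Quasieverywhere defined functions are represented by total functions; their
   values on a set of zero capacity are irrelevant in what follows. *)
Definition quasicontinuous (alpha s : R) (f : Rn -> \bar R) : Prop :=
  forall e : R, (0 < e)%R -> exists G : set Rn,
    [/\ open G, bessel_capacity alpha s G < e%:E &
        {within ~` G, continuous f}].

Definition choquet_integral (alpha s : R) (w : Rn -> \bar R) : \bar R :=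
  \int[lebesgue_measure]_(t in `[0%R, +oo[)
    bessel_capacity alpha s [set x | t%:E < w x].

Definition L1C_norm (alpha s : R) (f : Rn -> \bar R) : \bar R :=
  choquet_integral alpha s (abse \o f).

Definition L1C (alpha s : R) : set (Rn -> \bar R) :=
  [set f | quasicontinuous alpha s f /\ L1C_norm alpha s f < +oo].

(* Elements of the spaces below are functions rather than classes modulo a.e.
   equality: M_norm and N_norm do not distinguish a.e. equal functions. *)
Definition Lp_loc (p : R) : set (Rn -> R) :=
  [set f : Rn -> R | measurable_fun [set: Rn] f /\
    forall K, compact K -> \int[mu]_(x in K) (`|f x| `^ p)%:E < +oo].

Definition M_norm (alpha s p : R) (f : Rn -> R) : \bar R :=
  ereal_sup [set (\int[mu]_(x in K) (`|f x| `^ p)%:E /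
                  bessel_capacity alpha s K) `^ p^-1%R |
    K in [set K : set Rn | compact K /\ bessel_capacity alpha s K != 0]].

Definition M_space (alpha s p : R) : set (Rn -> R) :=
  [set f | Lp_loc p f /\ M_norm alpha s p f < +oo].

Definition local_maximal (f : Rn -> \bar R) x : \bar R :=
  ereal_sup [set (mu (eball x r))^-1 * \int[mu]_(y in eball x r) `|f y| |
    r in `]0%R, 1%R]].

Definition locally_integrable_rV (f : Rn -> \bar R) : Prop :=
  measurable_fun [set: Rn] f /\
  forall K, compact K -> \int[mu]_(x in K) `|f x| < +oo.

Definition A1loc_bound (w : Rn -> \bar R) : set R :=
  [set C | (0 <= C)%R /\ {ae mu, forall x, local_maximal w x <= C%:E * w x}].

Definition A1loc : set (Rn -> \bar R) :=
  [set w | [/\ forall x, 0 <= w x, locally_integrable_rV w &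
               A1loc_bound w !=set0]].

Definition A1loc_const (w : Rn -> \bar R) : \bar R :=
  ereal_inf (EFin @` A1loc_bound w).

Definition N_weights (alpha s cbar : R) : set (Rn -> \bar R) :=
  [set w | [/\ L1C alpha s w, A1loc w, L1C_norm alpha s w <= 1 &
               A1loc_const w <= cbar%:E]].

(* w^(1-q) is written as the inverse of w^(q-1), because the library sets
   0 `^ r = 0 for r < 0, whereas 0^-1 = +oo and +oo^-1 = 0 in \bar R; moreover
   0 * +oo = 0, so a finite integral forces g = 0 a.e. on {w = 0}. *)
Definition N_norm (alpha s cbar q : R) (g : Rn -> R) : \bar R :=
  ereal_inf [set
    (\int[mu]_x ((`|g x| `^ q)%:E * (w x `^ (q - 1)%R)^-1)) `^ q^-1%R |
    w in N_weights alpha s cbar].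

Definition N_space (alpha s cbar q : R) : set (Rn -> R) :=
  [set g : Rn -> R |
    measurable_fun [set: Rn] g /\ N_norm alpha s cbar q g < +oo].

(* Functionals on N_space are total functions of which only the restriction to
   N_space matters. *)
Definition N_dual (alpha s cbar q : R) : set ((Rn -> R) -> R) :=
  [set L |
    (forall (a : R) g h, N_space alpha s cbar q g -> N_space alpha s cbar q h ->
       L (fun x => a * g x + h x)%R = (a * L g + L h)%R) /\
    exists C : R, forall g, N_space alpha s cbar q g ->
      `|L g|%:E <= C%:E * N_norm alpha s cbar q g].

Definition N_dual_norm (alpha s cbar q : R) (L : (Rn -> R) -> R) : \bar R :=
  ereal_sup [set `|L g|%:E | g in [set g | N_space alpha s cbar q g /\
                                           N_norm alpha s cbar q g <= 1]].

Definition pairing (f g : Rn -> R) : R := (\int[mu]_x (f x * g x))%R.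

End choquet.

(* Main.v *)
(* Upper bound: for [f] in [M] the layer-cake formula and inner regularity give
   [\int |f|^p w <= ||f||_M^p ||w||_L1(C)], so Hoelder's inequality with weight [w]
   bounds [\int f g].
   Lower bound: testing with [|f|^(p-1) sgn f] on a compact [K] reduces it to finding
   a weight, admissible for [N] with a uniform constant, which equals [c / Cap K] on [K].
   To build it, take [f] nearly optimal for [Cap K], dominate [f^tau], [1 < tau < s], by
   an A_1 function [P] (Rubio de Francia), and let [F = P^(1/tau)] and
   [u = sum_j 2^(-j alpha) A_j F], a finite sum, [A_j] being the average over the sup-norm
   ball of radius [2^-j].  Up to constants, [G_alpha * F >= u] everywhere and [u >= 1] on
   [K], so the capacity of [u > t] is controlled by [||F||_s], while [u^theta] is locally
   A_1 for some [theta > s]; the weight is a multiple of [min(1, c u)^theta].  The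
   comparison of [u] with [G_alpha * F] uses the formula for [G_alpha] as an average of
   Gaussians, which is the Bessel kernel by uniqueness of the Fourier transform.
   Representation: a bounded functional on [N], applied to indicators of subsets of an
   annulus, is a charge dominated by Lebesgue measure; the Radon-Nikodym densities are
   glued into [f], and bounded functions with compact support are dense in [N]. *)
Require Import Defs.
From HB Require Import structures.
From mathcomp Require Import all_boot all_order all_algebra.
From mathcomp Require Import all_classical all_reals all_analysis
  measurable_realfun.
From mathcomp Require Import ring lra.

Set Implicit Arguments.
Unset Strict Implicit.
Unset Printing Implicit Defensive.

Import Order.TTheory GRing.Theory Num.Theory.
Import numFieldNormedType.Exports.

Local Open Scope classical_set_scope.
Local Open Scope ring_scope.

(** * Lebesgue measure on R^n *)

(** The exponents answer two opposite demands. The capacity of [u > t] grows like [t^(-s)] as [t]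
    tends to zero, so the capacities of the superlevel sets of [u^theta] are integrable near zero
    only for [theta > s]; the maximal operator on [L^(s/tau)] requires [tau < s]. Both hold with
    [theta = tau / (1 - kappa)], where [n kappa / tau = alpha / 2]: half of the decay [2^(-j alpha)]
    pays for the passage to smaller balls, the other half remains as a geometric ratio, and
    [theta > s] as soon as [tau] is close to [s]. All of this involves [n], [alpha], [s] alone,
    which is why one [cbar] serves every [p]; the exponent [p] enters only with Hoelder's inequality
    and with testing. The second obstacle is regularity. A Bessel potential is only lower
    semicontinuous, and the number of dyadic terms needed to see it is large depends on the point.
    Truncating the functions and using finite sums of averages makes [u] continuous and bounded;
    compactness of [K] gives one number of terms for all its points, and no constant depends on that
    number. *)

Section rV_measure.
Context {R : realType}.
Local Notation mu := (@lebesgue_rV R _).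

Lemma ball_rVP n (x y : 'rV[R]_n) (r : R) : 0 < r ->
  ball x r y <-> forall i, `|x ord0 i - y ord0 i| < r.
Proof.
move=> r0; split=> [[_ h] i|h]; first exact: (h ord0 i).
by split=> // i j; rewrite (ord1 i); exact: h.
Qed.

Lemma measurable_ball_rV n (x : 'rV[R]_n) (r : R) : measurable (ball x r).
Proof.
have [r0|r0] := ltP 0 r; last first.
  suff -> : ball x r = set0 by exact: measurable0.
  by rewrite -subset0 => y [] /lt_le_trans/(_ r0); rewrite ltxx.
have -> : ball x r = \big[setI/setT]_(i < n)
    ((fun y : 'rV[R]_n => y ord0 i) @^-1` ball (x ord0 i) r).
  rewrite predeqE => y; split=> [/ball_rVP-/(_ r0) h|].
    by rewrite -bigcap_seq => i _; exact: h.
  by rewrite -bigcap_seq => h; apply/ball_rVP => // i; apply: h; rewrite /= mem_index_enum.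
apply: bigsetI_measurable => i _; rewrite -[X in measurable X]setTI.
by apply: measurable_coor => //; exact: measurable_ball.
Qed.

(** The sigma-algebra is generated by the coordinates, so an open set is exhausted by countably many
    products of intervals: the sup-norm balls with rational centre and radius [1/(k+1)] that lie
    inside [U]. *)
Lemma open_measurable_rV n (U : set 'rV[R]_n) : open U -> measurable U.
Proof.
move=> oU.
pose B (p : 'rV[rat]_n * nat) : set 'rV[R]_n :=
  ball (map_mx ratr p.1 : 'rV[R]_n) p.2.+1%:R^-1.
have -> : U = \bigcup_p [set x | B p x /\ B p `<=` U].
  rewrite predeqE => x; split=> [Ux|[p _]]; last by case=> Bx; exact.
  have /nbhs_ballP[e /= e0 eU] : nbhs x U by exact: open_nbhs_nbhs.
  (* With radius below [e / 2], a cube whose rational centre is within [1/(k+1)] of [x] contains [x]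
     and stays inside [ball x e]. *)
  have [k ke] : exists k : nat, k.+1%:R^-1 < e / 2.
    by exists (Num.truncn (e / 2)^-1); rewrite invf_plt ?posrE ?divr_gt0// truncnS_gt.
  have /choice[q hq] : forall i, exists q : rat, ratr q \in `](x ord0 i - k.+1%:R^-1), (x ord0 i + k.+1%:R^-1)[.
    move=> i; have := @dense_rat R `](x ord0 i - k.+1%:R^-1), (x ord0 i + k.+1%:R^-1)[%classic.
    case=> [|//|y [/= yi [q _ qy]]]; last by exists q; rewrite qy.
      exists (x ord0 i); rewrite /= in_itv/= ltrBlDr !ltrDl.
      by rewrite invr_gt0 ltr0n.
  have k0 : 0 < k.+1%:R^-1 :> R by rewrite invr_gt0.
  pose d : R := k.+1%:R^-1; rewrite -/d in ke hq k0.
  exists (\row_i q i, k) => //; split; last first.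
    move=> y /= /ball_rVP-/(_ k0) h; apply: eU; apply/ball_rVP => // i.
    have := h i; have := hq i; rewrite /= !mxE -/d in_itv/= !ltr_norml => /andP[? ?] /andP[? ?].
    by apply/andP; split; lra.
  apply/ball_rVP => // i; have := hq i; rewrite /= !mxE -/d in_itv/= ltr_norml => /andP[? ?].
  by apply/andP; split; lra.
apply: countable_bigcupT_measurable => [|p]; first exact: countableP.
have [h|h] := pselect (B p `<=` U).
  rewrite (_ : [set _ | _] = B p); first exact: measurable_ball_rV.
  by apply/seteqP; split=> x //= [].
by rewrite (_ : [set _ | _] = set0)// -subset0 => x [].
Qed.

Lemma closed_measurable_rV n (U : set 'rV[R]_n) : closed U -> measurable U.
Proof. by move=> cU; rewrite -(setCK U); apply: measurableC; apply: open_measurable_rV; exact: closed_openC. Qed.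

Lemma compact_measurable_rV n (U : set 'rV[R]_n) : compact U -> measurable U.
Proof. by move=> /(compact_closed (@norm_hausdorff _ _)); exact: closed_measurable_rV. Qed.

Lemma continuous_measurable_rV n (f : 'rV[R]_n -> R) :
  continuous f -> measurable_fun setT f.
Proof.
move=> /continuousP cf.
apply: (measurability _ (RGenOInfty.measurableE R)).
move=> _ [_ [a ->] <-]; rewrite setTI; apply: open_measurable_rV.
by apply: cf; exact: interval_open.
Qed.

Lemma rV_cons0 n (a : R) (x : 'rV[R]_n) : rV_cons (a, x) ord0 ord0 = a.
Proof. by rewrite mxE unlift_none. Qed.

Lemma rV_consS n (a : R) (x : 'rV[R]_n) i :
  rV_cons (a, x) ord0 (lift ord0 i) = x ord0 i.
Proof. by rewrite mxE liftK. Qed.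

Lemma lebesgue_rVS n (A : set 'rV[R]_n.+1) :
  mu A = (lebesgue_measure \x (@lebesgue_rV R n))%E ((@rV_cons R n) @^-1` A).
Proof. by []. Qed.

Lemma ge0_integral_rVS n (f : 'rV[R]_n.+1 -> \bar R) :
  measurable_fun setT f -> (forall x, 0 <= f x)%E ->
  (\int[mu]_x f x = \int[lebesgue_measure]_a \int[mu]_x f (rV_cons (a, x)))%E.
Proof.
move=> mf f0; rewrite [LHS](ge0_integral_pushforward (@measurable_rV_cons R n))//.
rewrite preimage_setT fubini_tonelli1//; last by move=> x; exact: f0.
by apply: measurableT_comp => //; exact: measurable_rV_cons.
Qed.

Lemma integral_rVS n (f : 'rV[R]_n.+1 -> \bar R) : mu.-integrable setT f ->
  (\int[mu]_x f x = \int[lebesgue_measure]_a \int[mu]_x f (rV_cons (a, x)))%E.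
Proof.
move=> intf; have mf := measurable_int _ intf.
rewrite [LHS](integral_pushforward (@measurable_rV_cons R n))//; last first.
  apply/integrableP; split; first exact: measurableT_comp mf (@measurable_rV_cons R n).
  have /integrableP[_] := intf.
  rewrite [X in (X < _)%E -> _](ge0_integral_pushforward (@measurable_rV_cons R n))//.
  exact: measurableT_comp.
rewrite preimage_setT.
rewrite -integral12_prod_meas1//.
apply/integrableP; split; first exact: measurableT_comp mf (@measurable_rV_cons R n).
have /integrableP[_] := intf.
rewrite [X in (X < _)%E -> _](ge0_integral_pushforward (@measurable_rV_cons R n))//.
exact: measurableT_comp.
Qed.

Lemma lebesgue_rV_ball n (x : 'rV[R]_n) (r : R) : 0 < r ->
  mu (ball x r) = ((r *+ 2) ^+ n)%:E.
Proof.
move=> r0; elim: n x => [|n IH] x.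
  rewrite expr0 /= diracE mem_set//=.
  by apply/ball_rVP => // -[].
rewrite lebesgue_rVS (_ : _ @^-1` _ =
    ball (x ord0 ord0) r `*` ball (\row_i x ord0 (lift ord0 i)) r); last first.
  rewrite predeqE => -[a y]; split=> /=.
    move/ball_rVP => /(_ r0) h; split=> /=.
      by have := h ord0; rewrite rV_cons0.
    by apply/ball_rVP => // i; rewrite mxE; have := h (lift ord0 i); rewrite rV_consS.
  move=> [/= h0 /ball_rVP-/(_ r0) h]; apply/ball_rVP => // i.
  case: (unliftP ord0 i) => [j|] ->; first by rewrite rV_consS; have := h j; rewrite mxE.
  by rewrite rV_cons0.
rewrite product_measure1E//; last exact: measurable_ball_rV.
  by have /= -> := lebesgue_measure_ball (x ord0 ord0) (ltW r0); rewrite IH -EFinM exprS.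
exact: measurable_ball.
Qed.

Lemma affine_measurable n (a : 'rV[R]_n) (c : R) :
  measurable_fun setT (fun x : 'rV[R]_n => a + c *: x).
Proof.
apply: measurable_fun_coorP => i; under eq_fun do rewrite mxE mxE.
apply: measurable_funD => //; apply: measurable_funM => //; exact: measurable_coor.
Qed.

(** The rescaled pushforward agrees with Lebesgue measure on half-open intervals, which determines
    it. For [c < 0] the preimage of []b, d]] is half-open on the other side, with the same
    length. *)
Lemma lebesgue_measure_affine (a c : R) (A : set R) : c != 0 -> measurable A ->
  lebesgue_measure A = (`|c|%:E * lebesgue_measure ((fun x => (a + c * x)%R) @^-1` A))%E.
Proof.
move=> c0 mA.
have mT : measurable_fun setT ((fun x => a + c * x) : measurableTypeR R -> measurableTypeR R).
  by apply: measurable_funD => //; apply: measurable_funM.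
pose m := mscale (NngNum (normr_ge0 c))
  (measure_function_pushforward__canonical__measure_function_Measure
    (@lebesgue_measure R) mT).
rewrite (@lebesgue_measure_unique _ m)// => _ [[b d]] _ <-.
rewrite /m /= /mscale /= /pushforward.
have [c0'|c0'|c0'] := ltgtP c 0; last by rewrite c0' eqxx in c0.
- rewrite (_ : _ @^-1` _ = `[(d - a) / c, (b - a) / c[%classic); last first.
    rewrite predeqE => x /=; rewrite !in_itv/= ler_ndivrMr// ltr_ndivlMr//.
    by rewrite lerBrDl ltrBlDl mulrC andbC.
  rewrite !lebesgue_measure_itv/= !lte_fin ltr_nM2r ?invr_lt0// ltrD2r.
  case: ifPn => _; last by rewrite mule0.
  rewrite -EFinD -EFinM -mulrBl; congr EFin; rewrite ltr0_norm//.
  by field.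
- rewrite (_ : _ @^-1` _ = `](b - a) / c, (d - a) / c]%classic); last first.
    rewrite predeqE => x /=; rewrite !in_itv/= ler_pdivlMr// ltr_pdivrMr//.
    by rewrite lerBrDl ltrBlDl mulrC.
  rewrite !lebesgue_measure_itv/= !lte_fin ltr_pM2r ?invr_gt0// ltrD2r.
  case: ifPn => _; last by rewrite mule0.
  rewrite -EFinD -EFinM -mulrBl; congr EFin; rewrite gtr0_norm//.
  by field.
Qed.

(** Induction on the dimension: on rectangles the two factors scale by [|c|] and [|c|^n], and a
    product measure is determined by its values on rectangles. *)
Lemma lebesgue_rV_affine n (a : 'rV[R]_n) (c : R) (A : set 'rV[R]_n) :
  c != 0 -> measurable A ->
  mu A = ((`|c| ^+ n)%:E * mu ((fun x => (a + c *: x)%R) @^-1` A))%E.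
Proof.
move=> c0; elim: n a A => [|n IH] a A mA.
  rewrite expr0 mul1e (_ : _ @^-1` _ = A)// predeqE => x /=.
  by rewrite (_ : a + c *: x = x)//; apply/rowP => -[].
rewrite !lebesgue_rVS.
pose a' : R * 'rV[R]_n := (a ord0 ord0, \row_i a ord0 (lift ord0 i)).
have mT : measurable_fun setT ((fun x => (a'.1 + c * x.1, a'.2 + c *: x.2)) :
   measurableTypeR R * 'rV[R]_n -> measurableTypeR R * 'rV[R]_n).
  apply: measurable_fun_pair.
    by apply: measurable_funD => //; apply: measurable_funM => //; exact: measurable_fst.
  exact: (measurableT_comp (@affine_measurable n a'.2 c) measurable_snd).
pose m := mscale (NngNum (exprn_ge0 n.+1 (normr_ge0 c)))
  (measure_function_pushforward__canonical__measure_function_Measure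
    (lebesgue_measure \x (@lebesgue_rV R n))%E mT).
rewrite (@product_measure_unique _ _ _ _ _ _ _ m); last 2 first.
- move=> B C mB mC; rewrite /m /= /mscale /= /pushforward.
  rewrite (_ : _ @^-1` _ = ((fun x => a'.1 + c * x) @^-1` B) `*` ((fun x => a'.2 + c *: x) @^-1` C)); last first.
    by [].
  rewrite product_measure1E//; last 2 first.
  + have mT1 : measurable_fun setT (fun x : R => a'.1 + c * x).
      by apply: measurable_funD => //; apply: measurable_funM.
    by rewrite -[X in measurable X]setTI; exact: mT1.
  + rewrite -[X in measurable X]setTI; apply: affine_measurable => //.
  rewrite [in RHS](lebesgue_measure_affine a'.1 c0)// [in RHS](IH a'.2)//.
  rewrite exprS EFinM -!muleA; congr (_ * _)%E.
  by rewrite !muleA (muleC (lebesgue_measure _)).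
- rewrite -[X in measurable X]setTI; exact: measurable_rV_cons.
rewrite /m /= /mscale /= /pushforward; congr (_ * (_ \x _) _)%E.
rewrite predeqE => -[b x] /=.
suff -> : rV_cons (a'.1 + c * b, a'.2 + c *: x) = a + c *: rV_cons (b, x) by [].
apply/rowP => i; case: (unliftP ord0 i) => [j|] ->.
  by rewrite rV_consS !mxE liftK.
by rewrite rV_cons0 !mxE unlift_none.
Qed.

Lemma ge0_integral_affine n (a : 'rV[R]_n) (c : R) (f : 'rV[R]_n -> \bar R) :
  c != 0 -> measurable_fun setT f -> (forall x, 0 <= f x)%E ->
  (\int[mu]_x f x = (`|c| ^+ n)%:E * \int[mu]_x f (a + c *: x)%R)%E.
Proof.
move=> c0 mf f0.
have mT := @affine_measurable n a c.
pose m := mscale (NngNum (exprn_ge0 n (normr_ge0 c)))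
  (measure_function_pushforward__canonical__measure_function_Measure (@lebesgue_rV R n) mT).
rewrite (@eq_measure_integral _ _ _ setT m (@lebesgue_rV R n)); last first.
  by move=> A mA _; exact: (lebesgue_rV_affine a c0 mA).
rewrite [LHS]ge0_integral_mscale//; congr (_ * _)%E.
by rewrite [LHS](ge0_integral_pushforward mT).
Qed.

Lemma lebesgue_rV_affine0 n (a : 'rV[R]_n) (c : R) (A : set 'rV[R]_n) :
  c != 0 -> mu.-negligible A -> mu.-negligible ((fun x => a + c *: x) @^-1` A).
Proof.
move=> c0 [B [mB B0 AB]]; exists ((fun x => a + c *: x) @^-1` B); split.
- by rewrite -[X in measurable X]setTI; exact: affine_measurable.
- move: B0; rewrite (@lebesgue_rV_affine n a c)// => /eqP.
  by rewrite mule_eq0 => /orP[|/eqP//]; rewrite eqe expf_eq0 normr_eq0 (negPf c0) andbF.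
- by move=> x Ax; exact: AB.
Qed.

End rV_measure.

(** * Inner regularity *)

Lemma cvge_lt_eventually {R : realType} (u : nat -> \bar R) (l e : \bar R) :
  u @ \oo --> l -> (l < e)%E -> exists N, forall k, (N <= k)%N -> (u k < e)%E.
Proof.
move=> ul le.
have /ul[N _ hN] : nbhs l [set y | (y < e)%E].
  by apply: open_nbhs_nbhs; split => //; exact: open_ereal_lt_ereal.
by exists N.
Qed.

Section density_measure.
Context d (T : measurableType d) (R : realType) (mu : {measure set T -> \bar R}).
Variables (f : T -> \bar R) (mf : measurable_fun setT f) (f0 : forall x, (0 <= f x)%E).

Definition density_measure (A : set T) : \bar R := \int[mu]_(x in A) f x.

Let density_measure0 : density_measure set0 = 0%E.
Proof. exact: integral_set0. Qed.

Let density_measure_ge0 A : (0 <= density_measure A)%E.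
Proof. by apply: integral_ge0. Qed.

HB.instance Definition _ := isMeasure.Build _ _ _ density_measure
  density_measure0 density_measure_ge0 (semi_sigma_additive_nng_induced mf f0).

Definition density_measure_def : {measure set T -> \bar R} := density_measure.

End density_measure.

Section regularity.
Context {R : realType} {n : nat}.
Local Notation Rn := 'rV[R]_n.

(** Approximation from inside by closed sets and from outside by open sets at the same time is
    symmetric under complements, so the regular sets can be shown to form a sigma-algebra. *)
Definition regular_set (nu : set Rn -> \bar R) (E : set Rn) :=
  forall e : R, 0 < e -> exists C U, [/\ closed C, open U, C `<=` E, E `<=` U &
    (nu (U `\` C) < e%:E)%E].

Variable (nu : {measure set Rn -> \bar R}).
Hypothesis nuT : (nu setT < +oo)%E.

Let nu_fin A : measurable A -> (nu A < +oo)%E.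
Proof. by move=> mA; apply: le_lt_trans nuT; rewrite le_measure// inE. Qed.

Let mD (C U : set Rn) : closed C -> open U -> measurable (U `\` C).
Proof. by move=> cC oU; apply: measurableD; [exact: open_measurable_rV|exact: closed_measurable_rV]. Qed.

Lemma regular_setC E : regular_set nu E -> regular_set nu (~` E).
Proof.
move=> rE e /rE[C [U [cC oU CE EU h]]]; exists (~` U), (~` C); split.
- exact: open_closedC.
- exact: closed_openC.
- exact: subsetC.
- exact: subsetC.
- by rewrite setDE setCK setIC -setDE.
Qed.

(** All the open sets may be united, but only finitely many of the closed ones. The mass left out
    tends to zero by continuity from above, [nu] being finite. *)
Lemma regular_set_bigcup (E : nat -> set Rn) : (forall k, regular_set nu (E k)) ->
  regular_set nu (\bigcup_k E k).
Proof.
move=> rE e e0.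
have /choice[CU hCU] k : exists CU : set Rn * set Rn, [/\ closed CU.1, open CU.2,
    CU.1 `<=` E k, E k `<=` CU.2 & (nu (CU.2 `\` CU.1) < (e / 2 / (2 ^ k.+1)%:R)%:E)%E].
  have [|C [U h]] := rE k (e / 2 / (2 ^ k.+1)%:R); last by exists (C, U).
  by rewrite !divr_gt0// ltr0n expn_gt0.
pose C N := \bigcup_(k < N) (CU k).1.
pose U := \bigcup_k (CU k).2.
have oU : open U by apply: bigcup_open => k _; have [] := hCU k.
have cC N : closed (C N).
  rewrite /C; apply: closed_bigcup; first exact: finite_II.
  by move=> k _; have [] := hCU k.
have mF N : measurable (U `\` C N) by exact: mD.
have mF' : measurable (\bigcap_N (U `\` C N)) by apply: bigcapT_measurable.
have : (nu \o (fun N => U `\` C N)) x @[x --> \oo] --> nu (\bigcap_N (U `\` C N)).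
  apply: nonincreasing_cvg_mu => //; first exact: nu_fin.
  move=> N M NM; apply/subsetPset; apply: setDS => x [k /= kN Ck].
  by exists k => //=; exact: leq_trans NM.
have small : (nu (\bigcap_N (U `\` C N)) < e%:E)%E.
  apply: (@le_lt_trans _ _ (e / 2)%:E); last by rewrite lte_fin; lra.
  (* A point left over for every [N] lies in some open [(CU k).2] and in no closed [(CU k).1], so
     the limit set costs at most the sum of the budgets, [e / 2]. *)
  apply: (@le_trans _ _ (\sum_(0 <= k <oo) nu ((CU k).2 `\` (CU k).1))%E).
    apply: measure_sigma_subadditive => //.
      by move=> k; have [? ? _ _ _] := hCU k; exact: mD.
    move=> x h; have [[k _ Uk] _] := h 0%N I; exists k => //; split => // Ck.
    by have [_] := h k.+1 I; apply; exists k => /=.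
  apply: le_trans (epsilon_trick0 xpredT _); last by rewrite divr_ge0// ltW.
  by apply: lee_nneseries => k _ //; have [_ _ _ _ /ltW] := hCU k.
move=> /cvge_lt_eventually/(_ small)[N /(_ N (leqnn N))/= hN].
exists (C N), U; split => //.
- by move=> x [k _ Ck]; exists k => //; have [_ _ + _ _] := hCU k; exact.
- by move=> x [k _ Ek]; exists k => //; have [_ _ _ + _] := hCU k; exact.
Qed.

Lemma regular_set_open_coor (i : 'I_n) (a : R) :
  regular_set nu [set x : Rn | a < x ord0 i].
Proof.
move=> e e0.
have cc := @coord_continuous R 1 n ord0 i.
have oU : open [set x : Rn | a < x ord0 i].
  rewrite (_ : [set _ | _] = (fun x : Rn => x ord0 i) @^-1` `]a, +oo[%classic); last first.
    by apply/seteqP; split=> x /=; rewrite in_itv/= andbT.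
  by move/continuousP : cc; apply; exact: interval_open.
pose C (k : nat) := [set x : Rn | a + k.+1%:R^-1 <= x ord0 i].
have cC k : closed (C k).
  rewrite (_ : C k = (fun x : Rn => x ord0 i) @^-1` `[a + k.+1%:R^-1, +oo[%classic); last first.
    by apply/seteqP; split=> x /=; rewrite in_itv/= andbT.
  by move/continuous_closedP : cc; apply; exact: interval_closed.
have : (nu \o (fun N => [set x : Rn | a < x ord0 i] `\` C N)) x @[x --> \oo] -->
   nu (\bigcap_N ([set x : Rn | a < x ord0 i] `\` C N)).
  apply: nonincreasing_cvg_mu => //; first by apply: nu_fin; exact: mD.
  - by move=> k; exact: mD.
  - by apply: bigcapT_measurable => k; exact: mD.
  - move=> N M NM; apply/subsetPset; apply: setDS => x; apply: le_trans.
    by rewrite lerD2l lef_pV2 ?posrE// ler_nat ltnS.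
rewrite (_ : \bigcap_N _ = set0); last first.
  rewrite -subset0 => x h; have [/= ax _] := h 0%N I.
  have [_] := h (Num.truncn (x ord0 i - a)^-1) I; apply.
  rewrite /C /= -lerBrDl; apply: ltW.
  by rewrite invf_plt ?posrE ?subr_gt0// truncnS_gt.
rewrite measure0 => /cvge_lt_eventually/(_ (_ : 0%E < e%:E)%E)[|N /(_ N (leqnn N))/= hN].
  by rewrite lte_fin.
exists (C N), [set x : Rn | a < x ord0 i]; split => //.
by move=> x; apply: lt_le_trans; rewrite ltrDl invr_gt0.
Qed.

(** The generators come in two layers, preimages under a coordinate of Borel sets of the line and
    the open rays that generate these; the sigma-algebra argument is run once for each layer. *)
Lemma regular_measurable (E : set Rn) : measurable E -> regular_set nu E.
Proof.
move: E; apply: smallest_sub => /=.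
  split.
  - move=> e e0; exists set0, set0; split => //; first exact: closed0.
    by rewrite setD0 measure0 lte_fin.
  - by move=> A; rewrite setTD; exact: regular_setC.
  - exact: regular_set_bigcup.
move=> B; rewrite -bigcup_seq => -[i _] [D mD' <-] /=; rewrite setTI.
have {}mD' : (@RGenOInfty.G R).-sigma.-measurable D by rewrite -RGenOInfty.measurableE.
move: D mD'; apply: smallest_sub => /=.
  split.
  - rewrite preimage_set0 => e e0; exists set0, set0; split => //; first exact: closed0.
    by rewrite setD0 measure0 lte_fin.
  - by move=> A; rewrite setTD preimage_setC; exact: regular_setC.
  - by move=> F rF; rewrite preimage_bigcup; exact: regular_set_bigcup.
move=> _ [a ->].
rewrite (_ : _ @^-1` _ = [set x : Rn | a < x ord0 i]); first exact: regular_set_open_coor.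
by apply/seteqP; split=> x /=; rewrite in_itv/= andbT.
Qed.

End regularity.

Section inner_regularity.
Context {R : realType} {n : nat}.
Local Notation Rn := 'rV[R]_n.
Local Notation mu := (@lebesgue_rV R n).

Definition cball (r : R) : set Rn := [set x | `|x| <= r].

Lemma closed_cball r : closed (cball r).
Proof.
rewrite (_ : cball r = (fun x : Rn => `|x|) @^-1` `]-oo, r]%classic).
  have /continuous_closedP h : continuous (fun x : Rn => `|x|) by exact: norm_continuous.
  by apply: h; exact: interval_closed.
by apply/seteqP; split=> x /=; rewrite in_itv.
Qed.

Lemma compact_cball r : compact (cball r).
Proof.
apply: bounded_closed_compact; last exact: closed_cball.
exists r; split; first exact: num_real.
by move=> t rt x /= xr; apply: le_trans xr _; exact: ltW.
Qed.

Lemma measurable_cball r : measurable (cball r).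
Proof. by apply: closed_measurable_rV; exact: closed_cball. Qed.

Lemma bigcup_cball : \bigcup_k cball k%:R = setT.
Proof.
rewrite -subTset => x _; exists (Num.truncn `|x|).+1 => //.
by rewrite /cball/=; apply: ltW; exact: truncnS_gt.
Qed.

Lemma cball_nd : {homo (fun k : nat => cball k%:R) : k m / (k <= m)%N >-> (k <= m)%O}.
Proof.
by move=> k m km; apply/subsetPset => x /le_trans; apply; rewrite ler_nat.
Qed.

(** [M_norm] tests compact sets only, whereas the layer-cake formula and the maximal function
    produce measurable superlevel sets. Cutting with the balls [cball k] makes [f dx] a finite
    measure, to which inner regularity applies. *)
Lemma integral_le_of_compact (f : Rn -> \bar R) (E : set Rn) (c : \bar R) :
  measurable_fun setT f -> (forall x, 0 <= f x)%E ->
  (forall K, compact K -> \int[mu]_(x in K) f x < +oo)%E -> measurable E ->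
  (forall K, compact K -> K `<=` E -> \int[mu]_(x in K) f x <= c)%E ->
  (\int[mu]_(x in E) f x <= c)%E.
Proof.
move=> mf f0 fK mE hE.
have nd := cball_nd.
rewrite (_ : E = \bigcup_k (E `&` cball k%:R)); last by rewrite -setI_bigcupr bigcup_cball setIT.
have Fnd : {homo (fun k : nat => E `&` cball k%:R) : k m / (k <= m)%N >-> (k <= m)%O}.
  move=> k m km; apply/subsetPset => x [Ex xk]; split => //.
  by move: xk; have /subsetPset := nd _ _ km; apply.
have mF k : measurable (E `&` cball k%:R) by apply: measurableI => //; exact: measurable_cball.
have /cvg_lim <- // := @ge0_nondecreasing_set_cvg_integral _ _ _ _ f mu Fnd mF
   (fun k => measurable_funTS mf) (fun k x _ => f0 x).
apply: lime_le.
  apply: ereal_nondecreasing_is_cvgn => k m km; apply: ge0_subset_integral => //.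
  - exact: measurable_funTS.
  - exact/subsetPset/Fnd.
near=> k => {nd}.
have mf' : measurable_fun setT (f \_ (cball k%:R)).
  by apply/(measurable_restrictT _ (measurable_cball k%:R)); exact: measurable_funTS.
have f0' x : (0 <= (f \_ (cball k%:R)) x)%E by rewrite patchE; case: ifPn.
pose nu := density_measure_def mu mf' f0'.
have nuE A : (nu A = \int[mu]_(x in A `&` cball k%:R) f x)%E by rewrite integral_mkcondr.
have nuT : (nu setT < +oo)%E by rewrite nuE// setTI; apply: fK; exact: compact_cball.
apply/lee_addgt0Pr => e e0.
have [C [U [cC oU CE EU h]]] := regular_measurable nuT (mF k) e0.
have mC := closed_measurable_rV cC.
have mU := open_measurable_rV oU.
rewrite (_ : E `&` cball k%:R = (E `&` cball k%:R) `&` cball k%:R); last by rewrite -setIA setIid.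
rewrite -nuE; apply: (@le_trans _ _ (nu C + nu (U `\` C))%E).
  rewrite -measureU//; [|exact: measurableD|by rewrite setDE setIC -setIA setICl setI0].
  rewrite le_measure ?inE//; first by apply: measurableU => //; exact: measurableD.
  by move=> x /EU Ux; have [Cx|nCx] := pselect (C x); [left|right].
apply: leeD; last exact: ltW.
have -> : (nu C = \int[mu]_(x in C) f x)%E.
  by rewrite nuE; congr (integral _ _ _); apply/setIidPl => x /CE [].
apply: hE.
  apply: (subclosed_compact cC (@compact_cball k%:R)).
  by move=> x /CE[].
by move=> x /CE[].
Unshelve. all: by end_near. Qed.

End inner_regularity.

(** * One-dimensional Gaussians *)

Section gaussian_fourier1.
Context {R : realType}.
Local Notation leb := (@lebesgue_measure R).

(** Fundamental theorem of calculus on [[-(m+1), m+1]]: as [harmonic m] is [1/(m+1)], the boundary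
    terms vanish in the limit. This is the form in which integration by parts is used. *)
Lemma integral_derive_eq0 (F f : R -> R) (C : R) :
  (forall x : R, is_derive x 1 F (f x)) -> continuous f ->
  leb.-integrable setT (EFin \o f) ->
  (forall m, `|F m.+1%:R| <= C * harmonic m) ->
  (forall m, `|F (- m.+1%:R)| <= C * harmonic m) ->
  (\int[leb]_x (f x)%:E = 0)%E.
Proof.
move=> dF cf intf F1 F2.
pose S (m : nat) : set R := `[- m.+1%:R, m.+1%:R]%classic.
have mS m : measurable (S m) by exact: measurable_itv.
have mf : measurable_fun setT f by exact: continuous_measurable_fun.
have Im m : (\int[leb]_(x in S m) (f x)%:E = (F m.+1%:R - F (- m.+1%:R))%:E)%E.
  have lt : - m.+1%:R < m.+1%:R :> R by rewrite gtrN// ltr0n.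
  rewrite (continuous_FTC2 lt (F := F)) //.
  - by apply: continuous_subspaceT.
  - have cF : continuous F by move=> x; apply: differentiable_continuous; apply/derivable1_diffP; have := dF x; case.
    split.
    + by move=> x _; have [] := dF x.
    + apply: cvg_at_right_filter; exact: cF.
    + apply: cvg_at_left_filter; exact: cF.
  - by move=> x _; rewrite derive1E; have [_ ->] := dF x.
have h1 : (fun m => \int[leb]_(x in S m) (f x)%:E)%E @ \oo --> (\int[leb]_x (f x)%:E)%E.
  under eq_fun do rewrite integral_mkcond.
  apply: (@dominated_cvg _ _ _ leb setT measurableT _ _ (fun x => `|(f x)%:E|)%E) => //.
  - move=> m; apply/(measurable_restrictT _ (mS m)); apply: measurable_funTS.
    exact/measurable_EFinP.
  - move=> x _; apply: cvg_near_cst; near=> m; rewrite patchE mem_set// /S /= in_itv/=.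
    rewrite -ler_norml; apply: (@le_trans _ _ m%:R); last by rewrite ler_nat.
    by near: m; exact: nbhs_infty_ger.
  - exact: integrable_abse.
  - by move=> m x _; rewrite patchE; case: ifPn => //; rewrite abse0.
have h2 : (fun m => \int[leb]_(x in S m) (f x)%:E)%E @ \oo --> 0%E.
  under eq_fun do rewrite Im.
  apply: cvg_EFin; first by near=> m.
  apply/norm_cvg0P.
  have hh : \forall m \near \oo, cst 0 m <= `|F m.+1%:R - F (- m.+1%:R)| <= (C *+ 2) * harmonic m.
    near=> m; rewrite /= normr_ge0/=; apply: le_trans (ler_normB _ _) _.
    by rewrite mulrnAl mulr2n lerD.
  apply: (squeeze_cvgr hh).
  - exact: cvg_cst.
  - rewrite -(mulr0 (C *+ 2)); apply: cvgM; [exact: cvg_cst|exact: cvg_harmonic].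
exact: (cvg_unique _ h1 h2).
Unshelve. all: by end_near. Qed.

Definition gauss1 (a x : R) : R := expR (- (a * x ^+ 2)).

Lemma gauss1_ge0 (a x : R) : 0 <= gauss1 a x.
Proof. exact: expR_ge0. Qed.

Lemma gauss1_continuous (a : R) : continuous (gauss1 a).
Proof.
move=> x; apply: (@continuous_comp _ _ _ (fun x : R => - (a * x ^+ 2)) expR).
  apply: cvgN; apply: cvgM; first exact: cvg_cst.
  exact: exprn_continuous.
exact: continuous_expR.
Qed.

Lemma measurable_gauss1 (a : R) : measurable_fun setT (gauss1 a).
Proof. by apply: continuous_measurable_fun; exact: gauss1_continuous. Qed.

Lemma integral_gauss1 (a : R) : 0 < a ->
  (\int[leb]_x (gauss1 a x)%:E = (Num.sqrt (pi / a))%:E)%E.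
Proof.
move=> a0; pose s := Num.sqrt ((2 * a)^-1).
have s0 : 0 < s by rewrite sqrtr_gt0 invr_gt0 mulr_gt0.
have s2 : s ^+ 2 = (2 * a)^-1 by rewrite sqr_sqrtr// invr_ge0 mulr_ge0// ltW.
have := integral_normal_pdf 0 s.
have k0 : 0 < Num.sqrt (pi / a) by rewrite sqrtr_gt0 divr_gt0// pi_gt0.
rewrite (_ : (fun x => _) = (fun x => (Num.sqrt (pi / a))^-1%:E * (gauss1 a x)%:E)%E); last first.
  apply/funext => x; rewrite /normal_pdf gt_eqF// -EFinM /normal_peak /normal_fun s2 subr0.
  congr (_ * _)%:E.
    by congr (_ ^-1); congr Num.sqrt; field; rewrite gt_eqF.
  by rewrite /gauss1; congr expR; field; rewrite gt_eqF.
rewrite ge0_integralZl//.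
- move=> h; have <- : ((Num.sqrt (pi / a))%:E * ((Num.sqrt (pi / a))^-1%:E * \int[leb]_x (gauss1 a x)%:E) = (Num.sqrt (pi / a))%:E)%E.
    by rewrite h mule1.
  by rewrite muleA -EFinM divff ?mul1e// gt_eqF.
- by apply/measurable_EFinP; exact: measurable_gauss1.
- by move=> x _; rewrite lee_fin expR_ge0.
Qed.

Lemma integrable_gauss1 (a : R) : 0 < a -> leb.-integrable setT (EFin \o gauss1 a).
Proof.
move=> a0; apply/integrableP; split; first by apply/measurable_EFinP; exact: measurable_gauss1.
rewrite (_ : (fun x => _) = (fun x => (gauss1 a x)%:E)).
  by rewrite integral_gauss1// ltry.
by apply/funext => x /=; rewrite ger0_norm// expR_ge0.
Qed.

(** Half of the Gaussian absorbs the factor [|x|], through [e^(-y) <= 1/(1+y)]. The result is the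
    dominating function for differentiating the Fourier integral in the frequency. *)
Lemma integrable_xgauss1 (a : R) : 0 < a ->
  leb.-integrable setT (EFin \o (fun x => `|x| * gauss1 a x)).
Proof.
move=> a0; have a2 : 0 < a / 2 by rewrite divr_gt0.
apply: (@le_integrable _ _ _ leb setT measurableT _ (fun x => (1 + (a / 2)^-1)%:E * (gauss1 (a / 2) x)%:E)%E) => //.
- apply/measurable_EFinP; apply: measurable_funM; last exact: measurable_gauss1.
  exact: normr_measurable.
- move=> x _ /=; rewrite lee_fin !normrM normr_id !(ger0_norm (gauss1_ge0 _ _)).
  rewrite (ger0_norm (_ : 0 <= 1 + _)); last by rewrite addr_ge0// invr_ge0 ltW.
  rewrite (_ : gauss1 a x = gauss1 (a / 2) x * gauss1 (a / 2) x); last first.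
    by rewrite /gauss1 -expRD; congr expR; field.
  rewrite mulrA ler_wpM2r ?gauss1_ge0//.
  have h : gauss1 (a / 2) x <= (1 + a / 2 * x ^+ 2)^-1.
    rewrite /gauss1 expRN lef_pV2 ?posrE ?expR_gt0 ?expR_ge1Dx//.
    by rewrite ltr_wpDr// mulr_ge0 ?sqr_ge0// ltW.
  apply: le_trans (ler_wpM2l (normr_ge0 x) h) _.
  have p : 0 < 1 + a / 2 * x ^+ 2 by rewrite ltr_wpDr// mulr_ge0 ?sqr_ge0// ltW.
  rewrite ler_pdivrMr// -(real_normK (num_real x)).
  set y := `|x|; have y0 : 0 <= y by exact: normr_ge0.
  set b := a / 2 in a2 *.
  have -> : (1 + b^-1) * (1 + b * y ^+ 2) = 1 + b * y ^+ 2 + b^-1 + y ^+ 2.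
    by field; rewrite gt_eqF.
  have : 0 <= b^-1 by rewrite invr_ge0 ltW.
  have : 0 <= b * y ^+ 2 by rewrite mulr_ge0 ?sqr_ge0// ltW.
  by nra.
- by apply: integrableZl => //; exact: integrable_gauss1.
Qed.

Lemma bounded_gauss1_integrable (a : R) (h : R -> R) : 0 < a -> measurable_fun setT h ->
  (forall x, `|h x| <= 1) -> leb.-integrable setT (EFin \o (fun x => gauss1 a x * h x)).
Proof.
move=> a0 mh h1; apply: le_integrable (integrable_gauss1 a0) => //.
  by apply/measurable_EFinP; apply: measurable_funM => //; exact: measurable_gauss1.
move=> x _ /=; rewrite lee_fin normrM ler_piMr//.
Qed.

(** One has [J'(t) = -(t/(2a)) J(t)], by differentiation under the integral sign and an integration
    by parts, so [e^(t^2/(4a)) J(t)] is constant. The phase [phi] treats cosine and sine together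
    and closes the induction on the dimension, where the remaining coordinates act as a phase. *)
Lemma fourier_gauss1 (a xi phi : R) : 0 < a ->
  (\int[leb]_x (gauss1 a x * cos (x * xi + phi))%:E =
   (cos phi * Num.sqrt (pi / a) * expR (- (xi ^+ 2 / (4 * a))))%:E)%E.
Proof.
move=> a0.
pose J t := (\int[leb]_x (gauss1 a x * cos (x * t + phi)))%R.
have dlin (x t : R) : is_derive t 1 (fun t => x * t + phi) x.
  have h := is_deriveD (is_deriveZ x (is_derive_id t (1 : R))) (is_derive_cst phi t (1 : R)).
  by apply: is_derive_eq h _; rewrite addr0 /GRing.scale/= mulr1.
have dcos (x t : R) : is_derive t 1 (fun t => gauss1 a x * cos (x * t + phi)) (- (x * gauss1 a x * sin (x * t + phi))).
  have h := is_deriveZ (gauss1 a x) (@is_derive1_comp R cos (fun t => x * t + phi) t _ _ (is_derive_cos _) (dlin x t)).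
  by apply: is_derive_eq h _; rewrite /GRing.scale/=; ring.
have mlin (t : R) : measurable_fun setT (fun x : R => x * t + phi).
  by apply: measurable_funD => //; apply: measurable_funM.
have mcos (t : R) : measurable_fun setT (fun x : R => cos (x * t + phi)).
  apply: measurableT_comp (mlin t); apply: continuous_measurable_fun; exact: continuous_cos.
have msin (t : R) : measurable_fun setT (fun x : R => sin (x * t + phi)).
  apply: measurableT_comp (mlin t); apply: continuous_measurable_fun; exact: continuous_sin.
have intc t : leb.-integrable setT (EFin \o (fun x => gauss1 a x * cos (x * t + phi))).
  by apply: bounded_gauss1_integrable => // x; rewrite ler_norml cos_geN1 cos_le1.
have intxs t : leb.-integrable setT (EFin \o (fun x => x * gauss1 a x * sin (x * t + phi))).
  apply: le_integrable (integrable_xgauss1 a0) => //.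
    apply/measurable_EFinP; apply: measurable_funM; last exact: msin.
    by apply: measurable_funM => //; exact: measurable_gauss1.
  move=> x _ /=; rewrite lee_fin !normrM normr_id ler_piMr ?mulr_ge0//.
  by rewrite ler_norml sin_geN1 sin_le1.
have pE t x : partial1of2 (fun t x => gauss1 a x * cos (x * t + phi)) t x = - (x * gauss1 a x * sin (x * t + phi)).
  by rewrite /partial1of2 derive1E; have [_ ->] := dcos x t.
have dJ (t : R) : is_derive t 1 J (- (\int[leb]_x (x * gauss1 a x * sin (x * t + phi)))).
  have tin : `]t - 1, t + 1[%classic t by rewrite /= in_itv/= ltrBlDr ltrDl ltr01.
  have Gub : forall (y x : R), `]t - 1, t + 1[%classic y -> [set: R] x ->
     `|partial1of2 (fun t x => gauss1 a x * cos (x * t + phi)) y x| <= `|x| * gauss1 a x.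
    move=> y x _ _; rewrite pE normrN !normrM (ger0_norm (gauss1_ge0 _ _)) ler_piMr//.
      by rewrite mulr_ge0// gauss1_ge0.
    by rewrite ler_norml sin_geN1 sin_le1.
  have G0 x : 0 <= `|x| * gauss1 a x by rewrite mulr_ge0// gauss1_ge0.
  have ders (y x : R) : `]t - 1, t + 1[%classic y -> [set: R] x ->
     derivable ((fun t x => gauss1 a x * cos (x * t + phi))^~ x) y 1.
    by move=> _ _; have [] := dcos x y.
  have dd := derivable_under_integral measurableT tin (fun y _ => intc y) ders G0 (integrable_xgauss1 a0) Gub.
  have de := differentiation_under_integral measurableT tin (fun y _ => intc y) ders G0 (integrable_xgauss1 a0) Gub.
  apply: DeriveDef dd _; rewrite -derive1E de.
  under eq_Rintegral do rewrite pE.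
  rewrite -[RHS]mulN1r -RintegralZl//.
  by apply: eq_Rintegral => x _; rewrite mulN1r.
(* The derivative in [x] of [gauss1 a x * sin (x * t + phi)] integrates to zero. *)
have parts t : t * J t = 2 * a * (\int[leb]_x (x * gauss1 a x * sin (x * t + phi))).
  pose F x := gauss1 a x * sin (x * t + phi).
  pose f x := t * (gauss1 a x * cos (x * t + phi)) - 2 * a * (x * gauss1 a x * sin (x * t + phi)).
  have dg (x : R) : is_derive x 1 (gauss1 a) (- (2 * a * x * gauss1 a x)).
    have h2 := is_deriveN (is_deriveZ a (is_deriveM (is_derive_id x (1 : R)) (is_derive_id x (1 : R)))).
    have h := @is_derive1_comp R expR (fun x => - (a * x ^+ 2)) x _ _ (is_derive_expR _) h2.
    by apply: is_derive_eq h _; rewrite /gauss1 /GRing.scale/=; ring.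
  have dF (x : R) : is_derive x 1 F (f x).
    have dl : is_derive x 1 (fun x => x * t + phi) t.
      have h := is_deriveD (is_deriveM (is_derive_id x (1 : R)) (is_derive_cst t x (1 : R))) (is_derive_cst phi x (1 : R)).
      by apply: is_derive_eq h _; rewrite /GRing.scale/=; ring.
    have h := is_deriveM (dg x) (@is_derive1_comp R sin (fun x => x * t + phi) x _ _ (is_derive_sin _) dl).
    by apply: is_derive_eq h _; rewrite /GRing.scale/= /f; ring.
  have int1 := integrableZl measurableT t (intc t).
  have int2 := integrableZl measurableT (2 * a) (intxs t).
  have intf : leb.-integrable setT (EFin \o f).
    by apply: eq_integrable (integrableB measurableT int1 int2).
  have cl : continuous (fun x : R => x * t + phi).
    move=> x; apply: cvgD; last exact: cvg_cst.
    by apply: cvgM; [exact: cvg_id|exact: cvg_cst].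
  have cc : continuous (fun x : R => cos (x * t + phi)).
    move=> x; apply: (@continuous_comp _ _ _ (fun x : R => x * t + phi) cos); first exact: cl.
    exact: continuous_cos.
  have cs : continuous (fun x : R => sin (x * t + phi)).
    move=> x; apply: (@continuous_comp _ _ _ (fun x : R => x * t + phi) sin); first exact: cl.
    exact: continuous_sin.
  have cf : continuous f.
    move=> x; apply: cvgB; apply: cvgM; try exact: cvg_cst.
      by apply: cvgM; [exact: gauss1_continuous|exact: cc].
    apply: cvgM; last exact: cs.
    by apply: cvgM; [exact: cvg_id|exact: gauss1_continuous].
  have Fb (x : R) (m : nat) : x ^+ 2 = m.+1%:R ^+ 2 -> `|F x| <= a^-1 * harmonic m.
    move=> xm; rewrite /F normrM (ger0_norm (gauss1_ge0 _ _)).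
    apply: (@le_trans _ _ (gauss1 a x)).
      by rewrite ler_piMr ?gauss1_ge0// ler_norml sin_geN1 sin_le1.
    rewrite /gauss1 xm expRN -invfM lef_pV2 ?posrE ?expR_gt0//; last by rewrite mulr_gt0.
    apply: le_trans (expR_ge1Dx _); rewrite -[leLHS]add0r lerD//.
    by rewrite ler_pM2l// expr2 ler_peMr// ler1n.
  have := integral_derive_eq0 dF cf intf (fun m => Fb _ _ erefl) (fun m => Fb _ _ (sqrrN _)).
  move=> /(congr1 fine)/=.
  rewrite -/(Rintegral _ _ _) /f RintegralB//= => /eqP.
  by rewrite RintegralZl// RintegralZl// subr_eq0 => /eqP.
have J0 : J 0 = cos phi * Num.sqrt (pi / a).
  rewrite /J; under eq_Rintegral do rewrite mulr0 add0r mulrC.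
  by rewrite RintegralZl//; [rewrite /Rintegral integral_gauss1|exact: integrable_gauss1].
pose E t := expR (t ^+ 2 / (4 * a)) * J t.
have dE (t : R) : is_derive t 1 E 0.
  have de : is_derive t 1 (fun t => expR (t ^+ 2 / (4 * a))) (expR (t ^+ 2 / (4 * a)) * (t / (2 * a))).
    have h2 := is_deriveM (is_deriveM (is_derive_id t (1 : R)) (is_derive_id t (1 : R))) (is_derive_cst (4 * a)^-1 t (1 : R)).
    have h := @is_derive1_comp R expR (fun t => t ^+ 2 / (4 * a)) t _ _ (is_derive_expR _) h2.
    by apply: is_derive_eq h _; rewrite /GRing.scale/=; field; rewrite gt_eqF.
  have h := is_deriveM de (dJ t).
  apply: is_derive_eq h _; rewrite /GRing.scale/=.
  have := parts t; set A := (\int[leb]_x _)%R => h3.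
  have -> : J t * (expR (t ^+ 2 / (4 * a)) * (t / (2 * a))) = expR (t ^+ 2 / (4 * a)) * ((t * J t) / (2 * a)).
    by ring.
  by rewrite h3; field; rewrite gt_eqF.
have := is_derive_0_is_cst xi 0 dE.
rewrite /E J0 expr0n/= mul0r expR0 mul1r => h.
have JE : J xi = cos phi * Num.sqrt (pi / a) * expR (- (xi ^+ 2 / (4 * a))).
  by rewrite -h mulrAC -expRD subrr expR0 mul1r.
rewrite -JE /J /Rintegral fineK//.
exact: integrable_fin_num (intc xi).
Qed.

End gaussian_fourier1.

(** * Integrals over the half-line *)

Section half_line.
Context {R : realType}.
Local Notation leb := (@lebesgue_measure R).
Local Notation D0 := (`]0%R, +oo[%classic : set R).

Lemma measurable_halfline : measurable D0.
Proof. exact: measurable_itv. Qed.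

Lemma integral_halfline_le (f : measurableTypeR R -> \bar R) (C : \bar R) :
  measurable_fun setT f -> (forall x, 0 <= f x)%E ->
  (forall k : nat, \int[leb]_(x in `[k.+1%:R^-1%R, k.+1%:R]) f x <= C)%E ->
  (\int[leb]_(x in D0) f x <= C)%E.
Proof.
move=> mf f0 h.
pose F (k : nat) : set R := `[k.+1%:R^-1%R, k.+1%:R]%classic.
have -> : D0 = \bigcup_k F k.
  apply/seteqP; split=> x /=; rewrite in_itv/= andbT.
    move=> x0; exists (maxn (Num.truncn x) (Num.truncn x^-1)) => //.
    rewrite /F /= in_itv/=; apply/andP; split; last first.
      apply: ltW; apply: lt_le_trans (truncnS_gt _) _.
      by rewrite ler_nat ltnS leq_maxl.
    rewrite -[leRHS]invrK lef_pV2 ?posrE ?invr_gt0//.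
    by apply: ltW; apply: lt_le_trans (truncnS_gt _) _; rewrite ler_nat ltnS leq_maxr.
  by move=> [k _]; rewrite /F/= in_itv/= => /andP[+ _]; apply: lt_le_trans; rewrite invr_gt0.
have Fnd : {homo F : k m / (k <= m)%N >-> (k <= m)%O}.
  move=> k m km; apply/subsetPset => x; rewrite /F/= !in_itv/= => /andP[h1 h2].
  apply/andP; split.
    by apply: le_trans h1; rewrite lef_pV2 ?posrE// ler_nat.
  by apply: le_trans h2 _; rewrite ler_nat.
have mF k : measurable (F k) by exact: measurable_itv.
have /cvg_lim <- // := @ge0_nondecreasing_set_cvg_integral _ _ _ _ f leb Fnd mF
   (fun k => measurable_funTS mf) (fun k x _ => f0 x).
apply: lime_le; last by near=> k; exact: h.
apply: ereal_nondecreasing_is_cvgn => k m km; apply: ge0_subset_integral => //.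
- exact: mF.
- exact: mF.
- exact: measurable_funTS.
- exact/subsetPset/Fnd.
Unshelve. all: by end_near. Qed.

(* [a * powk a t] is the derivative of [t^a / (1 + t^a)]. *)
Definition powk (a t : R) : R := t `^ (a - 1) / (1 + t `^ a) ^+ 2.

Lemma powk_ge0 a t : 0 <= powk a t.
Proof. by rewrite divr_ge0 ?powR_ge0 ?sqr_ge0. Qed.

Lemma measurable_powk a : measurable_fun setT (powk a).
Proof.
rewrite /powk.
apply: measurable_funM; first exact: measurable_powR.
have -> : (fun x : R => (1 + x `^ a) ^- 2) = (fun x => (1 + x `^ a) `^ (- 2)).
  by apply/funext => x; rewrite powRN powR_mulrn// addr_ge0 ?powR_ge0.
apply: (@measurableT_comp _ _ _ _ _ _ (fun y : R => y `^ (- 2))).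
  exact: measurable_powR.
by apply: measurable_funD => //; exact: measurable_powR.
Qed.

Lemma is_derive_powk (a x : R) : a != 0 -> 0 < x ->
  is_derive x 1 (fun t => - a^-1 * (1 + t `^ a)^-1) (powk a x).
Proof.
move=> a0 x0.
have p0 : 1 + x `^ a != 0 by rewrite gt_eqF// ltr_wpDr// powR_ge0.
have h := is_deriveZ (- a^-1) (@is_deriveV R (fun t => 1 + t `^ a) x _ 1 p0 (is_deriveD (is_derive_cst (1 : R) x (1 : R)) (is_derive1_powR a x0))).
apply: is_derive_eq h _; rewrite /powk /GRing.scale/=.
by field; rewrite a0 p0.
Qed.

(** The primitive [-(a (1 + t^a))^-1] stays within [1/|a|] of zero, with a constant sign, whatever
    the sign of [a]. The kernel thus controls both ends of the half-line, and it is the dominating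
    function in [gamma_lty], [inverse_gamma_lty] and [L1C_norm_le]. *)
Lemma integral_powk (a : R) : a != 0 ->
  (\int[leb]_(t in D0) (powk a t)%:E <= `|a|^-1%:E)%E.
Proof.
move=> a0; apply: integral_halfline_le.
- by apply/measurable_EFinP; exact: measurable_powk.
- by move=> x; rewrite lee_fin powk_ge0.
move=> k.
(* For [k = 0] the interval reduces to the point [1]. *)
have [->|k0] := posnP k.
  rewrite invr1 set_itv1 integral_set1 lee_fin invr_ge0//.
have lt1 : k.+1%:R^-1 < k.+1%:R :> R.
  apply: (@lt_trans _ _ 1); last by rewrite ltr1n.
  by rewrite invf_lt1// ltr1n.
have pos (x : R) : k.+1%:R^-1 <= x -> 0 < x by apply: lt_le_trans; rewrite invr_gt0.
pose F t := - a^-1 * (1 + t `^ a)^-1.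
have dF (x : R) : 0 < x -> is_derive x 1 F (powk a x) by exact: is_derive_powk.
have cF (x : R) : 0 < x -> {for x, continuous F}.
  move=> /dF[+ _] => d; apply: differentiable_continuous; exact/derivable1_diffP.
rewrite (@continuous_FTC2 _ _ F)//.
- rewrite -EFinB lee_fin /F -mulrBr.
  apply: le_trans (ler_norm _) _; rewrite normrM normrN normrV ?unitfE//.
  rewrite ler_piMr ?invr_ge0//.
  have h t : 0 <= (1 + t `^ a)^-1 <= 1.
    by rewrite invr_ge0 addr_ge0 ?powR_ge0//= invf_le1 ?lerDl ?powR_ge0// ltr_wpDr// powR_ge0.
  have /andP[? ?] := h k.+1%:R; have /andP[? ?] := h k.+1%:R^-1.
  by rewrite ler_norml; apply/andP; split; lra.
- apply: continuous_in_subspaceT => x; rewrite inE/= in_itv/= => /andP[/pos x0 _].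
  have cp (b : R) : {for x, continuous (fun t : R => t `^ b)}.
    have [d _] := is_derive1_powR b x0.
    by apply: differentiable_continuous; exact/derivable1_diffP.
  apply: cvgM; first exact: cp.
  apply: cvgV; first by rewrite sqrf_eq0 gt_eqF// ltr_wpDr// powR_ge0.
  by apply: cvgM; apply: cvgD; try exact: cvg_cst; exact: cp.
- split.
  + move=> x; rewrite in_itv/= => /andP[/ltW/pos/dF[]] //.
  + apply: cvg_at_right_filter; apply: cF; by rewrite invr_gt0.
  + by apply: cvg_at_left_filter; apply: cF.
- by move=> x; rewrite in_itv/= => /andP[/ltW/pos/dF[_ <-]] _; rewrite derive1E.
Qed.

Lemma powRVl (x b : R) : 0 <= x -> x^-1 `^ b = (x `^ b)^-1.
Proof. by move=> x0; rewrite -(@powR_inv1 _ x)// -powRrM mulN1r powRN. Qed.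

Lemma measurable_invr : measurable_fun setT (fun x : R => x^-1).
Proof.
have -> : (fun x : R => x^-1) = (fun x => x * (x ^+ 2) `^ (- 1)).
  apply/funext => x; rewrite powR_inv1 ?sqr_ge0//.
  by have [->|x0] := eqVneq x 0; [rewrite invr0 mul0r|field].
apply: measurable_funM => //.
by apply: (@measurableT_comp _ _ _ _ _ _ (fun y : R => y `^ (- 1))); [exact: measurable_powR|exact: exprn_measurable].
Qed.

(** Raise [x / p <= e^(x/p)] to the power [p]. *)
Lemma powR_expRN_le (p x : R) : 0 < p -> 0 <= x -> x `^ p * expR (- x) <= p `^ p.
Proof.
move=> p0 x0.
rewrite expRN -ler_pdivlMr ?invr_gt0 ?expR_gt0// invrK.
have h : x / p <= expR (x / p).
  by apply: le_trans (expR_ge1Dx _); rewrite lerDr.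
have n1 : x / p \is Num.nneg by rewrite nnegrE divr_ge0// ltW.
have n2 : expR (x / p) \is Num.nneg by rewrite nnegrE expR_ge0.
have := ge0_ler_powR (ltW p0) n1 n2 h.
rewrite -[expR _ `^ _]expRM divfK ?gt_eqF// => h2.
rewrite -ler_pdivrMl ?powR_gt0//.
by apply: le_trans h2; rewrite powRM ?invr_ge0 ?(ltW p0)// mulrC powRVl// ltW.
Qed.

Lemma gamma_lty (a : R) : 0 < a ->
  (\int[leb]_(t in D0) (t `^ (a - 1) * expR (- t))%:E < +oo)%E.
Proof.
(* With [y = t^a] one has [(1 + y)^2 <= 2 + 2 y^2], and [y^2 e^(-t) = t^(2a) e^(-t)] is at most
   [(2a)^(2a)]; hence the constant for which [C * powk a] dominates. *)
move=> a0; pose C : R := 2 + 2 * (2 * a) `^ (2 * a).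
have C0 : 0 <= C by rewrite addr_ge0// mulr_ge0// powR_ge0.
have aN0 : a != 0 by rewrite gt_eqF.
apply: (@le_lt_trans _ _ (\int[leb]_(t in D0) (C%:E * (powk a t)%:E))%E); last first.
  rewrite ge0_integralZl//; last 2 first.
  - by apply/measurable_EFinP; apply: measurable_funTS; exact: measurable_powk.
  - by move=> x _; rewrite lee_fin powk_ge0.
  apply: (@le_lt_trans _ _ (C%:E * `|a|^-1%:E)%E); last by rewrite -EFinM ltry.
  by rewrite lee_wpmul2l// integral_powk.
apply: ge0_le_integral => //.
- by move=> x _; rewrite lee_fin mulr_ge0 ?powR_ge0 ?expR_ge0.
- apply/measurable_EFinP; apply: measurable_funTS; apply: measurable_funM; first exact: measurable_powR.
  by apply: measurableT_comp => //; exact: measurable_expR.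
- apply: measurable_funTS; apply: emeasurable_funM => //.
  by apply/measurable_EFinP; exact: measurable_powk.
move=> t; rewrite /= in_itv/= andbT => t0.
rewrite -EFinM lee_fin /powk mulrCA ler_wpM2l ?powR_ge0//.
have p0 : 0 < (1 + t `^ a) ^+ 2 by rewrite exprn_gt0// ltr_wpDr// powR_ge0.
rewrite ler_pdivlMr//.
have h := powR_expRN_le (_ : 0 < 2 * a) (ltW t0).
have d0 : 0 < 2 * a by rewrite mulr_gt0.
have {}h := h d0.
have h2 : (1 + t `^ a) ^+ 2 <= 2 + 2 * t `^ (2 * a).
  rewrite (mulrC 2 a) powRrM powR_mulrn ?powR_ge0//; set y := t `^ a.
  by have := sqr_ge0 (1 - y); rewrite !expr2; lra.
have e1 : expR (- t) <= 1 by rewrite -expR0 ler_expR oppr_le0 ltW.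
apply: le_trans (ler_wpM2l (expR_ge0 _) h2) _.
rewrite mulrDr /C lerD//; first by rewrite ler_piMl.
by rewrite mulrCA ler_pM2l// mulrC.
Qed.

(** The domination of [gamma_lty] with exponent [-b]: in terms of [u = 1/(4t)] one has
    [t^(-b) = 4^b u^b], and [e^(-u)] controls the end where [t] tends to zero. *)
Lemma inverse_gamma_lty (b : R) : 0 < b ->
  (\int[leb]_(t in D0) (t `^ (- b - 1) * expR (- (4 * t)^-1))%:E < +oo)%E.
Proof.
move=> b0; pose C : R := 2 + 2 * (4 `^ (2 * b) * (2 * b) `^ (2 * b)).
have C0 : 0 <= C by rewrite addr_ge0// mulr_ge0// mulr_ge0// powR_ge0.
have aN0 : - b != 0 by rewrite oppr_eq0 gt_eqF.
have mE : measurable_fun setT (fun t : R => expR (- (4 * t)^-1)).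
  apply: measurableT_comp; first exact: measurable_expR.
  apply: measurableT_comp => //.
  by apply: measurableT_comp; [exact: measurable_invr|exact: measurable_funM].
apply: (@le_lt_trans _ _ (\int[leb]_(t in D0) (C%:E * (powk (- b) t)%:E))%E); last first.
  rewrite ge0_integralZl//; last 2 first.
  - by apply/measurable_EFinP; apply: measurable_funTS; exact: measurable_powk.
  - by move=> x _; rewrite lee_fin powk_ge0.
  apply: (@le_lt_trans _ _ (C%:E * `|- b|^-1%:E)%E); last by rewrite -EFinM ltry.
  by rewrite lee_wpmul2l// integral_powk.
apply: ge0_le_integral => //.
- by move=> x _; rewrite lee_fin mulr_ge0 ?powR_ge0 ?expR_ge0.
- apply/measurable_EFinP; apply: measurable_funTS; apply: measurable_funM; first exact: measurable_powR.
  exact: mE.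
- apply: measurable_funTS; apply: emeasurable_funM => //.
  by apply/measurable_EFinP; exact: measurable_powk.
move=> t; rewrite /= in_itv/= andbT => t0.
rewrite -EFinM lee_fin /powk mulrCA ler_wpM2l ?powR_ge0//.
have p0 : 0 < (1 + t `^ (- b)) ^+ 2 by rewrite exprn_gt0// ltr_wpDr// powR_ge0.
rewrite ler_pdivlMr//.
set u := (4 * t)^-1.
have u0 : 0 <= u by rewrite invr_ge0 mulr_ge0// ltW.
have d0 : 0 < 2 * b by rewrite mulr_gt0.
have h := powR_expRN_le d0 u0.
have tb : t `^ (- b) = 4 `^ b * u `^ b.
  rewrite -powRM// (_ : 4 * u = t^-1); first by rewrite powRVl ?ltW// powRN.
  by rewrite /u; field; rewrite gt_eqF.
have h2 : (1 + t `^ (- b)) ^+ 2 <= 2 + 2 * (4 `^ (2 * b) * u `^ (2 * b)).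
  rewrite (mulrC 2 b) !powRrM !powR_mulrn ?powR_ge0// -exprMn -tb; set y := t `^ _.
  by have := sqr_ge0 (1 - y); rewrite !expr2; lra.
have e1 : expR (- u) <= 1 by rewrite -expR0 ler_expR oppr_le0.
apply: le_trans (ler_wpM2l (expR_ge0 _) h2) _.
rewrite mulrDr /C lerD//; first by rewrite ler_piMl.
rewrite mulrCA ler_pM2l// mulrCA ler_pM2l ?powR_gt0//.
by rewrite mulrC.
Qed.

Lemma ge0_integral_halfline_scale (c : R) (f : measurableTypeR R -> \bar R) : 0 < c ->
  measurable_fun setT f -> (forall x, 0 <= f x)%E ->
  (\int[leb]_(t in D0) f t = c%:E * \int[leb]_(t in D0) f (c * t)%R)%E.
Proof.
move=> c0 mf f0; have cN0 : c != 0 by rewrite gt_eqF.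
have mT : measurable_fun setT ((fun x => 0 + c * x) : measurableTypeR R -> measurableTypeR R).
  by apply: measurable_funD => //; apply: measurable_funM.
pose m := mscale (NngNum (normr_ge0 c))
  (measure_function_pushforward__canonical__measure_function_Measure leb mT).
rewrite (@eq_measure_integral _ (measurableTypeR R) _ D0 m leb); last first.
  by move=> A mA _; exact: (lebesgue_measure_affine 0 cN0 mA).
rewrite [LHS]ge0_integral_mscale//; last exact: measurable_funTS.
rewrite /= gtr0_norm//; congr (_ * _)%E.
rewrite (ge0_integral_pushforward mT)//; last exact: measurable_funTS.
rewrite (_ : _ @^-1` _ = D0); last first.
  by apply/seteqP; split=> x /=; rewrite !in_itv/= !andbT add0r pmulr_rgt0.
by apply: eq_integral => x _ /=; rewrite add0r.
Qed.

End half_line.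

(** * The Bessel kernel as a Gamma average of heat kernels *)

Section gaussian_fourier.
Context {R : realType}.
Local Notation mu := (@lebesgue_rV R _).

Definition rV_tail n (x : 'rV[R]_n.+1) : 'rV[R]_n := \row_i x ord0 (lift ord0 i).

Lemma dotr_cons n (a : R) (x : 'rV[R]_n) (y : 'rV[R]_n.+1) :
  dotr (rV_cons (a, x)) y = a * y ord0 ord0 + dotr x (rV_tail y).
Proof.
rewrite /dotr big_ord_recl rV_cons0; congr (_ + _).
by apply: eq_bigr => i _; rewrite rV_consS mxE.
Qed.

Lemma dotr_ge0 n (x : 'rV[R]_n) : 0 <= dotr x x.
Proof. by apply: sumr_ge0 => i _; exact: sqr_ge0. Qed.

Lemma measurable_dotr n (y : 'rV[R]_n) : measurable_fun setT (fun x : 'rV[R]_n => dotr x y).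
Proof.
apply: measurable_sum => i; apply: measurable_funM => //; exact: measurable_coor.
Qed.

Lemma measurable_dotrxx n : measurable_fun setT (fun x : 'rV[R]_n => dotr x x).
Proof.
apply: measurable_sum => i; apply: measurable_funM => //; exact: measurable_coor.
Qed.

Definition gaussn n (a : R) (x : 'rV[R]_n) : R := expR (- (a * dotr x x)).

Lemma gaussn_ge0 n a (x : 'rV[R]_n) : 0 <= gaussn a x.
Proof. exact: expR_ge0. Qed.

Lemma measurable_gaussn n a : measurable_fun setT (@gaussn n a).
Proof.
apply: measurableT_comp; first exact: measurable_expR.
apply: measurableT_comp => //; apply: measurable_funM => //.
exact: measurable_dotrxx.
Qed.

Lemma gaussn_cons n a (b : R) (x : 'rV[R]_n) :
  gaussn a (rV_cons (b, x)) = gauss1 a b * gaussn a x.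
Proof.
rewrite /gaussn dotr_cons rV_cons0 /gauss1 -expRD; congr expR.
rewrite (_ : rV_tail _ = x); first by rewrite expr2 mulrDr opprD.
by apply/rowP => i; rewrite mxE rV_consS.
Qed.

Lemma integral_gaussn n (a : R) : 0 < a ->
  (\int[mu]_(x in [set: 'rV[R]_n]) (gaussn a x)%:E = (Num.sqrt (pi / a) ^+ n)%:E)%E.
Proof.
move=> a0; elim: n => [|n IH].
  rewrite expr0 /= integral_dirac//; last by apply/measurable_EFinP; exact: measurable_gaussn.
  by rewrite diracT mul1e /gaussn /dotr big_ord0 mulr0 oppr0 expR0.
rewrite ge0_integral_rVS; last 2 first.
- by apply/measurable_EFinP; exact: measurable_gaussn.
- by move=> x; rewrite lee_fin gaussn_ge0.
under eq_integral => b _.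
  under eq_integral do rewrite gaussn_cons EFinM.
  rewrite ge0_integralZl//; last 3 first.
  - by apply/measurable_EFinP; exact: measurable_gaussn.
  - by move=> x _; rewrite lee_fin gaussn_ge0.
  - by rewrite lee_fin gauss1_ge0.
  rewrite IH muleC.
  over.
rewrite ge0_integralZl//; last 2 first.
- by apply/measurable_EFinP; exact: measurable_gauss1.
- by move=> x _; rewrite lee_fin gauss1_ge0.
by rewrite integral_gauss1// -EFinM -exprSr.
Qed.

Lemma integrable_gaussn n (a : R) : 0 < a -> (@lebesgue_rV R n).-integrable setT (EFin \o gaussn a).
Proof.
move=> a0; apply/integrableP; split; first by apply/measurable_EFinP; exact: measurable_gaussn.
rewrite (_ : (fun x => _) = (fun x : 'rV[R]_n => (gaussn a x)%:E)).
  by rewrite integral_gaussn// ltry.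
by apply/funext => x /=; rewrite ger0_norm// gaussn_ge0.
Qed.

Lemma bounded_gaussn_integrable n (a : R) (h : 'rV[R]_n -> R) : 0 < a -> measurable_fun setT h ->
  (forall x, `|h x| <= 1) -> (@lebesgue_rV R n).-integrable setT (EFin \o (fun x => gaussn a x * h x)).
Proof.
move=> a0 mh h1; apply: le_integrable (@integrable_gaussn n _ a0) => //.
  by apply/measurable_EFinP; apply: measurable_funM => //; exact: measurable_gaussn.
by move=> x _ /=; rewrite lee_fin normrM ler_piMr.
Qed.

Lemma measurable_cos_dotr n (xi : 'rV[R]_n) phi :
  measurable_fun setT (fun x : 'rV[R]_n => cos (dotr x xi + phi)).
Proof.
apply: measurableT_comp; first by apply: continuous_measurable_fun; exact: continuous_cos.
by apply: measurable_funD => //; exact: measurable_dotr.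
Qed.

Lemma fourier_gaussn n (a phi : R) (xi : 'rV[R]_n) : 0 < a ->
  (\int[mu]_x (gaussn a x * cos (dotr x xi + phi))%:E =
   (cos phi * Num.sqrt (pi / a) ^+ n * expR (- (dotr xi xi / (4 * a))))%:E)%E.
Proof.
move=> a0; elim: n phi xi => [|n IH] phi xi.
  rewrite expr0 /= integral_dirac//; last first.
    apply/measurable_EFinP; apply: measurable_funM; first exact: measurable_gaussn.
    exact: measurable_cos_dotr.
  by rewrite diracT mul1e /gaussn /dotr !big_ord0 mulr0 mul0r oppr0 expR0 add0r mul1r !mulr1.
have intn m (psi : R) (eta : 'rV[R]_m) : (@lebesgue_rV R m).-integrable setT (EFin \o (fun x => gaussn a x * cos (dotr x eta + psi))).
  apply: bounded_gaussn_integrable => //; first exact: measurable_cos_dotr.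
  by move=> x; rewrite ler_norml cos_geN1 cos_le1.
rewrite integral_rVS; last exact: intn.
under eq_integral => b _.
  under eq_integral => x _.
    rewrite gaussn_cons dotr_cons -mulrA EFinM (addrC (b * _)) -addrA.
    over.
  rewrite integralZl//; last exact: intn.
  rewrite IH -EFinM mulrA mulrA -mulrA EFinM muleC.
  over.
rewrite integralZl//; last first.
  apply: bounded_gauss1_integrable => // [|x]; last by rewrite ler_norml cos_geN1 cos_le1.
  apply: measurableT_comp; first by apply: continuous_measurable_fun; exact: continuous_cos.
  by apply: measurable_funD => //; apply: measurable_funM.
rewrite fourier_gauss1// -EFinM; congr EFin.
rewrite (exprS (Num.sqrt _)) (_ : dotr xi xi = xi ord0 ord0 ^+ 2 + dotr (rV_tail xi) (rV_tail xi)); last first.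
  by rewrite /dotr big_ord_recl expr2; congr (_ + _); apply: eq_bigr => i _; rewrite !mxE.
by rewrite (mulrDl _ _ (4 * a)^-1) opprD expRD; ring.
Qed.

End gaussian_fourier.

Section bessel_density.
Context {R : realType}.
Local Notation leb := (@lebesgue_measure R).
Local Notation mu := (@lebesgue_rV R _).
Local Notation D0 := (`]0%R, +oo[%classic : set R).

Definition gamma_dens (a t : R) : R := \1_D0 t * (t `^ (a - 1) * expR (- t)).

Lemma gamma_dens_ge0 a t : 0 <= gamma_dens a t.
Proof. by rewrite mulr_ge0// mulr_ge0 ?powR_ge0 ?expR_ge0. Qed.

Lemma measurable_gamma_dens a : measurable_fun setT (gamma_dens a).
Proof.
apply: measurable_funM; first by apply: measurable_indic; exact: measurable_halfline.
apply: measurable_funM; first exact: measurable_powR.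
by apply: measurableT_comp => //; exact: measurable_expR.
Qed.

Lemma integral_indic_halfline (f : measurableTypeR R -> R) :
  (\int[leb]_t (\1_D0 t * f t)%:E = \int[leb]_(t in D0) (f t)%:E)%E.
Proof.
rewrite [RHS]integral_mkcond; apply: eq_integral => t _.
rewrite patchE indicE; case: ifPn => _ /=; by [rewrite mul1r|rewrite mul0r].
Qed.

Definition Gamma_int (a : R) : R := fine (\int[leb]_t (gamma_dens a t)%:E)%E.

Lemma integral_gamma_dens_lty a : 0 < a -> (\int[leb]_t (gamma_dens a t)%:E < +oo)%E.
Proof. by move=> a0; rewrite integral_indic_halfline; exact: gamma_lty. Qed.

Lemma integral_gamma_dens a : 0 < a ->
  (\int[leb]_t (gamma_dens a t)%:E = (Gamma_int a)%:E)%E.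
Proof.
move=> a0; rewrite /Gamma_int fineK// ge0_fin_numE ?integral_gamma_dens_lty//.
by apply: integral_ge0 => t _; rewrite lee_fin gamma_dens_ge0.
Qed.

Lemma Gamma_int_gt0 a : 0 < a -> 0 < Gamma_int a.
Proof.
move=> a0; rewrite -lte_fin -integral_gamma_dens//.
pose S : set R := `[1, 2]%classic.
have mS : measurable S by exact: measurable_itv.
pose c := Num.min 1 (2 `^ (a - 1)) * expR (- 2).
have c0 : 0 < c by rewrite mulr_gt0 ?expR_gt0// lt_min ltr01 powR_gt0.
apply: (@lt_le_trans _ _ (\int[leb]_(t in S) (cst c%:E) t)%E).
  have hS : leb S = 1%:E by rewrite /S lebesgue_measure_itv/= lte_fin ltr1n -EFinD; congr EFin; ring.
  by rewrite integral_cst//= hS mule1 lte_fin.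
apply: (@le_trans _ _ (\int[leb]_(t in S) (gamma_dens a t)%:E)%E); last first.
  apply: ge0_subset_integral => //.
  - by apply/measurable_EFinP; exact: measurable_gamma_dens.
  - by move=> x _; rewrite lee_fin gamma_dens_ge0.
apply: ge0_le_integral => //.
- by move=> x _; rewrite lee_fin ltW.
- by apply/measurable_EFinP; apply: measurable_funTS; exact: measurable_gamma_dens.
move=> t; rewrite /S/= in_itv/= => /andP[t1 t2].
have t0 : 0 < t by apply: lt_le_trans t1.
rewrite lee_fin /gamma_dens indicE mem_set ?mul1r/=; last by rewrite in_itv/= andbT.
rewrite /c ler_pM ?expR_ge0 ?le_min ?ler01 ?powR_ge0//; last by rewrite ler_expR lerN2.
have [a1|a1] := leP 1 a.
  by rewrite ge_min -{1}(powRr0 t) ?gt_eqF// ler_powR// subr_ge0 a1.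
rewrite ge_min; apply/orP; right.
rewrite -(opprB 1 a) !powRN lef_pV2 ?posrE ?powR_gt0//.
by apply: ge0_ler_powR; rewrite ?nnegrE ?subr_ge0// ltW.
Qed.

(** Substitution of [(1 + q) t] for [t] in the Gamma integral. With [q = |xi|^2] it is the
    subordination identity that writes [(1 + |xi|^2)^(-a)] as a mixture of the Gaussians
    [e^(-t |xi|^2)]. *)
Lemma gamma_dens_scale a q : 0 < a -> 0 <= q ->
  (\int[leb]_t (gamma_dens a t * expR (- (t * q)))%:E =
   ((1 + q) `^ (- a) * Gamma_int a)%:E)%E.
Proof.
move=> a0 q0; have c0 : 0 < 1 + q by rewrite ltr_wpDr.
rewrite EFinM -integral_gamma_dens// integral_indic_halfline.
under eq_integral do rewrite /gamma_dens -mulrA.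
rewrite integral_indic_halfline.
rewrite [in RHS](ge0_integral_halfline_scale c0); last 2 first.
- apply/measurable_EFinP; apply: measurable_funM; first exact: measurable_powR.
  by apply: measurableT_comp => //; exact: measurable_expR.
- by move=> t; rewrite lee_fin mulr_ge0 ?powR_ge0 ?expR_ge0.
rewrite (_ : (\int[leb]_(t in D0) (((1 + q) * t) `^ (a - 1) * expR (- ((1 + q) * t)))%:E =
   ((1 + q) `^ (a - 1))%:E * \int[leb]_(t in D0) (t `^ (a - 1) * expR (- t) * expR (- (t * q)))%:E)%E); last first.
  rewrite -ge0_integralZl//; last 3 first.
  - apply/measurable_EFinP; apply: measurable_funTS; apply: measurable_funM.
      apply: measurable_funM; first exact: measurable_powR.
      by apply: measurableT_comp => //; exact: measurable_expR.
    apply: measurableT_comp; first exact: measurable_expR.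
    by apply: measurableT_comp => //; exact: measurable_funM.
  - by move=> t _; rewrite lee_fin !mulr_ge0 ?powR_ge0 ?expR_ge0.
  - by rewrite lee_fin powR_ge0.
  apply: eq_integral => t; rewrite inE/= in_itv/= andbT => t0.
  rewrite -EFinM powRM ?ltW// -!mulrA -expRD; congr (_ * (_ * expR _))%:E.
  by ring.
rewrite !muleA -!EFinM (_ : _ * (1 + q) `^ (a - 1) = 1) ?mul1e//.
rewrite -{2}(powRr1 (ltW c0)) -!powRD ?(gt_eqF c0) ?implybT//.
by rewrite (_ : - a + 1 + (a - 1) = 0) ?powRr0//; ring.
Qed.

(** The factor after [gamma_dens] is the heat kernel [(4 pi t)^(-n/2) e^(-|x|^2/(4t))], of mass one,
    at time [t = p.1]; the indicator in [gamma_dens] removes the times [t <= 0]. *)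
Definition heat_dens n (a : R) (p : measurableTypeR R * 'rV[R]_n) : R :=
  gamma_dens a p.1 * (Num.sqrt (pi * (4 * p.1)) ^- n * gaussn (4 * p.1)^-1 p.2).

Lemma heat_dens_ge0 n a p : 0 <= @heat_dens n a p.
Proof. by rewrite mulr_ge0 ?gamma_dens_ge0// mulr_ge0 ?gaussn_ge0// invr_ge0 exprn_ge0// sqrtr_ge0. Qed.

Lemma measurable_heat_dens n a : measurable_fun setT (@heat_dens n a).
Proof.
have m4 : measurable_fun setT (fun p : measurableTypeR R * 'rV[R]_n => 4 * p.1).
  by apply: measurable_funM => //; exact: measurable_fst.
apply: measurable_funM.
  by apply: measurableT_comp measurable_fst; exact: measurable_gamma_dens.
apply: measurable_funM.
  apply: (measurableT_comp measurable_invr); apply: measurable_funX.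
  apply: (@measurableT_comp _ _ _ _ _ _ (@Num.sqrt R)).
    by apply: continuous_measurable_fun; exact: sqrt_continuous.
  exact: measurable_funM.
apply: measurableT_comp; first exact: measurable_expR.
apply: measurableT_comp => //; apply: measurable_funM.
  exact: (measurableT_comp measurable_invr).
exact: (measurableT_comp (@measurable_dotrxx R n) measurable_snd).
Qed.

Lemma fourier_heat_dens n a t (xi : 'rV[R]_n) phi :
  (\int[mu]_x (heat_dens a (t, x) * cos (dotr x xi + phi))%:E =
   (gamma_dens a t * (cos phi * expR (- (t * dotr xi xi))))%:E)%E.
Proof.
have [t0|t0] := ltP 0 t; last first.
  rewrite /heat_dens /gamma_dens indicE memNset/=; last by rewrite in_itv/= andbT => /lt_le_trans/(_ t0); rewrite ltxx.
  rewrite !mul0r; rewrite (eq_integral (cst 0%E)) ?integral0// => x _.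
  by rewrite !mul0r.
have a0 : 0 < (4 * t)^-1 by rewrite invr_gt0 mulr_gt0.
rewrite /heat_dens/=.
under eq_integral do rewrite (mulrA (gamma_dens a t)) -(mulrA _ (gaussn _ _)) EFinM.
rewrite integralZl//; last first.
  apply: bounded_gaussn_integrable => //; first exact: measurable_cos_dotr.
  by move=> x; rewrite ler_norml cos_geN1 cos_le1.
rewrite fourier_gaussn// -EFinM; congr EFin.
have p0 : 0 < Num.sqrt (pi * (4 * t)) by rewrite sqrtr_gt0 mulr_gt0 ?pi_gt0// mulr_gt0.
rewrite invrK (_ : dotr xi xi / (4 * (4 * t)^-1) = t * dotr xi xi); last by field; rewrite gt_eqF.
by field; rewrite expf_neq0// gt_eqF.
Qed.

Lemma integral_heat_dens n a t :
  (\int[mu]_(x in [set: 'rV[R]_n]) (heat_dens a (t, x))%:E = (gamma_dens a t)%:E)%E.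
Proof.
have := @fourier_heat_dens n a t 0 0.
have d0 : dotr (0 : 'rV[R]_n) 0 = 0 by rewrite /dotr big1// => i _; rewrite mxE mul0r.
rewrite d0 mulr0 oppr0 expR0 cos0 !mulr1 => <-.
apply: eq_integral => x _; rewrite addr0 (_ : dotr x 0 = 0) ?cos0 ?mulr1//.
by rewrite /dotr big1// => i _; rewrite mxE mulr0.
Qed.

End bessel_density.

Section bessel_explicit.
Context {R : realType} {n : nat}.
Local Notation leb := (@lebesgue_measure R).
Local Notation Rn := 'rV[R]_n.
Local Notation mu := (@lebesgue_rV R n).
Variables (a : R) (a0 : 0 < a).

(** Extended-valued, because it may be infinite at the origin. It is integrable, hence finite almost
    everywhere, and [bessel_explicit] takes its finite part. *)
Definition heat_potential (x : Rn) : \bar R := \int[leb]_t (heat_dens a (t, x))%:E.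

Lemma heat_potential_ge0 x : (0 <= heat_potential x)%E.
Proof. by apply: integral_ge0 => t _; rewrite lee_fin heat_dens_ge0. Qed.

Lemma measurable_heat_potential : measurable_fun setT heat_potential.
Proof.
apply: (@measurable_fun_fubini_tonelli_G _ _ _ _ _ _ (fun p => (heat_dens a p)%:E)).
  by apply/measurable_EFinP; exact: measurable_heat_dens.
by move=> p; rewrite lee_fin heat_dens_ge0.
Qed.

Lemma integral_heat_potential : (\int[mu]_x heat_potential x = (Gamma_int a)%:E)%E.
Proof.
have mh : measurable_fun setT (fun p : measurableTypeR R * Rn => (heat_dens a p)%:E).
  by apply/measurable_EFinP; exact: measurable_heat_dens.
have h0 (p : measurableTypeR R * Rn) : (0 <= (heat_dens a p)%:E)%E by rewrite lee_fin heat_dens_ge0.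
have := @fubini_tonelli _ _ _ _ _ leb mu _ mh h0.
rewrite /fubini_F /fubini_G -/heat_potential => <-.
by rewrite -integral_gamma_dens//; apply: eq_integral => t _; rewrite integral_heat_dens.
Qed.

Lemma integrable_heat_potential : mu.-integrable setT heat_potential.
Proof.
apply/integrableP; split; first exact: measurable_heat_potential.
by under eq_integral do rewrite gee0_abs ?heat_potential_ge0//; rewrite integral_heat_potential ltry.
Qed.

Definition bessel_explicit (x : Rn) : R := (Gamma_int a)^-1 * fine (heat_potential x).

Lemma measurable_bessel_explicit : measurable_fun setT bessel_explicit.
Proof.
apply: measurable_funM => //; apply: (measurableT_comp _ measurable_heat_potential).
exact: fine_measurable.
Qed.

Lemma ae_fine_heat_potential :
  {ae mu, forall x, (fine (heat_potential x))%:E = heat_potential x}.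
Proof.
have := integrable_ae measurableT integrable_heat_potential.
by apply: filterS => x /(_ I) h; rewrite fineK.
Qed.

Lemma integrable_bessel_explicit : mu.-integrable setT (EFin \o bessel_explicit).
Proof.
apply: (@eq_integrable _ _ _ mu setT measurableT (fun x => (Gamma_int a)^-1%:E * (fine (heat_potential x))%:E)%E) => //.
apply: integrableZl => //.
apply/integrableP; split.
  by apply/measurable_EFinP; apply: (measurableT_comp _ measurable_heat_potential); exact: fine_measurable.
rewrite (@ae_eq_integral _ _ _ mu setT heat_potential) => //.
- by rewrite integral_heat_potential ltry.
- apply: measurableT_comp => //; apply/measurable_EFinP.
  by apply: (measurableT_comp _ measurable_heat_potential); exact: fine_measurable.
- exact: measurable_heat_potential.
- apply: filterS ae_fine_heat_potential => x h _ /=.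
  by rewrite -{2}h ger0_norm// fine_ge0// heat_potential_ge0.
Qed.

(** Fubini in [(t, x)], then the transform of each heat kernel and [gamma_dens_scale]. The finite
    part taken in [bessel_explicit] changes the potential only on a null set. *)
Lemma fourier_bessel_explicit (xi : Rn) phi :
  (\int[mu]_x (bessel_explicit x * cos (dotr x xi + phi)))%R =
  cos phi * (1 + dotr xi xi) `^ (- a).
Proof.
have g0 := Gamma_int_gt0 a0.
pose F (p : measurableTypeR R * Rn) := (heat_dens a p * cos (dotr p.2 xi + phi))%:E.
have mF : measurable_fun setT F.
  apply/measurable_EFinP; apply: measurable_funM; first exact: measurable_heat_dens.
  exact: (measurableT_comp (@measurable_cos_dotr R n xi phi) measurable_snd).
have intF : (leb \x mu)%E.-integrable setT F.
  apply/integrableP; split => //.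
  apply: (@le_lt_trans _ _ (\int[(leb \x mu)%E]_p (heat_dens a p)%:E)%E).
    apply: ge0_le_integral => //.
    - exact: measurableT_comp.
    - by apply/measurable_EFinP; exact: measurable_heat_dens.
    - move=> p _; rewrite /F /= lee_fin normrM ger0_norm ?heat_dens_ge0// ler_piMr ?heat_dens_ge0//.
      by rewrite ler_norml cos_geN1 cos_le1.
  rewrite fubini_tonelli1; last 2 first.
  - by apply/measurable_EFinP; exact: measurable_heat_dens.
  - by move=> p; rewrite lee_fin heat_dens_ge0.
  rewrite /fubini_F; under eq_integral do rewrite integral_heat_dens.
  exact: integral_gamma_dens_lty.
have Fub := Fubini intF.
have key : (\int[mu]_x (fine (heat_potential x) * cos (dotr x xi + phi))%:E =
   (cos phi * (1 + dotr xi xi) `^ (- a) * Gamma_int a)%:E)%E.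
  transitivity (\int[mu]_x \int[leb]_t F (t, x))%E.
    apply: ae_eq_integral => //.
    - apply/measurable_EFinP; apply: measurable_funM; last exact: measurable_cos_dotr.
      by apply: (measurableT_comp _ measurable_heat_potential); exact: fine_measurable.
    - exact: (measurable_fubini_G intF).
    apply: filterS2 ae_fine_heat_potential (ae_integrable2 intF) => x hx ix _.
    rewrite EFinM hx muleC /heat_potential -integralZl//; last first.
      apply/integrableP; split.
        apply/measurable_EFinP; apply: (@measurableT_comp _ _ _ _ _ _ (@heat_dens R n a)).
          exact: measurable_heat_dens.
        exact: pair2_measurable.
      under eq_integral do rewrite gee0_abs ?lee_fin ?heat_dens_ge0//.
      by rewrite -/(heat_potential x) -hx ltry.
    by apply: eq_integral => t _; rewrite /F/= -EFinM mulrC.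
  rewrite -Fub.
  under eq_integral do rewrite /F/= fourier_heat_dens mulrCA EFinM.
  rewrite integralZl//; first by rewrite gamma_dens_scale ?dotr_ge0// -EFinM mulrA.
  apply/integrableP; split.
    apply/measurable_EFinP; apply: measurable_funM; first exact: measurable_gamma_dens.
    apply: measurableT_comp; first exact: measurable_expR.
    by apply: measurableT_comp => //; exact: measurable_funM.
  under eq_integral => t _.
    rewrite gee0_abs; last by rewrite lee_fin mulr_ge0 ?gamma_dens_ge0 ?expR_ge0.
    over.
  by rewrite gamma_dens_scale ?dotr_ge0// ltry.
rewrite /Rintegral.
under eq_integral do rewrite /bessel_explicit -mulrA EFinM.
rewrite integralZl//.
  by rewrite key -EFinM/=; field; rewrite gt_eqF.
apply/integrableP; split.
  apply/measurable_EFinP; apply: measurable_funM; last exact: measurable_cos_dotr.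
  by apply: (measurableT_comp _ measurable_heat_potential); exact: fine_measurable.
apply: (@le_lt_trans _ _ (\int[mu]_x heat_potential x)%E); last by rewrite integral_heat_potential ltry.
apply: ae_ge0_le_integral => //.
- apply: measurableT_comp => //; apply/measurable_EFinP; apply: measurable_funM; last exact: measurable_cos_dotr.
  by apply: (measurableT_comp _ measurable_heat_potential); exact: fine_measurable.
- by move=> x _; exact: heat_potential_ge0.
- exact: measurable_heat_potential.
apply: filterS ae_fine_heat_potential => x hx _.
rewrite -[leRHS]hx lee_fin normrM ger0_norm ?fine_ge0 ?heat_potential_ge0//.
by rewrite ler_piMr ?fine_ge0 ?heat_potential_ge0// ler_norml cos_geN1 cos_le1.
Qed.

End bessel_explicit.

Lemma is_inverse_fourier_bessel_explicit {R : realType} {n : nat} (alpha : R) : 0 < alpha ->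
  is_inverse_fourier (fun xi : 'rV[R]_n => (1 + dotr xi xi) `^ (- alpha / 2))
    (bessel_explicit (alpha / 2)).
Proof.
move=> al0; have a0 : 0 < alpha / 2 by rewrite divr_gt0.
split; first exact: integrable_bessel_explicit.
move=> xi; split.
  have := fourier_bessel_explicit a0 xi 0; rewrite cos0 mul1r mulNr => <-.
  by apply: eq_Rintegral => x _; rewrite addr0.
(* The phase [- pi / 2] turns the cosine into the sine. *)
have := fourier_bessel_explicit a0 xi (- (pi / 2)).
rewrite cosN cos_pihalf mul0r => <-.
apply: eq_Rintegral => x _; congr (_ * _).
by rewrite cosD cosN cos_pihalf mulr0 sinN sin_pihalf mulrN1 opprK add0r.
Qed.

(** * Uniqueness of the Fourier transform *)

Section fourier_uniqueness.
Context {R : realType} {n : nat}.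
Local Notation Rn := 'rV[R]_n.
Local Notation mu := (@lebesgue_rV R n).

Lemma continuous_prod_seq (I : Type) (T : topologicalType) (f : I -> T -> R) (s : seq I) :
  (forall i, continuous (f i)) -> continuous (fun x => \prod_(i <- s) f i x).
Proof.
move=> cf; elim: s => [|i s IH] x.
  by under eq_fun do rewrite big_nil; exact: cvg_cst.
under eq_fun do rewrite big_cons.
by apply: cvgM; [exact: cf|exact: IH].
Qed.

Lemma cvg_prod_seq (I : Type) (u : I -> nat -> R) (l : I -> R) (s : seq I) :
  (forall i, u i @ \oo --> l i) ->
  (fun k => \prod_(i <- s) u i k) @ \oo --> \prod_(i <- s) l i.
Proof.
move=> ul; elim: s => [|i s IH].
  by under eq_fun do rewrite big_nil; rewrite big_nil; exact: cvg_cst.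
under eq_fun do rewrite big_cons.
by rewrite big_cons; apply: cvgM.
Qed.

Definition obox (a b : Rn) : set Rn :=
  [set x | forall i, a ord0 i < x ord0 i < b ord0 i].

(* Increases to the indicator of [0 < u] as [k] grows. *)
Definition ramp (k : nat) (u : R) : R := 1 - expR (- (k%:R * (u + `|u|))).

Definition obox_approx (a b : Rn) (k : nat) (x : Rn) : R :=
  \prod_(i < n) (ramp k (x ord0 i - a ord0 i) * ramp k (b ord0 i - x ord0 i)).

Lemma ramp_ge0 k u : 0 <= ramp k u.
Proof.
rewrite subr_ge0 -expR0 ler_expR oppr_le0 mulr_ge0//.
by have := ler_norm (- u); rewrite normrN; lra.
Qed.

Lemma ramp_le1 k u : ramp k u <= 1.
Proof. by rewrite lerBlDr lerDl expR_ge0. Qed.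

Lemma continuous_ramp k : continuous (ramp k).
Proof.
move=> u; apply: cvgB; first exact: cvg_cst.
apply: (@continuous_comp _ _ _ (fun u : R => - (k%:R * (u + `|u|))) expR); last exact: continuous_expR.
apply: cvgN; apply: cvgM; first exact: cvg_cst.
by apply: cvgD; [exact: cvg_id|exact: norm_continuous].
Qed.

Lemma cvg_ramp u : 0 < u -> ramp^~ u @ \oo --> (1 : R).
Proof.
move=> u0; rewrite -[X in _ --> X]subr0; apply: cvgB; first exact: cvg_cst.
apply: (@cvg_comp _ _ _ (fun k : nat => k%:R * (u + `|u|)) (fun x : R => expR (- x))); last exact: cvgr_expR.
apply/cvgryPge => A; near=> k.
have v0 : 0 < u + `|u| by rewrite addr_gt0// normr_gt0 gt_eqF.
rewrite -ler_pdivrMr//; near: k; exact: nbhs_infty_ger.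
Unshelve. all: by end_near. Qed.

Lemma ramp_eq0 k u : u <= 0 -> ramp k u = 0.
Proof. by move=> u0; rewrite /ramp ler0_norm// subrr mulr0 oppr0 expR0 subrr. Qed.

Lemma obox_approx_ge0 a b k x : 0 <= obox_approx a b k x.
Proof. by apply: prodr_ge0 => i _; rewrite mulr_ge0// ramp_ge0. Qed.

Lemma obox_approx_indic a b k x : obox_approx a b k x <= \1_(obox a b) x.
Proof.
have [xa|nxa] := pselect (obox a b x).
  rewrite indicE mem_set//; apply: prodr_ile1 => i _.
  by rewrite mulr_ge0 ?ramp_ge0//= mulr_ile1 ?ramp_ge0 ?ramp_le1.
rewrite indicE memNset//; move/existsNP : nxa => [i /negP].
rewrite negb_and -!leNgt => xi; rewrite /obox_approx (bigD1 i)//=.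
case/orP: xi => xi.
  by rewrite [ramp k (x ord0 i - _)]ramp_eq0 ?subr_le0// !mul0r.
by rewrite [ramp k (b ord0 i - _)]ramp_eq0 ?subr_le0// mulr0 mul0r.
Qed.

Lemma obox_approx_le1 a b k x : obox_approx a b k x <= 1.
Proof. by apply: le_trans (obox_approx_indic a b k x) _; rewrite indicE; case: (_ \in _). Qed.

Lemma continuous_obox_approx a b k : continuous (obox_approx a b k).
Proof.
apply: continuous_prod_seq => i x.
have ci := @coord_continuous R 1 n ord0 i x.
have c1 : {for x, continuous (fun x : Rn => ramp k (x ord0 i - a ord0 i))}.
  apply: (@continuous_comp _ _ _ (fun x : Rn => x ord0 i - a ord0 i) (ramp k)); last exact: continuous_ramp.
  exact: (cvgB ci (cvg_cst _)).
have c2 : {for x, continuous (fun x : Rn => ramp k (b ord0 i - x ord0 i))}.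
  apply: (@continuous_comp _ _ _ (fun x : Rn => b ord0 i - x ord0 i) (ramp k)); last exact: continuous_ramp.
  exact: (cvgB (cvg_cst _) ci).
exact: (cvgM c1 c2).
Qed.

Lemma cvg_obox_approx a b x : (obox_approx a b)^~ x @ \oo --> (\1_(obox a b) x : R).
Proof.
have [xa|nxa] := pselect (obox a b x).
  rewrite indicE mem_set// -[X in _ --> X](_ : \prod_(i < n) (1 : R) = 1); last by rewrite big1.
  apply: cvg_prod_seq => i; have /andP[x1 x2] := xa i.
  by rewrite -[X in _ --> X]mulr1; apply: cvgM; apply: cvg_ramp; rewrite subr_gt0.
rewrite indicE memNset//; apply: cvg_near_cst; near=> k; apply/eqP; rewrite eq_le obox_approx_ge0 andbT.
by apply: le_trans (obox_approx_indic a b k x) _; rewrite indicE memNset.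
Unshelve. all: by end_near. Qed.

Lemma measurable_obox a b : measurable (obox a b).
Proof.
rewrite (_ : obox a b = \big[setI/setT]_(i < n)
    ((fun x : Rn => x ord0 i) @^-1` `](a ord0 i), (b ord0 i)[%classic)).
  apply: bigsetI_measurable => i _; rewrite -[X in measurable X]setTI.
  by apply: measurable_coor => //; exact: measurable_itv.
rewrite predeqE => x; split=> [h|]; rewrite -bigcap_seq.
  by move=> i _; rewrite /= in_itv/=; exact: h.
by move=> h i; have := h i; rewrite /= in_itv/=; apply; rewrite mem_index_enum.
Qed.

Lemma norm_coord_le (x : Rn) i : `|x ord0 i| <= `|x|.
Proof.
rewrite leNgt; apply/negP => h.
have r0 : 0 < `|x ord0 i| by apply: le_lt_trans h.
have : ball (0 : Rn) `|x ord0 i| x by rewrite mx_norm_ball /ball_/= sub0r normrN.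
by move=> /ball_rVP-/(_ r0 i); rewrite mxE sub0r normrN ltxx.
Qed.

Lemma lebesgue_rV_obox_lty a b : (mu (obox a b) < +oo)%E.
Proof.
pose r := 1 + \sum_i (`|a ord0 i| + `|b ord0 i|).
have r0 : 0 < r by rewrite ltr_wpDr// sumr_ge0// => i _; rewrite addr_ge0.
have sub : obox a b `<=` ball (0 : Rn) r.
  move=> x h; apply/ball_rVP => // i; rewrite mxE sub0r normrN.
  have /andP[h1 h2] := h i.
  apply: (@le_lt_trans _ _ (`|a ord0 i| + `|b ord0 i|)).
    have := ler_norm (b ord0 i); have := ler_norm (- a ord0 i); rewrite normrN => ? ?.
    have := normr_ge0 (a ord0 i); have := normr_ge0 (b ord0 i) => ? ?.
    by rewrite ler_norml; apply/andP; split; lra.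
  rewrite /r (bigD1 i)//= addrCA ltrDl; apply: ltr_wpDr => //.
  by apply: sumr_ge0 => j _; exact: addr_ge0.
apply: (@le_lt_trans _ _ (mu (ball (0 : Rn) r))).
  by rewrite le_measure ?inE//; [exact: measurable_obox|exact: measurable_ball_rV].
by rewrite lebesgue_rV_ball// ltry.
Qed.

Variable (h : Rn -> R).
Hypothesis inth : mu.-integrable setT (EFin \o h).
Hypothesis h0 : forall xi, (\int[mu]_x (h x * cos (dotr x xi)) = 0 /\
                            \int[mu]_x (h x * sin (dotr x xi)) = 0)%R.

Let mh : measurable_fun setT h.
Proof. by apply/measurable_EFinP; exact: measurable_int inth. Qed.

Let abs_lty : (\int[mu]_x `|(h x)%:E| < +oo)%E.
Proof. by have /integrableP[_] := inth. Qed.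

Lemma integrable_mul_bounded (g : Rn -> R) (M : R) : measurable_fun setT g ->
  (forall x, `|g x| <= M) -> mu.-integrable setT (EFin \o (fun x => h x * g x)).
Proof.
move=> mg gM; apply: (@le_integrable _ _ _ mu setT measurableT _ (fun x => M%:E * (h x)%:E)%E) => //.
- by apply/measurable_EFinP; exact: measurable_funM.
- move=> x _ /=; rewrite lee_fin !normrM mulrC ler_wpM2r//.
  by apply: le_trans (gM x) (ler_norm _).
- exact: integrableZl.
Qed.

Lemma integrable_prod_mul (g : Rn -> R) (F : Rn * Rn -> R) :
  (forall x, 0 <= g x) -> measurable_fun setT g -> (\int[mu]_x (g x)%:E < +oo)%E ->
  measurable_fun setT F -> (forall p, `|F p| <= 1) ->
  (mu \x mu)%E.-integrable setT (fun p : Rn * Rn => (h p.1 * (g p.2 * F p))%:E).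
Proof.
move=> g0 mg gy mF F1.
have m1 : measurable_fun setT (fun p : Rn * Rn => h p.1) by exact: measurableT_comp mh measurable_fst.
have m2 : measurable_fun setT (fun p : Rn * Rn => g p.2) by exact: measurableT_comp mg measurable_snd.
apply/integrableP; split.
  by apply/measurable_EFinP; apply: measurable_funM => //; apply: measurable_funM.
apply: (@le_lt_trans _ _ (\int[(mu \x mu)%E]_p (`|h p.1| * g p.2)%:E)%E).
  apply: ge0_le_integral => //.
  - apply: measurableT_comp => //; apply/measurable_EFinP; apply: measurable_funM => //.
    exact: measurable_funM.
  - apply/measurable_EFinP; apply: measurable_funM => //; exact: measurableT_comp.
  - move=> p _; rewrite /= lee_fin normrM ler_wpM2l// normrM ger0_norm// ler_piMr//.
rewrite fubini_tonelli1//; last 2 first.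
- apply/measurable_EFinP; apply: measurable_funM => //; exact: measurableT_comp.
- by move=> p; rewrite lee_fin mulr_ge0.
rewrite /fubini_F /=.
under eq_integral => x _.
  under eq_integral do rewrite EFinM.
  rewrite ge0_integralZl//; last 2 first.
  - by apply/measurable_EFinP.
  - by move=> y _; rewrite lee_fin.
  over.
have gfin : (\int[mu]_x (g x)%:E)%E \is a fin_num.
  by rewrite ge0_fin_numE// integral_ge0// => x _; rewrite lee_fin.
rewrite ge0_integralZr//; last 2 first.
- apply/measurable_EFinP; exact: measurableT_comp.
- by apply: integral_ge0 => x _; rewrite lee_fin.
by rewrite lte_mul_pinfty// ?integral_ge0// ge0_fin_numE// integral_ge0.
Qed.

Lemma measurable_cos_dotr0 (xi : Rn) : measurable_fun setT (fun x : Rn => cos (dotr x xi)).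
Proof.
apply: measurableT_comp; first by apply: continuous_measurable_fun; exact: continuous_cos.
exact: measurable_dotr.
Qed.

(** A Gaussian is the Fourier transform of a Gaussian. After exchanging the integrals, the inner
    integral in [x] is a combination of the cosine and sine transforms of [h], hence zero. *)
Lemma integral_mul_gaussn (b : R) (a : Rn) : 0 < b ->
  (\int[mu]_x (h x * gaussn b (x - a))%:E = 0)%E.
Proof.
(* The Gaussian of parameter [c = 1/(4b)] has transform [e^(-b |.|^2)] up to the factor [K]. *)
move=> b0; pose c := (4 * b)^-1; have c0 : 0 < c by rewrite invr_gt0 mulr_gt0.
pose K := Num.sqrt (pi / c) ^+ n.
have K0 : 0 < K by rewrite exprn_gt0// sqrtr_gt0 divr_gt0// pi_gt0.
pose F (p : Rn * Rn) := cos (dotr p.2 (p.1 - a)).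
have mF : measurable_fun setT F.
  apply: measurableT_comp; first by apply: continuous_measurable_fun; exact: continuous_cos.
  apply: measurable_sum => i; apply: measurable_funM.
    exact: (measurableT_comp (@measurable_coor R n i) measurable_snd).
  under eq_fun do rewrite !mxE; apply: measurable_funB => //.
  exact: (measurableT_comp (@measurable_coor R n i) measurable_fst).
have F1 p : `|F p| <= 1 by rewrite ler_norml cos_geN1 cos_le1.
have gy : (\int[mu]_x (gaussn c x)%:E < +oo)%E by rewrite integral_gaussn// ltry.
have intF := integrable_prod_mul (@gaussn_ge0 R n c) (@measurable_gaussn R n c) gy mF F1.
have := Fubini intF => /=.
under eq_integral => x _.
  under eq_integral do rewrite EFinM.
  rewrite integralZl//; last first.
    apply: bounded_gaussn_integrable => //.
    by rewrite /F/=; exact: (measurable_cos_dotr0 (x - a)).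
  under eq_integral do rewrite /F/= -[dotr _ _]addr0.
  rewrite fourier_gaussn// cos0 mul1r (_ : dotr (x - a) (x - a) / (4 * c) = b * dotr (x - a) (x - a)); last first.
    by rewrite /c; field; rewrite gt_eqF.
  rewrite -/(gaussn b (x - a)) -EFinM mulrCA EFinM.
  over.
rewrite integralZl//; last first.
  apply: (@integrable_mul_bounded _ 1).
    apply: measurableT_comp; first exact: measurable_gaussn.
    apply: measurable_fun_coorP => i; under eq_fun do rewrite !mxE.
    by apply: measurable_funB => //; exact: measurable_coor.
  by move=> x; rewrite ger0_norm ?gaussn_ge0// /gaussn -expR0 ler_expR oppr_le0 mulr_ge0 ?dotr_ge0 ?(ltW b0).
rewrite [X in _ = X](_ : _ = 0%E); last first.
  apply: integral0_eq => y _.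
  rewrite (eq_integral (fun x : Rn => (gaussn c y * cos (dotr y a))%:E * (h x * cos (dotr x y))%:E +
     (gaussn c y * sin (dotr y a))%:E * (h x * sin (dotr x y))%:E)%E); last first.
    move=> x _; rewrite -!EFinM -EFinD /F/=; congr EFin.
    have -> : dotr y (x - a) = dotr x y - dotr y a.
      rewrite /dotr -sumrB; apply: eq_bigr => i _; rewrite !mxE; ring.
    by rewrite cosB; ring.
  have ic : mu.-integrable setT (EFin \o (fun x => h x * cos (dotr x y))).
    apply: (@integrable_mul_bounded _ 1); last by move=> x; rewrite ler_norml cos_geN1 cos_le1.
    exact: measurable_cos_dotr0.
  have is_ : mu.-integrable setT (EFin \o (fun x => h x * sin (dotr x y))).
    apply: (@integrable_mul_bounded _ 1); last by move=> x; rewrite ler_norml sin_geN1 sin_le1.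
    apply: measurableT_comp; first by apply: continuous_measurable_fun; exact: continuous_sin.
    exact: measurable_dotr.
  have z1 : (\int[mu]_x (h x * cos (dotr x y))%:E = 0)%E.
    by have [+ _] := h0 y; rewrite /Rintegral -[X in X = _ -> _]/(fine _) => e; rewrite -(fineK (integrable_fin_num measurableT ic)) e.
  have z2 : (\int[mu]_x (h x * sin (dotr x y))%:E = 0)%E.
    by have [_ +] := h0 y; rewrite /Rintegral -[X in X = _ -> _]/(fine _) => e; rewrite -(fineK (integrable_fin_num measurableT is_)) e.
  rewrite integralD//; [|exact: integrableZl|exact: integrableZl].
  by rewrite integralZl// integralZl// z1 z2 !mule0 adde0.
move=> /eqP; rewrite mule_eq0 => /orP[|/eqP//].
by rewrite eqe gt_eqF.
Qed.

(** [T m] is [psi] smoothed by a Gaussian of width [s m]. Its integral against [h] is zero by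
    [integral_mul_gaussn] and Fubini, and it tends to [K psi] while staying below [K]. *)
Lemma integral_mul_continuous (psi : Rn -> R) : continuous psi ->
  (forall x, 0 <= psi x <= 1) -> (\int[mu]_x (psi x)%:E < +oo)%E ->
  (\int[mu]_x (h x * psi x)%:E = 0)%E.
Proof.
move=> cpsi psi01 psiy.
have psi0 x : 0 <= psi x by have /andP[] := psi01 x.
have psi1 x : psi x <= 1 by have /andP[] := psi01 x.
have mpsi : measurable_fun setT psi by exact: continuous_measurable_rV.
pose s (m : nat) : R := m.+1%:R^-1.
have s0 m : 0 < s m by rewrite invr_gt0.
pose T m (x : Rn) := (\int[mu]_y (psi (x + s m *: y) * gaussn 1 y)%:E)%E.
pose K := Num.sqrt (pi / 1) ^+ n : R.
have K0 : 0 < K by rewrite exprn_gt0// sqrtr_gt0 divr_gt0// pi_gt0.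
have mg := @measurable_gaussn R n 1.
have gK : (\int[mu]_x (gaussn 1 x)%:E = K%:E)%E by rewrite integral_gaussn.
have mT m (x : Rn) : measurable_fun setT (fun y : Rn => psi (x + s m *: y) * gaussn 1 y).
  apply: measurable_funM => //; apply: measurableT_comp => //; exact: affine_measurable.
have Tb m x : (0 <= T m x <= K%:E)%E.
  apply/andP; split.
    by apply: integral_ge0 => y _; rewrite lee_fin mulr_ge0 ?gaussn_ge0.
  rewrite -gK; apply: ge0_le_integral => //.
  - by move=> y _; rewrite lee_fin mulr_ge0 ?gaussn_ge0.
  - exact/measurable_EFinP.
  - exact/measurable_EFinP.
  - by move=> y _; rewrite lee_fin ler_piMl ?gaussn_ge0.
have Tfin m x : T m x \is a fin_num.
  by have /andP[t0 tK] := Tb m x; rewrite ge0_fin_numE//; apply: le_lt_trans tK _; rewrite ltry.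
have mTT m : measurable_fun setT (T m).
  apply: (@measurable_fun_fubini_tonelli_F _ _ Rn Rn R mu (fun p => (psi (p.1 + s m *: p.2) * gaussn 1 p.2)%:E)).
    apply/measurable_EFinP; apply: measurable_funM; last exact: measurableT_comp mg measurable_snd.
    apply: (measurableT_comp mpsi); apply: measurable_fun_coorP => i.
    under eq_fun do rewrite !mxE; apply: measurable_funD.
      exact: (measurableT_comp (@measurable_coor R n i) measurable_fst).
    apply: measurable_funM => //.
    exact: (measurableT_comp (@measurable_coor R n i) measurable_snd).
  by move=> p; rewrite lee_fin mulr_ge0 ?gaussn_ge0.
have Tcvg x : T^~ x @ \oo --> (psi x * K)%:E.
  rewrite EFinM -gK -ge0_integralZl//; last 3 first.
  - exact/measurable_EFinP.
  - by move=> y _; rewrite lee_fin gaussn_ge0.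
  - by rewrite lee_fin.
  apply: (@dominated_cvg _ _ _ mu setT measurableT _ _ (EFin \o gaussn 1)) => //.
  - by move=> m; apply/measurable_EFinP; exact: mT.
  - move=> y _; rewrite -EFinM; apply: cvg_EFin; first by near=> m.
    apply: cvgM; last exact: cvg_cst.
    apply: (@cvg_comp _ _ _ (fun m : nat => x + s m *: y) psi _ (nbhs x)); last exact: cpsi.
    have hc : (fun m => x + s m *: y) @ \oo --> x + 0 *: y.
      apply: cvgD; first exact: cvg_cst.
      apply: cvgZr_tmp; exact: cvg_harmonic.
    by move: hc; rewrite scale0r addr0.
  - exact: integrable_gaussn.
  - move=> m y _; rewrite /= lee_fin normrM !ger0_norm ?gaussn_ge0// ler_piMl ?gaussn_ge0//.
have Tz m : (\int[mu]_x ((h x)%:E * T m x) = 0)%E.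
  pose b := s m ^- 2; have b0 : 0 < b by rewrite invr_gt0 exprn_gt0.
  pose F (p : Rn * Rn) := gaussn b (p.1 - p.2).
  have mF : measurable_fun setT F.
    apply: measurableT_comp; first exact: measurable_gaussn.
    apply: measurable_fun_coorP => i; under eq_fun do rewrite !mxE.
    apply: measurable_funB.
      exact: (measurableT_comp (@measurable_coor R n i) measurable_fst).
    exact: (measurableT_comp (@measurable_coor R n i) measurable_snd).
  have F1 p : `|F p| <= 1.
    by rewrite ger0_norm ?gaussn_ge0// /F/gaussn -expR0 ler_expR oppr_le0 mulr_ge0 ?dotr_ge0 ?(ltW b0).
  have intF := integrable_prod_mul psi0 mpsi psiy mF F1.
  (* A change of variables moves [x] from the argument of [psi] to that of the Gaussian, so that
     [T m] becomes a superposition of translates of [gaussn b] with [b = (s m)^(-2)]. *)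
  have TE x : T m x = ((s m ^- n)%:E * \int[mu]_y (psi y * gaussn b (x - y))%:E)%E.
    rewrite (@ge0_integral_affine _ _ x (s m)) ?gt_eqF//; last 2 first.
    - apply/measurable_EFinP; apply: measurable_funM => //.
      apply: measurableT_comp; first exact: measurable_gaussn.
      apply: measurable_fun_coorP => i; under eq_fun do rewrite !mxE.
      by apply: measurable_funB => //; exact: measurable_coor.
    - by move=> y; rewrite lee_fin mulr_ge0 ?gaussn_ge0.
    rewrite muleA -EFinM gtr0_norm// mulVf ?mul1e ?expf_neq0 ?gt_eqF//.
    apply: eq_integral => y _; congr (_ * _)%:E; rewrite /gaussn; congr expR; congr (- _).
    rewrite mul1r /dotr mulr_sumr; apply: eq_bigr => i _; rewrite !mxE /b.
    by field; rewrite gt_eqF.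
  rewrite (eq_integral (fun x => (s m ^- n)%:E * \int[mu]_y (h x * (psi y * F (x, y)))%:E)%E); last first.
    move=> x _; rewrite TE muleCA; congr (_ * _)%E.
    rewrite -integralZl//; last first.
      apply: (@le_integrable _ _ _ mu setT measurableT _ (fun y => (psi y)%:E)%E) => //.
      - apply/measurable_EFinP; apply: measurable_funM => //.
        exact: (measurableT_comp mF (@pair1_measurable _ _ Rn Rn x)).
      - move=> y _ /=; rewrite lee_fin normrM ler_piMr//; exact: (F1 (x, y)).
      - apply/integrableP; split; first exact/measurable_EFinP.
        by under eq_integral do rewrite gee0_abs ?lee_fin//.
  rewrite integralZl//; last exact: (integrable_fubini_F intF).
  rewrite (Fubini intF) integral0_eq ?mule0// => y _.
  rewrite (eq_integral (fun x => (psi y)%:E * (h x * gaussn b (x - y))%:E)%E); last first.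
    by move=> x _; rewrite -EFinM mulrCA.
  rewrite integralZl//; first by rewrite integral_mul_gaussn// mule0.
  apply: (@integrable_mul_bounded _ 1).
    exact: (measurableT_comp mF (@pair2_measurable _ _ Rn Rn y)).
  by move=> x; exact: (F1 (x, y)).
have : (fun m => \int[mu]_x ((h x)%:E * T m x))%E @ \oo --> (\int[mu]_x ((h x)%:E * (psi x * K)%:E))%E.
  apply: (@dominated_cvg _ _ _ mu setT measurableT _ _ (fun x => K%:E * `|(h x)%:E|)%E) => //.
  - move=> m; apply: emeasurable_funM => //; exact/measurable_EFinP.
  - by move=> x _; apply: cvgeZl => //; exact: Tcvg.
  - apply: integrableZl => //; exact: integrable_abse.
  - move=> m x _; rewrite abseM muleC; have /andP[t0 tK] := Tb m x.
    by apply: lee_pmul => //; rewrite gee0_abs.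
under eq_fun do rewrite Tz.
move=> hz; have : (\int[mu]_x ((h x)%:E * (psi x * K)%:E) = 0)%E by exact: (cvg_unique _ hz (cvg_cst 0%E)).
rewrite (eq_integral (fun x => K%:E * (h x * psi x)%:E)%E); last first.
  by move=> x _; rewrite -!EFinM; congr EFin; ring.
rewrite integralZl//.
  by move/eqP; rewrite mule_eq0 eqe gt_eqF//= => /eqP.
apply: (@integrable_mul_bounded _ 1) => // x.
by rewrite ger0_norm.
Unshelve. all: by end_near. Qed.

Lemma integral_obox_eq0 (a b : Rn) : (\int[mu]_(x in obox a b) (h x)%:E = 0)%E.
Proof.
have mb := measurable_obox a b.
have : (fun k => \int[mu]_x (h x * obox_approx a b k x)%:E)%E @ \oo --> (\int[mu]_x (h x * \1_(obox a b) x)%:E)%E.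
  apply: (@dominated_cvg _ _ _ mu setT measurableT _ _ (fun x => `|(h x)%:E|)%E) => //.
  - move=> m; apply/measurable_EFinP; apply: measurable_funM => //.
    apply: continuous_measurable_rV; exact: continuous_obox_approx.
  - move=> x _; apply: cvg_EFin; first by near=> m.
    apply: cvgM; [exact: cvg_cst|exact: cvg_obox_approx].
  - exact: integrable_abse.
  - move=> m x _ /=; rewrite lee_fin normrM ler_piMr// ger0_norm ?obox_approx_ge0//.
    exact: obox_approx_le1.
rewrite (_ : (fun k => _) = cst 0%E); last first.
  apply/funext => k; apply: integral_mul_continuous.
  - exact: continuous_obox_approx.
  - by move=> x; rewrite obox_approx_ge0 obox_approx_le1.
  - apply: (@le_lt_trans _ _ (\int[mu]_x (\1_(obox a b) x)%:E)%E).
      apply: ge0_le_integral => //.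
      + by move=> x _; rewrite lee_fin obox_approx_ge0.
      + apply/measurable_EFinP; apply: continuous_measurable_rV; exact: continuous_obox_approx.
      + by apply/measurable_EFinP; exact: measurable_indic.
      + by move=> x _; rewrite lee_fin obox_approx_indic.
    by rewrite integral_indic// setIT; exact: lebesgue_rV_obox_lty.
move=> hz; have <- : (\int[mu]_x (h x * \1_(obox a b) x)%:E = 0)%E by exact: (cvg_unique _ hz (cvg_cst 0%E)).
rewrite integral_mkcond; apply: eq_integral => x _.
by rewrite patchE indicE; case: ifPn => _; rewrite ?mulr1 ?mulr0.
Unshelve. all: by end_near. Qed.

Lemma measurable_rV_obox :
  @measurable _ Rn = <<s [set B | exists a b, B = obox a b] >>.
Proof.
apply/seteqP; split; last first.
  apply: smallest_sub; first exact: sigma_algebra_measurable.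
  by move=> _ [a [b ->]]; exact: measurable_obox.
pose S : set (set Rn) := <<s [set B | exists a b, B = obox a b] >>.
apply: smallest_sub; first exact: smallest_sigma_algebra.
move=> B; rewrite -bigcup_seq => -[i _] [D mD' <-] /=; rewrite setTI.
have {}mD' : (@RGenOInfty.G R).-sigma.-measurable D by rewrite -RGenOInfty.measurableE.
move: D mD'; apply: smallest_sub => /=.
  split.
  - by rewrite preimage_set0; exact: sigma_algebra0.
  - move=> A SA; rewrite setTD preimage_setC; exact: sigma_algebraC.
  - move=> F SF; rewrite preimage_bigcup; exact: sigma_algebra_bigcup.
move=> _ [c ->].
rewrite (_ : _ @^-1` _ = \bigcup_k (obox (\row_j if j == i then c else - k%:R) (\row_j k%:R))).
  by apply: sigma_algebra_bigcup => k; apply: sub_sigma_algebra; eexists; eexists.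
apply/seteqP; split => x /=; rewrite in_itv/= andbT.
  move=> cx; exists (Num.truncn `|x|).+1 => // j; rewrite !mxE.
  have : `|x ord0 j| < (Num.truncn `|x|).+1%:R.
    exact: le_lt_trans (norm_coord_le x j) (truncnS_gt _).
  by rewrite ltr_norml => /andP[h1 h2]; rewrite h2 andbT; case: eqP => [->|].
by move=> [k _ /(_ i)]; rewrite !mxE eqxx => /andP[].
Qed.

(** The positive and negative parts of [h] define finite measures that agree on open boxes, a
    pi-system generating the sigma-algebra; so they agree on every measurable set. *)
Lemma fourier_injective : {ae mu, forall x, h x = 0}.
Proof.
have [mp mn] : measurable_fun setT (EFin \o h)^\+%E /\ measurable_fun setT (EFin \o h)^\-%E.
  split; [apply: measurable_funepos|apply: measurable_funeneg]; exact/measurable_EFinP.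
pose n1 := density_measure_def mu mp (funepos_ge0 _).
pose n2 := density_measure_def mu mn (funeneg_ge0 _).
have fin1 A : measurable A -> (n1 A < +oo)%E.
  move=> mA; apply: (@le_lt_trans _ _ (\int[mu]_x (EFin \o h)^\+ x)%E); last exact: integral_funepos_lt_pinfty.
  exact: ge0_subset_integral.
have fin2 A : measurable A -> (n2 A < +oo)%E.
  move=> mA; apply: (@le_lt_trans _ _ (\int[mu]_x (EFin \o h)^\- x)%E); last exact: integral_funeneg_lt_pinfty.
  exact: ge0_subset_integral.
have n12 A : measurable A -> n1 A = n2 A.
  apply: (@measure_unique _ _ _ [set B | exists a b, B = obox a b] (fun k => obox (\row_j (- k%:R)) (\row_j k%:R))).
  - exact: measurable_rV_obox.
  - move=> _ _ [a [b ->]] [c [d ->]].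
    exists (\row_j Num.max (a ord0 j) (c ord0 j)), (\row_j Num.min (b ord0 j) (d ord0 j)).
    apply/seteqP; split=> x.
      by move=> [h1 h2] j; rewrite !mxE gt_max lt_min; have /andP[-> ->] := h1 j; have /andP[-> ->] := h2 j.
    by move=> H; split=> j; have := H j; rewrite !mxE gt_max lt_min => /andP[/andP[? ?] /andP[? ?]]; apply/andP.
  - by move=> k; eexists; eexists.
  - rewrite -subTset => x _; exists (Num.truncn `|x|).+1 => // j; rewrite !mxE.
    by rewrite -ltr_norml; exact: le_lt_trans (norm_coord_le x j) (truncnS_gt _).
  - move=> _ [a [b ->]]; have := integral_obox_eq0 a b.
    have f1 := fin1 _ (measurable_obox a b); have f2 := fin2 _ (measurable_obox a b).
    rewrite integralE => /eqP; rewrite sube_eq ?add0e; first by move/eqP.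
      by rewrite ge0_fin_numE ?integral_ge0.
    by rewrite fin_num_adde_defl// ge0_fin_numE ?integral_ge0.
  - by move=> k; apply: fin1; exact: measurable_obox.
have : ae_eq mu setT (EFin \o h) (cst 0%E).
  apply: integral_ae_eq => // E _ mE; rewrite integral0 integralE.
  rewrite [X in (X - _)%E](n12 _ mE) subee// ge0_fin_numE ?integral_ge0//.
  by have := fin1 _ mE; rewrite (n12 _ mE).
by apply: filterS => x /(_ I)[].
Qed.

End fourier_uniqueness.

(** [xget] picks some function with the prescribed transform: the explicit one shows that such
    functions exist, and injectivity identifies the two almost everywhere. *)
Lemma bessel_kernelE {R : realType} {n : nat} (alpha : R) : 0 < alpha ->
  {ae @lebesgue_rV R n, forall x, bessel_kernel alpha x = bessel_explicit (alpha / 2) x}.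
Proof.
move=> al0; have [iE fE] := @is_inverse_fourier_bessel_explicit R n alpha al0.
have [iB fB] : is_inverse_fourier (fun xi : 'rV[R]_n => (1 + dotr xi xi) `^ (- alpha / 2)) (bessel_kernel alpha).
  apply: (@xgetPex _ (cst 0) [set G | is_inverse_fourier (fun xi : 'rV[R]_n => (1 + dotr xi xi) `^ (- alpha / 2)) G]).
  by exists (bessel_explicit (alpha / 2)); split.
pose h (x : 'rV[R]_n) : R := bessel_kernel alpha x - bessel_explicit (alpha / 2) x.
have ih : (@lebesgue_rV R n).-integrable setT (EFin \o h).
  by apply: eq_integrable (integrableB measurableT iB iE).
have mB : measurable_fun setT (@bessel_kernel R n alpha) by apply/measurable_EFinP; exact: measurable_int iB.
have mE : measurable_fun setT (@bessel_explicit R n (alpha / 2)) by exact: measurable_bessel_explicit.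
have ib (f g : 'rV[R]_n -> R) : (@lebesgue_rV R n).-integrable setT (EFin \o f) ->
   measurable_fun setT g -> (forall x, `|g x| <= 1) -> (@lebesgue_rV R n).-integrable setT (EFin \o (fun x => f x * g x)).
  by move=> If mg g1; exact: integrable_mul_bounded If _ 1 mg g1.
have mc xi : measurable_fun setT (fun x : 'rV[R]_n => cos (dotr x xi)) by exact: measurable_cos_dotr0.
have ms xi : measurable_fun setT (fun x : 'rV[R]_n => sin (dotr x xi)).
  apply: measurableT_comp; first by apply: continuous_measurable_fun; exact: continuous_sin.
  exact: measurable_dotr.
have c1 xi (x : 'rV[R]_n) : `|cos (dotr x xi)| <= 1 by rewrite ler_norml cos_geN1 cos_le1.
have s1 xi (x : 'rV[R]_n) : `|sin (dotr x xi)| <= 1 by rewrite ler_norml sin_geN1 sin_le1.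
have := @fourier_injective R n h ih.
suff H xi : \int[lebesgue_rV n]_x (h x * cos (dotr x xi)) = 0 /\ \int[lebesgue_rV n]_x (h x * sin (dotr x xi)) = 0.
  by move=> /(_ H); apply: filterS => x /eqP; rewrite subr_eq0 => /eqP.
split.
  under eq_Rintegral do rewrite /h mulrBl.
  rewrite RintegralB//; [|exact: ib|exact: ib].
  by rewrite (fB xi).1 (fE xi).1 subrr.
under eq_Rintegral do rewrite /h mulrBl.
rewrite RintegralB//; [|exact: ib|exact: ib].
by rewrite (fB xi).2 (fE xi).2 subrr.
Qed.

(** * Averages over balls *)

Lemma mulr2n_expr_ratio (F : numFieldType) (k : nat) (a r s : F) : r != 0 ->
  a * (s *+ 2) ^+ k / (r *+ 2) ^+ k = (s / r) ^+ k * a.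
Proof.
move=> r0; rewrite expr_div_n -(mulr_natr r 2) -(mulr_natr s 2) !exprMn.
have rN0 : r ^+ k != 0 by rewrite expf_neq0.
have tN0 : (2%:R : F) ^+ k != 0 by rewrite expf_neq0// pnatr_eq0.
by rewrite invfM (mulrA a) mulrACA divff// mulr1 -mulrA mulrC.
Qed.

Lemma sub_le_of_common_bounds (F : realFieldType) (L U a b c E : F) :
  L <= b -> b <= U -> L <= a -> a <= U -> U <= L + c -> c <= E -> - E <= a - b <= E.
Proof. by move=> *; apply/andP; split; lra. Qed.

Section averages.
Context {R : realType} {n : nat}.
Local Notation Rn := 'rV[R]_n.
Local Notation mu := (@lebesgue_rV R n).

(** Potentials are built from truncated functions only. Boundedness keeps averages and maximal
    functions real-valued, while the constants of the later estimates are free of [B]. *)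
Definition bounded_mfun (B : R) (g : Rn -> R) :=
  measurable_fun setT g /\ forall x, 0 <= g x <= B.

(* [ball x r] is a ball of the sup norm, of volume [(2 r)^n]. *)
Definition avg (r : R) (g : Rn -> R) (x : Rn) : R :=
  fine (\int[mu]_(y in ball x r) (g y)%:E)%E / (r *+ 2) ^+ n.

Section bounded.
Variables (B : R) (g : Rn -> R).
Hypothesis Bg : bounded_mfun B g.

Lemma bounded_mfunM : measurable_fun setT g. Proof. by have [] := Bg. Qed.
Lemma bounded_mfun_ge0 x : 0 <= g x. Proof. by have [_ /(_ x) /andP[]] := Bg. Qed.
Lemma bounded_mfun_le x : g x <= B. Proof. by have [_ /(_ x) /andP[]] := Bg. Qed.
Lemma bounded_mfun_B0 : 0 <= B.
Proof. exact: le_trans (bounded_mfun_ge0 0) (bounded_mfun_le 0). Qed.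

Lemma bounded_mfunE (D : set Rn) : measurable_fun D (EFin \o g).
Proof. by apply/measurable_EFinP; apply: measurable_funTS; exact: bounded_mfunM. Qed.

Lemma integral_bounded_le (D : set Rn) : measurable D ->
  (\int[mu]_(y in D) (g y)%:E <= B%:E * mu D)%E.
Proof.
move=> mD; rewrite -integral_cst//; apply: ge0_le_integral => //.
- by move=> x _; rewrite lee_fin bounded_mfun_ge0.
- exact: bounded_mfunE.
- by move=> x _; rewrite lee_fin bounded_mfun_le.
Qed.

Lemma vol_gt0 (r : R) : 0 < r -> 0 < (r *+ 2) ^+ n.
Proof. by move=> r0; rewrite exprn_gt0// pmulrn_lgt0. Qed.

Lemma integral_ballE (r : R) x : 0 < r ->
  (\int[mu]_(y in ball x r) (g y)%:E = (avg r g x * (r *+ 2) ^+ n)%:E)%E.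
Proof.
move=> r0; rewrite /avg divfK ?gt_eqF ?vol_gt0// fineK// ge0_fin_numE.
  apply: le_lt_trans (integral_bounded_le (measurable_ball_rV x r)) _.
  have -> : mu (ball x r) = ((r *+ 2) ^+ n)%:E by exact: lebesgue_rV_ball.
  by rewrite -EFinM ltry.
by apply: integral_ge0 => y _; rewrite lee_fin bounded_mfun_ge0.
Qed.

Lemma avg_ge0 (r : R) x : 0 < r -> 0 <= avg r g x.
Proof.
move=> r0; rewrite /avg divr_ge0//; last exact/ltW/vol_gt0.
by rewrite fine_ge0// integral_ge0// => y _; rewrite lee_fin bounded_mfun_ge0.
Qed.

Lemma avg_sub (r s : R) (x y : Rn) : 0 < r -> 0 < s -> ball x r `<=` ball y s ->
  avg r g x * (r *+ 2) ^+ n <= avg s g y * (s *+ 2) ^+ n.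
Proof.
move=> r0 s0 sub; rewrite -lee_fin -(integral_ballE x r0) -(integral_ballE y s0).
apply: (@ge0_subset_integral _ _ _ mu (ball x r) (ball y s) (measurable_ball_rV x r)
  (measurable_ball_rV y s) (EFin \o g)).
- exact: bounded_mfunE.
- by move=> z _; rewrite lee_fin bounded_mfun_ge0.
- exact: sub.
Qed.

Lemma avg_sub_le (r s : R) (x y : Rn) : 0 < r -> 0 < s -> ball x r `<=` ball y s ->
  avg r g x <= (s / r) ^+ n * avg s g y.
Proof.
move=> r0 s0 sub; have := avg_sub r0 s0 sub.
rewrite -ler_pdivlMr ?vol_gt0// => h; apply: le_trans h _.
by rewrite mulr2n_expr_ratio ?gt_eqF.
Qed.

End bounded.

(** The comparison principle from which monotonicity, the bounds by a supremum or an infimum,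
    Jensen's inequality and the splitting at a level are read off. *)
Lemma avg_affine_le (B B' : R) (g h : Rn -> R) (r a b : R) x :
  bounded_mfun B g -> bounded_mfun B' h -> 0 < r -> 0 <= a -> 0 <= b ->
  (forall y, ball x r y -> g y <= a + b * h y) -> avg r g x <= a + b * avg r h x.
Proof.
move=> Bg Bh r0 a0 b0 gh.
have v0 := vol_gt0 r0.
rewrite -(ler_pM2r v0) mulrDl -lee_fin -(integral_ballE Bg)// EFinD -mulrA EFinM EFinM -(integral_ballE Bh)//.
have -> : ((r *+ 2) ^+ n)%:E = mu (ball x r) by rewrite lebesgue_rV_ball.
have mb := measurable_ball_rV x r.
rewrite -integral_cst// -ge0_integralZl//; last 2 first.
- exact: bounded_mfunE Bh _.
- by move=> y _; rewrite lee_fin (bounded_mfun_ge0 Bh).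
rewrite -ge0_integralD//; last 2 first.
- by move=> y _; rewrite -EFinM lee_fin mulr_ge0// (bounded_mfun_ge0 Bh).
- by apply: emeasurable_funM => //; exact: bounded_mfunE Bh _.
apply: ge0_le_integral => //.
- by move=> y _; rewrite lee_fin (bounded_mfun_ge0 Bg).
- exact: bounded_mfunE Bg _.
- by apply: emeasurable_funD => //; apply: emeasurable_funM => //; exact: bounded_mfunE Bh _.
Qed.

Lemma bounded_mfun_cst (c : R) : 0 <= c -> bounded_mfun c (cst c).
Proof. by move=> c0; split => // x; rewrite c0 /=. Qed.

Lemma avg_cst (r c : R) x : 0 < r -> 0 <= c -> avg r (cst c) x = c.
Proof.
move=> r0 c0; rewrite /avg /cst integral_cst; last exact: measurable_ball_rV.
rewrite [X in (_ * X)%E](lebesgue_rV_ball x r0).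
by rewrite -EFinM/= mulfK// gt_eqF// exprn_gt0// pmulrn_lgt0.
Qed.

Lemma avg_le_sup (B : R) (g : Rn -> R) (r c : R) x :
  bounded_mfun B g -> 0 < r -> 0 <= c -> (forall y, ball x r y -> g y <= c) -> avg r g x <= c.
Proof.
move=> Bg r0 c0 gc.
have := @avg_affine_le B c g (cst c) r c 0 x Bg (bounded_mfun_cst c0) r0 c0 (lexx _).
by rewrite mul0r addr0; apply => y /gc h; rewrite mul0r addr0.
Qed.

Lemma avg_le (B B' : R) (g h : Rn -> R) (r : R) x :
  bounded_mfun B g -> bounded_mfun B' h -> 0 < r ->
  (forall y, ball x r y -> g y <= h y) -> avg r g x <= avg r h x.
Proof.
move=> Bg Bh r0 gh.
have := @avg_affine_le B B' g h r 0 1 x Bg Bh r0 (lexx _) ler01.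
by rewrite add0r mul1r; apply => y /gh; rewrite add0r mul1r.
Qed.

Lemma avg_ge_inf (B : R) (g : Rn -> R) (r c : R) x :
  bounded_mfun B g -> 0 < r -> 0 <= c -> (forall y, ball x r y -> c <= g y) -> c <= avg r g x.
Proof.
by move=> Bg r0 c0 gc; rewrite -{1}(avg_cst x r0 c0); exact: avg_le (bounded_mfun_cst c0) Bg r0 gc.
Qed.

(** When [y] is within [d] of [x], the integrals over [ball x r] and [ball y r] both lie between
    those over [ball x (r - d)] and [ball x (r + d)], which differ by at most [B] times the volume
    [phi d] of the shell. *)
Lemma avg_continuous (B : R) (g : Rn -> R) (r : R) : bounded_mfun B g -> 0 < r ->
  continuous (avg r g).
Proof.
move=> Bg r0 x; apply/(@cvgrPdist_le R R Rn (nbhs x) _ (avg r g) (avg r g x)) => e e0.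
have v0 := vol_gt0 r0; have B0 := bounded_mfun_B0 Bg.
pose phi (d : R) := ((r + d) *+ 2) ^+ n - ((r - d) *+ 2) ^+ n.
have cphi : phi d @[d --> (0 : R)] --> phi 0.
  have ck (k : R -> R) : {for 0, continuous k} -> (k d *+ 2) ^+ n @[d --> (0 : R)] --> (k 0 *+ 2) ^+ n.
    move=> k0; apply: (@continuous_comp R R R (fun d => k d *+ 2) (fun y => y ^+ n)).
      change (k d *+ 2 @[d --> (0 : R)] --> k 0 *+ 2); rewrite mulr2n.
      by under eq_fun do rewrite mulr2n; exact: cvgD.
    exact: exprn_continuous.
  apply: cvgB; [apply: (ck (fun d => r + d))|apply: (ck (fun d => r - d))].
    by apply: cvgD; [exact: cvg_cst|exact: cvg_id].
  by apply: cvgB; [exact: cvg_cst|exact: cvg_id].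
have phi0 : phi 0 = 0 by rewrite /phi addr0 subr0 subrr.
rewrite phi0 in cphi.
have eB : 0 < e * (r *+ 2) ^+ n / (B + 1) by rewrite divr_gt0 ?mulr_gt0// ltr_wpDl.
move/cvgrPdist_lt : cphi => /(_ _ eB) /nbhs_ballP[d0 /= d00 hd].
pose d := Num.min (d0 / 2) (r / 2).
have dd : 0 < d by rewrite lt_min !divr_gt0.
have dr : d < r by rewrite gt_min; apply/orP; right; lra.
have {hd} pd : phi d < e * (r *+ 2) ^+ n / (B + 1).
  apply: le_lt_trans (ler_norm _) _; have := hd d; rewrite /ball/= !sub0r !normrN; apply.
  by rewrite gtr0_norm// gt_min; apply/orP; left; lra.
apply/nbhs_ballP; exists d => // y xy.
have rd : 0 < r - d by rewrite subr_gt0.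
have rd' : 0 < r + d by rewrite addr_gt0.
have s1 : ball x (r - d) `<=` ball y r.
  move=> z xz; have := ball_triangle (ball_sym xy) xz; by rewrite addrC subrK.
have s2 : ball y r `<=` ball x (r + d).
  by move=> z yz; have := ball_triangle xy yz; rewrite addrC.
have s3 : ball x (r - d) `<=` ball x r by apply: le_ball; rewrite lerBlDr lerDl ltW.
have s4 : ball x r `<=` ball x (r + d) by apply: le_ball; rewrite lerDl ltW.
have a1 := avg_sub Bg rd r0 s1; have a2 := avg_sub Bg r0 rd' s2.
have a3 := avg_sub Bg rd r0 s3; have a4 := avg_sub Bg r0 rd' s4.
have key : avg (r + d) g x * ((r + d) *+ 2) ^+ n <= avg (r - d) g x * ((r - d) *+ 2) ^+ n + B * phi d.
  rewrite -lee_fin EFinD -!(integral_ballE Bg)//.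
  have m1 := measurable_ball_rV x (r - d); have m2 := measurable_ball_rV x (r + d).
  have sub : ball x (r - d) `<=` ball x (r + d) by apply: subset_trans s3 s4.
  have -> : ball x (r + d) = ball x (r - d) `|` (ball x (r + d) `\` ball x (r - d)).
    by rewrite setDUK.
  rewrite ge0_integral_setU//; last 4 first.
  - exact: measurableD.
  - exact: bounded_mfunE Bg _.
  - by move=> z _; rewrite lee_fin (bounded_mfun_ge0 Bg).
  - by apply/disj_setPS => z [] ? [].
  rewrite leeD2l//; apply: le_trans (integral_bounded_le Bg (measurableD m2 m1)) _.
  have fm : (mu (ball x (r + d)) < +oo)%E by rewrite lebesgue_rV_ball// ltry.
  rewrite measureD// setIidr//.
  rewrite [X in (_ * (X - _))%E](lebesgue_rV_ball x rd').
  by rewrite [X in (_ * (_ - X))%E](lebesgue_rV_ball x rd) -EFinB -EFinM.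
have Bp : B * phi d <= e * (r *+ 2) ^+ n.
  have p0 : 0 <= phi d by rewrite subr_ge0; apply: lerXn2r;
    rewrite ?nnegrE ?mulrn_wge0 ?(ltW rd) ?(ltW rd')// lerMn2r/= lerD2l (@le_trans _ _ 0)// ?oppr_le0 ltW.
  apply: (@le_trans _ _ ((B + 1) * phi d)); first by rewrite ler_wpM2r// lerDl.
  by rewrite mulrC -ler_pdivlMr ?ltW// ltr_wpDl.
have /andP[h1 h2] := sub_le_of_common_bounds a1 a2 a3 a4 key Bp.
rewrite ler_norml; apply/andP; split; rewrite -(ler_pM2r v0) ?mulNr mulrBl; [exact: h1|exact: h2].
Qed.

(** Jensen's inequality. Young's inequality with second factor [b^(tau-1)], where [b] is the
    average, is the tangent-line bound for [y^tau] at [b], and averages respect affine bounds. *)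
Lemma avg_powR_le (B : R) (F : Rn -> R) (tau r : R) x : 1 < tau -> bounded_mfun B F -> 0 < r ->
  avg r F x `^ tau <= avg r (fun y => F y `^ tau) x.
Proof.
move=> t1 BF r0; have t0 : 0 < tau by apply: lt_trans t1.
have F0 := bounded_mfun_ge0 BF.
have B0 := bounded_mfun_B0 BF.
have BFt : bounded_mfun (B `^ tau) (fun y => F y `^ tau).
  split; first by apply: (@measurableT_comp _ _ _ _ _ _ (fun y : R => y `^ tau)); [exact: measurable_powR|exact: bounded_mfunM BF].
  by move=> y; rewrite powR_ge0/= ge0_ler_powR ?nnegrE ?(ltW t0)//; exact: bounded_mfun_le BF _.
set b := avg r F x; have b0 : 0 <= b by exact: avg_ge0 BF _ _ r0.
have [->|bN0] := eqVneq b 0; first by rewrite powR0 ?gt_eqF//; exact: avg_ge0 BFt _ _ r0.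
have bp : 0 < b by rewrite lt_def bN0.
pose sig := tau / (tau - 1).
have tm : 0 < tau - 1 by rewrite subr_gt0.
have s0 : 0 < sig by rewrite divr_gt0.
have conj : tau^-1 + sig^-1 = 1 by rewrite /sig; field; rewrite !gt_eqF.
have h y : F y <= b / sig + (b `^ (tau - 1))^-1 / tau * F y `^ tau.
  have := @conjugate_powR R (F y) (b `^ (tau - 1)) tau sig (F0 y) (powR_ge0 _ _) t0 s0 conj.
  rewrite -powRrM (_ : (tau - 1) * sig = tau); last by rewrite /sig; field; rewrite gt_eqF.
  have c0 : 0 < b `^ (tau - 1) by rewrite powR_gt0.
  rewrite -(ler_pM2r (_ : 0 < (b `^ (tau - 1))^-1)) ?invr_gt0// mulfK ?gt_eqF//.
  move=> /le_trans; apply; rewrite le_eqVlt; apply/orP; left; apply/eqP.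
  have -> : b `^ tau = b * b `^ (tau - 1).
    by rewrite -{2}(powRr1 b0) -powRD ?(gt_eqF bp) ?implybT//; congr (_ `^ _); ring.
  by field; rewrite !gt_eqF.
have k0 : 0 <= (b `^ (tau - 1))^-1 / tau by rewrite divr_ge0 ?invr_ge0 ?powR_ge0 ?ltW.
have := avg_affine_le BF BFt r0 (divr_ge0 b0 (ltW s0)) k0 (fun y _ => h y).
rewrite -/b => hb.
have c0 : 0 < b `^ (tau - 1) by rewrite powR_gt0.
have bt : b `^ tau = b * b `^ (tau - 1).
  by rewrite -{2}(powRr1 b0) -powRD ?(gt_eqF bp) ?implybT//; congr (_ `^ _); ring.
have : b / tau <= (b `^ (tau - 1))^-1 / tau * avg r (fun y => F y `^ tau) x.
  have -> : b / tau = b - b / sig by rewrite -[X in X - _]mulr1 -conj; ring.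
  by rewrite lerBlDl; exact: hb.
rewrite [X in _ <= X -> _]mulrAC ler_pM2r ?invr_gt0// ler_pdivlMl// bt mulrC.
by [].
Qed.

End averages.

(** * The maximal function *)

Section maximal_function.
Context {R : realType} {n : nat}.
Local Notation Rn := 'rV[R]_n.
Local Notation mu := (@lebesgue_rV R n).

Lemma compact_sub_ball (K : set Rn) : compact K -> exists2 r : R, 0 < r & K `<=` ball 0 r.
Proof.
move=> /compact_bounded[M [Mr hM]]; exists (`|M| + 2); first by rewrite ltr_wpDl.
move=> x Kx; rewrite -ball_normE/= sub0r normrN.
have : `|x| <= `|M| + 1.
  by apply: hM Kx; apply: le_lt_trans (ler_norm M) _; rewrite ltrDl.
by move=> /le_lt_trans; apply; rewrite ltrD2l ltr1n.
Qed.

Lemma lebesgue_rV_compact_lty (K : set Rn) : compact K -> (mu K < +oo)%E.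
Proof.
move=> cK; have [r r0 Kr] := compact_sub_ball cK.
apply: (@le_lt_trans _ _ (mu (ball 0 r))).
  by apply: le_measure => //; rewrite inE; [exact: compact_measurable_rV|exact: measurable_ball_rV].
by rewrite [ltLHS](lebesgue_rV_ball 0 r0) ltry.
Qed.

Lemma powR_pred (q x : R) : 0 < x -> x `^ q = x `^ (q - 1) * x.
Proof.
move=> x0; rewrite -[X in _ * X](powRr1 (ltW x0)) -powRD ?subrK//.
by rewrite (gt_eqF x0) implybT.
Qed.

Lemma powR_exprn (q x : R) (k : nat) : 0 <= x -> (x ^+ k) `^ q = (x `^ q) ^+ k.
Proof.
move=> x0; elim: k => [|k IH]; first by rewrite !expr0 powR1.
by rewrite !exprS powRM ?exprn_ge0// IH.
Qed.

(** Centred and over all radii of sup-norm balls. The supremum is taken among reals, which is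
    meaningful because it is applied to bounded functions. *)
Definition maxfun (g : Rn -> R) (x : Rn) : R :=
  sup [set avg r g x | r in [set r : R | 0 < r]].

Section bounded.
Variables (B : R) (g : Rn -> R).
Hypothesis Bg : bounded_mfun B g.

Lemma avg_le_maxfun (r : R) (x : Rn) : 0 < r -> avg r g x <= maxfun g x.
Proof.
move=> r0; apply: ub_le_sup; last by exists r.
exists B => _ [t t0 <-]; apply: (avg_le_sup Bg t0 (bounded_mfun_B0 Bg)) => y _.
exact: bounded_mfun_le Bg y.
Qed.

Lemma maxfun_le (x : Rn) (c : R) : (forall r, 0 < r -> avg r g x <= c) -> maxfun g x <= c.
Proof.
move=> h; apply: ge_sup; first by exists (avg 1 g x), 1 => //=; exact: ltr01.
by move=> _ [r r0 <-]; exact: h.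
Qed.

Lemma lt_maxfun (x : Rn) (c : R) : c < maxfun g x -> exists2 r, 0 < r & c < avg r g x.
Proof.
move=> cx; apply: contrapT => /forall2NP h.
suff : maxfun g x <= c by rewrite leNgt cx.
apply: maxfun_le => r r0; rewrite leNgt; apply/negP => cr.
by have [] := h r.
Qed.

Lemma open_lt_maxfun (c : R) : open [set x | c < maxfun g x].
Proof.
rewrite (_ : [set x | _] = \bigcup_(r in [set r : R | 0 < r]) (avg r g @^-1` `]c, +oo[)).
  apply: bigcup_open => r r0.
  have /continuousP := avg_continuous Bg r0; apply; exact: interval_open.
apply/seteqP; split => [x /lt_maxfun[r r0 cr]|x [r r0]] /=.
  by exists r => //=; rewrite in_itv/= andbT.
by rewrite in_itv/= andbT => /lt_le_trans; apply; exact: avg_le_maxfun.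
Qed.

Lemma bounded_maxfun : bounded_mfun B (maxfun g).
Proof.
have B0 := bounded_mfun_B0 Bg.
split.
  apply: (measurability _ (RGenOInfty.measurableE R)).
  move=> _ [_ [a ->] <-]; rewrite setTI; apply: open_measurable_rV.
  rewrite (_ : _ @^-1` _ = [set x | a < maxfun g x]); first exact: open_lt_maxfun.
  by apply/seteqP; split => x /=; rewrite in_itv/= andbT.
move=> x; apply/andP; split.
  by apply: le_trans (avg_le_maxfun x ltr01); exact: avg_ge0 Bg _ _ ltr01.
apply: maxfun_le => r r0; apply: (avg_le_sup Bg r0 B0) => y _.
exact: bounded_mfun_le Bg y.
Qed.

End bounded.

Let bunion (s : seq (Rn * R)) : set Rn := \bigcup_(p in [set` s]) ball p.1 p.2.

Let measurable_bunion s : measurable (bunion s).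
Proof. by apply: fin_bigcup_measurable => [|p _]; [exact: finite_seq|exact: measurable_ball_rV]. Qed.

Let max_radius (s : seq (Rn * R)) : s != [::] ->
  exists2 i, i \in s & forall p, p \in s -> p.2 <= i.2.
Proof.
elim: s => // i s IH _; have [->|/IH[j js jm]] := eqVneq s [::].
  by exists i; rewrite ?mem_head// => p; rewrite inE => /eqP ->.
have [ij|ji] := leP i.2 j.2.
  exists j; first by rewrite inE js orbT.
  by move=> p; rewrite inE => /orP[/eqP->//|/jm].
exists i; first exact: mem_head.
by move=> p; rewrite inE => /orP[/eqP->//|/jm /le_trans]; apply; exact: ltW.
Qed.

(* Keep the ball of maximal radius and drop the balls that meet it: its triple covers them. *)
Let vitali_covering (B : R) (g : Rn -> R) (l : R) (s : seq (Rn * R)) :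
  bounded_mfun B g -> 0 < l ->
  (forall p, p \in s -> 0 < p.2 /\ l < avg p.2 g p.1) ->
  (l%:E * mu (bunion s) <= (3 ^+ n)%:E * \int[mu]_(y in bunion s) (g y)%:E)%E.
Proof.
move=> Bg l0; have [m] := ubnP (size s); elim: m s => // m IH s sm hs.
have g0 A y : A y -> (0 <= (g y)%:E)%E by move=> _; rewrite lee_fin (bounded_mfun_ge0 Bg).
have [->|sN] := eqVneq s [::].
  rewrite /bunion (_ : [set` [::]] = set0); last by apply/seteqP; split.
  by rewrite bigcup_set0 measure0 integral_set0 !mule0.
have [[c r] is_ imax] := max_radius sN.
have [/= r0 lavg] := hs _ is_.
pose s' := [seq p <- s | `[< ball p.1 p.2 `&` ball c r = set0 >]].
(* The maximal ball meets itself, so it is dropped too and the list becomes strictly shorter. *)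
have s'm : (size s' < m)%N.
  rewrite -ltnS; apply: leq_trans sm; rewrite ltnS size_filter -(count_predC (fun p => `[< ball p.1 p.2 `&` ball c r = set0 >]) s) -addn1 leq_add2l -has_count.
  apply/hasP; exists (c, r) => //=; apply/negP => /asboolP/= h.
  by have : set0 c by rewrite -h; split; exact: ballxx.
have hs' p : p \in s' -> 0 < p.2 /\ l < avg p.2 g p.1 by rewrite mem_filter => /andP[_]; exact: hs.
have IHs := IH s' s'm hs'.
have r30 : 0 < r *+ 3 by rewrite pmulrn_lgt0.
have cover : bunion s `<=` ball c (r *+ 3) `|` bunion s'.
  move=> y [p /= ps py]; have [pi|pi] := EM (ball p.1 p.2 `&` ball c r = set0).
    by right; exists p => //=; rewrite mem_filter ps andbT; exact/asboolP.
  left; have [z [zp zc]] : ball p.1 p.2 `&` ball c r !=set0 by apply/set0P/eqP.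
  have pr : p.2 <= r by exact: imax ps.
  have := ball_triangle (ball_triangle zc (ball_sym zp)) py.
  by apply: le_ball; rewrite !mulrS mulr0n addr0 addrA; do 2?apply: lerD.
have mb := measurable_ball_rV c r; have mb3 := measurable_ball_rV c (r *+ 3).
have ms' := measurable_bunion s'.
have disj : [disjoint ball c r & bunion s'].
  apply/disj_setPS => y [yc [p /=]]; rewrite mem_filter => /andP[/asboolP h _] yp.
  by have : set0 y by rewrite -h; split.
have mug D : measurable_fun D (EFin \o g) by exact: bounded_mfunE Bg D.
have sub : ball c r `|` bunion s' `<=` bunion s.
  move=> y [yc|[p /=]]; first by exists (c, r).
  by rewrite mem_filter => /andP[_ ps] yp; exists p.
apply: (@le_trans _ _ ((3 ^+ n)%:E * \int[mu]_(y in ball c r `|` bunion s') (g y)%:E)%E); last first.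
  apply: lee_wpmul2l; first by rewrite lee_fin exprn_ge0.
  exact: (@ge0_subset_integral _ _ _ mu _ _ (measurableU _ _ mb ms') (measurable_bunion s) (EFin \o g) (mug _) (g0 _) sub).
rewrite ge0_integral_setU//; last exact: g0.
rewrite ge0_muleDr; last 2 first.
- by apply: integral_ge0 => y; exact: g0.
- by apply: integral_ge0 => y; exact: g0.
apply: (@le_trans _ _ (l%:E * (mu (ball c (r *+ 3)) + mu (bunion s')))%E).
  rewrite lee_pmul2l//; apply: (@le_trans _ _ (mu (ball c (r *+ 3) `|` bunion s'))).
    by apply: le_measure; rewrite ?inE//; exact: measurableU.
  exact: measureU2.
rewrite ge0_muleDr//.
apply: leeD => //.
rewrite [X in (_ * X)%E](lebesgue_rV_ball c r30) (integral_ballE Bg c r0) -!EFinM lee_fin.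
have -> : (r *+ 3 *+ 2) ^+ n = 3 ^+ n * (r *+ 2) ^+ n by rewrite -exprMn; congr (_ ^+ _); ring.
by rewrite mulrCA ler_pM2l ?exprn_gt0// ler_pM2r ?(vol_gt0 r0)// ltW.
Qed.

(** Each point of the superlevel set is the centre of a ball with large average. A compact subset is
    covered by finitely many of these, and [integral_le_of_compact], applied to the constant [1],
    passes from compact subsets to the whole set. *)
Lemma weak_type_maxfun (B : R) (g : Rn -> R) (l : R) : bounded_mfun B g -> 0 < l ->
  (l%:E * mu [set x | (l < maxfun g x)%R] <= (3 ^+ n)%:E * \int[mu]_x (g x)%:E)%E.
Proof.
move=> Bg l0.
have mE : measurable [set x | (l < maxfun g x)%R] by apply: open_measurable_rV; exact: open_lt_maxfun Bg l.
rewrite muleC -lee_pdivlMr// -[leLHS]mul1e -integral_cst//.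
have g0 A y : A y -> (0 <= (g y)%:E)%E by move=> _; rewrite lee_fin (bounded_mfun_ge0 Bg).
apply: integral_le_of_compact => //.
  by move=> K cK; rewrite integral_cst ?mul1e; [exact: lebesgue_rV_compact_lty|exact: compact_measurable_rV].
move=> K cK KE; have mK := compact_measurable_rV cK.
rewrite integral_cst// mul1e lee_pdivlMr// muleC.
have := cK; rewrite compact_cover => /(_ _ [set p : Rn * R | 0 < p.2 /\ l < avg p.2 g p.1] (fun p => ball p.1 p.2)).
case.
- move=> p _; exact: ball_open.
- by move=> x /KE /= /lt_maxfun[r r0 lr]; exists (x, r) => //; exact: ballxx.
move=> D' D'h KD'.
have Dh p : p \in finmap.enum_fset D' -> 0 < p.2 /\ l < avg p.2 g p.1 by move=> /D'h; rewrite inE.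
apply: le_trans (_ : l%:E * mu (bunion (finmap.enum_fset D')) <= _)%E.
  rewrite lee_pmul2l//; apply: le_measure; rewrite ?inE//.
apply: le_trans (vitali_covering Bg l0 Dh) _.
apply: lee_wpmul2l; first by rewrite lee_fin exprn_ge0.
refine (@ge0_subset_integral _ _ _ mu (bunion (finmap.enum_fset D')) setT (measurable_bunion _) measurableT
  (fun y => (g y)%:E) (@bounded_mfunE R n B g Bg setT) _ _) => //.
by move=> y _; exact: (g0 setT).
Qed.

(** The terms that are kept form a geometric progression starting below [T]. This is the discrete
    form of integrating [l^(q-2)] over the levels [l] below a threshold, in the interpolation
    argument that follows. *)
Lemma geometric_levels_le (F : realFieldType) (a c T : F) (N : nat) : 0 <= a -> 0 <= c < 1 -> 0 <= T ->
  \sum_(i < N) (if a * c ^+ i < T then a * c ^+ i else 0) <= T / (1 - c).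
Proof.
move=> a0 /andP[c0 c1] T0; have c10 : 0 < 1 - c by rewrite subr_gt0.
elim: N a a0 => [|N IH] a a0; first by rewrite big_ord0 divr_ge0// ltW.
rewrite big_ord_recl expr0 mulr1; case: ifPn => aT; last first.
  rewrite add0r; under eq_bigr do rewrite lift0 exprS mulrA.
  by apply: IH; rewrite mulr_ge0.
have -> : T / (1 - c) = a + (T / (1 - c) - a) by ring.
rewrite lerD2l; apply: (@le_trans _ _ (\sum_(i < N) a * c ^+ i.+1)).
  by apply: ler_sum => i _; rewrite lift0; case: ifPn => // _; rewrite mulr_ge0// exprn_ge0.
rewrite -mulr_sumr; apply: (@le_trans _ _ (a * (c / (1 - c)))).
  apply: ler_wpM2l => //; rewrite ler_pdivlMr//.
  have : (\sum_(i < N) c ^+ i.+1) * (1 - c) = c - c ^+ N.+1.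
    elim: N {IH} => [|N IHN]; first by rewrite big_ord0 expr1; ring.
    by rewrite big_ord_recr/= mulrDl IHN [c ^+ N.+2]exprS; ring.
  by move=> ->; rewrite lerBlDr lerDl exprn_ge0.
rewrite lerBrDr -{2}(mulr1 a) -mulrDr.
have -> : c / (1 - c) + 1 = (1 - c)^-1 by field; rewrite gt_eqF.
by rewrite ler_pM2r ?invr_gt0// ltW.
Qed.

(** Marcinkiewicz interpolation over the dyadic levels [l i = b 2^(-i)]. At level [l i] the
    weak-type bound is applied to the part of [g] above [l i / 2], since the rest raises an average
    by at most [l i / 2]. *)
Lemma strong_type_maxfun (q : R) : 1 < q -> exists2 C : R, 0 < C &
  forall (B : R) (g : Rn -> R), bounded_mfun B g ->
  (\int[mu]_x (maxfun g x `^ q)%:E <= C%:E * \int[mu]_x (g x `^ q)%:E)%E.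
Proof.
move=> q1.
pose c : R := 2^-1 `^ (q - 1).
have q0 : 0 < q by apply: lt_trans q1.
have qm : 0 < q - 1 by rewrite subr_gt0.
have h20 : 0 < (2^-1 : R) by rewrite invr_gt0.
have c0 : 0 < c by rewrite powR_gt0.
have c1 : c < 1.
  have e1 : (1 : R) `^ (q - 1) = 1 by rewrite powR1.
  rewrite /c -[ltRHS]e1.
  apply: gt0_ltr_powR => //; rewrite ?nnegrE ?ltW//.
  by rewrite invf_lt1// ltr1n.
have c10 : 0 < 1 - c by rewrite subr_gt0.
exists (2 `^ q * (2 * 3 ^+ n) * (2 `^ (q - 1) / (1 - c))).
  by rewrite !mulr_gt0 ?powR_gt0 ?exprn_gt0 ?invr_gt0.
move=> B g Bg.
(* A top level above all values of [maxfun g], so that the first level exceeded at a point never has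
   index [0]. *)
pose b := B + 1; have b0 : 0 < b by rewrite ltr_wpDl// (bounded_mfun_B0 Bg).
have BM := bounded_maxfun Bg.
pose l i : R := b * 2^-1 ^+ i.
have l0 i : 0 < l i by rewrite mulr_gt0// exprn_gt0.
pose E i := [set x | l i < maxfun g x].
have mE i : measurable (E i) by apply: open_measurable_rV; exact: open_lt_maxfun Bg _.
pose h i x := if l i / 2 < g x then g x else 0.
pose D i := [set x | l i / 2 < g x].
have mD i : measurable (D i).
  rewrite (_ : D i = setT `&` g @^-1` `]l i / 2, +oo[%classic).
    exact: (bounded_mfunM Bg).
  by apply/seteqP; split => x; rewrite /D /= in_itv/= andbT // => -[].
have hE i x : h i x = g x * \1_(D i) x.
  rewrite /h indicE; case: ifPn => hx; first by rewrite mem_set ?mulr1.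
  by rewrite memNset ?mulr0//; exact/negP.
have Bh i : bounded_mfun B (h i).
  split.
    rewrite (_ : h i = fun x => g x * \1_(D i) x); last exact/funext/hE.
    by apply: measurable_funM; [exact: bounded_mfunM Bg|exact: measurable_indic].
  move=> x; rewrite /h; case: ifPn => _.
    by rewrite (bounded_mfun_ge0 Bg) (bounded_mfun_le Bg).
  by rewrite lexx (bounded_mfun_B0 Bg).
have Mh i x : E i x -> l i / 2 < maxfun (h i) x.
  move=> /lt_maxfun[r r0 lr]; apply: lt_le_trans (avg_le_maxfun (Bh i) x r0).
  have l20 : 0 <= l i / 2 by rewrite divr_ge0// ltW.
  have := @avg_affine_le _ _ B B g (h i) r (l i / 2) 1 x Bg (Bh i) r0 l20 ler01.
  rewrite mul1r => H; have {}H : avg r g x <= l i / 2 + avg r (h i) x.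
    apply: H => y _; rewrite mul1r /h; case: ifPn => [_|]; first by rewrite lerDr.
    by rewrite -leNgt addr0.
  by have := lt_le_trans lr H; rewrite {1}[l i]splitr ltrD2l.
have mG i : measurable_fun setT (fun x => g x * (\1_(D i) x * l i `^ (q - 1))).
  apply: measurable_funM; first exact: bounded_mfunM Bg.
  by apply: measurable_funM => //; exact: measurable_indic.
have G0 i x : 0 <= g x * (\1_(D i) x * l i `^ (q - 1)).
  by rewrite mulr_ge0 ?(bounded_mfun_ge0 Bg)// mulr_ge0 ?powR_ge0.
have weak i : (((2 * l i) `^ q)%:E * mu (E i) <= (2 `^ q * (2 * 3 ^+ n))%:E *
    \int[mu]_x (g x * (\1_(D i) x * l i `^ (q - 1)))%:E)%E.
  have l20 : 0 < l i / 2 by rewrite divr_gt0.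
  have W : ((l i / 2)%:E * mu (E i) <= (3 ^+ n)%:E * \int[mu]_x (h i x)%:E)%E.
    apply: le_trans (weak_type_maxfun (Bh i) l20).
    rewrite lee_pmul2l//; apply: le_measure; rewrite ?inE//.
    - by apply: open_measurable_rV; exact: open_lt_maxfun (Bh i) _.
    - by move=> x; exact: Mh.
  have -> : (2 * l i) `^ q = 2 `^ q * 2 * l i `^ (q - 1) * (l i / 2).
    rewrite powRM ?(ltW (l0 i))// (powR_pred q (l0 i)).
    by move: (2 `^ q) (l i `^ (q - 1)) (l i) => u v w; field.
  rewrite EFinM -muleA.
  apply: (@le_trans _ _ ((2 `^ q * 2 * l i `^ (q - 1))%:E * ((3 ^+ n)%:E * \int[mu]_x (h i x)%:E))%E).
    by apply: lee_wpmul2l => //; rewrite lee_fin !mulr_ge0 ?powR_ge0.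
  have -> : (\int[mu]_x (g x * (\1_(D i) x * l i `^ (q - 1)))%:E =
      \int[mu]_x ((l i `^ (q - 1))%:E * (h i x)%:E))%E.
    by apply: eq_integral => x _; rewrite -EFinM hE; congr EFin; ring.
  rewrite ge0_integralZl//.
  - by rewrite !muleA -!EFinM; rewrite le_eqVlt; apply/orP; left; apply/eqP; congr (_%:E * _)%E; ring.
  - exact: bounded_mfunE (Bh i) _.
  - by move=> x _; rewrite lee_fin (bounded_mfun_ge0 (Bh i)).
  - by rewrite lee_fin powR_ge0.
have term (u : nat -> \bar R) k : (forall i, (0 <= u i)%E) -> (u k <= \sum_(0 <= i <oo) u i)%E.
  move=> u0; apply: le_trans (nneseries_lim_ge k.+1 _) => //.
  by rewrite big_nat_recr//= leeDr// sume_ge0.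
(* If [j.+1] is the first index whose level is exceeded, then [maxfun g x <= l j = 2 * l j.+1], and
   the term of index [j.+1] alone dominates. *)
have pt x : ((maxfun g x `^ q)%:E <= \sum_(0 <= i <oo) (((2 * l i) `^ q)%:E * (\1_(E i) x)%:E))%E.
  have t0 i : (0 <= ((2 * l i) `^ q)%:E * (\1_(E i) x)%:E)%E by rewrite -EFinM lee_fin mulr_ge0 ?powR_ge0.
  have [->|yN0] := eqVneq (maxfun g x) 0.
    by rewrite powR0 ?gt_eqF//; apply: nneseries_ge0.
  have y0 : 0 < maxfun g x by rewrite lt_def yN0 (bounded_mfun_ge0 BM).
  have exi : exists i, l i < maxfun g x.
    have : l i @[i --> \oo] --> b * 0.
      by apply: cvgMr; apply: cvg_expr; rewrite ger0_norm ?ltW// invf_lt1// ltr1n.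
    rewrite mulr0 => /cvgrPdist_lt /(_ _ y0)[N _ HN]; exists N.
    by have := HN N (leqnn N); rewrite /= sub0r normrN gtr0_norm.
  case: (ex_minnP exi) => -[|j] lj jmin.
    move: lj; rewrite /l expr0 mulr1 ltNge (le_trans (bounded_mfun_le BM x))//.
    by rewrite /b lerDl.
  apply: le_trans (term _ j.+1 t0); rewrite -EFinM lee_fin indicE mem_set//= mulr1.
  have tl : 0 <= 2 * l j.+1 by rewrite mulr_ge0// ltW.
  apply: ge0_ler_powR; rewrite ?nnegrE ?(ltW q0) ?(ltW y0)//.
  have -> : 2 * l j.+1 = l j by rewrite /l exprS; field.
  by rewrite leNgt; apply/negP => /jmin; rewrite ltnn.
(* Only the levels below [2 * g x] contribute at [x]; [geometric_levels_le] sums them with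
   [T = (2 g x)^(q-1)] and ratio [c = 2^(-(q-1))]. *)
have lev x : (\sum_(0 <= i <oo) (g x * (\1_(D i) x * l i `^ (q - 1)))%:E <=
    (2 `^ (q - 1) / (1 - c))%:E * (g x `^ q)%:E)%E.
  have gx0 := bounded_mfun_ge0 Bg x.
  apply: lime_le; first by apply: is_cvg_nneseries => i _ _; rewrite lee_fin.
  apply: nearW => N; rewrite big_mkord sumEFin -EFinM lee_fin -mulr_sumr.
  have lc i : l i `^ (q - 1) = b `^ (q - 1) * c ^+ i.
    rewrite /l powRM ?exprn_ge0 ?(ltW b0)//; congr (_ * _).
    by rewrite powR_exprn// ltW.
  have T0 : 0 <= (2 * g x) `^ (q - 1) by exact: powR_ge0.
  have c01 : 0 <= c < 1 by rewrite ltW.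
  have := geometric_levels_le N (powR_ge0 b (q - 1)) c01 T0.
  move=> H; apply: (@le_trans _ _ (g x * ((2 * g x) `^ (q - 1) / (1 - c)))).
    apply: ler_wpM2l => //; apply: le_trans H; apply: ler_sum => i _.
    rewrite -lc indicE; case: ifPn => lT.
      by rewrite ler_piMl ?powR_ge0//; case: (_ \in _).
    rewrite memNset ?mul0r// => Dx; move/negP: lT; apply.
    have li0 := ltW (l0 i); have g20 : 0 <= 2 * g x by rewrite mulr_ge0.
    apply: gt0_ltr_powR; rewrite ?nnegrE//.
    by move: Dx; rewrite /D/= ltr_pdivrMr// mulrC.
  rewrite powRM// le_eqVlt; apply/orP; left; apply/eqP.
  have [->|gN0] := eqVneq (g x) 0.
    by rewrite mul0r [in RHS]powR0 ?mulr0// gt_eqF.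
  have gx1 : 0 < g x by rewrite lt_def gN0.
  by rewrite [in RHS](powR_pred q gx1); ring.
apply: (@le_trans _ _ (\int[mu]_x \sum_(0 <= i <oo) (((2 * l i) `^ q)%:E * (\1_(E i) x)%:E))%E).
  apply: ge0_le_integral => //.
  - by move=> x _; rewrite lee_fin powR_ge0.
  - apply/measurable_EFinP.
    by apply: (@measurableT_comp _ _ _ _ _ _ (fun y : R => y `^ q)); [exact: measurable_powR|exact: bounded_mfunM BM].
  - apply: ge0_emeasurable_sum => [i x _ _|i _]; first by rewrite -EFinM lee_fin mulr_ge0 ?powR_ge0.
    by apply: emeasurable_funM => //; apply/measurable_EFinP; exact: measurable_indic.
rewrite integral_nneseries//; last 2 first.
- by move=> i; apply: emeasurable_funM => //; apply/measurable_EFinP; exact: measurable_indic.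
- by move=> i x _; rewrite -EFinM lee_fin mulr_ge0 ?powR_ge0.
apply: (@le_trans _ _ (\sum_(0 <= i <oo) ((2 `^ q * (2 * 3 ^+ n))%:E *
    \int[mu]_x (g x * (\1_(D i) x * l i `^ (q - 1)))%:E))%E).
  apply: lee_nneseries => i.
    by move=> _ _; apply: integral_ge0 => x _; rewrite -EFinM lee_fin mulr_ge0 ?powR_ge0.
  move=> _; rewrite ge0_integralZl//; last 2 first.
  - by apply/measurable_EFinP; exact: measurable_indic.
  - by rewrite lee_fin powR_ge0.
  by rewrite integral_indic// setIT; exact: weak.
have C10 : (0 <= (2 `^ q * (2 * 3 ^+ n))%:E)%E by rewrite lee_fin !mulr_ge0 ?powR_ge0// exprn_ge0.
have C20 : (0 <= (2 `^ (q - 1) / (1 - c))%:E)%E by rewrite lee_fin divr_ge0 ?powR_ge0 ?ltW.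
rewrite nneseriesZl; last by move=> i _; apply: integral_ge0 => x _; rewrite lee_fin.
rewrite [X in (_ <= X * _)%E]EFinM -[X in (_ <= X)%E]muleA; apply: lee_wpmul2l => //.
rewrite -integral_nneseries//; last 2 first.
- by move=> i; apply/measurable_EFinP.
- by move=> i x _; rewrite lee_fin.
have mgq : measurable_fun setT (fun x => (g x `^ q)%:E).
  apply/measurable_EFinP.
  by apply: (@measurableT_comp _ _ _ _ _ _ (fun y : R => y `^ q)); [exact: measurable_powR|exact: bounded_mfunM Bg].
rewrite -ge0_integralZl//; last by move=> x _; rewrite lee_fin powR_ge0.
apply: ge0_le_integral => //.
- by move=> x _; apply: nneseries_ge0 => i _ _; rewrite lee_fin.
- by apply: ge0_emeasurable_sum => [i x _ _|i _]; [rewrite lee_fin|apply/measurable_EFinP].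
- exact: emeasurable_funM.
Qed.

End maximal_function.

(** * A_1 majorants by iterating the maximal function *)

Section rubio_de_francia.
Context {R : realType} {n : nat}.
Local Notation Rn := 'rV[R]_n.
Local Notation mu := (@lebesgue_rV R n).

Lemma bounded_mfunDZ (B B' c : R) (g h : Rn -> R) :
  bounded_mfun B g -> bounded_mfun B' h -> 0 <= c ->
  bounded_mfun (B + c * B') (fun y => g y + c * h y).
Proof.
move=> Bg Bh c0; split.
  apply: measurable_funD; first exact: bounded_mfunM Bg.
  by apply: measurable_funM => //; exact: bounded_mfunM Bh.
move=> y; rewrite addr_ge0 ?mulr_ge0 ?(bounded_mfun_ge0 Bg) ?(bounded_mfun_ge0 Bh)//=.
by apply: lerD; [exact: bounded_mfun_le Bg y|apply: ler_wpM2l => //; exact: bounded_mfun_le Bh y].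
Qed.

Lemma avgDZ (B B' c r : R) (g h : Rn -> R) (x : Rn) :
  bounded_mfun B g -> bounded_mfun B' h -> 0 <= c -> 0 < r ->
  avg r (fun y => g y + c * h y) x = avg r g x + c * avg r h x.
Proof.
move=> Bg Bh c0 r0; have v0 := @vol_gt0 R n r r0.
apply: (mulIf (lt0r_neq0 v0)); apply: EFin_inj.
rewrite -(integral_ballE (bounded_mfunDZ Bg Bh c0) x r0) mulrDl -(mulrA c) EFinD (EFinM c).
rewrite -(integral_ballE Bg x r0) -(integral_ballE Bh x r0).
have mb := measurable_ball_rV x r.
rewrite -ge0_integralZl//; last 2 first.
- exact: bounded_mfunE Bh _.
- by move=> y _; rewrite lee_fin (bounded_mfun_ge0 Bh).
rewrite -ge0_integralD//.
- by move=> y _; rewrite lee_fin (bounded_mfun_ge0 Bg).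
- exact: bounded_mfunE Bg _.
- by move=> y _; rewrite -EFinM lee_fin mulr_ge0 ?(bounded_mfun_ge0 Bh).
- by apply: emeasurable_funM => //; exact: bounded_mfunE Bh _.
Qed.

Lemma sum_half_le (N : nat) : \sum_(i < N) (2^-1 : R) ^+ i <= 2.
Proof.
have -> : \sum_(i < N) (2^-1 : R) ^+ i = 2 - 2 * 2^-1 ^+ N.
  elim: N => [|N IH]; first by rewrite big_ord0 expr0; ring.
  by rewrite big_ord_recr/= IH exprS; field.
by rewrite lerBlDr lerDl mulr_ge0 ?exprn_ge0// invr_ge0.
Qed.

Lemma nneseries_le_geometric (u : nat -> \bar R) (I : \bar R) : (0 <= I)%E ->
  (forall k, 0 <= u k <= ((2^-1) ^+ k)%:E * I)%E -> (\sum_(0 <= k <oo) u k <= 2%:E * I)%E.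
Proof.
move=> I0 uI; apply: lime_le; first by apply: is_cvg_nneseries => i _ _; have /andP[] := uI i.
apply: nearW => N; rewrite big_mkord.
apply: (@le_trans _ _ (\sum_(k < N) ((2^-1) ^+ k)%:E * I)%E).
  by apply: lee_sum => i _; have /andP[] := uI i.
rewrite -ge0_sume_distrl; last by move=> i _; rewrite lee_fin exprn_ge0// invr_ge0.
by rewrite sumEFin; apply: lee_wpmul2r => //; rewrite lee_fin sum_half_le.
Qed.

(* The Rubio de Francia algorithm: [sum_k (4 A)^-k M^k g] dominates [g], and [M] shifts the sum. *)
Lemma rubio_de_francia (q : R) : 1 < q -> exists C1 C2 : R, [/\ 0 < C1, 0 < C2 &
  forall (B : R) (g : Rn -> R), bounded_mfun B g -> exists (B' : R) (P : Rn -> R),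
  [/\ bounded_mfun B' P, forall x, g x <= P x,
      forall (r : R) (x : Rn), 0 < r -> avg r P x <= C1 * P x &
      (\int[mu]_x (P x `^ q)%:E <= C2%:E * \int[mu]_x (g x `^ q)%:E)%E]].
Proof.
move=> q1; have q0 : 0 < q by apply: lt_trans q1.
have [K K0 strong] := @strong_type_maxfun R n q q1.
(* [A] bounds the maximal operator on [L^q], since [A^q >= K]; the maximum with [1] yields the ratio
   [w <= 1/4]. *)
pose A := (Num.max 1 K) `^ q^-1.
have A0 : 0 < A by rewrite powR_gt0// lt_max ltr01.
have AK : K <= A `^ q.
  by rewrite /A -powRrM mulVf ?gt_eqF// powRr1 ?le_max ?lexx ?orbT ?ler01.
have A1 : 1 <= A.
  have e1 : (1 : R) `^ q^-1 = 1 by rewrite powR1.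
  rewrite -e1 /A; apply: ge0_ler_powR; rewrite ?nnegrE ?le_max ?lexx ?ler01// invr_ge0 ltW//.
exists (4 * A), (2 `^ q * 2); split; first by rewrite mulr_gt0.
  by rewrite mulr_gt0 ?powR_gt0.
move=> B g Bg; have B0 := bounded_mfun_B0 Bg.
pose it k := iter k maxfun g.
have Bit k : bounded_mfun B (it k) by elim: k => //= k IH; exact: bounded_maxfun.
have it0 k x := bounded_mfun_ge0 (Bit k) x.
pose w := (4 * A)^-1.
have w0 : 0 < w by rewrite invr_gt0 mulr_gt0.
have w4 : w <= 4^-1 by rewrite /w invfM ler_piMr ?invr_ge0// invf_le1.
have w2 : w <= 2^-1 by apply: le_trans w4 _; rewrite lef_pV2 ?posrE// ler_nat.
pose PN N x := \sum_(k < N) w ^+ k * it k x.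
have PNS N : PN N.+1 = fun x => PN N x + w ^+ N * it N x.
  by apply/funext => x; rewrite /PN big_ord_recr.
have term0 k x : 0 <= w ^+ k * it k x by rewrite mulr_ge0 ?exprn_ge0 ?(ltW w0).
have BPN N : exists b, bounded_mfun b (PN N).
  elim: N => [|N [b Hb]].
    by exists 0; rewrite /PN (_ : (fun x => _) = cst 0); [exact: bounded_mfun_cst|apply/funext => x; rewrite big_ord0].
  by exists (b + w ^+ N * B); rewrite PNS; apply: bounded_mfunDZ => //; rewrite exprn_ge0// ltW.
(* A tail estimate uniform in [x]: it bounds [P], and it allows the average of [P] to be compared
   with the averages of the partial sums. *)
have PN_tail N M x : PN (N + M)%N x <= PN N x + 2^-1 ^+ N * (B * 2).
  have -> : PN (N + M)%N x = PN N x + \sum_(k < M) w ^+ (N + k) * it (N + k)%N x.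
    elim: M => [|M IHM]; first by rewrite addn0 big_ord0 addr0.
    by rewrite addnS PNS IHM big_ord_recr/= addrA.
  rewrite lerD2l; apply: (@le_trans _ _ (\sum_(k < M) 2^-1 ^+ N * (B * 2^-1 ^+ k))).
    apply: ler_sum => k _; rewrite exprD -mulrA; apply: ler_pM; rewrite ?exprn_ge0 ?mulr_ge0 ?exprn_ge0 ?(ltW w0)//.
      by apply: lerXn2r; rewrite ?nnegrE ?(ltW w0) ?invr_ge0.
    rewrite mulrC; apply: ler_pM; rewrite ?exprn_ge0 ?(ltW w0)//; first exact: bounded_mfun_le (Bit _) _.
    by apply: lerXn2r; rewrite ?nnegrE ?(ltW w0) ?invr_ge0.
  rewrite -!mulr_sumr; apply: ler_wpM2l; first by rewrite exprn_ge0// invr_ge0.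
  by apply: ler_wpM2l => //; exact: sum_half_le.
have PN_nd x : nondecreasing_seq (PN ^~ x).
  by apply/nondecreasing_seqP => N; rewrite PNS lerDl.
have PN_ub x : has_ubound (range (PN ^~ x)).
  exists (B * 2) => _ [N _ <-]; have := PN_tail 0%N N x.
  by rewrite add0n {2}/PN big_ord0 add0r expr0 mul1r.
pose P x := sup (range (PN ^~ x)).
have PNP N x : PN N x <= P x by apply: ub_le_sup => //; exists N.
have P_le x c : (forall N, PN N x <= c) -> P x <= c.
  by move=> h; apply: ge_sup => [|_ [N _ <-]]; [exists (PN 0%N x), 0%N|exact: h].
have P_tail N x : P x <= PN N x + 2^-1 ^+ N * (B * 2).
  apply: P_le => M; have [NM|MN] := leqP N M; first by rewrite -(subnKC NM).
  apply: (@le_trans _ _ (PN N x)); first by apply: PN_nd; exact: ltnW.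
  by rewrite lerDl mulr_ge0 ?mulr_ge0// exprn_ge0// invr_ge0.
have BP : bounded_mfun (B * 2) P.
  split.
    apply: (@measurable_fun_cvg _ _ _ _ PN).
      by move=> N; have [b] := BPN N; exact: bounded_mfunM.
    by move=> x _; exact: nondecreasing_cvgn.
  move=> x; apply/andP; split; first by apply: le_trans (PNP 0%N x); rewrite /PN big_ord0.
  by have := P_tail 0%N x; rewrite {1}/PN big_ord0 add0r expr0 mul1r.
exists (B * 2), P; split => //.
- by move=> x; apply: le_trans (PNP 1%N x); rewrite /PN big_ord1 expr0 mul1r.
- move=> r x r0.
  have avgPN N : avg r (PN N) x <= 4 * A * P x.
    apply: (@le_trans _ _ (\sum_(k < N) w ^+ k * it k.+1 x)).
      elim: N => [|N IH].
        rewrite big_ord0 /PN (_ : (fun x => _) = cst 0) ?avg_cst//.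
        by apply/funext => y; rewrite big_ord0.
      have [b Hb] := BPN N; rewrite PNS (avgDZ _ Hb (Bit N))// ?exprn_ge0 ?(ltW w0)//.
      rewrite big_ord_recr/=; apply: lerD => //; apply: ler_wpM2l; first by rewrite exprn_ge0// ltW.
      exact: (avg_le_maxfun (Bit N) x r0).
    apply: (@le_trans _ _ (4 * A * PN N.+1 x)); last by rewrite ler_pM2l// mulr_gt0.
    rewrite /PN big_ord_recl mulrDr; apply: ler_wpDl.
      by rewrite mulr_ge0 ?mulr_ge0// ltW.
    rewrite mulr_sumr; apply: ler_sum => k _; rewrite lift0 exprS !mulrA.
    by rewrite divff ?mul1r// mulf_neq0 ?gt_eqF.
  have h N : avg r P x <= 4 * A * P x + 2^-1 ^+ N * (B * 2).
    have [b Hb] := BPN N.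
    have e0 : 0 <= 2^-1 ^+ N * (B * 2) by rewrite !mulr_ge0 ?exprn_ge0 ?invr_ge0.
    have := @avg_affine_le _ _ _ _ P (PN N) r _ 1 x BP Hb r0 e0 ler01.
    move=> H; apply: (le_trans (H _)); first by move=> y _; rewrite mul1r addrC.
    by rewrite mul1r addrC lerD2r.
  have lim : 4 * A * P x + 2^-1 ^+ N * (B * 2) @[N --> \oo] --> 4 * A * P x + 0 * (B * 2).
    apply: cvgD; first exact: cvg_cst.
    by apply: cvgMl; apply: cvg_expr; rewrite ger0_norm ?invr_ge0// invf_lt1// ltr1n.
  rewrite -[leRHS]addr0 -[X in _ + X](mul0r (B * 2)) -(cvg_lim _ lim)//.
  by apply: limr_ge; [apply: cvgP lim|exact: nearW].
have m_powR (f : Rn -> R) : measurable_fun setT f -> measurable_fun setT (fun x => (f x `^ q)%:E).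
  move=> mf; apply/measurable_EFinP.
  by apply: (@measurableT_comp _ _ _ _ _ _ (fun y : R => y `^ q)); [exact: measurable_powR|].
have int_it k : (\int[mu]_x (it k x `^ q)%:E <= ((A `^ q) ^+ k)%:E * \int[mu]_x (g x `^ q)%:E)%E.
  elim: k => [|k IH]; first by rewrite expr0 mul1e.
  apply: le_trans (strong B (it k) (Bit k)) _.
  rewrite exprS EFinM -muleA; apply: lee_pmul => //; rewrite ?lee_fin ?(ltW K0)//.
  by apply: integral_ge0 => x _; rewrite lee_fin powR_ge0.
(* Of the factor [4^(-k)] in [w^k], one [2^(-k)] goes to [z k] and makes the integrals of its [q]-th
   power summable; the other gives [P <= 2 (sum_k (z k)^q)^(1/q)]. This takes the place of the
   triangle inequality in [L^q]. *)
pose z k x := (2^-1 ^+ k * A^-1 ^+ k) * it k x.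
have z0 k x : 0 <= z k x by rewrite !mulr_ge0 ?exprn_ge0 ?invr_ge0// ltW.
have zPN N x : PN N x = \sum_(k < N) 2^-1 ^+ k * z k x.
  apply: eq_bigr => k _; rewrite /z !mulrA -!exprMn; congr (_ ^+ _ * _).
  by rewrite /w invfM; field; rewrite gt_eqF.
have mz k : measurable_fun setT (z k) by apply: measurable_funM => //; exact: bounded_mfunM (Bit k).
have int_z k : (\int[mu]_x (z k x `^ q)%:E <= (2^-1 ^+ k)%:E * \int[mu]_x (g x `^ q)%:E)%E.
  have t0 : 0 < (2^-1 : R) ^+ k by rewrite exprn_gt0// invr_gt0.
  have a0 : 0 <= A^-1 ^+ k by rewrite exprn_ge0// invr_ge0 ltW.
  pose D := (2^-1 ^+ k * A^-1 ^+ k) `^ q.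
  have D0 : (0 <= D%:E)%E by rewrite lee_fin powR_ge0.
  have -> : (\int[mu]_x (z k x `^ q)%:E = D%:E * \int[mu]_x (it k x `^ q)%:E)%E.
    rewrite -ge0_integralZl//; last 2 first.
    - by apply: m_powR; exact: bounded_mfunM (Bit k).
    - by move=> x _; rewrite lee_fin powR_ge0.
    by apply: eq_integral => x _; rewrite -EFinM /z powRM// mulr_ge0// ltW.
  apply: (@le_trans _ _ (D%:E * (((A `^ q) ^+ k)%:E * \int[mu]_x (g x `^ q)%:E))%E).
    exact: lee_wpmul2l.
  rewrite muleA -EFinM; apply: lee_wpmul2r.
    by apply: integral_ge0 => x _; rewrite lee_fin powR_ge0.
  rewrite lee_fin /D powRM ?(ltW t0)// (powR_exprn _ _ (_ : 0 <= A^-1)) ?invr_ge0 ?(ltW A0)//.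
  rewrite -mulrA -exprMn -powRM ?invr_ge0 ?(ltW A0)// mulVf ?gt_eqF// powR1 expr1n mulr1.
  rewrite (powR_pred q t0) ler_piMl ?(ltW t0)//.
  have e1 : (1 : R) `^ (q - 1) = 1 by rewrite powR1.
  rewrite -[leRHS]e1; apply: ge0_ler_powR; rewrite ?nnegrE ?(ltW t0) ?subr_ge0 ?(ltW q1)//.
  by rewrite exprn_ile1 ?invr_ge0// invf_le1// ler1n.
have zq0 k x : (0 <= (z k x `^ q)%:E)%E by rewrite lee_fin powR_ge0.
have pt x : ((P x `^ q)%:E <= (2 `^ q)%:E * \sum_(0 <= k <oo) (z k x `^ q)%:E)%E.
  have term k : ((z k x `^ q)%:E <= \sum_(0 <= k <oo) (z k x `^ q)%:E)%E.
    apply: le_trans (nneseries_lim_ge k.+1 _) => //.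
    by rewrite big_nat_recr//= leeDr// sume_ge0.
  move: term; have : (0 <= \sum_(0 <= k <oo) (z k x `^ q)%:E)%E by apply: nneseries_ge0.
  case: (\sum_(0 <= k <oo) (z k x `^ q)%:E)%E => [s s0 term|_ _|//]; last first.
    by rewrite gt0_muley ?leey// lte_fin powR_gt0.
  rewrite lee_fin in s0.
  have zT k : z k x <= s `^ q^-1.
    have := term k; rewrite lee_fin => h.
    rewrite -[leLHS]powRr1// -(mulfV (lt0r_neq0 q0)) powRrM.
    by apply: ge0_ler_powR; rewrite ?nnegrE ?powR_ge0// invr_ge0 ltW.
  have PT : P x <= 2 * s `^ q^-1.
    apply: P_le => N; rewrite zPN.
    apply: (@le_trans _ _ ((\sum_(k < N) 2^-1 ^+ k) * s `^ q^-1)).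
      by rewrite mulr_suml; apply: ler_sum => k _; apply: ler_wpM2l.
    by apply: ler_wpM2r; [exact: powR_ge0|exact: sum_half_le].
  rewrite -EFinM lee_fin; apply: (@le_trans _ _ ((2 * s `^ q^-1) `^ q)).
    apply: ge0_ler_powR; rewrite ?nnegrE ?(ltW q0) ?mulr_ge0 ?powR_ge0//.
    exact: bounded_mfun_ge0 BP x.
  by rewrite powRM ?powR_ge0// -powRrM mulVf ?gt_eqF// powRr1.
have I0 : (0 <= \int[mu]_x (g x `^ q)%:E)%E by apply: integral_ge0 => x _; rewrite lee_fin powR_ge0.
have mzq k : measurable_fun setT (fun x => (z k x `^ q)%:E) by exact: m_powR.
apply: (@le_trans _ _ (\int[mu]_x ((2 `^ q)%:E * \sum_(0 <= k <oo) (z k x `^ q)%:E))%E).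
  apply: ge0_le_integral => //.
  - by move=> x _; rewrite lee_fin powR_ge0.
  - by apply: m_powR; exact: bounded_mfunM BP.
  - by apply: emeasurable_funM => //; apply: ge0_emeasurable_sum => [k x _ _|k _].
rewrite ge0_integralZl//; last 2 first.
- by apply: ge0_emeasurable_sum => [k x _ _|k _].
- by move=> x _; apply: nneseries_ge0.
rewrite EFinM -[X in (_ <= X)%E]muleA; apply: lee_wpmul2l; first by rewrite lee_fin powR_ge0.
rewrite integral_nneseries//; apply: nneseries_le_geometric => // k; rewrite int_z andbT.
by apply: integral_ge0.
Qed.

End rubio_de_francia.

(** * Dyadic potentials *)

Section dyadic_potential.
Context {R : realType} {n : nat}.
Local Notation Rn := 'rV[R]_n.

Lemma bounded_mfun_powR (B p : R) (g : Rn -> R) : bounded_mfun B g -> 0 <= p ->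
  bounded_mfun (B `^ p) (fun x => g x `^ p).
Proof.
move=> Bg p0; have B0 := bounded_mfun_B0 Bg; split.
  by apply: (@measurableT_comp _ _ _ _ _ _ (fun y : R => y `^ p)); [exact: measurable_powR|exact: bounded_mfunM Bg].
move=> x; rewrite powR_ge0/= ge0_ler_powR ?nnegrE//; first exact: bounded_mfun_ge0 Bg x.
exact: bounded_mfun_le Bg x.
Qed.

Lemma bounded_avg (B r : R) (g : Rn -> R) : bounded_mfun B g -> 0 < r -> bounded_mfun B (avg r g).
Proof.
move=> Bg r0; split; first exact: continuous_measurable_rV (avg_continuous Bg r0).
move=> x; rewrite (avg_ge0 Bg x r0)/=.
by apply: (avg_le_sup Bg r0 (bounded_mfun_B0 Bg)) => y _; exact: bounded_mfun_le Bg y.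
Qed.

Definition dyad (j : nat) : R := 2^-1 ^+ j.

Lemma dyad_gt0 j : 0 < dyad j. Proof. by rewrite exprn_gt0// invr_gt0. Qed.

Lemma dyadS j : dyad j = dyad j.+1 + dyad j.+1.
Proof. by rewrite /dyad exprS; field. Qed.

Lemma dyad_le i j : (i <= j)%N -> dyad j <= dyad i.
Proof. by move=> ij; rewrite /dyad ler_wiXn2l ?invr_ge0// invf_le1// ler1n. Qed.

Lemma dyad_ratio j i : (dyad j + dyad j) / dyad (j + i).+1 = 2 ^+ i.+2.
Proof.
rewrite /dyad -addnS exprD exprVn [2^-1 ^+ i.+1]exprVn !exprS.
by field; rewrite !expf_neq0.
Qed.

Definition dyadic_potential (alpha : R) (m : nat) (F : Rn -> R) (x : Rn) : R :=
  \sum_(j < m) (2^-1 `^ alpha) ^+ j * avg (dyad j) F x.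

Lemma bounded_dyadic_potential (alpha B : R) m F : bounded_mfun B F ->
  exists b, bounded_mfun b (dyadic_potential alpha m F).
Proof.
move=> BF; elim: m => [|m [b Hb]].
  exists 0; rewrite /dyadic_potential (_ : (fun x => _) = cst 0); first exact: bounded_mfun_cst.
  by apply/funext => x; rewrite big_ord0.
exists (b + (2^-1 `^ alpha) ^+ m * B).
rewrite (_ : dyadic_potential _ _ _ = fun x => dyadic_potential alpha m F x + (2^-1 `^ alpha) ^+ m * avg (dyad m) F x).
  by apply: bounded_mfunDZ => //; exact: bounded_avg BF (dyad_gt0 m).
by apply/funext => x; rewrite /dyadic_potential big_ord_recr.
Qed.

Lemma continuous_dyadic_potential (alpha B : R) m F : bounded_mfun B F ->
  continuous (dyadic_potential alpha m F).
Proof.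
move=> BF; elim: m => [|m IH].
  rewrite (_ : dyadic_potential _ _ _ = cst 0); first exact: cst_continuous.
  by apply/funext => x; rewrite /dyadic_potential big_ord0.
rewrite (_ : dyadic_potential _ _ _ = fun x => dyadic_potential alpha m F x + (2^-1 `^ alpha) ^+ m * avg (dyad m) F x).
  move=> x; apply: (@continuousD _ _ _ (dyadic_potential alpha m F)
    (fun y => (2^-1 `^ alpha) ^+ m * avg (dyad m) F y)); first exact: IH.
  apply: (@continuousM _ _ (cst _) (avg (dyad m) F)); first exact: cst_continuous.
  exact: (avg_continuous BF (dyad_gt0 m)).
by apply/funext => y; rewrite /dyadic_potential big_ord_recr.
Qed.

Lemma shifted_geometric_le (q : R) (j0 M : nat) : 0 <= q < 1 ->
  \sum_(j < M) (if (j0 <= j)%N then q ^+ (j - j0) else 0) <= (1 - q)^-1.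
Proof.
move=> /andP[q0 q1]; have q10 : 0 < 1 - q by rewrite subr_gt0.
rewrite -[leRHS]mul1r ler_pdivlMr//.
have -> : (\sum_(j < M) (if (j0 <= j)%N then q ^+ (j - j0) else 0)) * (1 - q) =
    if (j0 <= M)%N then 1 - q ^+ (M - j0) else 0.
  elim: M => [|M IH].
    by rewrite big_ord0 mul0r leqn0; case: eqP => // ->; rewrite expr0 subrr.
  rewrite big_ord_recr/= mulrDl IH; have [jM|Mj] := leqP j0 M.
    by rewrite (leqW jM) (subSn jM) exprS; ring.
  rewrite mul0r addr0; case: ifPn => // jM1.
  by have -> : j0 = M.+1; [apply/eqP; rewrite eqn_leq jM1|rewrite subnn expr0 subrr].
by case: ifPn => // _; rewrite lerBlDr lerDl exprn_ge0.
Qed.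

Lemma le_interpolate (x X Y k : R) : 0 <= x -> x <= X -> x <= Y -> 0 < k < 1 ->
  x <= X `^ (1 - k) * Y `^ k.
Proof.
move=> x0 xX xY /andP[k0 k1].
have [->|xN0] := eqVneq x 0; first by rewrite mulr_ge0 ?powR_ge0.
have xp : 0 < x by rewrite lt_def xN0.
rewrite -{1}(powRr1 x0) -[X in x `^ X](subrK k 1) powRD ?(gt_eqF xp) ?implybT//.
have pw p t : 0 <= p -> x <= t -> x `^ p <= t `^ p.
  by move=> p0 xt; apply: ge0_ler_powR; rewrite ?nnegrE// (le_trans x0).
by apply: ler_pM; rewrite ?powR_ge0//; apply: pw => //; rewrite ?subr_ge0 ltW.
Qed.

Lemma powR_add_le (x y p : R) : 0 <= x -> 0 <= y -> 0 <= p ->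
  (x + y) `^ p <= 2 `^ p * (x `^ p + y `^ p).
Proof.
move=> x0 y0 p0; wlog xy : x y x0 y0 / x <= y => [h|].
  by have [xy|/ltW yx] := leP x y; [exact: h|rewrite addrC [_ `^ p + _]addrC; exact: h].
apply: (@le_trans _ _ ((2 * y) `^ p)).
  by apply: ge0_ler_powR; rewrite ?nnegrE ?addr_ge0 ?mulr_ge0// mulr_natl mulr2n lerD2r.
by rewrite powRM//; apply: ler_wpM2l; rewrite ?powR_ge0// lerDr powR_ge0.
Qed.

Lemma mulr4_powR (p V X b K c y : R) : 0 <= V -> 0 <= X -> 0 <= b -> 0 <= K ->
  X `^ p = c * y -> (V * X * b * K) `^ p = V `^ p * b `^ p * K `^ p * c * y.
Proof. by move=> V0 X0 b0 K0 Xp; rewrite !powRM ?mulr_ge0// Xp; ring. Qed.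

Section A1.
Variables (alpha tau kappa C1 : R).
Hypotheses (alpha0 : 0 < alpha) (tau1 : 1 < tau) (kappa01 : 0 < kappa < 1)
  (kappaE : n%:R * (kappa / tau) = alpha / 2) (C10 : 0 < C1).

(** [e = 2^(n kappa / tau)] is the loss per scale when the share [kappa] of a bound comes from
    enclosing a small ball in a larger one, and [d = 2^(-alpha)] is the gain. By [kappaE] their
    product is [2^(-alpha/2)], so the sum over scales converges. *)
Let e : R := ((2 ^+ n) `^ tau^-1) `^ kappa.
Let d : R := 2^-1 `^ alpha.
Let C0 : R := 2 ^+ n * (2 ^+ n * C1 `^ tau^-1).
Let K : R := e * (d * e) / (1 - d * e).
Let theta := tau / (1 - kappa).

Definition potential_A1_const : R :=
  2 `^ theta * (C0 + 2 ^+ n) `^ theta + 2 `^ theta * (K `^ theta * C1) *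
    2 ^+ n * ((2 ^+ n * C1) `^ tau^-1) `^ theta.

Section point.
Variables (B : R) (P : Rn -> R).
Hypotheses (BP : bounded_mfun B P)
  (P_A1 : forall (r : R) (x : Rn), 0 < r -> avg r P x <= C1 * P x).

Let F (x : Rn) : R := P x `^ tau^-1.
Let tau0 : 0 < tau. Proof. exact: lt_trans tau1. Qed.
Let BF : bounded_mfun (B `^ tau^-1) F.
Proof. by apply: bounded_mfun_powR => //; rewrite invr_ge0 ltW. Qed.
Let P0 x : 0 <= P x := bounded_mfun_ge0 BP x.
Let F0 x : 0 <= F x := bounded_mfun_ge0 BF x.

Let FtauE x : F x `^ tau = P x.
Proof. by rewrite /F -powRrM mulVf ?gt_eqF// powRr1. Qed.

Let avgF_le (r : R) (x : Rn) : 0 < r -> avg r F x <= avg r P x `^ tau^-1.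
Proof.
move=> r0; have h := @avg_powR_le R n _ F tau r x tau1 BF r0.
rewrite (_ : (fun y => F y `^ tau) = P) in h; last by apply/funext.
have a0 := avg_ge0 BF x r0.
rewrite -[leLHS](powRr1 a0) -(mulfV (lt0r_neq0 tau0)) powRrM.
by apply: ge0_ler_powR; rewrite ?nnegrE ?powR_ge0 ?invr_ge0 ?(ltW tau0)// (avg_ge0 BP).
Qed.

Let F_A1 (r : R) (x : Rn) : 0 < r -> avg r F x <= C1 `^ tau^-1 * F x.
Proof.
move=> r0; apply: le_trans (avgF_le x r0) _.
rewrite /F -powRM ?(ltW C10)//; apply: ge0_ler_powR; rewrite ?nnegrE ?invr_ge0 ?(ltW tau0)//.
- exact: avg_ge0 BP _ _ r0.
- by rewrite mulr_ge0// ltW.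
- exact: P_A1.
Qed.

Let ball_sub (x z : Rn) (r t : R) : ball x r z -> ball z t `<=` ball x (r + t).
Proof. by move=> xz y zy; exact: ball_triangle xz zy. Qed.

Let avg_ball_sub (g : Rn -> R) b (x z : Rn) (r t r' : R) : bounded_mfun b g -> 0 < r -> 0 < t ->
  ball x r z -> r + t <= r' -> avg t g z <= (r' / t) ^+ n * avg r' g x.
Proof.
move=> Bg r0 t0 xz rt; have r'0 : 0 < r' by apply: lt_le_trans rt; exact: addr_gt0.
apply: (avg_sub_le Bg t0 r'0); apply: subset_trans (ball_sub xz) _; exact: le_ball.
Qed.

(** Every [y] in the unit ball around [x] satisfies [avg r F x <= 2^n avg (2 r) F y <= 2^n
    C1^(1/tau) F y]; then average in [y]. This is what makes the large radii of the global potential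
    harmless. *)
Lemma avg_large_le (x : Rn) (r : R) : 1 <= r -> avg r F x <= 2 ^+ n * C1 `^ tau^-1 * avg 1 F x.
Proof.
move=> r1; have r0 : 0 < r by apply: lt_le_trans r1.
have K0 : 0 < 2 ^+ n * C1 `^ tau^-1 by rewrite mulr_gt0 ?exprn_gt0 ?powR_gt0.
have a0 : 0 <= avg r F x / (2 ^+ n * C1 `^ tau^-1) by rewrite divr_ge0 ?(avg_ge0 BF) ?ltW.
rewrite mulrC -ler_pdivrMr//; apply: (avg_ge_inf BF ltr01 a0) => y xy.
rewrite ler_pdivrMr// mulrC -mulrA.
have r20 : 0 < r * 2 by rewrite mulr_gt0.
apply: (@le_trans _ _ (2 ^+ n * avg (r * 2) F y)).
  have -> : (2 : R) ^+ n = (r * 2 / r) ^+ n by congr (_ ^+ _); rewrite mulrAC divff ?mul1r// gt_eqF.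
  by apply: (avg_ball_sub BF ltr01 r0 (ball_sym xy)) => //; lra.
by apply: ler_wpM2l; [exact: exprn_ge0|exact: F_A1].
Qed.

Lemma avg_unit_doubling (x z : Rn) : ball x 1 z -> avg 1 F z <= C0 * avg 1 F x.
Proof.
move=> xz; apply: (@le_trans _ _ (2 ^+ n * avg 2 F x)).
  by have := avg_ball_sub BF ltr01 ltr01 xz (lexx _); rewrite divr1.
rewrite /C0 -mulrA; apply: ler_wpM2l; first exact: exprn_ge0.
by apply: avg_large_le; rewrite ler1n.
Qed.

Section scale.
Variables (m j0 : nat) (x : Rn).
Hypothesis m0 : (0 < m)%N.
Let u := dyadic_potential alpha m F.
Let a := avg (dyad j0 + dyad j0) P x.
Let b := a `^ tau^-1.

Let d0 : 0 < d. Proof. by rewrite powR_gt0// invr_gt0. Qed.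
Let e0 : 0 < e. Proof. by rewrite !powR_gt0// exprn_gt0. Qed.
Let a0 : 0 <= a. Proof. by rewrite (avg_ge0 BP)// addr_gt0// dyad_gt0. Qed.
Let b0 : 0 <= b. Proof. exact: powR_ge0. Qed.
Let term0 j y : 0 <= d ^+ j * avg (dyad j) F y.
Proof. by rewrite mulr_ge0 ?exprn_ge0 ?(ltW d0)// (avg_ge0 BF)// dyad_gt0. Qed.
Let u0 y : 0 <= u y. Proof. by apply: sumr_ge0 => j _; exact: term0. Qed.

Let d1 : d <= 1.
Proof.
have e1 : (1 : R) `^ alpha = 1 by rewrite powR1.
by rewrite -[leRHS]e1; apply: ge0_ler_powR; rewrite ?nnegrE ?(ltW alpha0) ?invr_ge0// invf_le1// ler1n.
Qed.

Let de : d * e = 2^-1 `^ (alpha / 2).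
Proof.
rewrite /e -powRrM [tau^-1 * _]mulrC -powR_mulrn// -powRrM kappaE /d.
have -> : 2^-1 `^ alpha = 2^-1 `^ (alpha / 2) * (2^-1 : R) `^ (alpha / 2).
  by rewrite -powRD -?splitr// invr_eq0 pnatr_eq0 implybT.
by rewrite -mulrA -powRM ?invr_ge0// mulVf// powR1 mulr1.
Qed.
Let de01 : 0 <= d * e < 1.
Proof.
rewrite de powR_ge0/=; have e1 : (1 : R) `^ (alpha / 2) = 1 by rewrite powR1.
rewrite -[ltRHS]e1; apply: gt0_ltr_powR; rewrite ?nnegrE ?invr_ge0// ?divr_gt0//.
by rewrite invf_lt1// ltr1n.
Qed.

(** The shift of index makes room for the displacement: since [2^(-j0) <= 2^(-j-1)], the ball of
    radius [2^(-j-1)] around [z] fits into the ball of radius [2^(-j)] around [x]. *)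
Let term_near z j : ball x (dyad j0) z -> (j < j0)%N ->
  d ^+ j.+1 * avg (dyad j.+1) F z <= 2 ^+ n * (d ^+ j * avg (dyad j) F x).
Proof.
move=> xz jj0; rewrite exprS -mulrA; apply: (@le_trans _ _ (1 * (d ^+ j * avg (dyad j.+1) F z))).
  by apply: ler_wpM2r => //; rewrite mulr_ge0 ?exprn_ge0 ?(ltW d0)// (avg_ge0 BF)// dyad_gt0.
rewrite mul1r [leRHS]mulrCA; apply: ler_wpM2l; first by rewrite exprn_ge0// ltW.
have -> : (2 : R) ^+ n = (dyad j / dyad j.+1) ^+ n.
  by congr (_ ^+ _); rewrite (dyadS j); field; rewrite gt_eqF// dyad_gt0.
apply: (avg_ball_sub BF (dyad_gt0 j0) (dyad_gt0 _) xz).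
by rewrite [leRHS]dyadS lerD2r; exact: dyad_le.
Qed.

Let term_far z j : ball x (dyad j0) z -> (j0 <= j)%N ->
  d ^+ j.+1 * avg (dyad j.+1) F z <=
  d ^+ j0 * (C1 `^ tau^-1 * F z) `^ (1 - kappa) * b `^ kappa * (e * (d * e)) * (d * e) ^+ (j - j0).
Proof.
move=> xz jj0.
have dj := dyad_gt0 j.+1.
(* The exponent [(j - j0).+2] is the ratio of the radii: [2 * 2^(-j0)] is [2^(j-j0+2)] times
   [2^(-j-1)]. *)
have Y : avg (dyad j.+1) F z <= b * ((2 ^+ n) `^ tau^-1) ^+ (j - j0).+2.
  apply: le_trans (avgF_le z dj) _.
  have n0 : 0 <= (2 ^+ n : R) ^+ (j - j0).+2 by apply: exprn_ge0; exact: exprn_ge0.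
  rewrite /b -powR_exprn ?exprn_ge0// -(powRM _ a0 n0).
  have an0 := mulr_ge0 a0 n0; have ti : 0 <= tau^-1 by rewrite invr_ge0 ltW.
  apply: ge0_ler_powR; rewrite ?nnegrE//; first exact: (avg_ge0 BP z dj).
  have := avg_ball_sub BP (dyad_gt0 j0) dj xz (_ : _ <= dyad j0 + dyad j0).
  rewrite lerD2l dyad_le 1?ltnW// => /(_ isT) /le_trans; apply.
  rewrite mulrC; apply: ler_wpM2l; first exact: a0.
  rewrite exprAC; have -> : (dyad j0 + dyad j0) / dyad j.+1 = 2 ^+ (j - j0).+2 => //.
  by rewrite -{1}(subnKC jj0) dyad_ratio.
have := le_interpolate (avg_ge0 BF z dj) (F_A1 z dj) Y kappa01.
have g0 : 0 <= (2 ^+ n) `^ tau^-1 by exact: powR_ge0.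
rewrite (powRM kappa b0 (exprn_ge0 (j - j0).+2 g0)) (powR_exprn kappa _ g0) -/e => h.
apply: (@le_trans _ _ (d ^+ j.+1 * ((C1 `^ tau^-1 * F z) `^ (1 - kappa) * (b `^ kappa * e ^+ (j - j0).+2)))).
  by apply: ler_wpM2l => //; rewrite exprn_ge0// ltW.
have -> : d ^+ j.+1 = d ^+ j0 * d ^+ (j - j0).+1 by rewrite -exprD addnS subnKC.
rewrite le_eqVlt; apply/orP; left; apply/eqP.
by rewrite exprMn !exprS; ring.
Qed.

(** The coarse terms at [z] are paired with those at [x] one index earlier; the term [0] at [z],
    left without a partner, is treated by [avg_unit_doubling]. The fine scales occur only if the
    finite sum reaches them, hence the test [j0.+1 < m]. *)
Let potential_le z : ball x (dyad j0) z -> u z <= (C0 + 2 ^+ n) * u x +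
  (if (j0.+1 < m)%N then d ^+ j0 * (C1 `^ tau^-1 * F z) `^ (1 - kappa) * b `^ kappa * K else 0).
Proof.
move=> xz; have [m' mE] : exists m', m = m'.+1 by exists m.-1; rewrite prednK.
have uE y : u y = avg 1 F y + \sum_(j < m') d ^+ j.+1 * avg (dyad j.+1) F y.
  by rewrite /u /dyadic_potential mE big_ord_recl expr0 mul1r {1}/dyad expr0.
have uE' y : u y = \sum_(j < m') d ^+ j * avg (dyad j) F y + d ^+ m' * avg (dyad m') F y.
  by rewrite /u /dyadic_potential mE big_ord_recr.
pose G := d ^+ j0 * (C1 `^ tau^-1 * F z) `^ (1 - kappa) * b `^ kappa * (e * (d * e)).
have G0 : 0 <= G.
  have h1 : 0 <= d ^+ j0 by rewrite exprn_ge0// ltW.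
  have h2 : 0 <= e * (d * e) by rewrite mulr_ge0 ?mulr_ge0// ltW.
  exact: mulr_ge0 (mulr_ge0 (mulr_ge0 h1 (powR_ge0 _ _)) (powR_ge0 _ _)) h2.
have n0 : 0 <= (2 : R) ^+ n by exact: exprn_ge0.
have C00 : 0 <= C0 by rewrite /C0 mulr_ge0// mulr_ge0 ?powR_ge0// exprn_ge0.
rewrite {1}uE mulrDl -addrA; apply: lerD.
  apply: (@le_trans _ _ (C0 * avg 1 F x)).
    by apply: avg_unit_doubling; apply: le_ball xz; rewrite -[leRHS]/(dyad 0); exact: dyad_le.
  by apply: ler_wpM2l => //; rewrite uE lerDl; apply: sumr_ge0 => j _; exact: term0.
apply: (@le_trans _ _ (\sum_(j < m') (2 ^+ n * (d ^+ j * avg (dyad j) F x) +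
    (if (j0 <= j)%N then G * (d * e) ^+ (j - j0) else 0)))).
  apply: ler_sum => j _; have [jj|jj] := leqP j0 j.
    by apply: le_trans (term_far xz jj) _; rewrite lerDr; exact: mulr_ge0.
  by rewrite addr0; exact: term_near.
rewrite big_split/=; apply: lerD.
  by rewrite -mulr_sumr; apply: ler_wpM2l => //; rewrite uE' lerDl; exact: term0.
rewrite mE ltnS; case: ifPn => jm; last first.
  rewrite big1// => j _; case: ifPn => // jj; move/negP: jm; case.
  exact: leq_ltn_trans jj (ltn_ord j).
rewrite /K mulrA -/G; apply: (@le_trans _ _ (G * \sum_(j < m') (if (j0 <= j)%N then (d * e) ^+ (j - j0) else 0))).
  by rewrite mulr_sumr; apply: ler_sum => j _; case: ifPn => //; rewrite mulr0.
by apply: ler_wpM2l => //; exact: shifted_geometric_le.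
Qed.

(** The single term [j0] of [u x] suffices: by the A_1 bound, the average [a] of [P] over the
    doubled ball is at most a constant times [P y] at every [y] of the ball, so [F] is bounded below
    there by a multiple of [b]. *)
Let potential_ge : (j0 < m)%N -> d ^+ j0 * b <= (2 ^+ n * C1) `^ tau^-1 * u x.
Proof.
move=> jm; have h0 := dyad_gt0 j0.
have K0 : 0 < 2 ^+ n * C1 by rewrite mulr_gt0// exprn_gt0.
have aK : 0 <= a / (2 ^+ n * C1) by apply: divr_ge0; [exact: a0|exact: ltW].
have ti : 0 <= tau^-1 by rewrite invr_ge0 ltW.
have bE : b = (2 ^+ n * C1) `^ tau^-1 * (a / (2 ^+ n * C1)) `^ tau^-1.
  by rewrite -powRM ?(ltW K0)// mulrC divfK ?gt_eqF.
have low : (a / (2 ^+ n * C1)) `^ tau^-1 <= avg (dyad j0) F x.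
  apply: (avg_ge_inf BF h0 (powR_ge0 _ _)) => y xy.
  apply: ge0_ler_powR; rewrite ?nnegrE//.
  rewrite ler_pdivrMr// mulrC -mulrA.
  have h20 : 0 < dyad j0 + dyad j0 by rewrite addr_gt0.
  have h40 : 0 < (dyad j0 + dyad j0) * 2 by rewrite mulr_gt0.
  apply: (@le_trans _ _ (2 ^+ n * avg ((dyad j0 + dyad j0) * 2) P y)).
    have -> : (2 : R) ^+ n = ((dyad j0 + dyad j0) * 2 / (dyad j0 + dyad j0)) ^+ n.
      by congr (_ ^+ _); rewrite mulrAC divff ?mul1r// gt_eqF.
    by apply: (avg_ball_sub BP h0 h20 (ball_sym xy)); lra.
  by apply: ler_wpM2l; [exact: exprn_ge0|exact: P_A1].
rewrite {1}bE mulrCA; apply: ler_wpM2l; first exact: powR_ge0.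
apply: (@le_trans _ _ (d ^+ j0 * avg (dyad j0) F x)).
  by apply: ler_wpM2l => //; rewrite exprn_ge0// ltW.
rewrite /u /dyadic_potential (bigD1 (Ordinal jm))//= lerDl.
by apply: sumr_ge0 => j _; exact: term0.
Qed.

(** The exponent satisfies [(1 - kappa) * theta = tau]. Hence the fine scales, raised to the power
    [theta], become a multiple of [F^tau = P], whose average is at most [2^n b^tau]. Together with
    the factor [b^(kappa theta)] this is [b^theta], which [potential_ge] brings back to [u x]. *)
Lemma avg_dyadic_potential_powR :
  avg (dyad j0) (fun z => u z `^ theta) x <= potential_A1_const * u x `^ theta.
Proof.
have h0 := dyad_gt0 j0.
have [k0 k1] : 0 < kappa /\ kappa < 1 by exact/andP.
have k10 : 0 < 1 - kappa by rewrite subr_gt0.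
have th0 : 0 < theta by rewrite divr_gt0.
have thE : (1 - kappa) * theta = tau by rewrite /theta mulrC divfK ?gt_eqF.
have [q0 q1] : 0 <= d * e /\ d * e < 1 by exact/andP.
have K0 : 0 <= K by rewrite divr_ge0 ?mulr_ge0 ?subr_ge0 ?ltW.
have n0 : 0 <= (2 : R) ^+ n by exact: exprn_ge0.
have C00 : 0 <= C0 by rewrite /C0 mulr_ge0// mulr_ge0 ?powR_ge0// exprn_ge0.
have CC0 : 0 <= C0 + 2 ^+ n by exact: addr_ge0.
have [bu Hbu] := bounded_dyadic_potential alpha m BF.
have But := bounded_mfun_powR Hbu (ltW th0).
have dj0 : 0 <= d ^+ j0 by rewrite exprn_ge0// ltW.
set V := d ^+ j0; have V0 : 0 <= V by exact: dj0.
pose T := 2 `^ theta * (V `^ theta * (b `^ kappa) `^ theta * K `^ theta * C1).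
have T0 : 0 <= T by rewrite !mulr_ge0 ?powR_ge0// ltW.
have A0 : 0 <= 2 `^ theta * ((C0 + 2 ^+ n) `^ theta * u x `^ theta) by rewrite !mulr_ge0 ?powR_ge0.
have pt z : ball x (dyad j0) z -> u z `^ theta <= 2 `^ theta * ((C0 + 2 ^+ n) `^ theta * u x `^ theta) +
    (if (j0.+1 < m)%N then T else 0) * P z.
  move=> xz; have CF0 : 0 <= C1 `^ tau^-1 * F z by rewrite mulr_ge0 ?powR_ge0// F0.
  set W := if (j0.+1 < m)%N then V * (C1 `^ tau^-1 * F z) `^ (1 - kappa) * b `^ kappa * K else 0.
  have W0 : 0 <= W 
    by rewrite /W; case: ifPn => // _; exact: mulr_ge0 (mulr_ge0 (mulr_ge0 V0 (powR_ge0 _ _)) (powR_ge0 _ _)) K0.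
  apply: (@le_trans _ _ (((C0 + 2 ^+ n) * u x + W) `^ theta)).
    apply: ge0_ler_powR; rewrite ?nnegrE ?(ltW th0) ?u0 ?addr_ge0 ?mulr_ge0 ?u0//.
    exact: potential_le.
  apply: (le_trans (powR_add_le _ W0 (ltW th0))); first by rewrite mulr_ge0// u0.
  rewrite mulrDr powRM// ?u0// lerD2l /W; case: ifPn => _; last by rewrite powR0 ?gt_eqF// mulr0 mul0r.
  have XP : ((C1 `^ tau^-1 * F z) `^ (1 - kappa)) `^ theta = C1 * P z.
    by rewrite -powRrM thE powRM ?powR_ge0// ?F0// FtauE -powRrM mulVf ?gt_eqF// powRr1// ltW.
  by rewrite (mulr4_powR V0 (powR_ge0 _ _) (powR_ge0 _ _) K0 XP) mulrA.
have T'0 : 0 <= (if (j0.+1 < m)%N then T else 0) by case: ifPn.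
apply: (le_trans (avg_affine_le But BP h0 A0 T'0 pt)).
rewrite /potential_A1_const mulrDl; apply: lerD; first by rewrite mulrA.
case: ifPn => jm; last by rewrite mul0r !mulr_ge0 ?powR_ge0// ltW.
have aP : avg (dyad j0) P x <= 2 ^+ n * b `^ tau.
  have -> : b `^ tau = a by rewrite /b -powRrM mulVf ?gt_eqF// powRr1// a0.
  have h20 : 0 < dyad j0 + dyad j0 by rewrite addr_gt0.
  have -> : (2 : R) ^+ n = ((dyad j0 + dyad j0) / dyad j0) ^+ n.
    by congr (_ ^+ _); field; rewrite gt_eqF.
  by apply: (avg_sub_le BP h0 h20); apply: le_ball; rewrite lerDl ltW.
apply: (@le_trans _ _ (T * (2 ^+ n * b `^ tau))); first by apply: ler_wpM2l.
have bth : (b `^ kappa) `^ theta * b `^ tau = b `^ theta.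
  have [->|bN0] := eqVneq b 0; first by rewrite [0 `^ tau]powR0 ?gt_eqF// mulr0 powR0// gt_eqF.
  rewrite -powRrM -powRD; last by rewrite bN0 implybT.
  by congr (_ `^ _); rewrite -thE; ring.
have -> : T * (2 ^+ n * b `^ tau) =
    2 `^ theta * (K `^ theta * C1) * 2 ^+ n * (V * b) `^ theta.
  have alg (y1 y2 y3 y4 y5 y6 y7 : R) :
    y1 * (y2 * y3 * y4 * y5) * (y6 * y7) = y1 * (y4 * y5) * y6 * (y2 * (y3 * y7)) by ring.
  by rewrite (powRM theta V0 b0) /T alg bth.
rewrite -[leRHS]mulrA; apply: ler_wpM2l; first by rewrite !mulr_ge0 ?powR_ge0// ltW.
rewrite -powRM ?powR_ge0 ?u0//; apply: ge0_ler_powR; rewrite ?nnegrE ?(ltW th0)//.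
- by apply: mulr_ge0 => //; exact: b0.
- by rewrite mulr_ge0 ?powR_ge0// u0.
- by apply: potential_ge; exact: ltnW.
Qed.

End scale.
End point.

(* Near [x] the terms [j < j0] of [u] are comparable to their values at [x]. For
   [j >= j0] both the A_1 bound of [P] at [z] and the inclusion of the small ball
   in the ball of radius [2^-(j0-1)] around [x] bound [A_j F z]; interpolating
   between the two makes the sum over [j] geometric. *)
Lemma dyadic_potential_A1 : exists2 C : R, 1 <= C &
  forall (B : R) (P : Rn -> R), bounded_mfun B P ->
  (forall (r : R) (x : Rn), 0 < r -> avg r P x <= C1 * P x) ->
  forall (m j0 : nat) (x : Rn), (0 < m)%N ->
  let u := dyadic_potential alpha m (fun y => P y `^ tau^-1) in
  avg (dyad j0) (fun z => u z `^ (tau / (1 - kappa))) x <= C * u x `^ (tau / (1 - kappa)).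
Proof.
exists (Num.max 1 potential_A1_const); first by rewrite le_max lexx.
move=> B P BP P_A1 m j0 x m0 /=.
apply: le_trans (avg_dyadic_potential_powR BP P_A1 j0 x m0) _.
by apply: ler_wpM2r; [exact: powR_ge0|rewrite le_max lexx orbT].
Qed.

End A1.
End dyadic_potential.

(** * Size of the Bessel kernel *)

Section bessel_bounds.
Context {R : realType} {n : nat}.
Local Notation leb := (@lebesgue_measure R).
Local Notation Rn := 'rV[R]_n.
Local Notation D0 := (`]0%R, +oo[%classic : set R).

Lemma dotr_lt_ball (v : Rn) (r : R) : 0 < r -> dotr v v < r ^+ 2 -> ball 0 r v.
Proof.
move=> r0 h; apply/(ball_rVP _ _ r0) => i; rewrite mxE sub0r normrN.
rewrite -(ltr_pXn2r (isT : (0 < 2)%N)) ?nnegrE ?(ltW r0)// real_normK ?num_real//.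
apply: le_lt_trans h; rewrite /dotr (bigD1 i)//= expr2 lerDl.
by apply: sumr_ge0 => j _; rewrite -expr2 sqr_ge0.
Qed.

Lemma ball_dotr_le (v : Rn) (r : R) : 0 < r -> ball 0 r v -> dotr v v <= n%:R * r ^+ 2.
Proof.
move=> r0 /(ball_rVP _ _ r0) h.
apply: (@le_trans _ _ (\sum_(i < n) r ^+ 2)); last first.
  by rewrite sumr_const card_ord mulr_natl.
apply: ler_sum => i _; rewrite -expr2 -(real_normK (num_real _)).
have := h i; rewrite mxE sub0r normrN => /ltW hi.
by apply: lerXn2r; rewrite ?nnegrE ?(ltW r0).
Qed.

Variable alpha : R.
Hypotheses (alpha0 : 0 < alpha) (alphan : alpha < n%:R).
Let a : R := alpha / 2.
Let b : R := n%:R / 2 - a.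
Let a0 : 0 < a. Proof. by rewrite divr_gt0. Qed.
Let b0 : 0 < b. Proof. by rewrite /b /a -mulrBl divr_gt0// subr_gt0. Qed.

(** Up to the constant [cn], the time integrand of the heat potential at [|x|^2 = rho]. Here
    [b = (n - alpha)/2 > 0] is half the order of the singularity at the origin. *)
Let kern (rho t : R) : R := t `^ (- b - 1) * (expR (- t) * expR (- (rho / (4 * t)))).
Let kern_ge0 rho t : 0 <= kern rho t.
Proof. by rewrite mulr_ge0 ?powR_ge0// mulr_ge0 ?expR_ge0. Qed.

Let m4 : measurable_fun setT (fun t : R => (4 * t)^-1).
Proof. by apply: measurableT_comp; [exact: measurable_invr|exact: measurable_funM]. Qed.

Let mexp (f : R -> R) : measurable_fun setT f -> measurable_fun setT (fun t => expR (- f t)).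
Proof. by move=> mf; apply: measurableT_comp; [exact: measurable_expR|exact: measurableT_comp]. Qed.

Let measurable_kern rho : measurable_fun setT (kern rho).
Proof.
apply: measurable_funM; first exact: measurable_powR.
by apply: measurable_funM; [exact: mexp|apply: mexp; exact: measurable_funM].
Qed.

Let cn : R := Num.sqrt (4 * pi) ^- n.
Let cn0 : 0 < cn. Proof. by rewrite invr_gt0 exprn_gt0// sqrtr_gt0 mulr_gt0// pi_gt0. Qed.

Let heat_potentialE (x : Rn) :
  heat_potential a x = (cn%:E * \int[leb]_(t in D0) (kern (dotr x x) t)%:E)%E.
Proof.
rewrite -ge0_integralZl//; last 3 first.
- by apply/measurable_EFinP; apply: measurable_funTS; exact: measurable_kern.
- by move=> t _; rewrite lee_fin.
- by rewrite lee_fin ltW.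
rewrite /heat_potential /heat_dens /gamma_dens/=.
under eq_integral do rewrite -mulrA.
rewrite integral_indic_halfline; apply: eq_integral => t; rewrite inE/= in_itv/= andbT => t0.
rewrite -EFinM; congr EFin; rewrite /kern /gaussn.
have -> : Num.sqrt (pi * (4 * t)) ^- n = cn * t `^ (- (n%:R / 2)).
  rewrite mulrCA mulrA sqrtrM ?mulr_ge0 ?pi_ge0// exprMn invfM; congr (_ * _).
  by rewrite powRN mulrC powRrM powR12_sqrt ?powR_mulrn ?sqrtr_ge0// ltW.
have -> : t `^ (- b - 1) = t `^ (a - 1) * t `^ (- (n%:R / 2)).
  by rewrite -powRD ?(gt_eqF t0) ?implybT//; congr (_ `^ _); rewrite /b; ring.
rewrite (_ : (4 * t)^-1 * dotr x x = dotr x x / (4 * t)); last by rewrite mulrC.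
by ring.
Qed.

(** Dropping [e^(-t)] and rescaling time by [rho] leaves the Riesz size
    [rho^(-b) = |x|^(alpha - n)]. *)
Let heat_near : exists2 C : R, 0 < C & forall x : Rn, 0 < dotr x x ->
  (heat_potential a x <= (C * dotr x x `^ (- b))%:E)%E.
Proof.
have := inverse_gamma_lty b0; set I := (\int[leb]_(t in D0) _)%E => Ioo.
have I0 : (0 <= I)%E by apply: integral_ge0 => t _; rewrite lee_fin mulr_ge0 ?powR_ge0 ?expR_ge0.
have If : I = (fine I)%:E by rewrite fineK// ge0_fin_numE.
exists (cn * (fine I + 1)); first by rewrite mulr_gt0// ltr_wpDl// fine_ge0.
move=> x; set rho := dotr x x => rho0.
rewrite heat_potentialE -/rho -mulrA EFinM; apply: lee_wpmul2l; first by rewrite lee_fin ltW.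
pose g t : R := t `^ (- b - 1) * expR (- (rho / (4 * t))).
have mg : measurable_fun setT g.
  apply: measurable_funM; first exact: measurable_powR.
  by apply: mexp; exact: measurable_funM.
apply: (@le_trans _ _ (\int[leb]_(t in D0) (g t)%:E)%E).
  apply: ge0_le_integral => //.
  - by move=> t _; rewrite lee_fin.
  - by apply/measurable_EFinP; apply: measurable_funTS; exact: measurable_kern.
  - by apply/measurable_EFinP; exact: measurable_funTS.
  - move=> t; rewrite /= in_itv/= andbT => t0; rewrite lee_fin /kern /g ler_wpM2l ?powR_ge0//.
    by rewrite ler_piMl ?expR_ge0// -expR0 ler_expR oppr_le0 ltW.
rewrite (@ge0_integral_halfline_scale R rho (fun t => (g t)%:E))//; last 2 first.
- exact/measurable_EFinP.
- by move=> t; rewrite lee_fin mulr_ge0 ?powR_ge0 ?expR_ge0.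
have -> : (\int[leb]_(t in D0) (g (rho * t))%:E = (rho `^ (- b - 1))%:E * I)%E.
  rewrite /I -ge0_integralZl//; last 3 first.
  - apply/measurable_EFinP; apply: measurable_funTS; apply: measurable_funM; first exact: measurable_powR.
    exact: mexp.
  - by move=> t _; rewrite lee_fin mulr_ge0 ?powR_ge0 ?expR_ge0.
  - by rewrite lee_fin powR_ge0.
  apply: eq_integral => t; rewrite inE/= in_itv/= andbT => t0; rewrite -EFinM; congr EFin.
  rewrite /g powRM ?(ltW rho0) ?(ltW t0)// -mulrA; congr (_ * (_ * expR (- _))).
  by field; rewrite !gt_eqF.
rewrite If -!EFinM lee_fin mulrA (mulrC rho) -(_ : rho `^ (- b) = _ * rho); last exact: powR_pred.
by rewrite mulrC ler_wpM2r ?powR_ge0// lerDl.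
Qed.

(** [e^(-rho/(4t)) <= C (t/rho)^p] with [p = (n+1)/2] gives the decay [|x|^(-n-1)], one power better
    than the volume growth; that extra power becomes the weights [2^(-i)] of [bessel_tail]. *)
Let heat_far : exists2 C : R, 0 < C & forall x : Rn, 0 < dotr x x ->
  (heat_potential a x <= (C * dotr x x `^ (- ((n%:R + 1) / 2)))%:E)%E.
Proof.
have a20 : 0 < a + 2^-1 by rewrite addr_gt0.
have := gamma_lty a20; set I := (\int[leb]_(t in D0) _)%E => Ioo.
have I0 : (0 <= I)%E by apply: integral_ge0 => t _; rewrite lee_fin mulr_ge0 ?powR_ge0 ?expR_ge0.
have If : I = (fine I)%:E by rewrite fineK// ge0_fin_numE.
set p := (n%:R + 1) / 2; have p0 : 0 < p by rewrite divr_gt0// ltr_wpDl.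
pose c := p `^ p * 4 `^ p; have c0 : 0 < c by rewrite mulr_gt0 ?powR_gt0.
have f1 : 0 < fine I + 1 by rewrite ltr_wpDl// fine_ge0.
exists (cn * (c * (fine I + 1))); first exact: mulr_gt0 cn0 (mulr_gt0 c0 f1).
move=> x; set rho := dotr x x => rho0.
rewrite heat_potentialE -/rho -mulrA EFinM; apply: lee_wpmul2l; first by rewrite lee_fin ltW.
pose g t : R := t `^ (a + 2^-1 - 1) * expR (- t).
have mg : measurable_fun setT g by apply: measurable_funM; [exact: measurable_powR|exact: mexp].
have k0 : 0 <= c * rho `^ (- p) by rewrite mulr_ge0 ?powR_ge0// ltW.
apply: (@le_trans _ _ (\int[leb]_(t in D0) ((c * rho `^ (- p))%:E * (g t)%:E))%E).
  apply: ge0_le_integral => //.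
  - by move=> t _; rewrite lee_fin.
  - by apply/measurable_EFinP; apply: measurable_funTS; exact: measurable_kern.
  - by apply: emeasurable_funM => //; apply/measurable_EFinP; exact: measurable_funTS.
  - move=> t; rewrite /= in_itv/= andbT => t0; rewrite -EFinM lee_fin /kern /g.
    have u0 : 0 < rho / (4 * t) by rewrite divr_gt0// mulr_gt0.
    have := powR_expRN_le p0 (ltW u0); rewrite -ler_pdivlMl ?powR_gt0// => h.
    have up : (rho / (4 * t)) `^ p = rho `^ p * (4 `^ p * t `^ p)^-1.
      by rewrite powRM ?invr_ge0 ?mulr_ge0 ?(ltW rho0) ?(ltW t0)// powRVl ?mulr_ge0 ?(ltW t0)// powRM// ltW.
    apply: (@le_trans _ _ (t `^ (- b - 1) * (expR (- t) * (((rho / (4 * t)) `^ p)^-1 * p `^ p)))).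
      by rewrite ler_wpM2l ?powR_ge0// ler_wpM2l ?expR_ge0.
    rewrite up (_ : t `^ (a + 2^-1 - 1) = t `^ (- b - 1) * t `^ p); last first.
      by rewrite -powRD ?(gt_eqF t0) ?implybT//; congr (_ `^ _); rewrite /b /p; field.
    rewrite powRN /c le_eqVlt; apply/orP; left; apply/eqP.
    by field; rewrite !gt_eqF// powR_gt0.
rewrite ge0_integralZl//; last 2 first.
- by apply/measurable_EFinP; exact: measurable_funTS.
- by move=> t _; rewrite lee_fin mulr_ge0 ?powR_ge0 ?expR_ge0.
have -> : (\int[leb]_(t in D0) (g t)%:E = (fine I)%:E)%E by [].
rewrite -EFinM lee_fin -(mulrA c) -(mulrA c); apply: ler_wpM2l; first exact: ltW.
by rewrite mulrC; apply: ler_wpM2r; rewrite ?powR_ge0// lerDl.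
Qed.

(** Identifies the weight of level [j] with the size [|x|^(alpha - n)] of the kernel at
    [|x| = 2^(-j)], up to the factor [2^(-n)]. *)
Lemma dyad_weight j :
  (2^-1 `^ alpha) ^+ j * (dyad j *+ 2) ^- n = 2 ^- n * (dyad j ^+ 2) `^ (- b).
Proof.
have h0 := @dyad_gt0 R j; rewrite -[dyad j *+ 2]mulr_natl exprMn invfM mulrCA; congr (_ * _).
rewrite -powR_exprn ?invr_ge0// -/(dyad j) powR_exprn ?(ltW h0)// expr2 -powRD; last by rewrite (gt_eqF h0) implybT.
rewrite -powR_mulrn ?(ltW h0)// -powRN -powRD; last by rewrite (gt_eqF h0) implybT.
by congr (_ `^ _); rewrite /b /a; field.
Qed.

(** The kernel whose convolution with [F] is [dyadic_potential alpha m F]; [bessel_tail] plays the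
    same role for the radii [2^i >= 1]. *)
Definition bessel_minorant (m : nat) (v : Rn) : R :=
  \sum_(j < m) (2^-1 `^ alpha) ^+ j * ((dyad j *+ 2) ^- n * \1_(ball (0 : Rn) (dyad j)) v).

Definition bessel_tail (m : nat) (v : Rn) : R :=
  \sum_(i < m) 2^-1 ^+ i * ((2 ^+ i *+ 2) ^- n * \1_(ball (0 : Rn) (2 ^+ i)) v).

Lemma bessel_minorant_ge0 m v : 0 <= bessel_minorant m v.
Proof.
apply: sumr_ge0 => j _; rewrite mulr_ge0 ?exprn_ge0 ?powR_ge0// mulr_ge0//.
by rewrite invr_ge0 exprn_ge0// mulrn_wge0// ltW// dyad_gt0.
Qed.

Lemma bessel_tail_ge0 m v : 0 <= bessel_tail m v.
Proof.
apply: sumr_ge0 => j _; rewrite mulr_ge0 ?exprn_ge0 ?invr_ge0// mulr_ge0//.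
Qed.

Let s (j : nat) : R := dyad j ^+ 2.
Let s_gt0 j : 0 < s j. Proof. by rewrite exprn_gt0// dyad_gt0. Qed.
Let sS j : s j.+1 = s j / 4.
Proof. by rewrite /s (dyadS j); field. Qed.

Let powRN_le (x y p : R) : 0 < x -> x <= y -> 0 <= p -> y `^ (- p) <= x `^ (- p).
Proof.
move=> x0 xy p0; have y0 := lt_le_trans x0 xy.
rewrite !powRN lef_pV2 ?posrE ?powR_gt0//.
by apply: ge0_ler_powR; rewrite ?nnegrE ?(ltW x0) ?(ltW y0).
Qed.

(** For times between [s j.+1 = s j / 4] and [s j], a point with [|v|^2 <= n s j] has
    [|v|^2/(4t) <= n], so both exponentials are bounded below; the slab has length [3/4 * s j]. *)
Let kern_slab j (v : Rn) : ball 0 (dyad j) v ->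
  ((3 / 4 * (expR (-1) * expR (- n%:R)) * s j `^ (- b))%:E <=
   \int[leb]_(t in (`[s j.+1, s j[%classic : set R)) (kern (dotr v v) t)%:E)%E.
Proof.
move=> /(ball_dotr_le (dyad_gt0 j)); rewrite -/(s j) => rho_le.
set k := s j `^ (- b - 1) * (expR (-1) * expR (- n%:R)).
have slt : s j.+1 < s j by rewrite sS; have := s_gt0 j; lra.
apply: (@le_trans _ _ (\int[leb]_(t in (`[s j.+1, s j[%classic : set R)) (cst k%:E t))%E).
  rewrite integral_cst//.
  have lT : leb (`[s j.+1, s j[%classic : set R) = (s j - s j.+1)%:E.
    by rewrite lebesgue_measure_itv/= lte_fin slt -EFinB.
  rewrite [X in (_ * X)%E]lT -EFinM lee_fin.
  rewrite le_eqVlt; apply/orP; left; apply/eqP.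
  rewrite (_ : s j `^ (- b) = s j `^ (- b - 1) * s j); last exact: powR_pred.
  by rewrite sS /k; field.
apply: ge0_le_integral => //.
- by move=> t _; rewrite lee_fin mulr_ge0 ?powR_ge0// mulr_ge0 ?expR_ge0.
- by apply/measurable_EFinP; apply: measurable_funTS; exact: measurable_kern.
- move=> t; rewrite /= in_itv/= => /andP[st ts]; rewrite lee_fin.
  have t0 : 0 < t by apply: lt_le_trans st.
  have s1 : s j <= 1 by rewrite /s /dyad -exprM exprn_ile1// ?invr_ge0// invf_le1// ler1n.
  apply: ler_pM; rewrite ?powR_ge0// ?mulr_ge0 ?expR_ge0//.
    by rewrite -opprD; apply: powRN_le (ltW ts) _ => //; rewrite addr_ge0// ltW.
  apply: ler_pM; rewrite ?expR_ge0// ler_expR lerN2; first by apply: le_trans (ltW ts) s1.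
  rewrite ler_pdivrMr ?mulr_gt0//; apply: le_trans rho_le _; apply: ler_wpM2l => //.
  by move: st; rewrite sS; lra.
Qed.

(** Level [j] of the sum is paid for by the time slab of index [j]. The slabs are disjoint, so the
    constant is independent of the number of levels. *)
Lemma heat_potential_ge : exists2 c : R, 0 < c & forall m v,
  ((c * bessel_minorant m v)%:E <= heat_potential a v)%E.
Proof.
pose c0 : R := 3 / 4 * (expR (-1) * expR (- n%:R)).
have c00 : 0 < c0 by rewrite mulr_gt0// mulr_gt0 ?expR_gt0.
have n0 : 0 < (2 : R) ^+ n by rewrite exprn_gt0.
exists (cn * (c0 * 2 ^+ n)); first by rewrite mulr_gt0// mulr_gt0.
move=> m v; rewrite heat_potentialE -mulrA EFinM; apply: lee_wpmul2l; first by rewrite lee_fin ltW.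
have mk D : measurable_fun D (fun t => (kern (dotr v v) t)%:E).
  by apply/measurable_EFinP; apply: measurable_funTS; exact: measurable_kern.
apply: (@le_trans _ _ (\int[leb]_(t in (`[s m, s 0[%classic : set R)) (kern (dotr v v) t)%:E)%E); last first.
  apply: ge0_subset_integral => //; [exact: mk|by move=> t _; rewrite lee_fin|].
  by move=> t; rewrite /= !in_itv/= andbT => /andP[/(lt_le_trans (s_gt0 m))].
elim: m => [|m IH].
  rewrite /bessel_minorant big_ord0 mulr0; apply: integral_ge0 => t _.
  by rewrite lee_fin.
have slt : s m.+1 <= s m by rewrite sS; have := s_gt0 m; lra.
have s0m : s m <= s 0 by rewrite /s; apply: lerXn2r; rewrite ?nnegrE ?(ltW (dyad_gt0 _)) ?dyad_le.
have -> : (`[s m.+1, s 0[%classic : set R) = `[s m.+1, s m[%classic `|` `[s m, s 0[%classic.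
  apply/seteqP; split => t; rewrite /= !in_itv/=.
    by move=> /andP[h1 h2]; have [h|h] := ltP t (s m); [left; rewrite h1|right].
  move=> [/andP[h1 h2]|/andP[h1 h2]]; first by rewrite h1 (lt_le_trans h2).
  by rewrite h2 (le_trans slt).
rewrite ge0_integral_setU//; last 3 first.
- exact: mk.
- by move=> t _; rewrite lee_fin.
- by apply/disj_setPS => t; rewrite /= !in_itv/= => -[/andP[_ h1] /andP[h2 _]]; move: h1; rewrite ltNge h2.
rewrite /bessel_minorant big_ord_recr/= mulrDr addrC EFinD; apply: leeD => //.
rewrite indicE; have [|vb] := boolP (v \in _); last first.
  by rewrite !mulr0; apply: integral_ge0 => t _; rewrite lee_fin.
rewrite inE mulr1 => /kern_slab; apply: le_trans; rewrite lee_fin.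
rewrite dyad_weight -/(s m) -mulrA ler_pM2l// !mulrA mulfV ?mul1r// gt_eqF//.
Qed.

(** The term for the dyadic shell containing [v] already dominates the bounds [heat_near] and
    [heat_far]. Hence the number of terms depends on [v], and the origin, which lies in no shell, is
    left out. *)
Lemma heat_potential_le : exists2 C : R, 0 < C & forall v : Rn, v != 0 ->
  exists m0 : nat, forall m, (m0 <= m)%N ->
  (heat_potential a v <= (C * (bessel_minorant m v + bessel_tail m v))%:E)%E.
Proof.
have [C1 C10 near] := heat_near; have [C2 C20 far] := heat_far.
have n0 : 0 < (2 : R) ^+ n by rewrite exprn_gt0.
pose K1 := C1 * (4 `^ b * 2 ^+ n); pose K2 := C2 * (2 * 4 ^+ n).
have K10 : 0 < K1 by rewrite mulr_gt0// mulr_gt0// powR_gt0.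
have K20 : 0 < K2 by rewrite mulr_gt0// mulr_gt0// exprn_gt0.
exists (K1 + K2); first exact: addr_gt0.
move=> v vN0; have nv0 : 0 < `|v| by rewrite normr_gt0.
have rho_ge r : 0 < r -> r <= `|v| -> r ^+ 2 <= dotr v v.
  move=> r0 rv; rewrite leNgt; apply/negP => /(dotr_lt_ball r0).
  by rewrite -ball_normE/= sub0r normrN ltNge rv.
have in_ball r : `|v| < r -> \1_(ball (0 : Rn) r) v = 1 :> R.
  by move=> h; rewrite indicE mem_set// -ball_normE/= sub0r normrN.
have fin m : (heat_potential a v <= (K1 * bessel_minorant m v)%:E)%E \/
    (heat_potential a v <= (K2 * bessel_tail m v)%:E)%E ->
  (heat_potential a v <= ((K1 + K2) * (bessel_minorant m v + bessel_tail m v))%:E)%E.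
  move=> [] /le_trans; apply; rewrite lee_fin; apply: ler_pM; rewrite ?bessel_minorant_ge0 ?bessel_tail_ge0 ?(ltW K10) ?(ltW K20)//.
  - by rewrite lerDl ltW.
  - by rewrite lerDl bessel_tail_ge0.
  - by rewrite lerDr ltW.
  - by rewrite lerDr bessel_minorant_ge0.
have [v1|v1] := ltP `|v| 1.
  have exj : exists j, dyad j <= `|v|.
    have : dyad j @[j --> \oo] --> (0 : R) by apply: cvg_expr; rewrite ger0_norm ?invr_ge0// invf_lt1// ltr1n.
    move=> /cvgrPdist_lt /(_ _ nv0)[N _ HN]; exists N.
    by have := HN N (leqnn N); rewrite /= sub0r normrN gtr0_norm ?dyad_gt0// => /ltW.
  case: (ex_minnP exj) => -[|j] vj jmin.
    by move: v1; rewrite ltNge -(expr0 (2^-1 : R)) vj.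
  exists j.+1 => m jm; apply: fin; left.
  have vlt : `|v| < dyad j by rewrite ltNge; apply/negP => /jmin; rewrite ltnn.
  have srho := rho_ge _ (dyad_gt0 j.+1) vj.
  apply: le_trans (near v (lt_le_trans (s_gt0 j.+1) srho)) _; rewrite lee_fin /K1 -!mulrA ler_pM2l//.
  apply: (@le_trans _ _ (s j.+1 `^ (- b))); first exact: powRN_le (s_gt0 _) srho (ltW b0).
  rewrite sS powRM ?invr_ge0 ?(ltW (s_gt0 _))// (_ : 4^-1 `^ (- b) = 4 `^ b); last first.
    by rewrite powRN powRVl// invrK.
  rewrite mulrC ler_pM2l ?powR_gt0//.
  rewrite /bessel_minorant (bigD1 (Ordinal jm))//= in_ball// mulr1 dyad_weight -/(s j) mulrDr mulrA mulfV ?gt_eqF// mul1r lerDl.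
  apply: mulr_ge0; first exact: ltW.
  apply: sumr_ge0 => i _.
  rewrite mulr_ge0 ?exprn_ge0 ?powR_ge0// mulr_ge0//.
  by rewrite invr_ge0 exprn_ge0// mulrn_wge0// ltW// dyad_gt0.
have exi : exists i, `|v| < (2 : R) ^+ i.
  have : (2^-1 : R) ^+ j @[j --> \oo] --> (0 : R) by apply: cvg_expr; rewrite ger0_norm ?invr_ge0// invf_lt1// ltr1n.
  have vV : 0 < `|v|^-1 by rewrite invr_gt0.
  move=> /cvgrPdist_lt /(_ _ vV)[N _ HN]; exists N.
  have := HN N (leqnn N); rewrite /= sub0r normrN gtr0_norm ?exprn_gt0 ?invr_gt0//.
  by rewrite exprVn ltf_pV2 ?posrE ?exprn_gt0.
case: (ex_minnP exi) => -[|i] vi imin.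
  by move: vi; rewrite expr0 ltNge v1.
exists i.+2 => m im; apply: fin; right.
have i0 : 0 < (2 : R) ^+ i by rewrite exprn_gt0.
have vge : (2 : R) ^+ i <= `|v| by rewrite leNgt; apply/negP => /imin; rewrite ltnn.
have srho := rho_ge _ i0 vge.
have s0 : 0 < ((2 : R) ^+ i) ^+ 2 by rewrite exprn_gt0.
apply: le_trans (far v (lt_le_trans s0 srho)) _; rewrite lee_fin /K2 -!mulrA ler_pM2l//.
set p := (n%:R + 1) / 2; have p0 : 0 <= p by rewrite divr_ge0// addr_ge0.
apply: (@le_trans _ _ (((2 ^+ i) ^+ 2) `^ (- p))); first exact: powRN_le s0 srho p0.
have -> : ((2 ^+ i) ^+ 2 : R) `^ (- p) = ((2 ^+ i) ^+ n)^-1 * (2 ^+ i)^-1.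
  rewrite powRN powR_exprn ?(ltW i0)// expr2 -powRD; last by rewrite (gt_eqF i0) implybT.
  have -> : p + p = n%:R + 1 by rewrite /p; field.
  by rewrite powRD ?(gt_eqF i0) ?implybT// powRr1 ?(ltW i0)// powR_mulrn ?(ltW i0)// invfM.
apply: (@le_trans _ _ (2 * (4 ^+ n * (2^-1 ^+ i.+1 * (2 ^+ i.+1 *+ 2) ^- n)))).
  rewrite le_eqVlt; apply/orP; left; apply/eqP.
  have -> : ((2 : R) ^+ i.+1 *+ 2) ^+ n = 4 ^+ n * (2 ^+ i) ^+ n.
    by rewrite -exprMn exprS; congr (_ ^+ _); ring.
  have i0n : 0 < ((2 : R) ^+ i) ^+ n by rewrite exprn_gt0.
  have f0n : 0 < (4 : R) ^+ n by rewrite exprn_gt0.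
  rewrite exprVn exprS; move: i0 i0n f0n.
  move: ((2 : R) ^+ i) (_ ^+ n) ((4 : R) ^+ n) => x y z x0 y0 z0.
  by field; rewrite !gt_eqF.
apply: ler_wpM2l => //; apply: ler_wpM2l; first exact: exprn_ge0.
rewrite /bessel_tail (bigD1 (Ordinal im))//= in_ball// mulr1 lerDl.
apply: sumr_ge0 => j _; rewrite mulr_ge0 ?exprn_ge0 ?invr_ge0// mulr_ge0//.
Qed.

End bessel_bounds.

(** * Bessel potentials compared with sums of averages *)

Section capacity.
Context {R : realType} {n : nat}.
Local Notation Rn := 'rV[R]_n.
Local Notation mu := (@lebesgue_rV R n).

(** Kernels are identified up to null sets in [v], whereas a convolution evaluates them at
    [x - y]. *)
Lemma ae_reflect (P : Rn -> Prop) (x : Rn) :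
  {ae mu, forall v, P v} -> {ae mu, forall y, P (x - y)}.
Proof.
move=> h; have := @lebesgue_rV_affine0 R n x (-1) _ (_ : (-1 : R) != 0) h.
rewrite oppr_eq0 oner_eq0 => /(_ isT).
by apply: negligibleS => y /=; rewrite scaleN1r.
Qed.

Lemma measurable_reflect (g : Rn -> \bar R) (x : Rn) : measurable_fun setT g ->
  measurable_fun setT (fun y : Rn => g (x - y)).
Proof.
move=> mg; rewrite (_ : (fun y => _) = g \o (fun y => x + (-1) *: y)).
  by apply: measurableT_comp mg _; exact: affine_measurable.
by apply/funext => y /=; rewrite scaleN1r.
Qed.

Lemma indic_ball_reflect (x y : Rn) (r : R) :
  \1_(ball (0 : Rn) r) (x - y) = \1_(ball x r) y :> R.
Proof.
have e : ball (0 : Rn) r (x - y) = ball x r y.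
  by rewrite -[in LHS]ball_normE -[in RHS]ball_normE /= sub0r normrN.
rewrite !indicE; have -> // : (x - y \in (ball (0 : Rn) r : set Rn)) = (y \in (ball x r : set Rn)).
by apply/idP/idP; rewrite !in_setE e.
Qed.

Lemma integral_ball_sum (B : R) (w r : nat -> R) (F : Rn -> R) (m : nat) (x : Rn) :
  bounded_mfun B F -> (forall j, 0 <= w j) -> (forall j, 0 < r j) ->
  (\int[mu]_y ((\sum_(j < m) w j * ((r j *+ 2) ^- n * \1_(ball (0 : Rn) (r j)) (x - y))) * F y)%:E =
   (\sum_(j < m) w j * avg (r j) F x)%:E)%E.
Proof.
move=> BF w0 r0.
have v0 j := @vol_gt0 R n (r j) (r0 j).
have mF := bounded_mfunM BF; have F0 := bounded_mfun_ge0 BF.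
pose h j y : R := w j * ((r j *+ 2) ^- n * (\1_(ball x (r j)) y * F y)).
have mh j : measurable_fun setT (h j).
  do 3![apply: measurable_funM => //]; apply: measurable_indic; exact: measurable_ball_rV.
have h0 j y : 0 <= h j y by rewrite mulr_ge0// mulr_ge0 ?invr_ge0 ?(ltW (v0 j))// mulr_ge0.
rewrite (_ : (fun y => _) = fun y => (\sum_(j < m) (h j y)%:E)%E); last first.
  apply/funext => y; rewrite sumEFin; congr EFin; rewrite mulr_suml; apply: eq_bigr => j _.
  by rewrite indic_ball_reflect /h !mulrA.
rewrite ge0_integral_sum//; last 2 first.
- by move=> j; apply/measurable_EFinP.
- by move=> j y _; rewrite lee_fin.
rewrite -sumEFin; apply: eq_bigr => j _; rewrite /h.
have mhj : measurable_fun setT (fun y => \1_(ball x (r j)) y * F y).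
  by apply: measurable_funM => //; apply: measurable_indic; exact: measurable_ball_rV.
under eq_integral do rewrite mulrA EFinM.
rewrite ge0_integralZl//; last 3 first.
- exact/measurable_EFinP.
- by move=> y _; rewrite lee_fin mulr_ge0.
- by rewrite lee_fin mulr_ge0 ?invr_ge0 ?(ltW (v0 j)).
rewrite (_ : (\int[mu]_y (\1_(ball x (r j)) y * F y)%:E = \int[mu]_(y in ball x (r j)) (F y)%:E)%E); last first.
  rewrite [RHS]integral_mkcond; apply: eq_integral => y _.
  by rewrite patchE indicE; case: ifPn => _ /=; [rewrite mul1r|rewrite mul0r].
rewrite (integral_ballE BF x (r0 j)) -EFinM; congr EFin.
by rewrite mulrACA mulVf ?mulr1// gt_eqF.
Qed.

Section kernel.
Variable alpha : R.
Hypotheses (alpha0 : 0 < alpha) (alphan : alpha < n%:R).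
Local Notation hp := (@heat_potential R n (alpha / 2)).

Let G0 : 0 < Gamma_int (alpha / 2). Proof. by rewrite Gamma_int_gt0// divr_gt0. Qed.

Lemma measurable_bessel_kernel : measurable_fun setT (@bessel_kernel R n alpha).
Proof.
have [iB _] : is_inverse_fourier (fun xi : Rn => (1 + dotr xi xi) `^ (- alpha / 2)) (bessel_kernel alpha).
  apply: (@xgetPex _ (cst 0) [set G | is_inverse_fourier (fun xi : Rn => (1 + dotr xi xi) `^ (- alpha / 2)) G]).
  by exists (bessel_explicit (alpha / 2)); exact: is_inverse_fourier_bessel_explicit.
by apply/measurable_EFinP; exact: measurable_int iB.
Qed.

Lemma measurable_bessel_minorant m : measurable_fun setT (@bessel_minorant R n alpha m).
Proof.
apply: measurable_sum => j; do 2![apply: measurable_funM => //].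
by apply: measurable_indic; exact: measurable_ball_rV.
Qed.

Lemma measurable_bessel_tail m : measurable_fun setT (@bessel_tail R n m).
Proof.
apply: measurable_sum => j; do 2![apply: measurable_funM => //].
by apply: measurable_indic; exact: measurable_ball_rV.
Qed.

Lemma convolution_besselE (f : Rn -> R) (x : Rn) : measurable_fun setT f -> (forall y, 0 <= f y) ->
  convolution (bessel_kernel alpha) f x =
  ((Gamma_int (alpha / 2))^-1%:E * \int[mu]_y (hp (x - y)%R * (f y)%:E))%E.
Proof.
move=> mf f0.
have mhp : measurable_fun setT (fun y : Rn => hp (x - y)).
  by apply: measurable_reflect; exact: measurable_heat_potential.
rewrite -ge0_integralZl//; last 3 first.
- by apply: emeasurable_funM => //; exact/measurable_EFinP.
- by move=> y _; rewrite mule_ge0 ?heat_potential_ge0// lee_fin.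
- by rewrite lee_fin invr_ge0 ltW.
apply: ae_eq_integral => //.
- have mB : measurable_fun setT (EFin \o @bessel_kernel R n alpha).
    by apply/measurable_EFinP; exact: measurable_bessel_kernel.
  have := @measurable_reflect (EFin \o @bessel_kernel R n alpha) x mB.
  move=> h; rewrite (_ : (fun y => _) = fun y : Rn => ((bessel_kernel alpha (x - y))%:E * (f y)%:E)%E); last first.
    by apply/funext => y; rewrite EFinM.
  by apply: emeasurable_funM => //; exact/measurable_EFinP.
- by apply: emeasurable_funM => //; apply: emeasurable_funM => //; exact/measurable_EFinP.
- have a20 : 0 < alpha / 2 by rewrite divr_gt0.
  have h1 := ae_reflect x (@bessel_kernelE R n alpha alpha0).
  have h2 := ae_reflect x (@ae_fine_heat_potential R n (alpha / 2) a20).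
  apply: filterS2 h1 h2 => y e1 e2 _.
  by rewrite e1 /bessel_explicit -e2 /= -!EFinM mulrA.
Qed.

Lemma convolution_ge_dyadic_potential : exists2 c : R, 0 < c &
  forall (B : R) (F : Rn -> R), bounded_mfun B F -> forall m x,
  ((c * dyadic_potential alpha m F x)%:E <= convolution (bessel_kernel alpha) F x)%E.
Proof.
have [c c0 hc] := @heat_potential_ge R n alpha alphan.
exists ((Gamma_int (alpha / 2))^-1 * c); first by rewrite mulr_gt0// invr_gt0.
move=> B F BF m x; have F0 := bounded_mfun_ge0 BF; have mF := bounded_mfunM BF.
rewrite convolution_besselE// -mulrA EFinM; apply: lee_wpmul2l; first by rewrite lee_fin invr_ge0 ltW.
rewrite EFinM /dyadic_potential.
have d0 j : 0 <= (2^-1 `^ alpha : R) ^+ j by rewrite exprn_ge0 ?powR_ge0.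
rewrite -(integral_ball_sum m x BF d0 (@dyad_gt0 R)).
have mm : measurable_fun setT (fun y : Rn => (bessel_minorant alpha m (x - y) * F y)%:E).
  apply/measurable_EFinP; apply: measurable_funM => //; apply/measurable_EFinP.
  apply: (@measurable_reflect (EFin \o bessel_minorant alpha m)).
  by apply/measurable_EFinP; exact: measurable_bessel_minorant.
rewrite -ge0_integralZl//; last 2 first.
- by move=> y _; rewrite lee_fin mulr_ge0// bessel_minorant_ge0.
- by rewrite lee_fin ltW.
apply: ge0_le_integral => //.
- by move=> y _; rewrite -EFinM lee_fin !mulr_ge0 ?(ltW c0)// bessel_minorant_ge0.
- exact: emeasurable_funM.
- apply: emeasurable_funM; last exact/measurable_EFinP.
  by apply: measurable_reflect; exact: measurable_heat_potential.
- move=> y _; rewrite -/(bessel_minorant alpha m (x - y)).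
  apply: (@le_trans _ _ ((c * bessel_minorant alpha m (x - y))%:E * (F y)%:E)%E).
    by rewrite -!EFinM mulrA.
  apply: lee_wpmul2r; first by rewrite lee_fin.
  exact: hc.
Qed.

(** An admissible function is merely measurable and nonnegative. Its truncations are bounded, so
    their averages are continuous, and at each point they eventually coincide with it. *)
Definition truncation (f : Rn -> R) (m : nat) (y : Rn) : R :=
  Num.min (f y) m%:R * \1_(@cball R n m%:R) y.

Lemma bounded_truncation (f : Rn -> R) m : measurable_fun setT f -> (forall y, 0 <= f y) ->
  bounded_mfun m%:R (truncation f m).
Proof.
move=> mf f0; split.
  apply: measurable_funM; first exact: measurable_minr.
  by apply: measurable_indic; exact: measurable_cball.
move=> y; rewrite /truncation indicE; case: (_ \in _); rewrite ?mulr1 ?mulr0 ?lexx ?ler0n//.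
by rewrite le_min f0 ler0n ge_min lexx orbT.
Qed.

Lemma truncation_le (f : Rn -> R) m y : (forall y, 0 <= f y) -> truncation f m y <= f y.
Proof.
move=> f0; rewrite /truncation indicE; case: (_ \in _); rewrite ?mulr1 ?mulr0//.
by rewrite ge_min lexx.
Qed.

Lemma truncation_nd (f : Rn -> R) y : (forall y, 0 <= f y) ->
  {homo truncation f ^~ y : k m / (k <= m)%N >-> k <= m}.
Proof.
move=> f0 k m km; rewrite /truncation; apply: ler_pM => //.
- by rewrite le_min f0 ler0n.
- by rewrite le_min ge_min lexx/= ge_min ler_nat km orbT.
- rewrite !indicE ler_nat; case: (boolP (y \in cball k%:R)) => // yk.
  by rewrite (mem_set (_ : cball m%:R y))// ; move: yk; rewrite inE; move/subsetPset : (@cball_nd R n _ _ km); apply.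
Qed.

Lemma truncation_eventually (f : Rn -> R) y : exists m0, forall m, (m0 <= m)%N -> truncation f m y = f y.
Proof.
have [k _ yk] : (\bigcup_k @cball R n k%:R) y by rewrite bigcup_cball.
have [N fN] : exists N : nat, f y <= N%:R.
  by exists (Num.truncn (f y)).+1; apply: ltW; exact: truncnS_gt.
exists (maxn k N) => m; rewrite geq_max => /andP[km Nm].
rewrite /truncation indicE mem_set ?mulr1.
  by apply/min_idPl; apply: le_trans fN _; rewrite ler_nat.
by move: yk; move/subsetPset : (@cball_nd R n _ _ km); apply.
Qed.

Definition global_potential (m : nat) (F : Rn -> R) (x : Rn) : R :=
  dyadic_potential alpha m F x + \sum_(i < m) 2^-1 ^+ i * avg (2 ^+ i) F x.

Lemma global_potentialE (B : R) (F : Rn -> R) m x : bounded_mfun B F ->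
  (\int[mu]_y ((bessel_minorant alpha m (x - y) + bessel_tail m (x - y)) * F y)%:E =
   (global_potential m F x)%:E)%E.
Proof.
move=> BF; have F0 := bounded_mfun_ge0 BF; have mF := bounded_mfunM BF.
have mr (h : Rn -> R) : measurable_fun setT h -> measurable_fun setT (fun y : Rn => (h (x - y) * F y)%:E).
  move=> mh; apply/measurable_EFinP; apply: measurable_funM => //; apply/measurable_EFinP.
  by apply: (@measurable_reflect (EFin \o h)); exact/measurable_EFinP.
under eq_integral do rewrite mulrDl EFinD.
rewrite ge0_integralD//; last 4 first.
- by move=> y _; rewrite lee_fin mulr_ge0// bessel_minorant_ge0.
- by apply: mr; exact: measurable_bessel_minorant.
- by move=> y _; rewrite lee_fin mulr_ge0// bessel_tail_ge0.
- by apply: mr; exact: measurable_bessel_tail.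
rewrite EFinD; congr (_ + _)%E.
  by apply: (integral_ball_sum m x BF) => j; rewrite ?exprn_ge0 ?powR_ge0//; exact: dyad_gt0.
by apply: (integral_ball_sum m x BF) => j; rewrite ?exprn_ge0 ?invr_ge0 ?exprn_gt0.
Qed.

Lemma continuous_global_potential (B : R) (F : Rn -> R) m : bounded_mfun B F ->
  continuous (global_potential m F).
Proof.
move=> BF x; apply: (@continuousD _ _ _ (dyadic_potential alpha m F)
  (fun y => \sum_(i < m) 2^-1 ^+ i * avg (2 ^+ i) F y)).
  exact: continuous_dyadic_potential BF x.
elim: m => [|m IH].
  rewrite (_ : (fun y => _) = cst 0); first exact: cst_continuous.
  by apply/funext => y; rewrite big_ord0.
rewrite (_ : (fun y => _) = fun y => (\sum_(i < m) 2^-1 ^+ i * avg (2 ^+ i) F y) + 2^-1 ^+ m * avg (2 ^+ m) F y); last first.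
  by apply/funext => y; rewrite big_ord_recr.
apply: (@continuousD _ _ _ (fun y => \sum_(i < m) 2^-1 ^+ i * avg (2 ^+ i) F y)
  (fun y => 2^-1 ^+ m * avg (2 ^+ m) F y)) => //.
apply: (@continuousM _ _ (cst _) (avg (2 ^+ m) F)); first exact: cst_continuous.
by apply: (avg_continuous BF); rewrite exprn_gt0.
Qed.

Let sum_ord_nd (u : nat -> R) k m : (forall j, 0 <= u j) -> (k <= m)%N ->
  \sum_(j < k) u j <= \sum_(j < m) u j.
Proof.
move=> u0 km; rewrite -(subnKC km); elim: (m - k)%N => [|i IH]; first by rewrite addn0.
by rewrite addnS big_ord_recr/=; exact: ler_wpDr.
Qed.

Lemma global_potential_le (B B' : R) (F F' : Rn -> R) m m' x :
  bounded_mfun B F -> bounded_mfun B' F' -> (forall y, F y <= F' y) -> (m <= m')%N ->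
  global_potential m F x <= global_potential m' F' x.
Proof.
move=> BF BF' FF' mm'.
have h (w r : nat -> R) : (forall j, 0 <= w j) -> (forall j, 0 < r j) ->
    \sum_(j < m) w j * avg (r j) F x <= \sum_(j < m') w j * avg (r j) F' x.
  move=> w0 r0; apply: (@le_trans _ _ (\sum_(j < m) w j * avg (r j) F' x)).
    by apply: ler_sum => j _; apply: ler_wpM2l => //; exact: (avg_le BF BF').
  by apply: (@sum_ord_nd (fun j => w j * avg (r j) F' x)) => // j; rewrite mulr_ge0// (avg_ge0 BF').
by apply: lerD; apply: h => j; rewrite ?exprn_ge0 ?powR_ge0 ?invr_ge0 ?exprn_gt0//; exact: dyad_gt0.
Qed.

(** In dimension [0] the measure is a Dirac mass, whence [0 < n]. For positive [n] the enclosing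
    small cubes have volume at most [e]. *)
Lemma lebesgue_rV_set1 (x : Rn) : (0 < n)%N -> mu [set x] = 0%E.
Proof.
move=> n0; apply/eqP; rewrite eq_le measure_ge0 andbT; apply/lee_addgt0Pr => e e0; rewrite add0e.
pose r : R := Num.min 1 e / 2.
have m0 : 0 < Num.min 1 e by rewrite lt_min ltr01.
have r0 : 0 < r by rewrite divr_gt0.
apply: (@le_trans _ _ (mu (ball x r))).
  apply: le_measure; rewrite ?inE.
  - by apply: compact_measurable_rV; exact: compact_set1.
  - exact: measurable_ball_rV.
  - by move=> y ->; exact: ballxx.
rewrite [leLHS](lebesgue_rV_ball x r0) lee_fin (_ : r *+ 2 = Num.min 1 e); last by rewrite /r mulr2n -splitr.
rewrite -(prednK n0) exprS; apply: (@le_trans _ _ (Num.min 1 e)); last by rewrite ge_min lexx orbT.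
rewrite ler_piMr ?(ltW m0)// exprn_ile1 ?(ltW m0)// ge_min lexx//.
Qed.

(** If no truncated potential exceeded the threshold [(2 K)^-1], monotone convergence would bound
    the whole convolution by [1/2]. *)
Lemma convolution_le_global_potential : (0 < n)%N -> exists2 C : R, 0 < C &
  forall (f : Rn -> R), measurable_fun setT f -> (forall y, 0 <= f y) -> forall x,
  (1 <= convolution (bessel_kernel alpha) f x)%E ->
  exists m, C < global_potential m (truncation f m) x.
Proof.
move=> n0; have [C C0 hC] := @heat_potential_le R n alpha alpha0 alphan.
pose K := (Gamma_int (alpha / 2))^-1 * C.
have K0 : 0 < K by rewrite mulr_gt0// invr_gt0.
exists (2 * K)^-1; first by rewrite invr_gt0 mulr_gt0.
move=> f mf f0 x; rewrite convolution_besselE// => h1; apply: contrapT => /forallNP hm.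
pose g m (y : Rn) : \bar R := ((bessel_minorant alpha m (x - y) + bessel_tail m (x - y)) * truncation f m y)%:E.
have Bt m := bounded_truncation m mf f0.
have t0 m y : 0 <= truncation f m y by exact: bounded_mfun_ge0 (Bt m) y.
have k0 m v : 0 <= @bessel_minorant R n alpha m v + bessel_tail m v.
  by rewrite addr_ge0 ?bessel_minorant_ge0 ?bessel_tail_ge0.
have g0 m y : (0 <= g m y)%E by rewrite lee_fin mulr_ge0.
have mg m : measurable_fun setT (g m).
  apply/measurable_EFinP; apply: measurable_funM; last exact: bounded_mfunM (Bt m).
  apply/measurable_EFinP; apply: (@measurable_reflect (fun v => (bessel_minorant alpha m v + bessel_tail m v)%:E)).
  by apply/measurable_EFinP; apply: measurable_funD; [exact: measurable_bessel_minorant|exact: measurable_bessel_tail].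
have k_nd v : {homo (fun m => @bessel_minorant R n alpha m v + bessel_tail m v) : k m / (k <= m)%N >-> k <= m}.
  have i0 (r : R) : 0 <= r -> 0 <= (r *+ 2) ^- n.
    by move=> r0; rewrite invr_ge0 exprn_ge0// mulrn_wge0.
  move=> k m km; apply: lerD.
    apply: (@sum_ord_nd (fun j => (2^-1 `^ alpha) ^+ j * ((dyad j *+ 2) ^- n * \1_(ball (0 : Rn) (dyad j)) v))) => // j.
    by rewrite mulr_ge0 ?exprn_ge0 ?powR_ge0// mulr_ge0// i0// ltW// dyad_gt0.
  apply: (@sum_ord_nd (fun j => 2^-1 ^+ j * ((2 ^+ j *+ 2) ^- n * \1_(ball (0 : Rn) (2 ^+ j)) v))) => // j.
have g_nd y : {homo g ^~ y : k m / (k <= m)%N >-> (k <= m)%E}.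
  by move=> k m km; rewrite lee_fin; apply: ler_pM => //; [exact: k_nd|exact: truncation_nd].
have lim_le : (\int[mu]_y limn (g ^~ y) <= ((2 * K)^-1)%:E)%E.
  rewrite monotone_convergence//; apply: lime_le.
    apply: ereal_nondecreasing_is_cvgn => k m km.
    by apply: ge0_le_integral => // y _; exact: g_nd.
  apply: nearW => m; rewrite (global_potentialE m x (Bt m)) lee_fin leNgt.
  by apply/negP; exact: hm.
have lim_ge m y : (g m y <= limn (g ^~ y))%E.
  apply: lime_ge; first exact: ereal_nondecreasing_is_cvgn.
  by exists m => // k /= mk; exact: g_nd.
have mlim : measurable_fun setT (fun y => limn (g ^~ y)).
  by apply: (emeasurable_fun_cvg g) => // y _; exact: ereal_nondecreasing_is_cvgn.
have lim0 y : (0 <= limn (g ^~ y))%E by apply: le_trans (lim_ge 0%N y).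
have : (\int[mu]_y (hp (x - y)%R * (f y)%:E) <= \int[mu]_y (C%:E * limn (g ^~ y)))%E.
  apply: ae_ge0_le_integral => //.
  - by move=> y _; rewrite mule_ge0 ?heat_potential_ge0// lee_fin.
  - apply: emeasurable_funM; last exact/measurable_EFinP.
    by apply: measurable_reflect; exact: measurable_heat_potential.
  - by move=> y _; rewrite mule_ge0// lee_fin ltW.
  - exact: emeasurable_funM.
  (* The point [y = x] is the only exception, since [heat_potential_le] leaves out the origin. *)
  exists [set x]; split; [|exact: lebesgue_rV_set1|].
    by apply: compact_measurable_rV; exact: compact_set1.
  move=> y /= /not_implyP[_] hy; apply: contrapT => /eqP yx; apply: hy.
  have xy : x - y != 0 by rewrite subr_eq0 eq_sym.
  have [m0 hm0] := hC _ xy; have [m1 hm1] := truncation_eventually f y.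
  apply: (@le_trans _ _ (C%:E * g (maxn m0 m1) y)%E); last first.
    by apply: lee_wpmul2l => //; rewrite lee_fin ltW.
  rewrite /g hm1 ?leq_maxr// -EFinM mulrA EFinM; apply: lee_wpmul2r; first by rewrite lee_fin.
  by apply: hm0; rewrite leq_maxl.
rewrite ge0_integralZl//; last by rewrite lee_fin ltW.
move=> h2; have : (1%E <= (Gamma_int (alpha / 2))^-1%:E * (C%:E * ((2 * K)^-1)%:E))%E.
  apply: le_trans h1 _; apply: lee_wpmul2l; first by rewrite lee_fin invr_ge0 ltW.
  by apply: le_trans h2 _; apply: lee_wpmul2l => //; rewrite lee_fin ltW.
rewrite -!EFinM lee_fin mulrA -/K invfM mulrCA mulfV ?gt_eqF// mulr1.
by rewrite leNgt invf_lt1// ltr1n.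
Qed.

End kernel.
End capacity.

(** * Bessel capacity *)

Section bessel_capacity_theory.
Context {R : realType} {n : nat}.
Local Notation Rn := 'rV[R]_n.
Local Notation mu := (@lebesgue_rV R n).
Variables alpha s : R.
Hypotheses (n0 : (0 < n)%N) (alpha0 : 0 < alpha) (s1 : 1 < s) (alphan : alpha < n%:R).
Local Notation cap := (@bessel_capacity R n alpha s).
Local Notation conv := (convolution (@bessel_kernel R n alpha)).

Let s0 : 0 < s. Proof. exact: lt_trans s1. Qed.

Definition admissible (f : Rn -> R) (E : set Rn) : Prop :=
  [/\ measurable_fun setT f, forall x, 0 <= f x & forall x, E x -> (1 <= conv f x)%E].

Let Lnorm_powE (f : Rn -> R) : (forall x, 0 <= f x) ->
  ('N[mu]_s%:E[EFin \o f] `^ s = \int[mu]_x (f x `^ s)%:E)%E.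
Proof.
move=> f0; have sN0 : s != 0 by rewrite gt_eqF.
rewrite (poweR_Lnorm _ _ sN0); apply: eq_integral => x _ /=.
by rewrite (ger0_norm (f0 x)).
Qed.

Lemma capacity_le (f : Rn -> R) (E : set Rn) : admissible f E ->
  (cap E <= \int[mu]_x (f x `^ s)%:E)%E.
Proof. by move=> [mf f0 hf]; rewrite -Lnorm_powE//; apply: ereal_inf_lbound; exists f. Qed.

Lemma capacity_lt (E : set Rn) (c : \bar R) : (cap E < c)%E ->
  exists2 f, admissible f E & (\int[mu]_x (f x `^ s)%:E < c)%E.
Proof.
by move=> /ereal_inf_lt[_ [f [mf f0 hf] <-]]; rewrite Lnorm_powE//; exists f.
Qed.

Lemma capacity_mono (E E' : set Rn) : E `<=` E' -> (cap E <= cap E')%E.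
Proof.
move=> EE'; apply: ereal_inf_le_tmp => _ [f [mf f0 hf] <-].
by exists f => //; split => // x /EE'; exact: hf.
Qed.

Lemma capacity_ge0 (E : set Rn) : (0 <= cap E)%E.
Proof. by apply: le_ereal_inf_tmp => _ [f _ <-]; exact: poweR_ge0. Qed.

Lemma capacity_set0 : cap set0 = 0%E.
Proof.
apply/eqP; rewrite eq_le capacity_ge0 andbT; apply: (@le_trans _ _ (\int[mu]_x ((cst 0 x) `^ s)%:E)%E).
  by apply: capacity_le; split.
by rewrite (eq_integral (cst 0%E)) ?integral0// => x _; rewrite /= powR0// gt_eqF.
Qed.

Lemma avgZ (B c r : R) (g : Rn -> R) (x : Rn) : bounded_mfun B g -> 0 <= c -> 0 < r ->
  avg r (fun y => c * g y) x = c * avg r g x.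
Proof.
move=> Bg c0 r0; have := avgDZ x (bounded_mfun_cst (lexx 0)) Bg c0 r0.
by rewrite avg_cst// add0r => <-; congr avg; apply/funext => y; rewrite add0r.
Qed.

Lemma bounded_mfunZ (B c : R) (g : Rn -> R) : bounded_mfun B g -> 0 <= c ->
  bounded_mfun (c * B) (fun y => c * g y).
Proof.
move=> Bg c0; split; first by apply: measurable_funM => //; exact: bounded_mfunM Bg.
move=> y; rewrite mulr_ge0 ?(bounded_mfun_ge0 Bg)//=.
by apply: ler_wpM2l => //; exact: bounded_mfun_le Bg y.
Qed.

Lemma dyadic_potentialZ (B c : R) (g : Rn -> R) m (x : Rn) : bounded_mfun B g -> 0 <= c ->
  dyadic_potential alpha m (fun y => c * g y) x = c * dyadic_potential alpha m g x.
Proof.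
move=> Bg c0; rewrite /dyadic_potential mulr_sumr; apply: eq_bigr => j _.
by rewrite (avgZ x Bg c0 (dyad_gt0 j)) mulrCA.
Qed.

Let m_powR (p : R) (g : Rn -> R) : measurable_fun setT g -> measurable_fun setT (fun x => (g x `^ p)%:E).
Proof.
move=> mg; apply/measurable_EFinP.
by apply: (@measurableT_comp _ _ _ _ _ _ (fun y : R => y `^ p)); [exact: measurable_powR|].
Qed.

(** By [convolution_ge_dyadic_potential], the function [F / (c t)] is admissible for the superlevel
    set at level [t]. *)
Lemma capacity_dyadic_potential : exists2 C : R, 0 < C & forall (B : R) (F : Rn -> R) m (t : R),
  bounded_mfun B F -> 0 < t ->
  (cap [set x : Rn | (t < dyadic_potential alpha m F x)%R] <= (C * t `^ (- s))%:E * \int[mu]_x (F x `^ s)%:E)%E.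
Proof.
have [c c0 hc] := convolution_ge_dyadic_potential alpha0 alphan.
exists (c `^ (- s)); first by rewrite powR_gt0.
move=> B F m t BF t0.
have ct0 : 0 < c * t by rewrite mulr_gt0.
have i0 : 0 <= (c * t)^-1 by rewrite invr_ge0 ltW.
have BF' := bounded_mfunZ BF i0.
apply: (@le_trans _ _ (\int[mu]_x (((c * t)^-1 * F x) `^ s)%:E)%E).
  apply: capacity_le; split; [exact: bounded_mfunM BF'|exact: bounded_mfun_ge0 BF'|].
  move=> x /= tx; apply: le_trans (hc _ _ BF' m x); rewrite lee_fin (dyadic_potentialZ m x BF i0).
  rewrite invfM mulrA mulrA mulfV ?gt_eqF// mul1r ler_pdivlMl// mulr1 ltW//.
have F0 := bounded_mfun_ge0 BF.
rewrite (eq_integral (fun x => (((c * t)^-1 `^ s)%:E * (F x `^ s)%:E)%E)); last first.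
  by move=> x _; rewrite powRM// EFinM.
rewrite ge0_integralZl//; last 3 first.
- by apply: m_powR; exact: bounded_mfunM BF.
- by move=> x _; rewrite lee_fin powR_ge0.
- by rewrite lee_fin powR_ge0.
by rewrite powRVl ?(ltW ct0)// -powRN (powRM _ (ltW c0) (ltW t0)).
Qed.

(** A multiple of the indicator of a ball one unit larger than [K] is admissible: the unit-scale
    average is already large enough on [K]. *)
Lemma capacity_compact_lty (K : set Rn) : compact K -> (cap K < +oo)%E.
Proof.
move=> /compact_sub_ball[r r0 Kr].
have [c c0 hc] := convolution_ge_dyadic_potential alpha0 alphan.
have ci : 0 <= c^-1 by rewrite invr_ge0 ltW.
pose F (y : Rn) : R := c^-1 * \1_(ball (0 : Rn) (r + 1)) y.
have r10 : 0 < r + 1 by rewrite addr_gt0.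
have mb := measurable_ball_rV (0 : Rn) (r + 1).
have BF : bounded_mfun c^-1 F.
  split; first by apply: measurable_funM => //; exact: measurable_indic.
  move=> y; rewrite /F indicE; case: (_ \in _); by rewrite ?mulr1 ?mulr0 ?lexx ?ci.
apply: (@le_lt_trans _ _ (\int[mu]_x (F x `^ s)%:E)%E).
  apply: capacity_le; split; [exact: bounded_mfunM BF|exact: bounded_mfun_ge0 BF|].
  move=> x /Kr xr; apply: le_trans (hc _ _ BF 1%N x); rewrite lee_fin.
  rewrite /dyadic_potential big_ord1 expr0 mul1r {1}/dyad expr0.
  rewrite -ler_pdivrMl// mulr1; apply: (avg_ge_inf BF ltr01 ci) => y xy.
  by rewrite /F indicE mem_set ?mulr1//; exact: ball_triangle xr xy.
rewrite (eq_integral (fun x => ((c^-1 `^ s)%:E * (\1_(ball (0 : Rn) (r + 1)) x)%:E)%E)); last first.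
  move=> x _; rewrite /F -EFinM indicE; case: (_ \in _); rewrite ?mulr1 ?mulr0// powR0// gt_eqF//.
rewrite ge0_integralZl//; last 2 first.
- by apply/measurable_EFinP; exact: measurable_indic.
- by rewrite lee_fin powR_ge0.
rewrite integral_indic// setIT [X in (_ * X < _)%E](lebesgue_rV_ball (0 : Rn) r10).
by rewrite -EFinM ltry.
Qed.

(** The number of terms found at a single point depends on that point. The superlevel sets of the
    truncated potentials are open and increase with [m], so compactness gives one [m] for all of
    [K]. *)
Lemma compact_global_potential : exists2 C : R, 0 < C & forall (K : set Rn) (f : Rn -> R),
  compact K -> admissible f K ->
  exists m, forall x, K x -> C < global_potential alpha m (truncation f m) x.
Proof.
have [C C0 hC] := convolution_le_global_potential alpha0 alphan n0.
exists C => // K f cK [mf f0 hf].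
pose U (m : nat) := [set x | C < global_potential alpha m (truncation f m) x].
have nd m m' x : (m <= m')%N -> U m x -> U m' x.
  move=> mm' /lt_le_trans; apply; apply: (global_potential_le alpha x (bounded_truncation m mf f0) (bounded_truncation m' mf f0)) => //.
  by move=> y; apply: truncation_nd.
have := cK; rewrite compact_cover => /(_ _ [set: nat] U) [].
- move=> m _; rewrite (_ : U m = global_potential alpha m (truncation f m) @^-1` `]C, +oo[).
    have /continuousP := @continuous_global_potential R n alpha _ _ m (bounded_truncation m mf f0); apply.
    exact: interval_open.
  by apply/seteqP; split => x; rewrite /U/= in_itv/= andbT.
- by move=> x /hf /hC -/(_ mf f0)[m hm]; exists m.
move=> D' _ KD'; exists (\max_(m <- finmap.enum_fset D') m)%N => x /KD'[m /= mD' Umx].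
by apply: (nd m) => //; apply: (@leq_bigmax_seq _ (finmap.enum_fset D') xpredT (fun m => m) m).
Qed.

(** On [K] the truncated potential of an admissible function is at least [c], and it is at most [D]
    times a maximal function, so the [L^s] maximal inequality bounds the volume. In particular the
    compact sets of zero capacity, which [M_norm] ignores, are null sets. *)
Lemma lebesgue_le_capacity : exists2 C : R, 0 < C &
  forall K : set Rn, compact K -> (mu K <= C%:E * cap K)%E.
Proof.
have [c c0 hc] := compact_global_potential.
have [Cm Cm0 strong] := @strong_type_maxfun R n s s1.
pose d : R := 2^-1 `^ alpha.
have [d0 d1] : 0 <= d /\ d < 1.
  split; first exact: powR_ge0.
  have e1 : (1 : R) `^ alpha = 1 by rewrite powR1.
  rewrite -[ltRHS]e1; apply: gt0_ltr_powR; rewrite ?nnegrE ?invr_ge0//.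
  by rewrite invf_lt1// ltr1n.
(* The total of the weights: [sum_j 2^(-j alpha) <= (1 - d)^-1] for the small radii and
   [sum_i 2^(-i) <= 2] for the large ones. *)
pose D := (1 - d)^-1 + 2; have D0 : 0 < D by rewrite addr_gt0// invr_gt0 subr_gt0.
have cD0 : 0 < c / D by exact: divr_gt0.
pose C := (c / D) `^ (- s) * Cm; have C0 : 0 < C by rewrite mulr_gt0// powR_gt0.
exists C => // K cK; rewrite leNgt; apply/negP => hK.
have mK := compact_measurable_rV cK.
have mKoo := lebesgue_rV_compact_lty cK.
have : (cap K < C^-1%:E * mu K)%E.
  by rewrite lte_pdivlMl.
move=> /capacity_lt[f fK]; apply/negP; rewrite -leNgt; have [mf f0 hf] := fK.
have [m hm] := hc K f cK fK.
have Bt := bounded_truncation m mf f0; have BM := bounded_maxfun Bt.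
have low x : K x -> c / D <= maxfun (truncation f m) x.
  move=> /hm /ltW h; rewrite ler_pdivrMr//; apply: le_trans h _.
  have M0 := bounded_mfun_ge0 BM x.
  rewrite /global_potential /D mulrDr; apply: lerD.
    rewrite mulrC; apply: (@le_trans _ _ ((\sum_(j < m) d ^+ j) * maxfun (truncation f m) x)).
      rewrite mulr_suml; apply: ler_sum => j _; apply: ler_wpM2l; first exact: exprn_ge0.
      exact: (avg_le_maxfun Bt x (dyad_gt0 j)).
    apply: ler_wpM2r => //; have d01 : 0 <= d < 1 by rewrite d0.
    by have := shifted_geometric_le 0 m d01; under eq_bigr do rewrite subn0.
  rewrite mulrC; apply: (@le_trans _ _ ((\sum_(i < m) 2^-1 ^+ i) * maxfun (truncation f m) x)).
    rewrite mulr_suml; apply: ler_sum => j _; apply: ler_wpM2l; first by rewrite exprn_ge0// invr_ge0.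
    by apply: (avg_le_maxfun Bt x); rewrite exprn_gt0.
  by apply: ler_wpM2r => //; exact: sum_half_le.
rewrite lee_pdivrMl//; apply: (@le_trans _ _ (((c / D) `^ (- s))%:E * \int[mu]_x (maxfun (truncation f m) x `^ s)%:E)%E).
  have cDs : 0 < (c / D) `^ s by rewrite powR_gt0.
  rewrite powRN lee_pdivlMl//.
  have mM := m_powR s (bounded_mfunM BM).
  apply: (@le_trans _ _ (\int[mu]_(x in K) (maxfun (truncation f m) x `^ s)%:E)%E); last first.
    by apply: ge0_subset_integral => // x _; rewrite lee_fin powR_ge0.
  rewrite -integral_cst//; apply: ge0_le_integral => //.
  - by move=> x _; rewrite lee_fin ltW.
  - exact: measurable_funTS.
  - move=> x Kx; rewrite lee_fin; apply: ge0_ler_powR; rewrite ?nnegrE ?(ltW s0) ?(ltW cD0)//; last exact: low.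
    exact: bounded_mfun_ge0 BM x.
rewrite /C EFinM -muleA; apply: lee_wpmul2l; first by rewrite lee_fin powR_ge0.
apply: le_trans (strong _ _ Bt) _; apply: lee_wpmul2l; first by rewrite lee_fin ltW.
apply: ge0_le_integral => //.
- by move=> x _; rewrite lee_fin powR_ge0.
- by apply: m_powR; exact: bounded_mfunM Bt.
- exact: m_powR.
- move=> x _; rewrite lee_fin; apply: ge0_ler_powR; rewrite ?nnegrE ?(ltW s0)//; last exact: truncation_le.
  exact: bounded_mfun_ge0 Bt x.
Qed.

Hypothesis alphas : alpha * s <= n%:R.

Lemma potential_for_compact : exists theta C c D : R,
  [/\ s < theta, 1 <= C, 0 < c, 0 < D & forall K, compact K -> cap K != 0%E ->
  exists u : Rn -> R, [/\ continuous u, exists b, bounded_mfun b u, forall x, K x -> c <= u x,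
    forall j x, avg (dyad j) (fun z => u z `^ theta) x <= C * u x `^ theta &
    forall t, 0 < t -> (cap [set x : Rn | (t < u x)%R] <= (D * t `^ (- s))%:E * cap K)%E]].
Proof.
have nR0 : 0 < n%:R :> R by rewrite ltr0n.
pose e := s * alpha / (2 * n%:R).
have e0 : 0 < e by rewrite divr_gt0 ?mulr_gt0.
(* [tau] has to lie in []1, s[] and to satisfy [tau (1 + e) > s], which amounts to [theta > s]
   below. Both lower bounds are less than [s], and [tau] is the midpoint between [s] and the larger
   one. *)
pose L := Num.max 1 (s / (1 + e)).
have L_s : L < s.
  rewrite /L gt_max s1/= ltr_pdivrMr ?addr_gt0// ltr_pMr// ltrDl//.
pose tau := (L + s) / 2.
have tau_s : tau < s by rewrite /tau; lra.
have L_tau : L < tau by rewrite /tau; lra.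
have tau1 : 1 < tau by apply: le_lt_trans L_tau; rewrite le_max lexx.
have tau0 : 0 < tau by apply: lt_trans tau1.
have tau_e : s / (1 + e) < tau by apply: le_lt_trans L_tau; rewrite le_max lexx orbT.
(* Dictated by [kappaE]; it is below [1] because [alpha * tau < alpha * s <= n < 2 n]. *)
pose kappa := alpha * tau / (2 * n%:R).
have n20 : 0 < 2 * n%:R :> R by rewrite mulr_gt0.
have kappa0 : 0 < kappa by exact: divr_gt0 (mulr_gt0 alpha0 tau0) n20.
have kappa1 : kappa < 1.
  rewrite ltr_pdivrMr ?mulr_gt0// mul1r; apply: (@lt_trans _ _ (alpha * s)); first by rewrite ltr_pM2l.
  by apply: le_lt_trans alphas _; lra.
have kappa01 : 0 < kappa < 1 by rewrite kappa0.
have kappaE : n%:R * (kappa / tau) = alpha / 2.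
  by rewrite /kappa; field; rewrite !gt_eqF.
pose theta := tau / (1 - kappa).
have k10 : 0 < 1 - kappa by rewrite subr_gt0.
have theta_s : s < theta.
  rewrite /theta ltr_pdivlMr//; move: tau_e; rewrite ltr_pdivrMr ?addr_gt0//.
  have -> : s * (1 - kappa) = s - tau * e by rewrite /kappa /e; field; rewrite gt_eqF.
  lra.
(* [f^tau] is in [L^q] when [f] is in [L^s], and an A_1 majorant [P] of the truncated [f^tau] gives
   [F = P^(1/tau)] with [F^s = P^q]. *)
pose q := s / tau.
have q1 : 1 < q by rewrite ltr_pdivlMr// mul1r.
have [C1 [C2 [C10 C20 rubio]]] := @rubio_de_francia R n q q1.
have [C3 C31 A1] := @dyadic_potential_A1 R n alpha tau kappa C1 alpha0 tau1 kappa01 kappaE C10.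
have [CL CL0 capL] := capacity_dyadic_potential.
have [CU CU0 convU] := compact_global_potential.
pose E := 2 ^+ n * C1 `^ tau^-1; have E0 : 0 < E by rewrite mulr_gt0 ?exprn_gt0 ?powR_gt0.
have E1 : 0 < 1 + 2 * E by rewrite addr_gt0// pmulr_rgt0.
exists theta, C3, (CU / (1 + 2 * E)), (CL * (C2 * 2)); split => //.
- exact: divr_gt0.
- by rewrite !mulr_gt0.
move=> K cK capK0.
have capKf : cap K = (fine (cap K))%:E.
  by rewrite fineK// ge0_fin_numE ?capacity_ge0// capacity_compact_lty.
have fk0 : 0 < fine (cap K) by rewrite lt_def fine_ge0 ?capacity_ge0// andbT -eqe -capKf.
have : (cap K < (2 * fine (cap K))%:E)%E by rewrite {1}capKf lte_fin mulr_natl mulr2n ltrDl.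
move=> /capacity_lt[f fK fs]; have [mf f0 _] := fK.
have [m hm] := convU K f cK fK.
have Bt := bounded_truncation m mf f0.
have Bg := bounded_mfun_powR Bt (ltW tau0).
have [B' [P [BP gP P_A1 intP]]] := rubio _ _ Bg.
pose F x := P x `^ tau^-1.
have ti0 : 0 <= tau^-1 by rewrite invr_ge0 ltW.
have BF : bounded_mfun _ F := bounded_mfun_powR BP ti0.
have F0 := bounded_mfun_ge0 BF.
have fF x : truncation f m x <= F x.
  have t0 := bounded_mfun_ge0 Bt x.
  rewrite -[leLHS](powRr1 t0) -(mulfV (lt0r_neq0 tau0)) powRrM.
  by apply: ge0_ler_powR; rewrite ?nnegrE ?powR_ge0//; exact: bounded_mfun_ge0 BP x.
(* One term more than [m], so that the unit scale is present even for [m = 0]; it absorbs the large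
   radii through [avg_large_le]. *)
pose u := dyadic_potential alpha m.+1 F.
have u0 x : 0 <= u x.
  by apply: sumr_ge0 => j _; rewrite mulr_ge0 ?exprn_ge0 ?powR_ge0// (avg_ge0 BF)// dyad_gt0.
have u_avg x : avg 1 F x <= u x.
  rewrite /u /dyadic_potential big_ord_recl expr0 mul1r {1}/dyad expr0 lerDl.
  by apply: sumr_ge0 => j _; rewrite mulr_ge0 ?exprn_ge0 ?powR_ge0// (avg_ge0 BF)// dyad_gt0.
exists u; split.
- exact: continuous_dyadic_potential BF.
- exact: bounded_dyadic_potential BF.
- move=> x /hm /ltW h; rewrite ler_pdivrMr//.
  apply: le_trans h _; apply: le_trans (global_potential_le alpha x Bt BF fF (leqnSn m)) _.
  rewrite /global_potential -/(u x) mulrDr mulr1; apply: lerD => //.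
  apply: (@le_trans _ _ ((\sum_(i < m.+1) 2^-1 ^+ i) * (E * avg 1 F x))).
    rewrite mulr_suml; apply: ler_sum => i _; apply: ler_wpM2l; first by rewrite exprn_ge0// invr_ge0.
    by apply: (avg_large_le tau1 C10 BP P_A1); rewrite exprn_ege1// ler1n.
  apply: (@le_trans _ _ (2 * (E * avg 1 F x))).
    by apply: ler_wpM2r; [rewrite mulr_ge0 ?(ltW E0)// (avg_ge0 BF)|exact: sum_half_le].
  by rewrite mulrA mulrC; apply: ler_wpM2r; [rewrite mulr_ge0// ltW|exact: u_avg].
- by move=> j x; exact: A1 BP P_A1 m.+1 j x isT.
- move=> t t0; apply: le_trans (capL _ _ m.+1 t BF t0) _.
  have ts0 : 0 <= t `^ (- s) by exact: powR_ge0.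
  have -> : (\int[mu]_x (F x `^ s)%:E = \int[mu]_x (P x `^ q)%:E)%E.
    by apply: eq_integral => x _; rewrite /F -powRrM [tau^-1 * s]mulrC.
  have intg : (\int[mu]_x ((truncation f m x `^ tau) `^ q)%:E <= (2 * fine (cap K))%:E)%E.
    apply: le_trans (ltW fs); apply: ge0_le_integral => //.
    - by move=> x _; rewrite lee_fin powR_ge0.
    - by apply: m_powR; exact: bounded_mfunM Bg.
    - exact: m_powR.
    - move=> x _; rewrite lee_fin -powRrM (_ : tau * q = s); last by rewrite /q mulrC divfK// gt_eqF.
      apply: ge0_ler_powR; rewrite ?nnegrE ?(ltW s0)//; last exact: truncation_le.
      exact: bounded_mfun_ge0 Bt x.
  apply: (@le_trans _ _ ((CL * t `^ (- s))%:E * (C2%:E * (2 * fine (cap K))%:E))%E).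
    apply: lee_wpmul2l; first by rewrite lee_fin mulr_ge0// ltW.
    apply: le_trans intP _; apply: lee_wpmul2l => //; by rewrite lee_fin ltW.
  rewrite [in leRHS]capKf -!EFinM lee_fin le_eqVlt; apply/orP; left; apply/eqP.
  by ring.
Qed.

End bessel_capacity_theory.

Lemma emeasurable_nonincreasing {R : realType} (f : R -> \bar R) :
  (forall x y, x <= y -> (f y <= f x)%E) -> measurable_fun setT (f : measurableTypeR R -> \bar R).
Proof.
move=> f_nd; apply: (measurability _ (ErealGenOInfty.measurableE R)).
move=> _ [_ [c ->] <-]; rewrite setTI; apply: is_interval_measurable => x y /= hx hy z /andP[xz zy].
move: hy; rewrite !in_itv/= !andbT => /lt_le_trans; apply; exact: f_nd.
Qed.

(** * The local maximal function on Euclidean balls *)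

Section weights.
Context {R : realType} {n : nat}.
Local Notation Rn := 'rV[R]_n.
Local Notation mu := (@lebesgue_rV R n).
Hypothesis n0 : (0 < n)%N.

Lemma dyad_bracket (r : R) : 0 < r <= 1 -> exists j, dyad j.+1 < r <= dyad j.
Proof.
move=> /andP[r0 r1]; have exj : exists j, dyad j < r.
  have : dyad j @[j --> \oo] --> (0 : R) by apply: cvg_expr; rewrite ger0_norm ?invr_ge0// invf_lt1// ltr1n.
  move=> /cvgrPdist_lt /(_ _ r0)[N _ HN]; exists N.
  by have := HN N (leqnn N); rewrite /= sub0r normrN gtr0_norm ?dyad_gt0.
case: (ex_minnP exj) => -[|j] rj jmin.
  by move: rj; rewrite /dyad expr0 ltNge r1.
exists j; rewrite rj/= leNgt; apply/negP => /jmin; by rewrite ltnn.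
Qed.

Lemma measurable_eball (x : Rn) (r : R) : measurable (eball x r).
Proof.
have mg : measurable_fun setT (fun y : Rn => dotr (x - y) (x - y)).
  apply/measurable_EFinP; apply: (@measurable_reflect R n (fun v => (dotr v v)%:E)).
  by apply/measurable_EFinP; exact: measurable_dotrxx.
rewrite (_ : eball x r = setT `&` (fun y : Rn => dotr (x - y) (x - y)) @^-1` `]-oo, r ^+ 2[%classic).
  by apply: mg.
by apply/seteqP; split => y; rewrite /eball/= in_itv/= // => -[].
Qed.

Lemma eball_sub_ball (x : Rn) (r : R) : 0 < r -> eball x r `<=` ball x r.
Proof.
move=> r0 y /(dotr_lt_ball r0).
by rewrite -!ball_normE /= sub0r normrN.
Qed.

Lemma ball_sub_eball (x : Rn) (r : R) : 0 < r -> ball x (r / (2 * n%:R)) `<=` eball x r.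
Proof.
have nR0 : 0 < n%:R :> R by rewrite ltr0n.
move=> r0 y xy; set d := r / (2 * n%:R) in xy *.
have d0 : 0 < d by rewrite divr_gt0// mulr_gt0.
have xy0 : ball (0 : Rn) d (x - y) by move: xy; rewrite -!ball_normE /= sub0r normrN.
rewrite /eball/=; apply: le_lt_trans (ball_dotr_le d0 xy0) _.
have -> : n%:R * d ^+ 2 = r ^+ 2 * (4 * n%:R)^-1 by rewrite /d; field; rewrite gt_eqF.
rewrite ltr_pdivrMr ?mulr_gt0// ltr_pMr ?exprn_gt0//.
have : 1 <= n%:R :> R by rewrite ler1n.
by move: (n%:R) => N hN; lra.
Qed.

(** A Euclidean ball of radius [r] lies in the sup-norm ball of radius [2^(-j)] and contains the one
    of radius [r/(2n)]. As [2^(-j) < 2 r], the two volumes differ by a factor of at most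
    [(4n)^n]. *)
Lemma local_maximal_le (B : R) (w : Rn -> R) (C : R) (x : Rn) : bounded_mfun B w ->
  (forall j, avg (dyad j) w x <= C) ->
  (local_maximal (EFin \o w) x <= ((4 * n%:R) ^+ n * C)%:E)%E.
Proof.
have nR0 : 0 < n%:R :> R by rewrite ltr0n.
move=> Bw hC; apply: ge_ereal_sup => _ [r ri <-].
move: ri; rewrite /= in_itv/= => /[dup] /dyad_bracket[j /andP[jr rj]] /andP[r0 r1].
have w0 := bounded_mfun_ge0 Bw.
have h0 := @dyad_gt0 R j.
have d0 : 0 < r / (2 * n%:R) by rewrite divr_gt0// mulr_gt0.
have int_le : (\int[mu]_(y in eball x r) `|(EFin \o w) y| <= (C * (dyad j *+ 2) ^+ n)%:E)%E.
  rewrite (eq_integral (fun y => (w y)%:E)); last by move=> y _; rewrite /= ger0_norm.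
  apply: (@le_trans _ _ (\int[mu]_(y in ball x (dyad j)) (w y)%:E)%E).
    apply: ge0_subset_integral => //.
    - exact: measurable_eball.
    - exact: measurable_ball_rV.
    - exact: bounded_mfunE Bw _.
    - by move=> y _; rewrite lee_fin.
    - by apply: subset_trans (eball_sub_ball r0) _; exact: le_ball.
  rewrite (integral_ballE Bw x h0) lee_fin; apply: ler_wpM2r; [exact/ltW/vol_gt0|exact: hC].
have mlow : ((((r / (2 * n%:R)) *+ 2) ^+ n)%:E <= mu (eball x r))%E.
  rewrite -(lebesgue_rV_ball x d0); apply: le_measure; rewrite ?inE; [|exact: measurable_eball|exact: ball_sub_eball].
  exact: measurable_ball_rV.
have mup : (mu (eball x r) < +oo)%E.
  apply: (@le_lt_trans _ _ (mu (ball x r))).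
    by apply: le_measure; rewrite ?inE; [exact: measurable_eball|exact: measurable_ball_rV|exact: eball_sub_ball].
  by rewrite [ltLHS](lebesgue_rV_ball x r0) ltry.
have vd := @vol_gt0 R n _ d0.
have mf : mu (eball x r) = (fine (mu (eball x r)))%:E by rewrite fineK// ge0_fin_numE.
have fm : ((r / (2 * n%:R)) *+ 2) ^+ n <= fine (mu (eball x r)) by rewrite -lee_fin -mf.
have fm0 : 0 < fine (mu (eball x r)) by apply: lt_le_trans fm.
have C0 : 0 <= C by apply: le_trans (hC 0%N); exact: (avg_ge0 Bw x (dyad_gt0 0)).
rewrite [X in (X^-1 * _)%E]mf inver gt_eqF//.
apply: (@le_trans _ _ ((fine (mu (eball x r)))^-1%:E * (C * (dyad j *+ 2) ^+ n)%:E)%E).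
  by apply: lee_wpmul2l => //; rewrite lee_fin invr_ge0 ltW.
rewrite -EFinM lee_fin ler_pdivrMl//.
apply: (@le_trans _ _ (((r / (2 * n%:R)) *+ 2) ^+ n * ((4 * n%:R) ^+ n * C))); last first.
  by apply: ler_wpM2r => //; rewrite mulr_ge0// exprn_ge0// mulr_ge0.
rewrite mulrA -exprMn mulrC; apply: ler_wpM2r => //.
apply: lerXn2r; rewrite ?nnegrE ?mulrn_wge0 ?(ltW h0)//.
  by rewrite mulr_ge0 ?mulrn_wge0 ?(ltW d0)// mulr_ge0.
have -> : (r / (2 * n%:R)) *+ 2 * (4 * n%:R) = r * 4 by field; rewrite gt_eqF.
by move: jr; rewrite (dyadS j); lra.
Qed.

End weights.

(** * Weights adapted to a compact set *)

Section weight_for_compact.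
Context {R : realType} {n : nat}.
Local Notation Rn := 'rV[R]_n.
Local Notation leb := (@lebesgue_measure R).
Local Notation D0 := (`]0%R, +oo[%classic : set R).

Lemma powR_le_id (x p : R) : 0 <= x <= 1 -> 1 <= p -> x `^ p <= x.
Proof.
move=> /andP[x0 x1] p1; have [->|xN0] := eqVneq x 0; first by rewrite powR0// gt_eqF// (lt_le_trans _ p1).
have xp : 0 < x by rewrite lt_def xN0.
rewrite (powR_pred p xp) ler_piMl//.
have e1 : (1 : R) `^ (p - 1) = 1 by rewrite powR1.
by rewrite -[leRHS]e1; apply: ge0_ler_powR; rewrite ?nnegrE ?subr_ge0.
Qed.

(** Where [g] is positive the power is differentiable; at a zero of [g], the bound [t^p <= t] on
    [[0, 1]] transfers the continuity of [g]. *)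
Lemma continuous_powR_unit (g : Rn -> R) (p : R) : 1 <= p -> continuous g ->
  (forall y, 0 <= g y <= 1) -> continuous (fun y => g y `^ p).
Proof.
move=> p1 cg g01 x; have p0 : p != 0 by rewrite gt_eqF// (lt_le_trans _ p1).
have [gx|gxN] := eqVneq (g x) 0; last first.
  have gx0 : 0 < g x by rewrite lt_def gxN; have /andP[] := g01 x.
  apply: (@continuous_comp _ _ _ g (fun t : R => t `^ p)); first exact: cg.
  have [d _] := is_derive1_powR p gx0.
  exact/differentiable_continuous/derivable1_diffP.
apply/(@cvgrPdist_le R R Rn (nbhs x) _ (fun y => g y `^ p) (g x `^ p)) => e e0.
have /(@cvgrPdist_le R R Rn (nbhs x)) /(_ e e0) := cg x.
apply: filterS => y; rewrite gx powR0// !sub0r !normrN => h.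
have /andP[gy0 _] := g01 y; rewrite (ger0_norm gy0) in h.
by rewrite ger0_norm ?powR_ge0//; apply: le_trans h; exact: powR_le_id.
Qed.

Variables alpha s : R.
Hypotheses (n0 : (0 < n)%N) (alpha0 : 0 < alpha) (s1 : 1 < s) (alphan : alpha < n%:R)
  (alphas : alpha * s <= n%:R).
Local Notation cap := (@bessel_capacity R n alpha s).

Let s0 : 0 < s. Proof. exact: lt_trans s1. Qed.

(** Since [s / theta < 1], the bound on the capacities is integrable over []0, l[], and [w] never
    exceeds [l]. On []0, 1[] the power [x^(a-1)] with [a = 1 - s/theta] is at most [4 * powk a x],
    whence the constant [4 / a]. *)
Lemma L1C_norm_le (w : Rn -> R) (theta l E : R) : s < theta -> 0 < l -> 0 <= E ->
  (forall x, 0 <= w x <= l) ->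
  (forall t, 0 < t < l -> (cap [set x : Rn | (t < w x)%R] <= (E * (t / l) `^ (- (s / theta)))%:E)%E) ->
  (L1C_norm alpha s (EFin \o w) <= (4 / (1 - s / theta) * l * E)%:E)%E.
Proof.
move=> st l0 E0 wl hcap; have th0 : 0 < theta by apply: lt_trans st.
pose a := 1 - s / theta.
have a0 : 0 < a by rewrite subr_gt0 ltr_pdivrMr// mul1r.
pose H (t : R) := cap [set x : Rn | (t%:E < (abse \o (EFin \o w)) x)%E].
have HE (t : R) : H t = cap [set x : Rn | (t < w x)%R].
  congr cap; apply/seteqP; split => x /=; rewrite lte_fin ger0_norm//; by have /andP[] := wl x.
have H0 t : (0 <= H t)%E by exact: capacity_ge0.
have mH : measurable_fun setT (H : measurableTypeR R -> \bar R).
  by apply: emeasurable_nonincreasing => t t' tt'; apply: capacity_mono => x /=; apply: le_lt_trans; rewrite lee_fin.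
have pt (t : R) : 0 < t -> (H t <= (4 * E * powk a (l^-1 * t))%:E)%E.
  move=> t0; rewrite HE; have p0 : 0 <= 4 * E * powk a (l^-1 * t) by exact: mulr_ge0 (mulr_ge0 (ler0n R 4) E0) (powk_ge0 _ _).
  have [tl|lt] := ltP t l; last first.
    rewrite (_ : [set x | _] = set0) ?capacity_set0 ?lee_fin//.
    apply/seteqP; split => x //=; rewrite ltNge => /negP; apply.
    by apply: le_trans lt; have /andP[] := wl x.
  apply: le_trans (hcap t _) _; first by rewrite t0.
  have tl0 : 0 < t / l by rewrite divr_gt0.
  rewrite lee_fin -mulrA mulrCA; apply: ler_wpM2l => //.
  rewrite /powk (mulrC l^-1) (_ : a - 1 = - (s / theta)); last by rewrite /a; ring.
  rewrite mulrCA; apply: ler_peMr; first exact: powR_ge0.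
  rewrite ler_pdivlMr ?exprn_gt0 ?ltr_wpDr ?powR_ge0// mul1r.
  have -> : 4 = 2 ^+ 2 :> R by rewrite expr2; ring.
  apply: lerXn2r; rewrite ?nnegrE ?addr_ge0 ?powR_ge0//.
  have -> : 2 = 1 + 1 :> R by ring.
  rewrite lerD2l.
  have e1 : (1 : R) `^ a = 1 by rewrite powR1.
  rewrite -[leRHS]e1; apply: ge0_ler_powR; rewrite ?nnegrE ?(ltW a0) ?(ltW tl0)//.
  by rewrite ler_pdivrMr// mul1r ltW.
rewrite /L1C_norm /choquet_integral.
rewrite (_ : (\int[leb]_(t in `[0%R, +oo[) _ = \int[leb]_(t in D0) H t)%E); last first.
  by rewrite -integral_itv_obnd_cbnd//; exact: measurable_funTS.
pose f (t : measurableTypeR R) := (4 * E * powk a (l^-1 * t))%:E.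
have mf : measurable_fun setT f.
  apply/measurable_EFinP; apply: measurable_funM => //.
  by apply: (measurableT_comp (measurable_powk a)); exact: measurable_funM.
have f0 t : (0 <= f t)%E by rewrite lee_fin; exact: mulr_ge0 (mulr_ge0 (ler0n R 4) E0) (powk_ge0 _ _).
apply: (@le_trans _ _ (\int[leb]_(t in D0) f t)%E).
  apply: ge0_le_integral => //; try exact: measurable_funTS.
  by move=> t; rewrite /= in_itv/= andbT; exact: pt.
rewrite (ge0_integral_halfline_scale l0 mf f0).
have -> : (\int[leb]_(t in D0) f (l * t)%R = \int[leb]_(t in D0) ((4 * E)%:E * (powk a t)%:E))%E.
  by apply: eq_integral => t _; rewrite /f mulKf ?gt_eqF// EFinM.
rewrite ge0_integralZl//; last 3 first.
- by apply/measurable_EFinP; apply: measurable_funTS; exact: measurable_powk.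
- by move=> t _; rewrite lee_fin powk_ge0.
- by rewrite lee_fin mulr_ge0.
apply: (@le_trans _ _ (l%:E * ((4 * E)%:E * `|a|^-1%:E))%E).
  apply: lee_wpmul2l; first by rewrite lee_fin ltW.
  apply: lee_wpmul2l; first by rewrite lee_fin mulr_ge0.
  by apply: integral_powk; rewrite gt_eqF.
rewrite -!EFinM lee_fin (gtr0_norm a0) le_eqVlt; apply/orP; left; apply/eqP.
by rewrite /a; ring.
Qed.

Lemma exists_weight : exists cbar c : R, [/\ 1 <= cbar, 0 < c &
  forall K, compact K -> cap K != 0%E -> exists w : Rn -> R,
  [/\ N_weights alpha s cbar (EFin \o w), forall x, 0 <= w x &
      forall x, K x -> w x = c / fine (cap K)]].
Proof.
have nR1 : 1 <= n%:R :> R by rewrite ler1n.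
have [theta [C [c [D [th_s C1 c0 D0' pot]]]]] := potential_for_compact n0 alpha0 s1 alphan alphas.
have th0 : 0 < theta by apply: lt_trans th_s.
have th1 : 1 <= theta by apply: ltW; apply: lt_trans th_s.
pose a := 1 - s / theta.
have a0 : 0 < a by rewrite subr_gt0 ltr_pdivrMr// mul1r.
(* [L1C_norm_le] bounds the norm of the weight by [c2 * l * cap K], where [l] is its maximum. The
   choice [l = 1/(c2 cap K)] makes this [1], so the constant of the weight is [c2^-1]. *)
pose c2 := 4 / a * (D * c `^ (- s)).
have c20 : 0 < c2.
  by apply: mulr_gt0; [exact: divr_gt0|apply: mulr_gt0 => //; exact: powR_gt0].
exists ((4 * n%:R) ^+ n * C), c2^-1; split.
- apply: (@le_trans _ _ (1 * 1)); first by rewrite mulr1.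
  by apply: ler_pM => //; rewrite exprn_ege1//; lra.
- by rewrite invr_gt0.
move=> K cK capK0.
have capKf : cap K = (fine (cap K))%:E.
  by rewrite fineK// ge0_fin_numE ?capacity_ge0// capacity_compact_lty.
set k := fine (cap K) in capKf *.
have k0 : 0 < k by rewrite lt_def fine_ge0 ?capacity_ge0// andbT -eqe -capKf.
have [u [cu [bu Bu] uK uA1 ucap]] := pot K cK capK0.
have u0 := bounded_mfun_ge0 Bu.
have cu_ge0 y : 0 <= c^-1 * u y by rewrite mulr_ge0// invr_ge0 ltW.
pose v x := Num.min 1 (c^-1 * u x).
have v01 x : 0 <= v x <= 1.
  by rewrite /v le_min ler01 ge_min lexx/= mulr_ge0// invr_ge0 ltW.
have cv : continuous v.
  move=> x; apply: (@continuous_min R Rn (cst 1) (fun y => c^-1 * u y)); first exact: cst_continuous.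
  by apply: (@continuousM _ _ (cst c^-1) u); [exact: cst_continuous|exact: cu].
pose om x := v x `^ theta.
have com : continuous om by exact: continuous_powR_unit.
have om01 x : 0 <= om x <= 1.
  rewrite powR_ge0/=; apply: le_trans (powR_le_id (v01 x) th1) _; by have /andP[] := v01 x.
pose l := c2^-1 / k; have l0 : 0 < l by rewrite divr_gt0// invr_gt0.
pose w x := l * om x.
have cw : continuous w.
  by move=> x; apply: (@continuousM _ _ (cst l) om); [exact: cst_continuous|exact: com].
have w0l x : 0 <= w x <= l.
  by have /andP[omx0 omx1] := om01 x; rewrite mulr_ge0 ?(ltW l0)//= ler_piMr// ltW.
have Bw : bounded_mfun l w by split => //; exact: continuous_measurable_rV.
have Bom : bounded_mfun 1 om by split => //; exact: continuous_measurable_rV.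
have w0 x : 0 <= w x by have /andP[] := w0l x.
have w_avg j x : avg (dyad j) w x <= C * w x.
  rewrite /w (avgZ x Bom (ltW l0) (dyad_gt0 j)) [leRHS]mulrCA; apply: ler_wpM2l; first exact: ltW.
  have C0 : 0 <= C by apply: le_trans C1.
  (* If the minimum saturates at [x], the average is at most [1 = om x]. Otherwise
     [om <= (u/c)^theta] everywhere with equality at [x], and the A_1 bound of [u^theta] carries
     over. *)
  have [hv|hv] := leP 1 (c^-1 * u x).
    rewrite {2}/om (_ : v x = 1) ?powR1 ?mulr1; last exact/min_idPl.
    apply: le_trans _ C1; apply: (avg_le_sup Bom (dyad_gt0 j) ler01) => y _.
    by have /andP[] := om01 y.
  rewrite {2}/om (_ : v x = c^-1 * u x); last exact/min_idPr/ltW.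
  have cp0 : 0 <= c^-1 `^ theta by exact: powR_ge0.
  have H := @avg_affine_le _ _ _ _ om (fun y => u y `^ theta) (dyad j) 0 (c^-1 `^ theta) x Bom
    (bounded_mfun_powR Bu (ltW th0)) (dyad_gt0 j) (lexx 0) cp0.
  apply: le_trans (H _) _.
    move=> y _; rewrite add0r -powRM ?invr_ge0 ?(ltW c0)//.
    apply: ge0_ler_powR; rewrite ?nnegrE ?(ltW th0)//; [by have /andP[] := v01 y|by rewrite ge_min lexx orbT].
  by rewrite add0r powRM ?invr_ge0 ?(ltW c0)// [leRHS]mulrCA; apply: ler_wpM2l.
have norm1 : (L1C_norm alpha s (EFin \o w) <= 1)%E.
  have E0 : 0 <= D * c `^ (- s) * k by rewrite !mulr_ge0 ?powR_ge0// ltW.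
  apply: le_trans (L1C_norm_le th_s l0 E0 w0l _) _; last first.
    rewrite lee_fin -/a le_eqVlt; apply/orP; left; apply/eqP.
    have -> : 4 / a * l * (D * c `^ (- s) * k) = c2 * (l * k) by rewrite /c2; ring.
    by rewrite /l divfK ?gt_eqF// divff// gt_eqF.
  (* [w > t] forces [u > c (t/l)^(1/theta)]; the capacity bound for [u] at that level produces the
     power [(t/l)^(-s/theta)]. *)
  move=> t /andP[t0 tl]; have tl0 : 0 < t / l by exact: divr_gt0.
  have p0 : 0 < c * (t / l) `^ theta^-1 by rewrite mulr_gt0// powR_gt0.
  apply: (@le_trans _ _ (cap [set x : Rn | (c * (t / l) `^ theta^-1 < u x)%R])).
    apply: capacity_mono => x /= tw; rewrite -ltr_pdivlMl//.
    have h1 : t / l < (c^-1 * u x) `^ theta.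
      rewrite ltr_pdivrMr// mulrC; apply: lt_le_trans tw _; apply: ler_wpM2l; first exact: ltW.
      apply: ge0_ler_powR; rewrite ?nnegrE ?(ltW th0)//; [by have /andP[] := v01 x|by rewrite ge_min lexx orbT].
    have cu0 := cu_ge0 x.
    rewrite -[ltRHS](powRr1 cu0) -(mulfV (lt0r_neq0 th0)) powRrM.
    by apply: gt0_ltr_powR; rewrite ?nnegrE ?invr_gt0 ?powR_ge0// ltW.
  apply: le_trans (ucap _ p0) _; rewrite capKf -EFinM lee_fin le_eqVlt; apply/orP; left; apply/eqP.
  rewrite powRM ?(ltW c0) ?powR_ge0// -powRrM (_ : theta^-1 * - s = - (s / theta)); last by ring.
  by ring.
have a1b : A1loc_bound (EFin \o w) ((4 * n%:R) ^+ n * C).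
  split; first by rewrite mulr_ge0 ?exprn_ge0 ?mulr_ge0// (le_trans ler01).
  apply: aeW => x; rewrite /= -EFinM -mulrA.
  exact: (local_maximal_le n0 Bw (fun j => w_avg j x)).
exists w; split => //; last first.
  move=> x Kx; rewrite /w /om (_ : v x = 1) ?powR1 ?mulr1//.
  by apply/min_idPl; rewrite mulrC ler_pdivlMr// mul1r uK.
split => //.
- split; last by apply: le_lt_trans norm1 _; rewrite ltry.
  (* [w] is continuous everywhere, so the exceptional open set can be empty. *)
  move=> e e0; exists set0; split; [exact: open0|by rewrite capacity_set0 ?lte_fin|].
  apply: continuous_subspaceT => x; apply: (@cvg_EFin R _ (nbhs x) (nbhs_filter x) (EFin \o w) (w x)); first by apply: nearW => y.
  exact: cw.
- split; last by exists ((4 * n%:R) ^+ n * C).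
    by move=> x; rewrite lee_fin.
  split; first by apply/measurable_EFinP; exact: bounded_mfunM Bw.
  move=> K' cK'; have mK' := compact_measurable_rV cK'.
  rewrite (eq_integral (EFin \o w)); last by move=> x _; rewrite /= ger0_norm.
  apply: le_lt_trans (integral_bounded_le Bw mK') _.
  by rewrite lte_mul_pinfty ?lee_fin ?(ltW l0)//; exact: lebesgue_rV_compact_lty.
- by apply: ereal_inf_lbound; exists ((4 * n%:R) ^+ n * C).
Qed.

End weight_for_compact.

(** * Duality *)

Lemma emeasurable_inve {d} {T : measurableType d} {R : realType} (v : T -> \bar R) :
  measurable_fun setT v -> (forall x, 0 <= v x)%E -> measurable_fun setT (fun x => (v x)^-1%E).
Proof.
move=> mv v0; rewrite (_ : (fun x => _) = fun x => if v x == 0%E then +oo%E else ((fine (v x))^-1)%:E).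
  apply: measurable_fun_ifT => //.
    apply: (@measurable_fun_bool _ _ _ _ true).
    rewrite (_ : _ @^-1` _ = v @^-1` [set 0%E]); first by apply: mv => //; exact: emeasurable_set1.
    by apply/seteqP; split => x /= /eqP.
  apply/measurable_EFinP; apply: (measurableT_comp measurable_invr).
  exact: (measurableT_comp (fine_measurable _) mv).
apply/funext => x; have := v0 x; case: (v x) => [r r0| _|//].
  by rewrite inver eqe; case: ifPn.
by rewrite invey /= invr0.
Qed.

Section duality_upper.
Context {R : realType} {n : nat}.
Local Notation Rn := 'rV[R]_n.
Local Notation mu := (@lebesgue_rV R n).
Local Notation leb := (@lebesgue_measure R).
Variables alpha s : R.
Hypotheses (n0 : (0 < n)%N) (alpha0 : 0 < alpha) (s1 : 1 < s) (alphan : alpha < n%:R).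
Local Notation cap := (@bessel_capacity R n alpha s).

Lemma layer_cake (r : \bar R) : (0 <= r)%E ->
  (\int[leb]_t (\1_[set t : R | (0 <= t)%R /\ (t%:E < r)%E] t)%:E = r)%E.
Proof.
have mI (i : interval R) : measurable ([set` i] : set R) by exact: measurable_itv.
case: r => [r r0|_|//]; last first.
  rewrite (_ : [set t : R | _] = `[0%R, +oo[%classic); last first.
    by apply/seteqP; split => t /=; rewrite in_itv/= andbT; [case|move=> t0; rewrite ltry].
  by rewrite integral_indic// setIT [LHS]lebesgue_measure_itv/= ltry oppr0 adde0.
rewrite (_ : [set t : R | _] = `[0%R, r[%classic); last first.
  by apply/seteqP; split => t /=; rewrite in_itv/= lte_fin; [case=> -> ->|move/andP].
rewrite integral_indic// setIT [LHS]lebesgue_measure_itv/= lte_fin; case: ltP => [_|r0'].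
  by rewrite oppr0 adde0.
by congr EFin; apply/eqP; rewrite eq_le r0' andbT; move: r0; rewrite lee_fin.
Qed.

(** Tonelli on the region [S] under the graph of [w]: the slice at level [t] is the superlevel set
    [w > t], to which the hypothesis on [g] applies. *)
Lemma integral_mul_le_choquet (g : Rn -> R) (w : Rn -> \bar R) (C : R) :
  measurable_fun setT g -> (forall x, 0 <= g x) -> 0 <= C ->
  (forall E, measurable E -> \int[mu]_(x in E) (g x)%:E <= C%:E * cap E)%E ->
  measurable_fun setT w -> (forall x, 0 <= w x)%E ->
  (\int[mu]_x ((g x)%:E * w x) <= C%:E * L1C_norm alpha s w)%E.
Proof.
move=> mg g0 C0 hC mw w0.
pose S := [set z : measurableTypeR R * Rn | (0 <= z.1)%R /\ (z.1%:E < w z.2)%E].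
have mS : measurable S.
  rewrite (_ : S = (setT `&` fst @^-1` `[0%R, +oo[%classic) `&` (setT `&` [set z | (z.1%:E < w z.2)%E])).
    apply: measurableI; first by apply: measurable_fst => //; exact: measurable_itv.
    apply: measurable_lte => //; first by apply/measurable_EFinP; exact: measurable_fst.
    exact: (measurableT_comp mw measurable_snd).
  by apply/seteqP; split => -[t x] /=; rewrite in_itv/= andbT; [move=> []|move=> [[_ ?] [_ ?]]].
pose Phi (z : measurableTypeR R * Rn) : \bar R := (g z.2 * \1_S z)%:E.
have mPhi : measurable_fun setT Phi.
  apply/measurable_EFinP; apply: measurable_funM; last exact: measurable_indic.
  exact: (measurableT_comp mg measurable_snd).
have Phi0 z : (0 <= Phi z)%E by rewrite lee_fin mulr_ge0.
have -> : (\int[mu]_x ((g x)%:E * w x) = \int[mu]_x \int[leb]_t Phi (t, x))%E.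
  apply: eq_integral => x _; rewrite /Phi/=.
  under eq_integral do rewrite EFinM.
  rewrite ge0_integralZl//; last 2 first.
  - apply/measurable_EFinP; rewrite (_ : (fun t => _) = \1_S \o (fun t => (t, x))); last by [].
    by apply: measurableT_comp; [exact: measurable_indic|exact: pair2_measurable].
  - by rewrite lee_fin.
  by congr (_ * _)%E; rewrite -[LHS]layer_cake.
have <- := @fubini_tonelli _ _ _ _ _ leb mu _ mPhi Phi0.
pose H (t : R) := cap [set x : Rn | (t%:E < (abse \o w) x)%E].
have H0 t : (0 <= H t)%E by exact: capacity_ge0.
have mH : measurable_fun setT (H : measurableTypeR R -> \bar R).
  by apply: emeasurable_nonincreasing => t t' tt'; apply: capacity_mono => x /=; apply: le_lt_trans; rewrite lee_fin.
rewrite /L1C_norm /choquet_integral -[X in (_ * X)%E]/(\int[leb]_(t in `[0%R, +oo[) H t)%E.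
rewrite -ge0_integralZl; last 4 first.
- exact: measurable_itv.
- exact: measurable_funTS.
- by move=> t _.
- by rewrite lee_fin.
rewrite [leRHS]integral_mkcond.
apply: ge0_le_integral => //.
- by move=> t _; apply: integral_ge0.
- exact: measurable_fun_fubini_tonelli_F.
- apply/(measurable_restrictT _ _).1 => //; apply: measurable_funTS.
  exact: emeasurable_funM.
move=> t _; rewrite patchE; case: ifPn => [|ht]; last first.
  rewrite integral0_eq// => x _; rewrite /Phi indicE memNset ?mulr0// => -[/= t0 _].
  by move/negP: ht; apply; rewrite inE/= in_itv/= t0.
rewrite inE/= in_itv/= andbT => t0.
pose E := [set x : Rn | (t%:E < w x)%E].
have mE : measurable E.
  by have := @measurable_lte _ _ _ setT measurableT (cst t%:E) w (measurable_cst _) mw; rewrite setTI.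
apply: (@le_trans _ _ (\int[mu]_(x in E) (g x)%:E)%E).
  rewrite [leRHS]integral_mkcond; apply: ge0_le_integral => //.
  - exact: (measurableT_comp mPhi (pair1_measurable _)).
  - by apply/(measurable_restrictT _ _).1 => //; apply/measurable_EFinP; exact: measurable_funTS.
  move=> x _; rewrite patchE /Phi indicE; case: ifPn => xE.
    by rewrite lee_fin ler_piMr//; case: (_ \in _).
  by rewrite memNset ?mulr0// => -[/= _ h]; move/negP: xE; apply; rewrite inE.
apply: le_trans (hC E mE) _; apply: lee_wpmul2l => //.
by apply: capacity_mono => x /=; rewrite /E/= gee0_abs.
Qed.

Variables (cbar p : R).
Hypotheses (p1 : 1 < p).
Local Notation q := (p / (p - 1)).
Local Notation W := (@N_weights R n alpha s cbar).
Local Notation Mn := (@M_norm R n alpha s p).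

Let p0 : 0 < p. Proof. exact: lt_trans p1. Qed.
Let pm : 0 < p - 1. Proof. by rewrite subr_gt0. Qed.
Let q0 : 0 < q. Proof. exact: divr_gt0. Qed.
Let pq : p^-1 + q^-1 = 1. Proof. by field; rewrite !gt_eqF. Qed.
Let qm : q - 1 = q / p. Proof. by field; rewrite !gt_eqF. Qed.

Let m_powR_abs (r : R) (g : Rn -> R) : measurable_fun setT g ->
  measurable_fun setT (fun x => (`|g x| `^ r)%:E).
Proof.
move=> mg; apply/measurable_EFinP.
apply: (@measurableT_comp _ _ _ _ _ _ (fun y : R => y `^ r)); first exact: measurable_powR.
exact: measurableT_comp.
Qed.

(** Compact sets of zero capacity escape the supremum in [M_norm]; as they are Lebesgue null,
    integral estimates over them are trivial. *)
Lemma capacity_eq0_integral (K : set Rn) (h : Rn -> \bar R) : compact K -> cap K = 0%E ->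
  measurable_fun setT h -> (\int[mu]_(x in K) h x = 0)%E.
Proof.
move=> cK capK mh; have [C C0 hC] := lebesgue_le_capacity n0 alpha0 s1 alphan.
have muK : mu K = 0%E.
  by apply/eqP; rewrite eq_le measure_ge0 andbT; apply: le_trans (hC K cK) _; rewrite capK mule0.
have mK := compact_measurable_rV cK.
by apply: null_set_integral => //; exact: measurable_funTS.
Qed.

(** The closed unit ball has positive volume. Such a set makes the supremum in [M_norm] nonempty,
    and its union with any compact set carries a weight. *)
Lemma exists_capacity_neq0 : exists2 K : set Rn, compact K & cap K != 0%E.
Proof.
exists (cball 1); first exact: compact_cball.
apply/eqP => capK.
have := capacity_eq0_integral (@compact_cball R n 1) capK (measurable_cst 1%E).
rewrite integral_cst ?mul1e; last exact: measurable_cball.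
move=> mu0; have : (mu (ball 0%R 1%R) <= 0)%E.
  rewrite -mu0; apply: le_measure; rewrite ?inE; [exact: measurable_ball_rV|exact: measurable_cball|].
  by move=> x; rewrite -ball_normE/= sub0r normrN => /ltW.
by rewrite (lebesgue_rV_ball 0 ltr01) lee_fin leNgt vol_gt0.
Qed.

Lemma M_norm_ge0 (f : Rn -> R) : (0 <= Mn f)%E.
Proof.
have [K cK capK] := exists_capacity_neq0.
apply: (@le_trans _ _ ((\int[mu]_(x in K) (`|f x| `^ p)%:E / cap K) `^ p^-1)%E); first exact: poweR_ge0.
by apply: ereal_sup_ubound; exists K.
Qed.

Lemma M_space_integral_le (f : Rn -> R) : M_space alpha s p f -> forall E, measurable E ->
  (\int[mu]_(x in E) (`|f x| `^ p)%:E <= (fine (Mn f) `^ p)%:E * cap E)%E.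
Proof.
move=> [[mf fK] Mf] E mE; have mfp := m_powR_abs p mf.
apply: integral_le_of_compact => // K cK KE.
apply: (@le_trans _ _ ((fine (Mn f) `^ p)%:E * cap K)%E); last first.
  by apply: lee_wpmul2l; [rewrite lee_fin powR_ge0|exact: capacity_mono].
have [capK|capK] := eqVneq (cap K) 0%E.
  by rewrite (capacity_eq0_integral cK capK mfp) capK mule0.
have capKf : cap K = (fine (cap K))%:E.
  by rewrite fineK// ge0_fin_numE ?capacity_ge0// capacity_compact_lty.
set A := (\int[mu]_(x in K) _)%E.
have A0 : (0 <= A)%E by apply: integral_ge0 => x _; rewrite lee_fin powR_ge0.
have Af : A = (fine A)%:E by rewrite fineK// ge0_fin_numE// fK.
have k0 : 0 < fine (cap K) by rewrite lt_def fine_ge0 ?capacity_ge0// andbT -eqe -capKf.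
have h : ((A / cap K) `^ p^-1 <= Mn f)%E by apply: ereal_sup_ubound; exists K.
have dE : (A / cap K)%E = (fine A / fine (cap K))%:E by rewrite {1}Af capKf inver gt_eqF// EFinM.
rewrite dE poweR_EFin in h.
have M0 : (0 <= Mn f)%E by apply: le_trans h; rewrite lee_fin powR_ge0.
have Mff : Mn f = (fine (Mn f))%:E by rewrite fineK// ge0_fin_numE.
rewrite Mff lee_fin in h.
rewrite Af capKf -EFinM lee_fin -ler_pdivrMr//.
have a0 : 0 <= fine A / fine (cap K) by exact: divr_ge0 (fine_ge0 A0) (ltW k0).
rewrite -[leLHS](powRr1 a0) -(mulVf (lt0r_neq0 p0)) powRrM.
by apply: ge0_ler_powR; rewrite ?nnegrE ?powR_ge0 ?fine_ge0// ltW.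
Qed.

Definition weighted_integral (g : Rn -> R) (w : Rn -> \bar R) : \bar R :=
  \int[mu]_x ((`|g x| `^ q)%:E * (w x `^ (q - 1))^-1)%E.

Lemma integral_mul_le_weighted (f g : Rn -> R) (w : Rn -> \bar R) : M_space alpha s p f ->
  measurable_fun setT g -> W w -> (weighted_integral g w < +oo)%E ->
  (\int[mu]_x `|f x * g x|%:E <= (fine (Mn f))%:E * weighted_integral g w `^ q^-1)%E.
Proof.
move=> Mf mg Ww Ioo.
have [[mf fK] Mfoo] := Mf.
have [_ [w0 [mw wK] _] norm1 _] := Ww.
have qm0 : 0 < q - 1 by rewrite qm divr_gt0.
pose h x := ((`|g x| `^ q)%:E * (w x `^ (q - 1))^-1)%E.
have mh : measurable_fun setT h.
  apply: emeasurable_funM; first exact: m_powR_abs.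
  apply: emeasurable_inve; last by move=> x; exact: poweR_ge0.
  exact: (measurableT_comp (measurable_poweR _) mw).
have h0 x : (0 <= h x)%E by rewrite mule_ge0 ?lee_fin ?powR_ge0// inve_ge0 poweR_ge0.
have ae_h : {ae mu, forall x, h x \is a fin_num}.
  have : mu.-integrable setT h.
    by apply/integrableP; split => //; under eq_integral do rewrite gee0_abs//.
  by move=> /(integrable_ae measurableT); apply: filterS => x; exact.
(* Local integrability gives finiteness almost everywhere, one ball of the exhaustion at a time. *)
have ae_w : {ae mu, forall x, w x \is a fin_num}.
  have : {ae mu, forall x, forall k : nat, cball k%:R x -> w x \is a fin_num}.
    apply: ae_foralln => k; apply: (integrable_ae (measurable_cball _)).
    by apply/integrableP; split; [exact: measurable_funTS|apply: wK; exact: compact_cball].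
  apply: filterS => x hx; have [k _ xk] : (\bigcup_k @cball R n k%:R) x by rewrite bigcup_cball.
  exact: hx xk.
pose om x := fine (w x).
have om0 x : 0 <= om x by rewrite fine_ge0.
have mom : measurable_fun setT om by exact: (measurableT_comp (fine_measurable _) mw).
(* The weight is split as [w^(1/p) * w^(-1/p)]; since [q / p = q - 1], the [q]-th power of [F2] is
   the integrand that contains [w^(1-q)]. *)
pose F1 x := `|f x| * om x `^ p^-1.
pose F2 x := `|g x| * (om x `^ p^-1)^-1.
have mF1 : measurable_fun setT F1.
  apply: measurable_funM; first exact: measurableT_comp.
  by apply: (@measurableT_comp _ _ _ _ _ _ (fun y : R => y `^ p^-1)); [exact: measurable_powR|].
have mF2 : measurable_fun setT F2.
  apply: measurable_funM; first exact: measurableT_comp.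
  apply: (measurableT_comp measurable_invr).
  by apply: (@measurableT_comp _ _ _ _ _ _ (fun y : R => y `^ p^-1)); [exact: measurable_powR|].
have F10 x : 0 <= F1 x by rewrite mulr_ge0 ?powR_ge0.
have F20 x : 0 <= F2 x by rewrite mulr_ge0// invr_ge0 powR_ge0.
(* Where the weight vanishes its inverse is infinite, so finiteness of [h] forces [g] to vanish
   there. *)
have zero x : h x \is a fin_num -> w x \is a fin_num -> om x = 0 -> g x = 0.
  move=> hx wx omx; apply: contrapT => /eqP gN0; move: hx.
  have wx0 : w x = 0%E by rewrite -(fineK wx) -/(om x) omx.
  rewrite /h wx0 poweR_EFin powR0 ?gt_eqF// inve0 gt0_muley// lte_fin powR_gt0//.
  by rewrite normr_gt0.
have ae1 : {ae mu, forall x, setT x -> `|f x * g x|%:E = `|F1 x * F2 x|%:E}.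
  apply: filterS2 ae_h ae_w => x hx wx _.
  have [omx|omx] := eqVneq (om x) 0; first by rewrite /F2 (zero x hx wx omx) normr0 mul0r !mulr0.
  have op : 0 < om x `^ p^-1 by rewrite powR_gt0// lt_def omx om0.
  rewrite (ger0_norm (mulr_ge0 (F10 x) (F20 x))) normrM /F1 /F2 mulrACA divff ?mulr1// gt_eqF//.
have ae2 : {ae mu, forall x, setT x -> (`|(F2 x)%:E| `^ q)%E = h x}.
  apply: filterS2 ae_h ae_w => x hx wx _.
  rewrite abse_EFin ger0_norm// poweR_EFin.
  have [omx|omx] := eqVneq (om x) 0.
    by rewrite /F2 /h (zero x hx wx omx) normr0 mul0r powR0 ?mul0e// gt_eqF.
  have op : 0 < om x by rewrite lt_def omx om0.
  have wE : w x = (om x)%:E by rewrite /om fineK.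
  rewrite /h wE poweR_EFin inver gt_eqF ?powR_gt0// -EFinM; congr EFin.
  rewrite /F2 powRM// ?invr_ge0 ?powR_ge0//; congr (_ * _).
  by rewrite powRVl ?powR_ge0// -powRrM qm [p^-1 * _]mulrC.
have -> : (\int[mu]_x `|f x * g x|%:E = 'N[mu]_1[EFin \o (F1 \* F2)%R])%E.
  rewrite Lnorm1; apply: ae_eq_integral => //.
  - by apply/measurable_EFinP; apply: measurableT_comp => //; exact: measurable_funM.
  - by apply: measurableT_comp => //; apply/measurable_EFinP; exact: measurable_funM.
apply: le_trans (hoelder mu mF1 mF2 p0 q0 pq) _.
have pN0 : p != 0 by rewrite gt_eqF.
have qN0 : q != 0 by rewrite gt_eqF.
have N2 : ('N[mu]_q%:E[EFin \o F2] = weighted_integral g w `^ q^-1)%E.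
  have e := @poweR_Lnorm _ _ _ mu (EFin \o F2) q qN0.
  rewrite (_ : weighted_integral g w = 'N[mu]_q%:E[EFin \o F2] `^ q)%E; last first.
    rewrite e; apply/esym; apply: ae_eq_integral => //.
    by apply: (measurableT_comp (measurable_poweR _)); apply: measurableT_comp => //; exact/measurable_EFinP.
  by rewrite -poweRrM divff// poweRe1// Lnorm_ge0.
rewrite N2; apply: lee_wpmul2r; first exact: poweR_ge0.
have e := @poweR_Lnorm _ _ _ mu (EFin \o F1) p pN0.
have M0 : 0 <= fine (Mn f) by rewrite fine_ge0// M_norm_ge0.
have : ('N[mu]_p%:E[EFin \o F1] `^ p <= (fine (Mn f) `^ p)%:E)%E.
  rewrite e; apply: (@le_trans _ _ (\int[mu]_x ((`|f x| `^ p)%:E * w x))%E).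
    apply: ge0_le_integral => //.
    - by move=> x _; exact: poweR_ge0.
    - by apply: (measurableT_comp (measurable_poweR _)); apply: measurableT_comp => //; exact/measurable_EFinP.
    - by apply: emeasurable_funM => //; exact: m_powR_abs.
    move=> x _; rewrite abse_EFin ger0_norm// poweR_EFin /F1 powRM ?powR_ge0// -powRrM mulVf// powRr1// EFinM.
    apply: lee_wpmul2l; first by rewrite lee_fin powR_ge0.
    by rewrite /om; move: (w0 x); case: (w x) => //= r _; rewrite leey.
  have Mp0 : 0 <= fine (Mn f) `^ p by exact: powR_ge0.
  apply: le_trans (integral_mul_le_choquet _ _ Mp0 (M_space_integral_le Mf) mw w0) _.
  - by apply/measurable_EFinP; exact: m_powR_abs.
  - by move=> x; exact: powR_ge0.
  - by rewrite -[leRHS]mule1; apply: lee_wpmul2l; rewrite ?lee_fin.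
rewrite -poweR_EFin => hN.
have pi0 : 0 <= p^-1 by rewrite invr_ge0 ltW.
have Noo (y : \bar R) : (0 <= y)%E -> y \in `[0%E, +oo%E] by rewrite in_itv/= leey andbT.
have := @gt0_ler_poweR R p^-1 pi0 _ _ (Noo _ (poweR_ge0 _ _)) (Noo _ (poweR_ge0 _ _)) hN.
by rewrite -!poweRrM mulfV// !poweRe1 ?Lnorm_ge0// lee_fin.
Qed.

End duality_upper.

(** * Upper and lower bounds for the pairing *)

Section pairing_bounds.
Context {R : realType} {n : nat}.
Local Notation Rn := 'rV[R]_n.
Local Notation mu := (@lebesgue_rV R n).
Variables alpha s : R.
Hypotheses (n0 : (0 < n)%N) (alpha0 : 0 < alpha) (s1 : 1 < s) (alphan : alpha < n%:R).
Local Notation cap := (@bessel_capacity R n alpha s).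
Variables (cbar p : R).
Hypotheses (p1 : 1 < p).
Local Notation q := (p / (p - 1)).
Local Notation W := (@N_weights R n alpha s cbar).
Local Notation Nn := (@N_norm R n alpha s cbar q).
Local Notation N := (@N_space R n alpha s cbar q).
Local Notation M := (@M_space R n alpha s p).
Local Notation Mn := (@M_norm R n alpha s p).
Local Notation WI := (weighted_integral p).

Let p0 : 0 < p. Proof. exact: lt_trans p1. Qed.
Let pm : 0 < p - 1. Proof. by rewrite subr_gt0. Qed.
Let q0 : 0 < q. Proof. exact: divr_gt0. Qed.
Let qm : q - 1 = q / p. Proof. by field; rewrite !gt_eqF. Qed.

Lemma N_space_weight (g : Rn -> R) : N g -> exists2 w, W w & (WI g w < +oo)%E.
Proof.
move=> [_ /ereal_inf_lt[_ [w Ww <-] h]]; exists w => //.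
by apply: lty_poweRy h; rewrite gt_eqF// invr_gt0.
Qed.

Lemma N_norm_le (g : Rn -> R) (w : Rn -> \bar R) : W w -> (Nn g <= WI g w `^ q^-1)%E.
Proof. by move=> Ww; apply: ereal_inf_lbound; exists w. Qed.

Lemma N_norm_ge0 (g : Rn -> R) : (0 <= Nn g)%E.
Proof. by apply: le_ereal_inf_tmp => _ [w _ <-]; exact: poweR_ge0. Qed.

Lemma integral_mul_le_norms (f g : Rn -> R) : M f -> N g ->
  (\int[mu]_x `|f x * g x|%:E <= (fine (Mn f))%:E * Nn g)%E.
Proof.
move=> Mf Ng; have [mg _] := Ng.
have H w := @integral_mul_le_weighted _ _ _ _ n0 alpha0 s1 alphan cbar _ p1 f g w Mf mg.
have [w Ww woo] := N_space_weight Ng.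
(* The infimum over weights is taken after dividing by the norm of [f]; if that norm is zero, one
   weight of finite integral already shows that the left side vanishes. *)
have : 0 <= fine (Mn f) by rewrite fine_ge0//; exact: (M_norm_ge0 n0 alpha0 s1 alphan).
rewrite le_eqVlt => /orP[/eqP M0|M0].
  by rewrite -M0 mul0e; have := H w Ww woo; rewrite -M0 mul0e.
rewrite -lee_pdivrMl//; apply: le_ereal_inf_tmp => _ [w' Ww' <-].
rewrite lee_pdivrMl// -/(WI g w').
have [w'oo|] := ltP (WI g w') +oo%E; first exact: H.
by rewrite leye_eq => /eqP ->; rewrite poweRyr ?gt0_muley ?leey// ?lte_fin// gt_eqF// invr_gt0.
Qed.

Lemma integrable_mul (f g : Rn -> R) : M f -> N g ->
  mu.-integrable setT (EFin \o (fun x => f x * g x)).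
Proof.
move=> Mf Ng; apply/integrableP; split.
  by apply/measurable_EFinP; apply: measurable_funM; [case: Mf => -[]|case: Ng].
apply: le_lt_trans (integral_mul_le_norms Mf Ng) _.
rewrite lte_mul_pinfty// ?lee_fin ?fine_ge0//; last by case: Ng.
exact: (M_norm_ge0 n0 alpha0 s1 alphan).
Qed.

Lemma pairing_le (f g : Rn -> R) : M f -> N g ->
  (`|pairing f g|%:E <= (fine (Mn f))%:E * Nn g)%E.
Proof.
move=> Mf Ng; apply: le_trans (integral_mul_le_norms Mf Ng).
have h := integrable_mul Mf Ng.
have fn := integrable_fin_num measurableT h.
rewrite /pairing /Rintegral -abse_EFin fineK//.
by apply: le_abse_integral => //; exact: (measurable_int mu).
Qed.

Lemma pairing_dual (f : Rn -> R) : M f -> @N_dual R n alpha s cbar q (pairing f).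
Proof.
move=> Mf; split; last by exists (fine (Mn f)) => g; exact: pairing_le.
move=> a g h Ng Nh; rewrite /pairing -RintegralZl//; last exact: integrable_mul.
rewrite -RintegralD//; last 2 first.
- rewrite (_ : EFin \o _ = (fun x => a%:E * (EFin \o (fun x => (f x * g x)%R)) x)%E); last first.
    by apply/funext => x.
  by apply: integrableZl => //; exact: integrable_mul.
- exact: integrable_mul.
by apply: eq_Rintegral => x _; rewrite mulrDr mulrCA.
Qed.

Lemma N_dual_norm_pairing_le (f : Rn -> R) : M f ->
  (@N_dual_norm R n alpha s cbar q (pairing f) <= Mn f)%E.
Proof.
move=> Mf; apply: ge_ereal_sup => _ [g [Ng g1] <-].
apply: le_trans (pairing_le Mf Ng) _.
have M0 : (0 <= Mn f)%E by exact: (M_norm_ge0 n0 alpha0 s1 alphan).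
rewrite -[leRHS]mule1 fineK; last by rewrite ge0_fin_numE//; case: Mf.
exact: lee_wpmul2l.
Qed.

Variable c : R.
Hypotheses (c0 : 0 < c) (weightP : forall K : set Rn, compact K -> cap K != 0%E ->
  exists w : Rn -> R, [/\ W (EFin \o w), forall x, 0 <= w x &
    forall x, K x -> w x = c / fine (cap K)]).

Definition test_fun (g : Rn -> R) (K : set Rn) : Prop :=
  [/\ measurable_fun setT g, exists B, forall x, `|g x| <= B & forall x, ~ K x -> g x = 0].

Let measurable_powR_abs (r : R) (g : Rn -> R) : measurable_fun setT g ->
  measurable_fun setT (fun x => `|g x| `^ r).
Proof.
move=> mg; apply: (@measurableT_comp _ _ _ _ _ _ (fun y : R => y `^ r)); first exact: measurable_powR.
exact: measurableT_comp.
Qed.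

Lemma capacity_gt0_fin (K : set Rn) : compact K -> cap K != 0%E ->
  0 < fine (cap K) /\ cap K = (fine (cap K))%:E.
Proof.
move=> cK K0; have e : cap K = (fine (cap K))%:E.
  by rewrite fineK// ge0_fin_numE ?capacity_ge0// capacity_compact_lty.
by split => //; rewrite lt_def fine_ge0 ?capacity_ge0// andbT -eqe -e.
Qed.

(** The weight equals [c / cap K] on [K] and the integrand vanishes off [K] with [g], so the
    weighted integral is a multiple of the plain one. *)
Lemma N_norm_le_supported (g : Rn -> R) (K : set Rn) : compact K -> cap K != 0%E ->
  measurable_fun setT g -> (forall x, ~ K x -> g x = 0) ->
  (Nn g <= ((((c / fine (cap K)) `^ (q - 1))^-1)%:E * \int[mu]_x (`|g x| `^ q)%:E) `^ q^-1)%E.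
Proof.
move=> cK K0 mg gK; have [w [Ww w0 wK]] := weightP cK K0.
have [k0 _] := capacity_gt0_fin cK K0.
have t0 : 0 < c / fine (cap K) by exact: divr_gt0.
apply: le_trans (N_norm_le g Ww) _; rewrite le_eqVlt; apply/orP; left; apply/eqP; congr (_ `^ _)%E.
rewrite /weighted_integral -ge0_integralZl//; last 2 first.
- by apply/measurable_EFinP; exact: measurable_powR_abs.
- by rewrite lee_fin invr_ge0 powR_ge0.
apply: eq_integral => x _; have [xK|xK] := pselect (K x).
  by rewrite /= (wK x xK) inver gt_eqF ?powR_gt0// muleC.
by rewrite (gK x xK) normr0 powR0 ?gt_eqF// mul0e mule0.
Qed.

(** [K] itself may have zero capacity, and then carries no weight; hence the union with a compact
    [K1] of nonzero capacity. *)
Lemma N_space_test (g : Rn -> R) (K : set Rn) : compact K -> test_fun g K -> N g.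
Proof.
move=> cK [mg [B gB] gK]; split => //.
have [K1 cK1 K10] := exists_capacity_neq0 n0 alpha0 s1 alphan.
have cU : compact (K `|` K1) by exact: compactU.
have U0 : cap (K `|` K1) != 0%E.
  apply: contra K10 => /eqP h; rewrite eq_le capacity_ge0 andbT -h.
  exact: capacity_mono.
have gU x : ~ (K `|` K1) x -> g x = 0 by move=> h; apply: gK => Kx; apply: h; left.
apply: le_lt_trans (N_norm_le_supported cU U0 mg gU) _.
apply: poweR_lty; rewrite lte_mul_pinfty// ?lee_fin ?invr_ge0 ?powR_ge0//.
have mU := compact_measurable_rV cU.
have B0 : 0 <= B by apply: le_trans (gB 0).
apply: (@le_lt_trans _ _ (\int[mu]_(x in K `|` K1) (B `^ q)%:E)%E).
  rewrite [leRHS]integral_mkcond; apply: ge0_le_integral => //.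
  - by apply/measurable_EFinP; exact: measurable_powR_abs.
  - by apply/(measurable_restrictT _ _).1 => //; exact: measurable_cst.
  move=> x _; rewrite patchE; case: ifPn => [_|xU].
    by rewrite lee_fin; apply: ge0_ler_powR; rewrite ?nnegrE// ltW.
  by rewrite gU ?normr0 ?powR0 ?gt_eqF// => /mem_set h; rewrite h in xU.
rewrite integral_cst// lte_mul_pinfty ?lee_fin ?powR_ge0//.
exact: lebesgue_rV_compact_lty.
Qed.

(* Test with a multiple of [|f|^(p-1) sgn f] on [K], restricted to [|f| <= m]; then [m -> oo]. *)
Lemma integral_pow_le_of_test (f : Rn -> R) (B : R) : measurable_fun setT f -> 0 <= B ->
  (forall g K, compact K -> test_fun g K -> (Nn g <= 1)%E -> `|pairing f g| <= B) ->
  forall K, compact K -> cap K != 0%E ->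
  (\int[mu]_(x in K) (`|f x| `^ p)%:E <= (B `^ p * (fine (cap K) / c))%:E)%E.
Proof.
move=> mf B0 hB K cK K0; have [k0 _] := capacity_gt0_fin cK K0.
pose t := c / fine (cap K); have t0 : 0 < t by exact: divr_gt0.
have mK := compact_measurable_rV cK.
pose F (m : nat) := K `&` [set x | `|f x| <= m%:R].
have mF m : measurable (F m).
  apply: measurableI => //; rewrite (_ : [set x | _] = setT `&` (Num.norm \o f) @^-1` `]-oo, m%:R]%classic); last first.
    by apply/seteqP; split => x /=; rewrite in_itv/=; [move=> ?; split|case].
  by apply: (measurableT_comp _ mf) => //; exact: measurable_itv.
have ndF : {homo F : n m / (n <= m)%N >-> (n <= m)%O}.
  move=> i j ij; apply/subsetPset => x [Kx /= h]; split => //=.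
  by apply: le_trans h _; rewrite ler_nat.
have FK : \bigcup_m F m = K.
  apply/seteqP; split => x; first by case=> m _ [].
  move=> Kx; exists (Num.truncn `|f x|).+1 => //; split => //=.
  exact/ltW/truncnS_gt.
have mfp : measurable_fun setT (fun x => (`|f x| `^ p)%:E).
  by apply/measurable_EFinP; exact: measurable_powR_abs.
rewrite -{1}FK.
have /cvg_lim <- // := @ge0_nondecreasing_set_cvg_integral _ _ _ F (fun x => (`|f x| `^ p)%:E) mu ndF mF
   (fun k => measurable_funTS mfp) (fun k x _ => powR_ge0 _ _).
apply: lime_le.
  apply: ereal_nondecreasing_is_cvgn => i j ij; apply: ge0_subset_integral => //.
  - exact: measurable_funTS.
  - exact/subsetPset/ndF.
apply: nearW => m.
pose g0 x := \1_(F m) x * (f x * `|f x| `^ (p - 2)).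
have fp x : `|f x * `|f x| `^ (p - 2)| = `|f x| `^ (p - 1).
  have [->|fx] := eqVneq (f x) 0; first by rewrite mul0r normr0 powR0// gt_eqF.
  rewrite normrM (ger0_norm (powR_ge0 _ _)) mulrC (_ : p - 2 = (p - 1) - 1); last by ring.
  by rewrite -powR_pred// normr_gt0.
have mg0 : measurable_fun setT g0.
  apply: measurable_funM; first exact: measurable_indic.
  by apply: measurable_funM => //; exact: measurable_powR_abs.
set A := (\int[mu]_(x in F m) _)%E.
have A0 : (0 <= A)%E by apply: integral_ge0 => x _; rewrite lee_fin powR_ge0.
have Aoo : (A < +oo)%E.
  apply: (@le_lt_trans _ _ (\int[mu]_(x in F m) (m%:R `^ p)%:E)%E).
    apply: ge0_le_integral => //.
    - exact: measurable_funTS.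
    - by move=> x [_ /= h]; rewrite lee_fin; apply: ge0_ler_powR; rewrite ?nnegrE// ltW.
  rewrite integral_cst// lte_mul_pinfty ?lee_fin ?powR_ge0//.
  apply: le_lt_trans (lebesgue_rV_compact_lty cK); apply: le_measure; rewrite ?inE//.
  exact: subIsetl.
have AI : (\int[mu]_x (\1_(F m) x * `|f x| `^ p)%:E = A)%E.
  rewrite /A [RHS]integral_mkcond; apply: eq_integral => x _; rewrite patchE indicE.
  by case: ifPn => _; rewrite ?mul1r ?mul0r.
have AE : A = (fine A)%:E by rewrite fineK// ge0_fin_numE.
rewrite AE lee_fin -ler_pdivrMr ?divr_gt0// invf_div -/t.
have : 0 <= fine A by exact: fine_ge0.
rewrite le_eqVlt => /orP[/eqP <-|a0]; first by rewrite mul0r powR_ge0.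
set a := fine A in AE a0 *.
have at0 : 0 < a * t by exact: mulr_gt0.
(* With the factor [u / a] the pairing of the test function with [f] is [u], and its norm is at most
   one because [t^(1-q) (u/a)^q a = 1], as [u^q = (a t)^(q-1)]. Thus [u <= B], that is
   [a t <= B^p]. *)
pose u := (a * t) `^ p^-1; have u0 : 0 < u by exact: powR_gt0.
have up : u `^ p = a * t by rewrite -powRrM mulVf ?gt_eqF// powRr1// ltW.
rewrite -up; apply: ge0_ler_powR; rewrite ?nnegrE ?(ltW p0) ?(ltW u0)//.
pose g x := u / a * g0 x.
have ua0 : 0 <= u / a by rewrite divr_ge0 ?ltW.
have tg : test_fun g K.
  split.
  - exact: measurable_funM.
  - exists (u / a * m%:R `^ (p - 1)) => x; rewrite normrM (ger0_norm ua0); apply: ler_wpM2l => //.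
    rewrite /g0 normrM fp indicE; case: (boolP (x \in F m)) => [|_].
      rewrite inE => -[_ /= h]; rewrite normr1 mul1r; apply: ge0_ler_powR; rewrite ?nnegrE//.
      exact: ltW.
    by rewrite normr0 mul0r powR_ge0.
  - by move=> x Kx; rewrite /g /g0 indicE memNset ?mul0r ?mulr0// => -[].
have pg : pairing f g = u.
  rewrite /pairing (_ : (fun x => f x * g x) = fun x : Rn => (u / a) * (\1_(F m) x * `|f x| `^ p)); last first.
    apply/funext => x; rewrite /g /g0 [LHS]mulrCA; congr (_ * _); rewrite [LHS]mulrCA; congr (_ * _).
    have [->|fx] := eqVneq (f x) 0; first by rewrite mul0r normr0 powR0// gt_eqF.
    have fx0 : 0 < `|f x| by rewrite normr_gt0.
    rewrite mulrA -expr2 -real_normK ?num_real// -(powR_mulrn 2 (normr_ge0 _)) -powRD; last by rewrite (gt_eqF fx0) implybT.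
    by congr (_ `^ _); ring.
  rewrite /Rintegral; under eq_integral do rewrite EFinM.
  rewrite ge0_integralZl//; last first.
    by apply/measurable_EFinP; apply: measurable_funM; [exact: measurable_indic|exact: measurable_powR_abs].
  by rewrite AI AE /= divfK// gt_eqF.
have := hB g K cK tg; rewrite pg ger0_norm; last exact: ltW.
apply; have [_ _ gK] := tg.
have mg : measurable_fun setT g by case: tg.
apply: le_trans (N_norm_le_supported cK K0 mg gK) _.
rewrite (_ : \int[mu]_x _ = ((u / a) `^ q * a)%:E)%E; last first.
  transitivity (\int[mu]_x (((u / a) `^ q)%:E * (\1_(F m) x * `|f x| `^ p)%:E))%E.
    apply: eq_integral => x _; rewrite -EFinM; congr EFin.
    rewrite /g normrM (ger0_norm ua0) (powRM _ ua0 (normr_ge0 _)); congr (_ * _).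
    rewrite /g0 normrM fp indicE; case: (x \in F m); last by rewrite normr0 !mul0r powR0// gt_eqF.
    by rewrite normr1 !mul1r -powRrM mulrCA divff ?mulr1// gt_eqF.
  rewrite ge0_integralZl//; last 2 first.
  - by apply/measurable_EFinP; apply: measurable_funM; [exact: measurable_indic|exact: measurable_powR_abs].
  - by rewrite lee_fin powR_ge0.
  by rewrite AI AE.
rewrite -EFinM -/t (_ : _ * _ = 1) ?poweR_EFin ?powR1//.
have tq0 : 0 < t `^ (q - 1) by exact: powR_gt0.
have aq0 : 0 < a `^ (q - 1) by exact: powR_gt0.
have uq : u `^ q = a `^ (q - 1) * t `^ (q - 1).
  by rewrite -powRrM [p^-1 * _]mulrC -qm powRM// ltW.
have ai : 0 <= a^-1 by rewrite invr_ge0 ltW.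
rewrite powRM// ?(ltW u0)// powRVl ?(ltW a0)// uq [a `^ q]powR_pred//.
by field; rewrite !gt_eqF.
Qed.

(** Serves twice: with the bound of a functional it places the density found for it in [M], and with
    the operator norm of the pairing it gives the lower norm estimate. *)
Lemma M_norm_le_of_test (f : Rn -> R) (B : R) : measurable_fun setT f -> 0 <= B ->
  (forall g K, compact K -> test_fun g K -> (Nn g <= 1)%E -> `|pairing f g| <= B) ->
  M f /\ ((c `^ p^-1)%:E * Mn f <= B%:E)%E.
Proof.
move=> mf B0 hB; have H := integral_pow_le_of_test mf B0 hB.
have cp0 : 0 < c `^ p^-1 by exact: powR_gt0.
have Mle : ((c `^ p^-1)%:E * Mn f <= B%:E)%E.
  rewrite -lee_pdivlMl//; apply: ge_ereal_sup => _ [K [cK K0] <-].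
  have [k0 kE] := capacity_gt0_fin cK K0.
  have k' : 0 < fine (cap K) / c by exact: divr_gt0.
  have Noo (y : \bar R) : (0 <= y)%E -> y \in `[0%E, +oo%E] by rewrite in_itv/= leey andbT.
  have I0 : (0 <= \int[mu]_(x in K) (`|f x| `^ p)%:E)%E.
    by apply: integral_ge0 => x _; rewrite lee_fin powR_ge0.
  have ci0 : 0 <= c^-1 by rewrite invr_ge0 ltW.
  have Bc0 : 0 <= B `^ p / c by rewrite mulr_ge0// powR_ge0.
  have h : (\int[mu]_(x in K) (`|f x| `^ p)%:E / cap K <= (B `^ p / c)%:E)%E.
    rewrite kE inver gt_eqF// lee_pdivrMr//; apply: le_trans (H K cK K0) _.
    by rewrite -EFinM lee_fin le_eqVlt; apply/orP; left; apply/eqP; rewrite -[RHS]mulrA [c^-1 * _]mulrC.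
  have pi0 : 0 <= p^-1 by rewrite invr_ge0 ltW.
  apply: le_trans (gt0_ler_poweR pi0 (Noo _ _) (Noo _ _) h) _.
  - by rewrite mule_ge0// inve_ge0 capacity_ge0.
  - by rewrite lee_fin.
  rewrite poweR_EFin -EFinM lee_fin le_eqVlt; apply/orP; left; apply/eqP.
  rewrite powRM ?powR_ge0// -powRrM mulfV ?gt_eqF// powRr1// powRVl ?(ltW c0)//.
  by rewrite mulrC.
split => //; split; last first.
  rewrite ltNge leye_eq; apply/negP => /eqP h; move: Mle.
  by rewrite h gt0_muley ?lte_fin.
split => // K cK; have [K0|K0] := eqVneq (cap K) 0%E.
  rewrite (capacity_eq0_integral n0 alpha0 s1 alphan cK K0)//.
  by apply/measurable_EFinP; exact: measurable_powR_abs.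
by apply: le_lt_trans (H K cK K0) _; rewrite ltry.
Qed.

End pairing_bounds.

(** * Densities of absolutely continuous set functions *)

Section set_function_density.
Context d (T : measurableType d) (R : realType).
Variables (mu : {sigma_finite_measure set T -> \bar R}) (S : set T) (ell : set T -> R).
Hypotheses (mS : measurable S) (muS : (mu S < +oo)%E).
Hypothesis ellU : forall A B, measurable A -> measurable B -> A `<=` S -> B `<=` S ->
  [disjoint A & B] -> ell (A `|` B) = ell A + ell B.
Hypothesis ell_continuous : forall e : R, 0 < e -> exists2 del : R, 0 < del &
  forall A, measurable A -> A `<=` S -> (mu A < del%:E)%E -> `|ell A| <= e.

Let nu (E : set T) : \bar R := (ell (E `&` S))%:E.

Let ell0 : ell set0 = 0.
Proof.
have d0 : [disjoint (set0 : set T) & (set0 : set T)] by apply/disj_setPS; rewrite set0I.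
have := ellU measurable0 measurable0 (@sub0set T S) (@sub0set T S) d0.
by rewrite setU0 => /eqP; rewrite -subr_eq0 opprD addNKr oppr_eq0 => /eqP.
Qed.

Let nu0 : nu set0 = 0%E. Proof. by rewrite /nu set0I ell0. Qed.

(** Finite additivity turns the partial sums into [ell (A 0) - ell (A k)], where the tails [A k]
    decrease to the empty set. Their measure tends to zero because [S] has finite measure, and
    [ell_continuous] concludes. *)
Let nu_sigma_additive : semi_sigma_additive nu.
Proof.
move=> F mF tF mUF.
pose A k := (\bigcup_(i in [set i | (k <= i)%N]) F i) `&` S.
have mA k : measurable (A k) by apply: measurableI => //; exact: bigcup_measurable.
have AS k : A k = (F k `&` S) `|` A k.+1.
  apply/seteqP; split => x.
    move=> [[i /= ki Fi] Sx]; move: ki; rewrite leq_eqVlt => /orP[/eqP ->|ki]; first by left.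
    by right; split => //; exists i.
  by move=> [[Fx Sx]|[[i /= ki Fi] Sx]]; split => //; [exists k => //=|exists i => //=; exact: ltnW].
have sumE k : (\sum_(0 <= i < k) nu (F i) = (ell (A 0%N) - ell (A k))%:E)%E.
  elim: k => [|k IH]; first by rewrite big_geq// subrr.
  rewrite big_nat_recr//= IH /nu -EFinD; congr EFin.
  rewrite (AS k) ellU//; first by ring.
  - exact: measurableI.
  - exact: subIsetr.
  - apply/disj_setPS => x [[Fk _] [[i /= ki Fi] _]].
    have : k = i by apply: tF => //; exists x.
    by move=> e; move: ki; rewrite e ltnn.
have A0 : A 0%N = (\bigcup_i F i) `&` S by congr (_ `&` _); congr (bigcup _ _); apply/seteqP; split.
under eq_fun do rewrite sumE.
rewrite /nu -A0; apply: cvg_EFin; first exact: nearW.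
rewrite /=; apply/cvgrPdist_le => e e0; have [del del0 hd] := ell_continuous e0.
have Aoo : (mu (A 0%N) < +oo)%E.
  by apply: le_lt_trans muS; apply: le_measure; rewrite ?inE//; exact: subIsetr.
have ndA : {homo A : n m / (n <= m)%N >-> (m <= n)%O}.
  move=> i j ij; apply/subsetPset => x [[k /= jk Fk] Sx]; split => //.
  by exists k => //=; exact: leq_trans jk.
have capA : \bigcap_k A k = set0.
  apply/seteqP; split => x // Ax; have [[i _ Fi] _] := Ax 0%N I.
  have [[j /= ij Fj] _] := Ax i.+1 I.
  have : i = j by apply: tF => //; exists x.
  by move=> ee; move: ij; rewrite ee ltnn.
have := @nonincreasing_cvg_mu _ _ _ mu A Aoo mA.
rewrite capA measure0 => /(_ measurable0 ndA) h.
have near0 : \forall k \near \oo, (mu (A k) < del%:E)%E := h _ (nbhs_open_ereal_lt (f := fun=> del) del0).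
apply: filterS near0 => k /= hk.
rewrite opprB addrC subrK; apply: hd => //; exact: subIsetr.
Qed.

HB.instance Definition _ := isCharge.Build _ _ _ nu nu0 (fun _ _ => isT) nu_sigma_additive.

Lemma set_function_density : exists f : T -> R, mu.-integrable setT (EFin \o f) /\
  forall A, measurable A -> A `<=` S -> (ell A)%:E = (\int[mu]_(x in A) (f x)%:E)%E.
Proof.
have dom : nu `<< mu.
  apply/null_content_dominatesP => A mA A0; rewrite /nu; congr EFin.
  have mAS : measurable (A `&` S) by exact: measurableI.
  have AS0 : mu (A `&` S) = 0%E.
    by apply/eqP; rewrite eq_le measure_ge0 andbT -A0; apply: le_measure; rewrite ?inE//; exact: subIsetl.
  apply/eqP; rewrite -normr_eq0 eq_le normr_ge0 andbT; apply/ler_addgt0Pl => e e0.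
  rewrite addr0; have [del del0 hd] := ell_continuous e0; apply: hd; [exact: mAS|exact: subIsetr|by rewrite AS0 lte_fin].
pose f x := fine (Radon_Nikodym nu mu x).
have fE x : (f x)%:E = Radon_Nikodym nu mu x by rewrite fineK// Radon_Nikodym_fin_num.
exists f; split.
  by rewrite (_ : EFin \o f = Radon_Nikodym nu mu);
    [exact: Radon_Nikodym_integrable|apply/funext => x; exact: fE].
move=> A mA AS; under eq_integral do rewrite fE.
transitivity (nu A); last exact: Radon_Nikodym_integral.
by rewrite /nu setIidl.
Qed.

End set_function_density.

Lemma le0_of_geometric {R : realType} (a D : R) : (forall k, a <= D / 2 ^+ k) -> a <= 0.
Proof.
move=> h; rewrite leNgt; apply/negP => a0.
have := upper_nthrootP (leqnn (Num.Def.archi_bound (D / a))).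
have := h (Num.Def.archi_bound (D / a)); set k := Num.Def.archi_bound _.
rewrite ltr_pdivrMr// ler_pdivlMr ?exprn_gt0// mulrC => h1 h2.
by have := le_lt_trans h1 h2; rewrite ltxx.
Qed.

(** * Functionals on bounded functions supported in a compact set *)

Section representation.
Context {R : realType} {n : nat}.
Local Notation Rn := 'rV[R]_n.
Local Notation mu := (@lebesgue_rV R n).
Variables alpha s : R.
Hypotheses (n0 : (0 < n)%N) (alpha0 : 0 < alpha) (s1 : 1 < s) (alphan : alpha < n%:R).
Local Notation cap := (@bessel_capacity R n alpha s).
Variables (cbar p : R).
Hypotheses (p1 : 1 < p).
Local Notation q := (p / (p - 1)).
Local Notation W := (@N_weights R n alpha s cbar).
Local Notation Nn := (@N_norm R n alpha s cbar q).
Variable c : R.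
Hypotheses (c0 : 0 < c) (weightP : forall K : set Rn, compact K -> cap K != 0%E ->
  exists w : Rn -> R, [/\ W (EFin \o w), forall x, 0 <= w x &
    forall x, K x -> w x = c / fine (cap K)]).
Local Notation ballr m := (ball (0 : Rn) (m%:R : R)).

Let p0 : 0 < p. Proof. exact: lt_trans p1. Qed.
Let pm : 0 < p - 1. Proof. by rewrite subr_gt0. Qed.
Let q0 : 0 < q. Proof. exact: divr_gt0. Qed.

Lemma poweR_le (a b : \bar R) (r : R) : 0 <= r -> (0 <= a)%E -> (a <= b)%E -> (a `^ r <= b `^ r)%E.
Proof.
move=> r0 a0 ab; apply: gt0_ler_poweR => //; rewrite in_itv/= leey andbT//.
exact: le_trans ab.
Qed.

(** On a fixed compact set the norm of [N] is dominated by a multiple of the [L^q] norm; this is the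
    source of the absolute continuity of functionals. *)
Lemma N_norm_le_compact (K : set Rn) : compact K -> exists2 D : R, 0 <= D &
  forall g, test_fun g K -> (Nn g <= (D%:E * \int[mu]_x (`|g x| `^ q)%:E) `^ q^-1)%E.
Proof.
move=> cK; have [K1 cK1 K10] := exists_capacity_neq0 n0 alpha0 s1 alphan.
have cU : compact (K `|` K1) by exact: compactU.
have U0 : cap (K `|` K1) != 0%E.
  apply: contra K10 => /eqP h; rewrite eq_le capacity_ge0 andbT -h.
  exact: capacity_mono.
exists ((c / fine (cap (K `|` K1))) `^ (q - 1))^-1 => [|g [mg _ gK]]; first by rewrite invr_ge0 powR_ge0.
have gU x : ~ (K `|` K1) x -> g x = 0 by move=> h; apply: gK => Kx; apply: h; left.
exact: (N_norm_le_supported alpha0 s1 alphan p1 c0 weightP cU U0 mg gU).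
Qed.

Lemma ball_sub_cball (m : nat) : ballr m `<=` @cball R n m%:R.
Proof. by move=> x; rewrite -ball_normE/= sub0r normrN => /ltW. Qed.

Lemma test_fun_indic (A K : set Rn) : measurable A -> A `<=` K -> test_fun (\1_A : Rn -> R) K.
Proof.
move=> mA AK; split; first exact: measurable_indic.
  by exists 1 => x; rewrite indicE; case: (_ \in _); rewrite ?normr1 ?normr0.
by move=> x Kx; rewrite indicE memNset// => /AK.
Qed.

Lemma integral_indic_powR (A : set Rn) : measurable A ->
  (\int[mu]_x (`|\1_A x : R| `^ q)%:E = mu A)%E.
Proof.
move=> mA; rewrite -(setIT A) -integral_indic// setIT; apply: eq_integral => x _; rewrite indicE.
by case: (_ \in _); rewrite ?normr1 ?normr0 ?powR1 ?powR0// gt_eqF.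
Qed.

Lemma linear_test_fun (K : set Rn) (a : R) (g h : Rn -> R) :
  test_fun g K -> test_fun h K -> test_fun (fun x => a * g x + h x) K.
Proof.
move=> [mg [B gB] gK] [mh [B' hB] hK]; split.
- by apply: measurable_funD => //; exact: measurable_funM.
- exists (`|a| * B + B') => x; apply: le_trans (ler_normD _ _) _.
  by rewrite normrM lerD// ler_wpM2l.
- by move=> x Kx; rewrite gK// hK// mulr0 addr0.
Qed.

Lemma test_fun0 (K : set Rn) : test_fun (fun=> 0 : R) K.
Proof. by split => //; exists 0 => x; rewrite normr0. Qed.

(* Binary digits: [T g = T (2 g - 1_{g >= 1/2}) / 2] for [0 <= g <= 1]. *)
Lemma eq0_of_indicators (K : set Rn) (T : (Rn -> R) -> R) (D : R) : measurable K ->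
  (forall a g h, test_fun g K -> test_fun h K -> T (fun x => a * g x + h x) = a * T g + T h) ->
  (forall g, test_fun g K -> (forall x, `|g x| <= 1) -> `|T g| <= D) ->
  (forall A, measurable A -> A `<=` K -> T \1_A = 0) ->
  forall g, test_fun g K -> T g = 0.
Proof.
move=> mK TD Tb T0.
(* Each digit halves the value, so [k] digits turn the uniform bound [D] into [D / 2^k]; the
   remainder [2 g - 1_A] again takes values in [[0, 1]]. *)
have unit_case k g : test_fun g K -> (forall x, 0 <= g x <= 1) -> `|T g| <= D / 2 ^+ k.
  elim: k g => [|k IH] g tg g01.
    by rewrite expr0 divr1; apply: Tb => // x; have /andP[g0 g1] := g01 x; rewrite ger0_norm.
  have [mg _ gK] := tg.
  pose A := [set x : Rn | (1 / 2 <= g x)%R].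
  have mA : measurable A.
    rewrite (_ : A = setT `&` g @^-1` `[1 / 2, +oo[%classic); last first.
      by apply/seteqP; split => x /=; rewrite in_itv/= andbT; [move=> ?; split|case].
    by apply: mg => //; exact: measurable_itv.
  have AK : A `<=` K.
    by move=> x Ax; apply: contrapT => /gK gx; move: Ax; rewrite /A/= gx; lra.
  have tA := test_fun_indic mA AK.
  have e : T g = 2^-1 * T (fun x => 2 * g x + (-1 * \1_A x + 0)).
    rewrite TD//; last by apply: linear_test_fun => //; exact: test_fun0.
    rewrite (TD (-1) _ (fun=> 0) tA (test_fun0 K)) (T0 A mA AK).
    have -> : T (fun=> 0) = 0.
      by have := T0 set0 measurable0 (@sub0set _ _); rewrite indic0.
    by rewrite mulr0 !addr0 mulrA mulVf// mul1r.
  rewrite e normrM exprS invfM [leRHS]mulrCA (ger0_norm (_ : 0 <= 2^-1)) ?invr_ge0//.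
  apply: ler_wpM2l; first by rewrite invr_ge0.
  apply: IH.
    by do 2?[apply: linear_test_fun => //]; exact: test_fun0.
  move=> x; have /andP[g0 g1] := g01 x; rewrite indicE.
  have [xA|xA] := boolP (x \in A).
    by move: xA; rewrite inE /A/= => h; lra.
  have : g x < 1 / 2 by rewrite ltNge; apply: contra xA => h; rewrite inE.
  by move=> h; rewrite /=; lra.
have zero_unit g : test_fun g K -> (forall x, 0 <= g x <= 1) -> T g = 0.
  move=> tg g01; apply/eqP; rewrite -normr_le0; apply: (le0_of_geometric (D := D)) => k.
  exact: unit_case.
move=> g tg; have [mg [B gB] gK] := tg.
have tK := test_fun_indic mK (@subset_refl _ K).
pose B1 := `|B| + 1; have B10 : 0 < B1 by rewrite ltr_wpDl.
have gB1 x : `|g x| <= B1.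
  by apply: le_trans (gB x) _; apply: le_trans (ler_norm _) _; rewrite lerDl.
(* Affine normalisation to [[0, 1]]: on [K] it is [(g / B1 + 1) / 2]. The trailing zero function
   gives the expression the shape required by the linearity hypothesis [TD]. *)
pose h x := (2 * B1)^-1 * g x + (2^-1 * \1_K x + 0).
have th : test_fun h K.
  by do 2?[apply: linear_test_fun => //]; exact: test_fun0.
have h01 x : 0 <= h x <= 1.
  rewrite /h indicE; have [xK|xK] := boolP (x \in K); last first.
    by rewrite gK ?mulr0 ?addr0 ?lexx ?ler01// => /mem_set h'; rewrite h' in xK.
  have := gB1 x; rewrite ler_norml => /andP[l u].
  have l' : - 2^-1 <= (2 * B1)^-1 * g x.
    by rewrite mulrC ler_pdivlMr ?mulr_gt0// mulNr mulrA mulVf// mul1r.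
  have u' : (2 * B1)^-1 * g x <= 2^-1.
    by rewrite mulrC ler_pdivrMr ?mulr_gt0// mulrA mulVf// mul1r.
  by rewrite /=; lra.
have := zero_unit h th h01.
rewrite /h TD//; last by apply: linear_test_fun => //; exact: test_fun0.
rewrite TD//; last exact: test_fun0.
rewrite T0// (zero_unit (fun=> 0))//; last 2 first.
- exact: test_fun0.
- by move=> x; rewrite lexx ler01.
rewrite mulr0 !addr0 => /eqP; rewrite mulf_eq0 invr_eq0 mulf_eq0 (gt_eqF B10) orbF.
by rewrite pnatr_eq0/= => /eqP.
Qed.

End representation.

(** * Representation of bounded functionals *)

Section riesz.
Context {R : realType} {n : nat}.
Local Notation Rn := 'rV[R]_n.
Local Notation mu := (@lebesgue_rV R n).
Variables alpha s : R.
Hypotheses (n0 : (0 < n)%N) (alpha0 : 0 < alpha) (s1 : 1 < s) (alphan : alpha < n%:R).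
Local Notation cap := (@bessel_capacity R n alpha s).
Variables (cbar p : R).
Hypotheses (p1 : 1 < p).
Local Notation q := (p / (p - 1)).
Local Notation W := (@N_weights R n alpha s cbar).
Local Notation Nn := (@N_norm R n alpha s cbar q).
Local Notation N := (@N_space R n alpha s cbar q).
Local Notation M := (@M_space R n alpha s p).
Local Notation Mn := (@M_norm R n alpha s p).
Local Notation dual := (@N_dual R n alpha s cbar q).
Local Notation WI := (weighted_integral p).
Variable c : R.
Hypotheses (c0 : 0 < c) (weightP : forall K : set Rn, compact K -> cap K != 0%E ->
  exists w : Rn -> R, [/\ W (EFin \o w), forall x, 0 <= w x &
    forall x, K x -> w x = c / fine (cap K)]).
Local Notation ballr m := (ball (0 : Rn) (m%:R : R)).

Let p0 : 0 < p. Proof. exact: lt_trans p1. Qed.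
Let pm : 0 < p - 1. Proof. by rewrite subr_gt0. Qed.
Let q0 : 0 < q. Proof. exact: divr_gt0. Qed.
Let qi0 : 0 < q^-1. Proof. by rewrite invr_gt0. Qed.

Let powRqK (e : R) : 0 <= e -> (e `^ q) `^ q^-1 = e.
Proof. by move=> e0; rewrite -powRrM mulfV ?gt_eqF// powRr1. Qed.

Let N_test (g : Rn -> R) (K : set Rn) : compact K -> test_fun g K -> N g :=
  N_space_test n0 alpha0 s1 alphan p1 c0 weightP (K := K).

Lemma pairing_indic (f : Rn -> R) (A : set Rn) : measurable A ->
  mu.-integrable A (EFin \o f) -> (pairing f \1_A)%:E = (\int[mu]_(x in A) (f x)%:E)%E.
Proof.
move=> mA intf; have fn := integrable_fin_num mA intf.
rewrite /pairing /Rintegral (_ : \int[mu]_x _ = \int[mu]_(x in A) (f x)%:E)%E; first by rewrite fineK.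
rewrite [RHS]integral_mkcond; apply: eq_integral => x _; rewrite patchE indicE.
by case: ifPn => _; rewrite ?mulr1 ?mulr0.
Qed.

Lemma integrable_mul_test (f g : Rn -> R) (K : set Rn) : measurable K ->
  mu.-integrable K (EFin \o f) -> test_fun g K ->
  mu.-integrable setT (EFin \o (fun x => f x * g x)).
Proof.
move=> mK intf [mg [B gB] gK].
have mf : measurable_fun K f by apply/measurable_EFinP; exact: measurable_int intf.
have e : EFin \o (fun x => f x * g x) = (EFin \o (fun x => f x * g x)) \_ K.
  apply/funext => x; rewrite patchE; case: ifPn => // xK /=.
  by rewrite gK ?mulr0// => /mem_set h; rewrite h in xK.
rewrite e; apply/(integrable_mkcond _ mK).1.
apply: (@le_integrable _ _ _ mu K mK _ (fun x => `|B|%:E * (f x)%:E)%E).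
- by apply/measurable_EFinP; apply: measurable_funM => //; exact: measurable_funTS.
- move=> x _; rewrite [leLHS]/= -EFinM abse_EFin lee_fin !normrM normr_id mulrC ler_wpM2r//.
  by apply: le_trans (gB x) (ler_norm B).
- exact: integrableZl.
Qed.

Lemma pairing_linear (f g h : Rn -> R) (a : R) :
  mu.-integrable setT (EFin \o (fun x => f x * g x)) ->
  mu.-integrable setT (EFin \o (fun x => f x * h x)) ->
  pairing f (fun x => a * g x + h x) = a * pairing f g + pairing f h.
Proof.
move=> ig ih; rewrite /pairing -RintegralZl// -RintegralD//.
  by apply: eq_Rintegral => x _; rewrite mulrDr mulrCA.
rewrite (_ : EFin \o _ = (fun x => a%:E * (EFin \o (fun x => (f x * g x)%R)) x)%E).
  exact: integrableZl.
by apply/funext => x.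
Qed.

Lemma pairing_abs_le (f g : Rn -> R) : mu.-integrable setT (EFin \o (fun x => f x * g x)) ->
  (`|pairing f g|%:E <= \int[mu]_x `|f x * g x|%:E)%E.
Proof.
move=> h; have fn := integrable_fin_num measurableT h.
rewrite /pairing /Rintegral -abse_EFin fineK//.
by apply: le_abse_integral => //; exact: (measurable_int mu).
Qed.

Let m_powR_abs (r : R) (g : Rn -> R) : measurable_fun setT g ->
  measurable_fun setT (fun x => (`|g x| `^ r)%:E).
Proof.
move=> mg; apply/measurable_EFinP.
apply: (@measurableT_comp _ _ _ _ _ _ (fun y : R => y `^ r)); first exact: measurable_powR.
exact: measurableT_comp.
Qed.

(** [g] is cut to [A m], where both [|x|] and [|g x|] are at most [m]. With one fixed weight, the
    error is the weighted integral over the complement of [A m], a tail of a convergent integral. *)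
Lemma N_norm_sub_test (g : Rn -> R) (e : R) : N g -> 0 < e -> exists h K,
  [/\ compact K, test_fun h K & (Nn (fun x => (-1) * h x + g x)%R <= e%:E)%E].
Proof.
move=> Ng e0; have [mg _] := Ng; have [w Ww woo] := N_space_weight p1 Ng.
have [_ [w0 [mw _] _] _ _] := Ww.
pose phi x := ((`|g x| `^ q)%:E * (w x `^ (q - 1))^-1)%E.
have mphi : measurable_fun setT phi.
  apply: emeasurable_funM; first exact: m_powR_abs.
  apply: emeasurable_inve; last by move=> x; exact: poweR_ge0.
  exact: (measurableT_comp (measurable_poweR _) mw).
have phi0 x : (0 <= phi x)%E by rewrite mule_ge0 ?lee_fin ?powR_ge0// inve_ge0 poweR_ge0.
pose A (m : nat) := @cball R n m%:R `&` [set x | `|g x| <= m%:R].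
have mA m : measurable (A m).
  apply: measurableI; first exact: measurable_cball.
  rewrite (_ : [set x | _] = setT `&` (Num.norm \o g) @^-1` `]-oo, m%:R]%classic); last first.
    by apply/seteqP; split => x /=; rewrite in_itv/=; [move=> ?; split|case].
  by apply: (measurableT_comp _ mg) => //; exact: measurable_itv.
have ndA : {homo A : n m / (n <= m)%N >-> (n <= m)%O}.
  move=> i j ij; apply/subsetPset => x [/= xi gi]; rewrite -(ler_nat R) in ij.
  by split; rewrite /cball/=; [exact: le_trans xi ij|exact: le_trans gi ij].
have AT : \bigcup_m A m = setT.
  apply/seteqP; split => // x _; exists (Num.truncn (Num.max `|x| `|g x|)).+1 => //.
  have := truncnS_gt (Num.max `|x| `|g x|); rewrite gt_max => /andP[h1 h2].
  by split; rewrite /cball/=; exact: ltW.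
have Ifin : (\int[mu]_x phi x = (fine (\int[mu]_x phi x))%:E)%E.
  by rewrite fineK// ge0_fin_numE//; exact: integral_ge0.
have := @ge0_nondecreasing_set_cvg_integral _ _ _ A phi mu ndA mA
   (fun k => measurable_funTS mphi) (fun k x _ => phi0 x).
rewrite AT Ifin => h.
have eq0 : 0 < e `^ q by exact: powR_gt0.
have lt_e : fine (\int[mu]_x phi x) - e `^ q < fine (\int[mu]_x phi x) by rewrite ltrBlDr ltrDl.
have near_e : \forall m \near \oo, ((fine (\int[mu]_x phi x) - e `^ q)%:E < \int[mu]_(x in A m) phi x)%E :=
  h _ (nbhs_open_ereal_gt (f := fun y => y - e `^ q) lt_e).
have [m _ /(_ m (leqnn m)) hm] := near_e.
pose h1 x := \1_(A m) x * g x.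
exists h1, (cball m%:R); split; first exact: compact_cball.
  split.
  - by apply: measurable_funM => //; exact: measurable_indic.
  - exists m%:R => x; rewrite /h1 indicE; case: (boolP (x \in A m)) => [|_].
      by rewrite inE mul1r => -[].
    by rewrite mul0r normr0.
  - by move=> x xm; rewrite /h1 indicE memNset ?mul0r// => -[].
apply: le_trans (N_norm_le p _ Ww) _.
have WE : (WI (fun x => (-1) * h1 x + g x)%R w = \int[mu]_(x in ~` A m) phi x)%E.
  rewrite [RHS]integral_mkcond; apply: eq_integral => x _.
  rewrite patchE /h1 indicE in_setC; case: (x \in A m) => /=.
    by rewrite mul1r mulN1r addNr normr0 powR0 ?mul0e// gt_eqF.
  by rewrite mul0r mulr0 add0r.
have mAC : measurable (~` A m) by exact: measurableC.
have split_int : (\int[mu]_x phi x = \int[mu]_(x in A m) phi x + \int[mu]_(x in ~` A m) phi x)%E.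
  have dA : [disjoint A m & ~` A m] by apply/disj_setPS; rewrite setICr.
  have := @ge0_integral_setU _ _ _ mu _ _ (mA m) mAC phi.
  by rewrite setUv => /(_ mphi (fun x _ => phi0 x) dA).
have le_e : (\int[mu]_(x in ~` A m) phi x <= (e `^ q)%:E)%E.
  rewrite leNgt; apply/negP => hlt.
  have := lteD hm hlt; rewrite -split_int Ifin -EFinD subrK lte_fin ltxx.
  by [].
rewrite WE; apply: le_trans (poweR_le (ltW qi0) _ le_e) _.
  by apply: integral_ge0.
by rewrite poweR_EFin powRqK; [exact: lexx|exact: ltW].
Qed.

Section functional.
Variable L : (Rn -> R) -> R.
Hypothesis Ld : dual L.

Lemma dual_bound : exists2 C : R, 0 <= C & forall g, N g -> (`|L g|%:E <= C%:E * Nn g)%E.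
Proof.
have [_ [C hC]] := Ld; exists `|C| => // g Ng; apply: le_trans (hC g Ng) _.
by apply: lee_wpmul2r; [exact: N_norm_ge0|rewrite lee_fin ler_norm].
Qed.

Lemma dual_indicU (K A B : set Rn) : compact K -> measurable A -> measurable B ->
  A `<=` K -> B `<=` K -> [disjoint A & B] -> L \1_(A `|` B) = L \1_A + L \1_B.
Proof.
move=> cK mA mB AK BK dAB; have [Llin _] := Ld.
rewrite -[L \1_A]mul1r -Llin; last 2 first.
- by apply: N_test cK _; exact: test_fun_indic.
- by apply: N_test cK _; exact: test_fun_indic.
congr L; apply/funext => x; rewrite mul1r !indicE in_setU.
have [xA|xA] := boolP (x \in A); have [xB|xB] := boolP (x \in B) => //=; rewrite ?addr0 ?add0r//.
have : (A `&` B) x by split; apply/set_mem.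
by move/disj_setPS: dAB => h /h.
Qed.

(** Inside a compact ball [L] of an indicator is at most [C (D mu A)^(1/q)], which is the absolute
    continuity required. The annuli are disjoint, so their densities can be glued with no
    compatibility to check. *)
Lemma dual_annulus_density (m : nat) : exists f : Rn -> R, mu.-integrable setT (EFin \o f) /\
  forall A, measurable A -> A `<=` ballr m.+1 `\` ballr m ->
    (L \1_A)%:E = (\int[mu]_(x in A) (f x)%:E)%E.
Proof.
have cK := @compact_cball R n m.+1%:R.
have SK : ballr m.+1 `\` ballr m `<=` cball m.+1%:R.
  by move=> x [h _]; exact: ball_sub_cball.
have mS : measurable (ballr m.+1 `\` ballr m) by apply: measurableD; exact: measurable_ball_rV.
have [C C0 hC] := dual_bound.
have [D D0 hD] := N_norm_le_compact n0 alpha0 s1 alphan p1 c0 weightP cK.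
apply: (set_function_density (ell := fun A : set Rn => L \1_A) mS).
- apply: le_lt_trans (lebesgue_rV_compact_lty cK); apply: le_measure; rewrite ?inE//.
  exact: measurable_cball.
- move=> A B mA mB AS BS; apply: dual_indicU cK _ _ _ _ => //.
  + exact: subset_trans SK.
  + exact: subset_trans SK.
move=> e e0; have C1 : 0 < C + 1 by exact: ltr_wpDl.
have D1 : 0 < D + 1 by exact: ltr_wpDl.
have eC : 0 < e / (C + 1) by exact: divr_gt0.
(* Chosen so that [C (D delta)^(1/q) <= e]; the added ones keep the denominators positive. *)
exists ((e / (C + 1)) `^ q / (D + 1)); first by rewrite divr_gt0// powR_gt0.
move=> A mA AS hA; have AK := subset_trans AS SK.
have tA := test_fun_indic mA AK.
rewrite -lee_fin; apply: le_trans (hC _ (N_test cK tA)) _.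
have h1 : (Nn \1_A <= (e / (C + 1))%:E)%E.
  apply: le_trans (hD _ tA) _; rewrite (integral_indic_powR p1 mA).
  have le1 : (D%:E * mu A <= ((e / (C + 1)) `^ q)%:E)%E.
    apply: (@le_trans _ _ (D%:E * ((e / (C + 1)) `^ q / (D + 1))%:E)%E).
      by apply: lee_wpmul2l => //; exact: ltW.
    rewrite -EFinM lee_fin mulrCA -[leRHS]mulr1; apply: ler_wpM2l; first exact: powR_ge0.
    by rewrite ler_pdivrMr// mul1r lerDl.
  apply: le_trans (poweR_le (ltW qi0) _ le1) _; first by rewrite mule_ge0.
  by rewrite poweR_EFin powRqK; [exact: lexx|exact: ltW].
apply: (@le_trans _ _ (C%:E * (e / (C + 1))%:E)%E); first exact: lee_wpmul2l.
rewrite -EFinM lee_fin mulrCA -[leRHS]mulr1; apply: ler_wpM2l; first exact: ltW.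
by rewrite ler_pdivrMr// mul1r lerDl.
Qed.

Lemma dual_density : exists f : Rn -> R, forall m, mu.-integrable (ballr m) (EFin \o f) /\
  forall A, measurable A -> A `<=` ballr m -> (L \1_A)%:E = (\int[mu]_(x in A) (f x)%:E)%E.
Proof.
have [F hF] := choice dual_annulus_density.
(* The integer part of [|x|] is the index of the annulus that contains [x]. *)
pose f x := F (Num.truncn `|x|) x.
have fF m x : (ballr m.+1 `\` ballr m) x -> f x = F m x.
  rewrite -ball_normE/= sub0r normrN => -[h1 /negP]; rewrite -leNgt => h2.
  by rewrite /f (_ : Num.truncn `|x| = m)//; apply: truncn_def; rewrite h1 h2.
have mb m : measurable (ballr m) by exact: measurable_ball_rV.
have mS m : measurable (ballr m.+1 `\` ballr m) by exact: measurableD.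
have ballS m : ballr m.+1 = ballr m `|` (ballr m.+1 `\` ballr m).
  apply/seteqP; split => x; last by case=> [|[]//]; apply: le_ball; rewrite ler_nat.
  by move=> h; have [h'|h'] := pselect (ballr m x); [left|right].
have intS m : mu.-integrable (ballr m.+1 `\` ballr m) (EFin \o f).
  apply: (eq_integrable (mS m) (EFin \o F m)).
    by move=> x; rewrite inE => hx /=; rewrite (fF m).
  by apply: integrableS (hF m).1.
exists f; elim=> [|m [intm IH]].
  (* The induction starts from the ball of radius zero, which is empty; additivity gives [L] the
     value zero on its indicator. *)
  have b0 : ballr 0 = set0.
    by apply/seteqP; split => x //; rewrite -ball_normE/= ltNge normr_ge0.
  rewrite b0; split; first exact: integrable_set0.
  have d0 : [disjoint (set0 : set Rn) & (set0 : set Rn)] by apply/disj_setPS; rewrite set0I.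
  have s0 : set0 `<=` (cball 0 : set Rn) by [].
  have := dual_indicU (@compact_cball R n 0) measurable0 measurable0 s0 s0 d0.
  rewrite setU0 => /eqP; rewrite -subr_eq0 opprD addNKr oppr_eq0 => /eqP L0.
  by move=> A mA; rewrite subset0 => ->; rewrite L0 integral_set0.
split.
  rewrite ballS; apply/integrableP.
  have /integrableP[m1 i1] := intm; have /integrableP[m2 i2] := intS m.
  have mU : measurable_fun (ballr m `|` (ballr m.+1 `\` ballr m)) (EFin \o f) by apply/measurable_funU.
  split => //; rewrite ge0_integral_setU//; first exact: lte_add_pinfty.
  - by apply: measurableT_comp.
  - by apply/disj_setPS => x [h []].
move=> A mA Am.
pose A1 := A `&` ballr m; pose A2 := A `&` (ballr m.+1 `\` ballr m).
have AE : A = A1 `|` A2 by rewrite -setIUr -ballS setIidl.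
have mA1 : measurable A1 by exact: measurableI.
have mA2 : measurable A2 by exact: measurableI.
have d12 : [disjoint A1 & A2] by apply/disj_setPS => x [[_ h] [_ []]].
have cK := @compact_cball R n m.+1%:R.
have AK : A `<=` cball m.+1%:R by apply: subset_trans Am _; exact: ball_sub_cball.
rewrite AE (dual_indicU cK mA1 mA2)//; last 2 first.
- by move=> x [/AK].
- by move=> x [/AK].
rewrite EFinD integral_setU//.
- rewrite IH//; last exact: subIsetr.
  rewrite (hF m).2//; last exact: subIsetr.
  congr (_ + _)%E; apply: eq_integral => x; rewrite inE => -[_ hx].
  by rewrite (fF m).
apply/measurable_funU => //; split.
- by apply: measurable_funS (measurable_int mu intm) => //; exact: subIsetr.
- by apply: measurable_funS (measurable_int mu (intS m)) => //; exact: subIsetr.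
Qed.

(** The difference of [L] and the pairing is linear on test functions, bounded on those of modulus
    at most one, and zero on indicators, so [eq0_of_indicators] applies. *)
Lemma dual_test_representation : exists2 f : Rn -> R, measurable_fun setT f &
  forall K, compact K -> forall g, test_fun g K -> L g = pairing f g.
Proof.
have [f hf] := dual_density; have [Llin _] := Ld; have [C C0 hC] := dual_bound.
exists f.
  have UT : \bigcup_m ballr m = setT.
    apply/seteqP; split => // x _; exists (Num.truncn `|x|).+1 => //.
    by rewrite -ball_normE/= sub0r normrN; exact: truncnS_gt.
  rewrite -UT; apply/measurable_fun_bigcup => m; first exact: measurable_ball_rV.
  by apply/measurable_EFinP; exact: measurable_int (hf m).1.
move=> K0 cK0 g tg0; have [r r0 K0r] := compact_sub_ball cK0.
pose m := (Num.truncn r).+1; pose K := @cball R n m%:R.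
have cK : compact K by exact: compact_cball.
have mK : measurable K by exact: measurable_cball.
have tg : test_fun g K.
  have [mg gB gK] := tg0; split => // x xK; apply: gK => /K0r.
  rewrite -ball_normE/= sub0r normrN => xr; apply: xK; rewrite /K /cball/=.
  by apply: ltW; apply: lt_trans xr _; exact: truncnS_gt.
have Km : K `<=` ballr m.+1.
  move=> x; rewrite /K /cball/= -ball_normE/= sub0r normrN => /le_lt_trans; apply.
  by rewrite ltr_nat.
have intK : mu.-integrable K (EFin \o f).
  by apply: integrableS (hf m.+1).1 => //; exact: measurable_ball_rV.
have intM h : test_fun h K -> mu.-integrable setT (EFin \o (fun x => f x * h x)).
  exact: integrable_mul_test.
have [D D0 hD] := N_norm_le_compact n0 alpha0 s1 alphan p1 c0 weightP cK.
have muK : mu K = (fine (mu K))%:E.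
  by rewrite fineK// ge0_fin_numE//; exact: lebesgue_rV_compact_lty.
have If : (\int[mu]_(x in K) `|f x|%:E = (fine (\int[mu]_(x in K) `|f x|%:E))%:E)%E.
  rewrite fineK// ge0_fin_numE; last exact: integral_ge0.
  by have /integrableP[] := intK.
apply/eqP; rewrite -subr_eq0; apply/eqP.
apply: (@eq0_of_indicators _ _ K (fun h => L h - pairing f h)
  (C * (D * fine (mu K)) `^ q^-1 + fine (\int[mu]_(x in K) `|f x|%:E)) mK _ _ _ g tg).
- move=> a h1 h2 t1 t2; rewrite Llin; [|exact: N_test cK _|exact: N_test cK _].
  by rewrite pairing_linear; [ring|exact: intM|exact: intM].
- move=> h th h1; have [mh _ hK] := th; apply: le_trans (ler_normB _ _) _; apply: lerD.
    rewrite -lee_fin; apply: le_trans (hC _ (N_test cK th)) _.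
    rewrite EFinM; apply: lee_wpmul2l => //; apply: le_trans (hD h th) _.
    rewrite -poweR_EFin; apply: poweR_le; first exact: ltW.
      by rewrite mule_ge0//; apply: integral_ge0 => x _; rewrite lee_fin powR_ge0.
    rewrite EFinM -muK; apply: lee_wpmul2l => //.
    rewrite -(integral_indic_powR p1 mK); apply: ge0_le_integral => //.
    + exact: m_powR_abs mh.
    + by apply: m_powR_abs; exact: measurable_indic.
    move=> x _; rewrite lee_fin; apply: ge0_ler_powR; rewrite ?nnegrE ?(ltW q0)//.
    rewrite indicE; case: (boolP (x \in K)) => xK; first by rewrite normr1.
    by rewrite hK ?normr0// => /mem_set h'; rewrite h' in xK.
  rewrite -lee_fin -If; apply: le_trans (pairing_abs_le (intM h th)) _.
  rewrite [leRHS]integral_mkcond; apply: ge0_le_integral => //.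
  + have /integrableP[m1 _] := intM h th.
    by apply/measurable_EFinP; apply: measurableT_comp => //; apply/measurable_EFinP; exact: m1.
  + apply/(measurable_restrictT _ _).1 => //.
    have /integrableP[m1 _] := intK.
    by apply/measurable_EFinP; apply: measurableT_comp => //; apply/measurable_EFinP; exact: m1.
  move=> x _; rewrite patchE; case: ifPn => xK.
    by rewrite lee_fin normrM -[leRHS]mulr1; apply: ler_wpM2l.
  by rewrite hK ?mulr0 ?normr0// => /mem_set h'; rewrite h' in xK.
- move=> A mA AK; apply/eqP; rewrite subr_eq0 -eqe; apply/eqP.
  rewrite (hf m.+1).2//; last exact: subset_trans Km.
  by rewrite pairing_indic//; exact: integrableS intK.
Qed.

(** Test functions show first that [f] belongs to [M]. This makes the pairing continuous on [N], and
    the identity then extends from test functions by density. *)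
Lemma dual_representation : exists2 f : Rn -> R, M f & forall g, N g -> L g = pairing f g.
Proof.
have [f mf hf] := dual_test_representation; have [C C0 hC] := dual_bound; have [Llin _] := Ld.
have [Mf _] : M f /\ ((c `^ p^-1)%:E * Mn f <= C%:E)%E.
  apply: (M_norm_le_of_test n0 alpha0 s1 alphan p1 c0 weightP mf C0) => g K cK tg g1.
  rewrite -(hf K cK g tg) -lee_fin; apply: le_trans (hC _ (N_test cK tg)) _.
  by rewrite -[leRHS]mule1; apply: lee_wpmul2l.
exists f => // g Ng.
have [Plin _] := pairing_dual n0 alpha0 s1 alphan cbar p1 Mf.
have M0 : 0 <= fine (Mn f) by rewrite fine_ge0//; exact: (M_norm_ge0 n0 alpha0 s1 alphan).
apply/eqP; rewrite -subr_eq0 -normr_le0; apply/ler_addgt0Pl => e e0; rewrite addr0.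
have C1 : 0 < C + fine (Mn f) + 1 by rewrite ltr_wpDl// addr_ge0.
have [h [K [cK th he]]] := N_norm_sub_test Ng (divr_gt0 e0 C1).
have Nh := N_test cK th.
have Ngh : N (fun x => (-1) * h x + g x).
  split; last by apply: le_lt_trans he _; rewrite ltry.
  by apply: measurable_funD; [apply: measurable_funM => //; case: th|case: Ng].
have -> : L g - pairing f g = L (fun x => (-1) * h x + g x) - pairing f (fun x => (-1) * h x + g x).
  by rewrite Llin// Plin// (hf K cK h th); ring.
apply: le_trans (ler_normB _ _) _.
apply: (@le_trans _ _ (C * (e / (C + fine (Mn f) + 1)) + fine (Mn f) * (e / (C + fine (Mn f) + 1)))).
  apply: lerD; rewrite -lee_fin.
    by apply: le_trans (hC _ Ngh) _; rewrite EFinM; apply: lee_wpmul2l.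
  apply: le_trans (pairing_le n0 alpha0 s1 alphan p1 Mf Ngh) _.
  by rewrite EFinM; apply: lee_wpmul2l.
rewrite -mulrDl mulrCA -[leRHS]mulr1; apply: ler_wpM2l; first exact: ltW.
by rewrite ler_pdivrMr// mul1r lerDl.
Qed.

End functional.

(** Indicators of bounded measurable sets belong to [N], so [f] and [f'] have equal integrals over
    all measurable subsets of each ball. *)
Lemma pairing_inj (f f' : Rn -> R) : M f -> M f' -> (forall g, N g -> pairing f g = pairing f' g) ->
  {ae mu, forall x, f x = f' x}.
Proof.
move=> Mf Mf' h.
have intb (f1 : Rn -> R) m : M f1 -> mu.-integrable (cball m%:R) (EFin \o f1).
  move=> M1; have cK := @compact_cball R n m%:R; have mK := @measurable_cball R n m%:R.
  have := integrable_mul n0 alpha0 s1 alphan p1 M1 (N_test cK (test_fun_indic mK (@subset_refl _ _))).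
  move=> h1; apply/(integrable_mkcond _ mK).2.
  apply: (eq_integrable measurableT _ _ _ h1) => x _; rewrite patchE /= indicE.
  by case: ifPn => _; rewrite ?mulr1 ?mulr0.
have : {ae mu, forall x, forall m : nat, @cball R n m%:R x -> (f x)%:E = (f' x)%:E}.
  apply: ae_foralln => m; have cK := @compact_cball R n m%:R; have mK := @measurable_cball R n m%:R.
  have i1 := intb f m Mf; have i2 := intb f' m Mf'.
  apply: (integral_ae_eq mK i1); first exact: measurable_int i2.
  move=> E Em mE.
  rewrite -[LHS](pairing_indic mE); last exact: integrableS i1.
  rewrite -[RHS](pairing_indic mE); last exact: integrableS i2.
  by congr EFin; apply: h; apply: N_test cK _; exact: test_fun_indic.
apply: filterS => x hx; have [k _ xk] : (\bigcup_k @cball R n k%:R) x by rewrite bigcup_cball.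
by have [] := hx k xk.
Qed.

Lemma M_norm_le_dual (f : Rn -> R) : M f ->
  ((c `^ p^-1)%:E * Mn f <= @N_dual_norm R n alpha s cbar q (pairing f))%E.
Proof.
move=> Mf; set B := N_dual_norm _ _ _ _ _.
have hB g : N g -> (Nn g <= 1)%E -> (`|pairing f g|%:E <= B)%E.
  by move=> Ng g1; apply: ereal_sup_ubound; exists g.
have cK := @compact_cball R n 0.
(* The zero function competes in the supremum. *)
have B0 : (0 <= B)%E.
  apply: (@le_trans _ _ `|pairing f (fun=> 0)|%:E%E); first by rewrite lee_fin.
  have t0 := test_fun0 (cball 0 : set Rn).
  apply: hB; first exact: N_test cK t0.
  have [D D0 hD] := N_norm_le_compact n0 alpha0 s1 alphan p1 c0 weightP cK.
  apply: le_trans (hD _ t0) _; rewrite integral0_eq; last first.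
    by move=> x _; rewrite normr0 powR0// gt_eqF.
  by rewrite mule0 poweR_EFin powR0 ?lee_fin// gt_eqF.
have [Boo|] := ltP B +oo%E; last by rewrite leye_eq => /eqP ->; rewrite leey.
have BE : B = (fine B)%:E by rewrite fineK// ge0_fin_numE.
have [[mf _] _] := Mf.
rewrite BE; apply: (M_norm_le_of_test n0 alpha0 s1 alphan p1 c0 weightP mf (fine_ge0 B0) _).2.
by move=> g K cK' tg g1; rewrite -lee_fin -BE; apply: hB => //; exact: N_test cK' tg.
Qed.

End riesz.

Theorem theorem1p3 (R : realType) (n : nat) (alpha s : R)
    (hn : (1 <= n)%N) (halpha : 0 < alpha) (hs : 1 < s)
    (halphas : alpha * s <= n%:R) :
  exists2 cbar : R, 1 <= cbar & forall p : R, 1 < p ->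
    let p' := p / (p - 1) in
    let M := @M_space R n alpha s p in
    let N := @N_space R n alpha s cbar p' in
    let dual := @N_dual R n alpha s cbar p' in
    (forall L, dual L -> exists f : 'rV[R]_n -> R,
       [/\ M f,
           forall g, N g -> L g = pairing f g &
           forall f', M f' -> (forall g, N g -> L g = pairing f' g) ->
             {ae lebesgue_rV n, forall x, f' x = f x}]) /\
    (exists c1 c2 : R, [/\ 0 < c1, 0 < c2 &
       forall f, M f ->
         [/\ forall g, N g ->
               (lebesgue_rV n).-integrable setT (EFin \o (fun x => f x * g x)),
             dual (pairing f),
             (c1%:E * M_norm alpha s p f <=
               N_dual_norm alpha s cbar p' (pairing f))%E &
             (N_dual_norm alpha s cbar p' (pairing f) <=
               c2%:E * M_norm alpha s p f)%E]]).
Proof.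
(* [alpha < alpha * s] because [s > 1]. Hence the exponent [(n - alpha)/2] of the kernel bounds is
   positive, also in the limiting case [alpha * s = n]. *)
have alphan : alpha < n%:R by apply: lt_le_trans halphas; rewrite ltr_pMr.
have [cbar [c [cbar1 c0 weightP]]] := exists_weight hn halpha hs alphan halphas.
exists cbar => // p p1 p' M N dual; split.
  move=> L Ld; have [f Mf Lf] := dual_representation hn halpha hs alphan p1 c0 weightP Ld.
  exists f; split => // f' Mf' Lf'.
  apply: (pairing_inj hn halpha hs alphan p1 c0 weightP Mf' Mf) => g Ng.
  by rewrite -Lf'// Lf.
(* [c] comes with the weights and was fixed before [p]; testing costs the factor [c^(1/p)], while
   Hoelder's inequality gives the constant one. *)
exists (c `^ p^-1), 1; split; [exact: powR_gt0|exact: ltr01|move=> f Mf; split].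
- by move=> g; exact: (integrable_mul hn halpha hs alphan p1 Mf).
- exact: (pairing_dual hn halpha hs alphan cbar p1 Mf).
- exact: (M_norm_le_dual hn halpha hs alphan p1 c0 weightP Mf).
- by rewrite mul1e; exact: (N_dual_norm_pairing_le hn halpha hs alphan cbar p1 Mf).
Qed.
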